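(* Let $t_0<t_1$, $M=[t_0,t_1]\times\mathbb{R}^3$, $\mathcal{S}_0=\{t_0\}\times\mathbb{R}^3$, let $0<c\le 1$ be a constant, let $s\ge 0$, and let $\mathcal{K}\subset\mathcal{S}_0$ be compact. For $(f_1,f_2)\in\mathcal{N}^s$ with $f_1,f_2$ supported in $\mathcal{K}$, let $f$ be the solution of the Cauchy problem $$\partial_t^2 f-c^2\sum_{i=1}^3\partial_{x_i}^2 f=0\ \text{ on } M,\qquad f=f_1,\ \ \partial_t f=f_2\ \text{ on }\mathcal{S}_0 .$$ Then $X_Mf$ uniquely determines $f$ and $(f_1,f_2)$: if two such pairs of Cauchy data, with corresponding solutions $f$ and $\tilde f$, satisfy $X_Mf=X_M\tilde f$, then the pairs coincide and $f=\tilde f$. Moreover, there exists a constant $C>0$ such that for all such $(f_1,f_2)$ $$\|(f_1,f_2)\|_{\mathcal{N}^s}\le C\,\|X_Mf\|_{H^{s+2}(\mathcal{C})}\quad\text{and}\quad \|f\|_{H^{s+1}(M)}\le C\,\|X_Mf\|_{H^{s+2}(\mathcal{C})}.$$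
   Context: Coordinates on $M$ are $(t,x)$, $t\in[t_0,t_1]$, $x\in\mathbb{R}^3$; $M$ carries the Minkowski metric $g_M=-dt^2+dx^2$. $\mathcal{N}^s=H^{s+1}_{\mathrm{comp}}(\mathcal{S}_0)\times H^{s}_{\mathrm{comp}}(\mathcal{S}_0)$ (compactly supported Sobolev functions, $\mathcal{S}_0$ identified with $\mathbb{R}^3$), with norm $\|(f_1,f_2)\|_{\mathcal{N}^s}=\|f_1\|_{H^{s+1}}+\|f_2\|_{H^s}$. The set of light rays on $M$ is identified with $\mathcal{C}=\mathbb{R}^3\times\mathbb{S}^2$, where $\mathbb{S}^2\subset\mathbb{R}^3$ is the Euclidean unit sphere: $(y,v)$ corresponds to the light ray $\tau\mapsto(t_0+\tau,\,y+\tau v)$, $\tau\in[0,t_1-t_0]$. The light ray transform is $$X_Mf(y,v)=\int_0^{t_1-t_0}f(t_0+\tau,\,y+\tau v)\,d\tau,\qquad (y,v)\in\mathcal{C},$$ defined first on smooth compactly supported functions on $M$ and extended to the solutions $f$ considered here. $H^{s+2}(\mathcal{C})$ is the Sobolev space on $\mathbb{R}^3\times\mathbb{S}^2$; an estimate whose right-hand side is infinite is regarded as vacuous. *)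

(* Defs.v *)
From HB Require Import structures.
From mathcomp Require Import all_boot all_order all_algebra.
From mathcomp Require Import all_classical all_reals all_analysis.
From mathcomp Require Import complex.
From mathcomp Require Import ring lra.

Set Implicit Arguments.
Unset Strict Implicit.
Unset Printing Implicit Defensive.

Import Order.TTheory GRing.Theory Num.Theory numFieldNormedType.Exports.

Local Open Scope classical_set_scope.
Local Open Scope complex_scope.
Local Open Scope ring_scope.

(* R^2, R^3, R^4 = R_t * R^3_x and R^5 = R^3_y * R^2_z. The factor
   [measurableTypeR R] is [R] with its Borel sets, the type on which
   [lebesgue_measure] lives. *)
Notation R1 R := (measurableTypeR R).
Notation R2 R := (R1 R * R1 R)%type.
Notation R3 R := (R1 R * R1 R * R1 R)%type.
Notation R4 R := (R1 R * R3 R)%type.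
Notation R5 R := (R3 R * R2 R)%type.

(* [m1 \x m2] as a sigma-finite measure: the library infers this structure on
   products of finite measures only. *)
Definition sigma_finite_product d1 d2 (T1 : measurableType d1)
    (T2 : measurableType d2) (R : realType)
    (m1 : {sigma_finite_measure set T1 -> \bar R})
    (m2 : {sigma_finite_measure set T2 -> \bar R}) : set (T1 * T2) -> \bar R :=
  (m1 \x m2)%E.

Section sigma_finite_product.
Context d1 d2 (T1 : measurableType d1) (T2 : measurableType d2) (R : realType).
Variable m1 : {sigma_finite_measure set T1 -> \bar R}.
Variable m2 : {sigma_finite_measure set T2 -> \bar R}.

HB.instance Definition _ := Measure.copy (sigma_finite_product m1 m2) (m1 \x m2)%E.

Let sigma_finite_setT : sigma_finite setT (sigma_finite_product m1 m2).
Proof.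
have /sigma_finiteP[F [TF ndF Foo]] := sigma_finiteT m1.
have /sigma_finiteP[G [TG ndG Goo]] := sigma_finiteT m2.
exists (fun n => F n `*` G n).
  rewrite -setXTT TF TG predeqE => -[x y]; split.
    move=> [/= [n _ Fnx] [k _ Gky]]; exists (maxn n k) => //; split.
    - by move: x Fnx; exact/subsetPset/ndF/leq_maxl.
    - by move: y Gky; exact/subsetPset/ndG/leq_maxr.
  by move=> [n _ []/= ? ?]; split; exists n.
move=> k; have [? ?] := Foo k; have [? ?] := Goo k.
split; first exact: measurableX.
by rewrite /sigma_finite_product product_measure1E// lte_mul_pinfty// ge0_fin_numE//.
Qed.

HB.instance Definition _ := Measure_isSigmaFinite.Build _ _ _
  (sigma_finite_product m1 m2) sigma_finite_setT.

End sigma_finite_product.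

Notation leb1 R := (@lebesgue_measure R).
Notation leb2 R := (sigma_finite_product (leb1 R) (leb1 R)).
Notation leb3 R := (sigma_finite_product (leb2 R) (leb1 R)).
Notation leb4 R := (sigma_finite_product (leb1 R) (leb3 R)).
Notation leb5 R := (sigma_finite_product (leb3 R) (leb2 R)).

Section dot_products.
Context {R : realType}.

Definition dot2 (x y : R2 R) : R := x.1 * y.1 + x.2 * y.2.
Definition dot3 (x y : R3 R) : R := dot2 x.1 y.1 + x.2 * y.2.
Definition dot4 (x y : R4 R) : R := x.1 * y.1 + dot3 x.2 y.2.
Definition dot5 (x y : R5 R) : R := dot3 x.1 y.1 + dot2 x.2 y.2.

End dot_products.

Section sobolev_norm.
Context d (T : measurableType d) (R : realType).
Variables (mu : {measure set T -> \bar R}) (dot : T -> T -> R).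

Definition cintegral (D : set T) (u : T -> R[i]) : R[i] :=
  (\int[mu]_(x in D) complex.Re (u x)) +i* (\int[mu]_(x in D) complex.Im (u x)).

Definition cmeasurable (D : set T) (u : T -> R[i]) :=
  measurable_fun D (fun x => complex.Re (u x)) /\ measurable_fun D (fun x => complex.Im (u x)).

Definition L2norm (u : T -> R[i]) : \bar R :=
  Lnorm mu 2%:E (fun x => (Normc.normc (u x))%:E).

Definition in_L2 (u : T -> R[i]) := cmeasurable setT u /\ (L2norm u < +oo)%E.

Definition cis (a : R) : R[i] := cos a +i* sin a.

Definition truncated_fourier (r : R) (u : T -> R[i]) (xi : T) : R[i] :=
  cintegral [set x | dot x x <= r ^+ 2] (fun x => u x * cis (- dot x xi)).

(* Fourier-Plancherel: [w] is the Fourier transform of [u] when the truncated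
   integrals converge to [w] in L^2. *)
Definition is_fourier (u w : T -> R[i]) :=
  [/\ in_L2 u, in_L2 w &
    L2norm (fun xi => w xi - truncated_fourier r u xi) @[r --> +oo] --> 0%E].

(* The norm of H^sigma(R^n) for sigma >= 0, that is
   || (1 + |xi|^2)^(sigma/2) w ||_{L^2} with [w] the Fourier transform of [u]
   (without the normalising power of 2 pi). Such a [w] is unique up to a null
   set; if there is none, i.e. if [u] is not in L^2, the norm is
   ereal_inf set0 = +oo. Hence [u] is in H^sigma iff its norm is finite. *)
Definition sobolev_norm (sigma : R) (u : T -> R[i]) : \bar R :=
  ereal_inf [set L2norm (fun xi => ((1 + dot xi xi) `^ (sigma / 2))%:C * w xi)
            | w in [set w | is_fourier u w]].

End sobolev_norm.

Definition sobolev_norm3 (R : realType) := sobolev_norm (leb3 R) dot3.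
Definition sobolev_norm4 (R : realType) := sobolev_norm (leb4 R) dot4.
Definition sobolev_norm5 (R : realType) := sobolev_norm (leb5 R) dot5.

Section sphere.
Context {R : realType}.

Definition sphere : set (R3 R) := [set v | dot3 v v = 1].

(* Inverse stereographic projections: [stereo false] maps 0 to the north pole
   and omits the south pole, [stereo true] is its mirror image. *)
Definition stereo (e : bool) (z : R2 R) : R3 R :=
  let q := dot2 z z in
  (2 * z.1 / (1 + q), 2 * z.2 / (1 + q), (-1) ^+ e * ((1 - q) / (1 + q))).

Lemma stereo_sphere e z : sphere (stereo e z).
Proof.
rewrite /sphere /stereo /= /dot3 /dot2 /=.
have h : 1 + (z.1 * z.1 + z.2 * z.2) != 0 :> R.
  by rewrite gt_eqF// ltr_pwDl// addr_ge0// -expr2 sqr_ge0.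
by case: e; rewrite ?expr1 ?expr0; field.
Qed.

Definition flat (a : R) : R := if 0 < a then expR (- a^-1) else 0.

(* A smooth partition of unity on the sphere subordinate to the two charts:
   [cutoff false] vanishes where v_3 <= -1/2, [cutoff true] where v_3 >= 1/2. *)
Definition cutoff (e : bool) (v : R3 R) : R :=
  let a := (-1) ^+ e * v.2 in
  flat (2^-1 + a) / (flat (2^-1 + a) + flat (2^-1 - a)).

Lemma cutoffD v : cutoff false v + cutoff true v = 1.
Proof.
rewrite /cutoff expr0 expr1 mul1r mulN1r opprK.
rewrite [X in _ + _ / X]addrC -mulrDl divff //.
suff: 0 < flat (2^-1 + v.2) + flat (2^-1 - v.2) by move=> /gt_eqF ->.
rewrite /flat; case: ifPn => h; case: ifPn => h'.
- by rewrite addr_gt0 // expR_gt0.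
- by rewrite addr0 expR_gt0.
- by rewrite add0r expR_gt0.
- by move: h h'; rewrite -!leNgt => h h'; lra.
Qed.

Definition chart_piece (e : bool) (u : R3 R -> R3 R -> R[i]) (p : R5 R) : R[i] :=
  (cutoff e (stereo e p.2))%:C * u p.1 (stereo e p.2).

(* The norm of H^sigma(R^3 * S^2): sum of the H^sigma(R^5) norms of the
   localisations in the charts. Only values [u y v] with [v] in [sphere]
   matter. *)
Definition sobolev_normC (sigma : R) (u : R3 R -> R3 R -> R[i]) : \bar R :=
  (\sum_(e : bool) sobolev_norm5 sigma (chart_piece e u))%E.

(* Almost everywhere on R^3 * S^2. *)
Definition ae_C (P : R3 R -> R3 R -> Prop) :=
  forall e, {ae leb5 R, forall p, P p.1 (stereo e p.2)}.

End sphere.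

Section wave_equation.
Context {R : realType}.

Definition smooth (V : normedModType R) (f : V -> R) :=
  forall (vs : seq V) (x : V),
    differentiable (foldr (fun v g => 'D_v g) f vs : V -> R) x.

Variables t0 t1 : R.

Definition M : set (R4 R) := [set p | t0 <= p.1 <= t1].

(* The norm of H^sigma(M): quotient norm of the restriction to M. *)
Definition sobolev_normM (sigma : R) (f : R4 R -> R[i]) : \bar R :=
  ereal_inf [set sobolev_norm4 sigma F
            | F in [set F | {ae leb4 R, forall p, M p -> F p = f p}]].

Definition test_function (phi : R4 R -> R) :=
  smooth phi /\
  exists L : set (R4 R), [/\ compact L, L `<=` [set p | t0 < p.1 < t1] &
    forall p, ~ L p -> phi p = 0].

Definition basis3 : seq (R3 R) := [:: (1, 0, 0); (0, 1, 0); (0, 0, 1)].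

Definition wave_op (c : R) (phi : R4 R -> R) (p : R4 R) : R :=
  'D_(1, 0) ('D_(1, 0) phi) p
  - c ^+ 2 * \sum_(e <- basis3) 'D_(0, e) ('D_(0, e) phi) p.

(* The wave operator is its own transpose. *)
Definition weak_wave_equation (c : R) (f : R4 R -> R[i]) :=
  forall phi, test_function phi ->
    cintegral (leb4 R) M (fun p => f p * (wave_op c phi p)%:C) = 0.

Definition continuous_in_sobolev (sigma : R) (f : R4 R -> R[i]) :=
  forall t, t0 <= t <= t1 ->
    (sobolev_norm3 sigma (fun x => f (t, x)) < +oo)%E /\
    sobolev_norm3 sigma (fun x => f (r, x) - f (t, x))
      @[r --> within `[t0, t1] (nbhs t)] --> 0%E.

(* The derivative at the endpoints is one-sided. *)
Definition time_derivative_in_sobolev (sigma : R) (f g : R4 R -> R[i]) :=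
  forall t, t0 <= t <= t1 ->
    sobolev_norm3 sigma
        (fun x => ((r - t)^-1)%:C * (f (r, x) - f (t, x)) - g (t, x))
      @[r --> within `[t0, t1] t^'] --> 0%E.

Definition ae_on_slice (f g : R3 R -> R[i]) := {ae leb3 R, forall x, f x = g x}.

(* The solution in C^0([t0, t1]; H^{s+1}) /\ C^1([t0, t1]; H^s), represented by
   a function that is jointly measurable on M; [g] is its time derivative. *)
Definition wave_solution (c s : R) (f1 f2 : R3 R -> R[i]) (f : R4 R -> R[i]) :=
  cmeasurable M f /\ continuous_in_sobolev (s + 1) f /\
  weak_wave_equation c f /\ ae_on_slice (fun x => f (t0, x)) f1 /\
  exists g : R4 R -> R[i],
    [/\ continuous_in_sobolev s g, time_derivative_in_sobolev s f g &
      ae_on_slice (fun x => g (t0, x)) f2].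

(* By Fubini, for [f] in L^1(M) and each [v] the integral is defined for almost
   every [y], and changing [f] on a null set changes it on a null set of [y]
   only. *)
Definition light_ray_transform (f : R4 R -> R[i]) (y v : R3 R) : R[i] :=
  cintegral (leb1 R) `[0, t1 - t0] (fun tau => f (t0 + tau, y + tau *: v)).

End wave_equation.

Section cauchy_data.
Context {R : realType}.

Definition supported_in (K : set (R3 R)) (u : R3 R -> R[i]) :=
  {ae leb3 R, forall x, ~ K x -> u x = 0}.

Definition normN (s : R) (f1 f2 : R3 R -> R[i]) : \bar R :=
  (sobolev_norm3 (s + 1)%R f1 + sobolev_norm3 s f2)%E.

Definition cauchy_data (s : R) (K : set (R3 R)) (f1 f2 : R3 R -> R[i]) :=
  [/\ (normN s f1 f2 < +oo)%E, supported_in K f1 & supported_in K f2].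

End cauchy_data.

(* Main.v *)
(* Taking the Fourier transform in [x] turns the solution into
   [cos (omega tau) w1 + sin (omega tau) / omega w2] with [omega = c |xi|] and [w1, w2] the transforms
   of the data, and turns the light ray transform in direction [v] into the multiplier
   [al osc (xi.v + omega) + be osc (xi.v - omega)], where [osc b] is the integral of [exp (i tau b)] over
   [0, t1 - t0] and [al, be] are the amplitudes of the two travelling waves. Since [c <= 1] there are
   directions with [xi.v = omega] and [xi.v = - omega]; there one phase is stationary while the other
   oscillates, and [|osc b| < osc 0] for [b] away from [0], so the multiplier controls [|al| + |be|] on
   a spherical cap of radius about [1 / (1 + |xi|)]. Integrating over the cap, which costs one derivative,
   bounds the high frequencies of the data. The frequencies below a small [eps] are absorbed: the data
   are supported in a fixed compact set, so that their transforms are bounded by their [L2] norms. The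
   bound on [M] follows by cutting the evolution off smoothly in time. Plancherel's theorem is proved by
   Abel summation in dimension one and by Tonelli's theorem in products. *)
Require Import Defs.
From mathcomp Require Import all_boot all_order all_algebra.
From mathcomp Require Import all_classical all_reals all_analysis.
From mathcomp Require Import measurable_realfun complex.
From mathcomp Require Import ring lra.
Set Implicit Arguments.
Unset Strict Implicit.
Unset Printing Implicit Defensive.

Import Order.TTheory GRing.Theory Num.Theory numFieldNormedType.Exports.

Local Open Scope classical_set_scope.
Local Open Scope ring_scope.

(** * Complex-valued integrals *)

(** The loss of one derivative comes from the frequency [xi] dual to the base point alone.
    Plancherel's theorem in the chart variable bounds the weighted square norm of the multiplier by
    the [H^{s+2}] norm, and the area of the cap, of order [1 / (1 + |xi|^2)], is the gap between the
    squared weights of orders [s + 2] and [s + 1]. No compactness argument occurs: the data have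
    finite norm by hypothesis, so half of it can be subtracted, and injectivity comes from the same
    inequality as stability. The obstacle is regularity. A solution is a measurable function with
    Sobolev-continuous slices that satisfies the equation weakly, and its transforms are fixed only
    up to null sets. The equation is therefore tested against functions of bounded frequency, on
    which the propagators are strongly differentiable, and the solution formula follows by pairing
    with the backward evolution. Likewise the symbol of the light ray transform is identified by
    duality. Since the norm on [M] is a quotient norm, an extension has to be exhibited: its Fourier
    transform is written down explicitly and inverted by the completeness of [L2]. *)

Notation cRe := complex.Re.
Notation cIm := complex.Im.

Section complex_modulus.
Variable R : realType.
Implicit Types z w : R[i].

(** Two polynomial or piecewise linear substitutes for the modulus: [abs2] is its square, to which
    [ring] applies, and [abs1] is equivalent to it up to a factor and splits into the integrals of
    the two parts. *)
Definition abs2 z : R := cRe z ^+ 2 + cIm z ^+ 2.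
Definition abs1 z : R := `|cRe z| + `|cIm z|.

Lemma cReM z w : cRe (z * w) = cRe z * cRe w - cIm z * cIm w.
Proof. by case: z; case: w. Qed.
Lemma cImM z w : cIm (z * w) = cRe z * cIm w + cIm z * cRe w.
Proof. by case: z; case: w => a b c d /=; rewrite mulrC [_ * a]mulrC addrC mulrC [b * _]mulrC; ring. Qed.
Lemma cReD z w : cRe (z + w) = cRe z + cRe w.
Proof. by case: z; case: w. Qed.
Lemma cImD z w : cIm (z + w) = cIm z + cIm w.
Proof. by case: z; case: w. Qed.
Lemma cReN z : cRe (- z) = - cRe z.
Proof. by case: z. Qed.
Lemma cImN z : cIm (- z) = - cIm z.
Proof. by case: z. Qed.
Lemma cRe_conj z : cRe (conjc z) = cRe z.
Proof. by case: z. Qed.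
Lemma cIm_conj z : cIm (conjc z) = - cIm z.
Proof. by case: z. Qed.
Lemma cRe_real (a : R) : cRe (a%:C)%C = a. Proof. by []. Qed.
Lemma cIm_real (a : R) : cIm (a%:C)%C = 0. Proof. by []. Qed.
Lemma cRe0 : cRe (0 : R[i]) = 0. Proof. by []. Qed.
Lemma cIm0 : cIm (0 : R[i]) = 0. Proof. by []. Qed.
Lemma cRe_pair (a b : R) : cRe (a +i* b)%C = a. Proof. by []. Qed.
Lemma cIm_pair (a b : R) : cIm (a +i* b)%C = b. Proof. by []. Qed.

Definition cE := (cReM, cImM, cReD, cImD, cReN, cImN, cRe_conj, cIm_conj, cRe_real,
  cIm_real, cRe0, cIm0, cRe_pair, cIm_pair).

Lemma complex_ext z w : cRe z = cRe w -> cIm z = cIm w -> z = w.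
Proof. by case: z; case: w => a b c d /= -> ->. Qed.

Lemma abs2_ge0 z : 0 <= abs2 z.
Proof. by rewrite /abs2 addr_ge0 ?sqr_ge0. Qed.
Lemma abs1_ge0 z : 0 <= abs1 z.
Proof. by rewrite /abs1 addr_ge0. Qed.
Lemma abs2_eq0 z : (abs2 z == 0) = (z == 0).
Proof.
apply/idP/idP => [|/eqP ->]; last by rewrite /abs2 /= expr0n/= addr0.
rewrite /abs2 paddr_eq0 ?sqr_ge0// !sqrf_eq0 => /andP[/eqP a /eqP b].
by apply/eqP/complex_ext.
Qed.
Lemma abs2M z w : abs2 (z * w) = abs2 z * abs2 w.
Proof. by rewrite /abs2 !cE; ring. Qed.
Lemma abs2N z : abs2 (- z) = abs2 z.
Proof. by rewrite /abs2 !cE; ring. Qed.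
Lemma abs2_conj z : abs2 (conjc z) = abs2 z.
Proof. by rewrite /abs2 !cE; ring. Qed.
Lemma abs2_real (a : R) : abs2 (a%:C)%C = a ^+ 2.
Proof. by rewrite /abs2 !cE; ring. Qed.
Lemma abs20 : abs2 (0 : R[i]) = 0.
Proof. by rewrite /abs2 !cE; ring. Qed.
Lemma abs2_cis a : abs2 (cis a) = 1 :> R.
Proof. by rewrite /abs2 /cis /=; exact: cos2Dsin2. Qed.
Lemma abs2_le_abs1 z : abs2 z <= abs1 z ^+ 2.
Proof.
rewrite /abs2 /abs1 -(real_normK (num_real (cRe z))) -(real_normK (num_real (cIm z))).
by have := mulr_ge0 (normr_ge0 (cRe z)) (normr_ge0 (cIm z)); nra.
Qed.
Lemma abs1_le_abs2 z : abs1 z ^+ 2 <= 2 * abs2 z.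
Proof.
rewrite /abs2 /abs1 -(real_normK (num_real (cRe z))) -(real_normK (num_real (cIm z))).
by have := sqr_ge0 (`|cRe z| - `|cIm z|); nra.
Qed.
Lemma abs1M z w : abs1 (z * w) <= abs1 z * abs1 w.
Proof.
rewrite /abs1 !cE.
have h1 := ler_normB (cRe z * cRe w) (cIm z * cIm w).
have h2 := ler_normD (cRe z * cIm w) (cIm z * cRe w).
by rewrite !normrM in h1 h2; lra.
Qed.
Lemma abs1D z w : abs1 (z + w) <= abs1 z + abs1 w.
Proof.
rewrite /abs1 !cE; have h1 := ler_normD (cRe z) (cRe w).
by have h2 := ler_normD (cIm z) (cIm w); lra.
Qed.
Lemma abs1N z : abs1 (- z) = abs1 z.
Proof. by rewrite /abs1 !cE !normrN. Qed.
Lemma abs1_conj z : abs1 (conjc z) = abs1 z.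
Proof. by rewrite /abs1 !cE !normrN. Qed.
Lemma abs1_real (a : R) : abs1 (a%:C)%C = `|a|.
Proof. by rewrite /abs1 !cE normr0 addr0. Qed.
Lemma abs1_cis a : abs1 (cis a) <= 2 :> R.
Proof.
by rewrite /abs1 /cis /= -[2]/(1 + 1) lerD// ler_norml ?cos_geN1 ?cos_le1 ?sin_geN1 ?sin_le1.
Qed.
Lemma abs2D z w : abs2 (z + w) <= 2 * abs2 z + 2 * abs2 w.
Proof.
rewrite /abs2 !cE.
have := sqr_ge0 (cRe z - cRe w); have := sqr_ge0 (cIm z - cIm w).
by rewrite !expr2; lra.
Qed.
(** Young's inequality with a free weight. The factor 2 lost in [abs1_le_abs2] is exactly the factor
    one half of Young's inequality, so the constants are 1. *)
Lemma abs1_mul_le z w (d : R) : 0 < d -> abs1 (z * conjc w) <= d * abs2 z + d^-1 * abs2 w.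
Proof.
move=> d0; apply: (le_trans (abs1M _ _)); rewrite abs1_conj.
have h : d * d^-1 = 1 by rewrite mulfV// gt_eqF.
have d1 : 0 < d^-1 by rewrite invr_gt0.
have a := abs1_le_abs2 z; have b := abs1_le_abs2 w.
have := sqr_ge0 (d * abs1 z - abs1 w).
have : d^-1 * (d * abs1 z - abs1 w) ^+ 2 = d * abs1 z ^+ 2 - 2 * (abs1 z * abs1 w) + d^-1 * abs1 w ^+ 2.
  have -> : d^-1 * (d * abs1 z - abs1 w) ^+ 2 = (d * d^-1) * d * abs1 z ^+ 2 - 2 * (d * d^-1) * (abs1 z * abs1 w) + d^-1 * abs1 w ^+ 2 by ring.
  by rewrite h; ring.
move=> e p.
have : 0 <= d^-1 * (d * abs1 z - abs1 w) ^+ 2 by rewrite mulr_ge0// ltW.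
have : d * abs1 z ^+ 2 <= d * (2 * abs2 z) by rewrite ler_wpM2l// ltW.
have : d^-1 * abs1 w ^+ 2 <= d^-1 * (2 * abs2 w) by rewrite ler_wpM2l// ltW.
lra.
Qed.
Lemma mul_conj z : z * conjc z = (abs2 z)%:C%C.
Proof. by apply: complex_ext; rewrite /abs2 !cE; ring. Qed.
Lemma abs2_normc z : Normc.normc z ^+ 2 = abs2 z.
Proof. by case: z => a b; rewrite /Normc.normc /= sqr_sqrtr// addr_ge0 ?sqr_ge0. Qed.
Lemma cisD (a b : R) : cis (a + b) = cis a * cis b :> R[i].
Proof. by apply: complex_ext; rewrite !cE /cis /= ?cosD ?sinD; ring. Qed.
Lemma cisN (a : R) : cis (- a) = conjc (cis a).
Proof. by apply: complex_ext; rewrite !cE /cis /= ?cosN ?sinN. Qed.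
Lemma conjcM z w : conjc (z * w) = conjc z * conjc w.
Proof. by apply: complex_ext; rewrite !cE; ring. Qed.
Lemma conjcD z w : conjc (z + w) = conjc z + conjc w.
Proof. by apply: complex_ext; rewrite !cE; ring. Qed.
Lemma conjcN z : conjc (- z) = - conjc z.
Proof. by apply: complex_ext; rewrite !cE; ring. Qed.
Lemma conjcc z : conjc (conjc z) = z.
Proof. by apply: complex_ext; rewrite !cE; ring. Qed.
Lemma conjc_real (a : R) : conjc (a%:C)%C = (a%:C)%C.
Proof. by apply: complex_ext; rewrite !cE; ring. Qed.
End complex_modulus.

(** * Integrability and square norms of complex-valued functions *)

Section complex_integral.
Context d (T : measurableType d) (R : realType).
Implicit Types (u v : T -> R[i]).

Notation cmeas := (cmeasurable setT).

Lemma cmeasD u v : cmeas u -> cmeas v -> cmeas (fun x => u x + v x).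
Proof.
move=> [a b] [a' b']; split.
- by under eq_fun do rewrite cReD; exact: measurable_funD.
- by under eq_fun do rewrite cImD; exact: measurable_funD.
Qed.
Lemma cmeasM u v : cmeas u -> cmeas v -> cmeas (fun x => u x * v x).
Proof.
move=> [a b] [a' b']; split.
- by under eq_fun do rewrite cReM; apply: measurable_funB; exact: measurable_funM.
- by under eq_fun do rewrite cImM; apply: measurable_funD; exact: measurable_funM.
Qed.
Lemma cmeasN u : cmeas u -> cmeas (fun x => - u x).
Proof.
move=> [a b]; split.
- by under eq_fun do rewrite cReN; exact: measurableT_comp.
- by under eq_fun do rewrite cImN; exact: measurableT_comp.
Qed.
Lemma cmeasB u v : cmeas u -> cmeas v -> cmeas (fun x => u x - v x).
Proof. by move=> a b; apply: cmeasD => //; exact: cmeasN. Qed.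
Lemma cmeas_conj u : cmeas u -> cmeas (fun x => conjc (u x)).
Proof.
move=> [a b]; split.
- by under eq_fun do rewrite cRe_conj.
- by under eq_fun do rewrite cIm_conj; exact: measurableT_comp.
Qed.
Lemma cmeas_cst (z : R[i]) : cmeas (fun _ : T => z).
Proof. by split; exact: measurable_cst. Qed.
Lemma cmeas_real (f : T -> R) : measurable_fun setT f -> cmeas (fun x => (f x)%:C%C).
Proof. by move=> mf; split => //; exact: measurable_cst. Qed.
Lemma cmeas_cis (f : T -> R) : measurable_fun setT f -> cmeas (fun x => cis (f x)).
Proof.
move=> mf; split; rewrite /cis /=.
- by apply: measurableT_comp => //; apply: continuous_measurable_fun; exact: continuous_cos.
- by apply: measurableT_comp => //; apply: continuous_measurable_fun; exact: continuous_sin.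
Qed.
Lemma measurable_abs2 u : cmeas u -> measurable_fun setT (fun x => abs2 (u x)).
Proof. by move=> [a b]; rewrite /abs2; apply: measurable_funD; exact: measurable_funX. Qed.
Lemma measurable_abs1 u : cmeas u -> measurable_fun setT (fun x => abs1 (u x)).
Proof. by move=> [a b]; rewrite /abs1; apply: measurable_funD; exact: measurableT_comp. Qed.
Lemma cmeas_comp d' (S : measurableType d') (f : S -> T) u :
  measurable_fun setT f -> cmeas u -> cmeasurable setT (fun x => u (f x)).
Proof.
by move=> mf [a b]; split; [exact: (measurableT_comp a mf)|exact: (measurableT_comp b mf)].
Qed.

Variable mu : {measure set T -> \bar R}.

Definition cint u : R[i] := cintegral mu setT u.
Definition cintegrable u :=
  mu.-integrable setT (EFin \o (fun x => cRe (u x))) /\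
  mu.-integrable setT (EFin \o (fun x => cIm (u x))).
Definition sq u : \bar R := (\int[mu]_x (abs2 (u x))%:E)%E.
Definition l1 u : \bar R := (\int[mu]_x (abs1 (u x))%:E)%E.
Definition L2 u := cmeas u /\ (sq u < +oo)%E.
(** [fine] sends an infinite norm to 0, so that [nsq] is meaningful only together with [L2]. *)
Definition nsq u : R := fine (sq u).
Definition ip u v : R[i] := cint (fun x => u x * conjc (v x)).

Lemma Re_cint u : cRe (cint u) = \int[mu]_x cRe (u x). Proof. by []. Qed.
Lemma Im_cint u : cIm (cint u) = \int[mu]_x cIm (u x). Proof. by []. Qed.

Lemma cintegrable_meas u : cintegrable u -> cmeas u.
Proof. by move=> [/measurable_int/measurable_EFinP a /measurable_int/measurable_EFinP b]. Qed.

Lemma cintegrable_le u (g : T -> R) : cmeas u -> mu.-integrable setT (EFin \o g) ->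
  (forall x, abs1 (u x) <= g x) -> cintegrable u.
Proof.
move=> [a b] ig h; split.
- apply: (le_integrable _ _ _ ig) => //; first exact/measurable_EFinP.
  move=> x _ /=; rewrite lee_fin; apply: le_trans (ler_norm _); apply: le_trans (h x).
  by rewrite /abs1 lerDl.
- apply: (le_integrable _ _ _ ig) => //; first exact/measurable_EFinP.
  move=> x _ /=; rewrite lee_fin; apply: le_trans (ler_norm _); apply: le_trans (h x).
  by rewrite /abs1 lerDr.
Qed.

Lemma integrable_abs1 u : cintegrable u -> mu.-integrable setT (EFin \o (fun x => abs1 (u x))).
Proof.
move=> [a b]; rewrite /abs1.
have -> : EFin \o (fun x => `|cRe (u x)| + `|cIm (u x)|) =
  (fun x => `|(cRe (u x))%:E| + `|(cIm (u x))%:E|)%E by [].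
by apply: integrableD => //; exact: integrable_abse.
Qed.

Lemma l1_lty u : cmeas u -> (l1 u < +oo)%E -> cintegrable u.
Proof.
move=> mu' h; apply: (cintegrable_le (g := fun x => abs1 (u x))) => //.
apply/integrableP; split; first exact/measurable_EFinP/measurable_abs1.
rewrite (_ : (\int[mu]_x _)%E = l1 u)//; apply: eq_integral => x _ /=.
by rewrite ger0_norm// abs1_ge0.
Qed.

Lemma cintegrable_l1 u : cintegrable u -> (l1 u < +oo)%E.
Proof.
move=> /integrable_abs1/integrableP[_]; rewrite (_ : (\int[mu]_x _)%E = l1 u)//.
by apply: eq_integral => x _ /=; rewrite ger0_norm// abs1_ge0.
Qed.

Lemma cintegrableD u v : cintegrable u -> cintegrable v -> cintegrable (fun x => u x + v x).
Proof.
move=> [a b] [a' b']; split.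
- have -> : EFin \o (fun x => cRe (u x + v x)) = (fun x => (cRe (u x))%:E + (cRe (v x))%:E)%E.
    by apply/funext => x /=; rewrite cReD.
  exact: integrableD.
- have -> : EFin \o (fun x => cIm (u x + v x)) = (fun x => (cIm (u x))%:E + (cIm (v x))%:E)%E.
    by apply/funext => x /=; rewrite cImD.
  exact: integrableD.
Qed.

Lemma cintegrable_bnd u v (k : R) : cmeas u -> cintegrable v ->
  (forall x, abs1 (u x) <= k * abs1 (v x)) -> cintegrable u.
Proof.
move=> m i h; apply: (cintegrable_le (g := fun x => k * abs1 (v x))) => //.
have -> : EFin \o (fun x => k * abs1 (v x)) = (fun x => k%:E * (abs1 (v x))%:E)%E by [].
by apply: integrableZl => //; exact: integrable_abs1.
Qed.

Lemma cintegrableM u v (k : R) : cintegrable u -> cmeas v -> (forall x, abs1 (v x) <= k) ->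
  cintegrable (fun x => u x * v x).
Proof.
move=> i m h; apply: (cintegrable_bnd (v := u) (k := k)) => //.
  by apply: cmeasM => //; exact: cintegrable_meas.
move=> x; apply: (le_trans (abs1M _ _)); by rewrite mulrC ler_wpM2r// abs1_ge0.
Qed.

Lemma cintegrableN u : cintegrable u -> cintegrable (fun x => - u x).
Proof.
move=> i; apply: (cintegrable_bnd (v := u) (k := 1)) => //.
  by apply: cmeasN; exact: cintegrable_meas.
by move=> x; rewrite abs1N mul1r.
Qed.

Lemma cintegrable_conj u : cintegrable u -> cintegrable (fun x => conjc (u x)).
Proof.
move=> i; apply: (cintegrable_bnd (v := u) (k := 1)) => //.
  by apply: cmeas_conj; exact: cintegrable_meas.
by move=> x; rewrite abs1_conj mul1r.
Qed.

Lemma cintegrableB u v : cintegrable u -> cintegrable v -> cintegrable (fun x => u x - v x).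
Proof. by move=> a b; apply: cintegrableD => //; exact: cintegrableN. Qed.

Lemma cintegrableZ (z : R[i]) u : cintegrable u -> cintegrable (fun x => z * u x).
Proof.
move=> i; apply: (cintegrable_bnd (v := u) (k := abs1 z)) => //.
  by apply: cmeasM; [exact: cmeas_cst|exact: cintegrable_meas].
by move=> x; exact: abs1M.
Qed.

Lemma cintD u v : cintegrable u -> cintegrable v -> cint (fun x => u x + v x) = cint u + cint v.
Proof.
move=> [a b] [a' b']; apply: complex_ext; rewrite !(cReD, cImD) !(Re_cint, Im_cint).
- by under eq_Rintegral do rewrite cReD; rewrite RintegralD.
- by under eq_Rintegral do rewrite cImD; rewrite RintegralD.
Qed.

Lemma cint_conj u : cintegrable u -> cint (fun x => conjc (u x)) = conjc (cint u).
Proof.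
move=> [a b]; apply: complex_ext; rewrite !(cRe_conj, cIm_conj) !(Re_cint, Im_cint).
- by under eq_Rintegral do rewrite cRe_conj.
- under eq_Rintegral do rewrite cIm_conj -mulN1r.
  by rewrite RintegralZl// mulN1r.
Qed.

Lemma cintZ (z : R[i]) u : cintegrable u -> cint (fun x => z * u x) = z * cint u.
Proof.
move=> [a b]; have H (c : R) f : mu.-integrable setT (EFin \o f) -> mu.-integrable setT (EFin \o (fun x => c * f x)).
  move=> h; have -> : EFin \o (fun x => c * f x) = (fun x => c%:E * (f x)%:E)%E by [].
  exact: integrableZl.
apply: complex_ext; rewrite !(cReM, cImM) !(Re_cint, Im_cint).
- by under eq_Rintegral do rewrite cReM; rewrite RintegralB ?RintegralZl//; exact: H.
- by under eq_Rintegral do rewrite cImM; rewrite RintegralD ?RintegralZl//; exact: H.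
Qed.

Lemma cintZr (z : R[i]) u : cintegrable u -> cint (fun x => u x * z) = cint u * z.
Proof. by move=> i; rewrite mulrC -cintZ//; congr cint; apply/funext => x; rewrite mulrC. Qed.

Lemma cintN u : cintegrable u -> cint (fun x => - u x) = - cint u.
Proof.
move=> i; rewrite -mulN1r -cintZ//; congr cint; apply/funext => x; by rewrite mulN1r.
Qed.

Lemma cintB u v : cintegrable u -> cintegrable v -> cint (fun x => u x - v x) = cint u - cint v.
Proof. by move=> a b; rewrite cintD ?cintN//; exact: cintegrableN. Qed.

Lemma abs1_cint u : cintegrable u -> ((abs1 (cint u))%:E <= l1 u)%E.
Proof.
move=> i; have [a b] := i.
have e (f : T -> R) : mu.-integrable setT (EFin \o f) ->
    (`|\int[mu]_x f x|%:E <= \int[mu]_x (`|f x|)%:E)%E.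
  move=> h; rewrite EFin_normr_Rintegral//.
  apply: le_trans (le_abse_integral _ _ _) _ => //; exact: measurable_int h.
rewrite /abs1 /cint /cintegral /= EFinD; apply: le_trans (leeD (e _ a) (e _ b)) _.
have [ma mb] := cintegrable_meas i.
by rewrite -ge0_integralD//; apply/measurable_EFinP; exact: measurableT_comp.
Qed.

Lemma cint_ae u v : cmeas u -> cmeas v -> {ae mu, forall x, u x = v x} -> cint u = cint v.
Proof.
move=> [a b] [a' b'] h; apply: complex_ext; rewrite /cint /cintegral /Rintegral !cE; congr fine.
- apply: ae_eq_integral => //; try exact/measurable_EFinP.
  by apply: filterS h => x -> _.
- apply: ae_eq_integral => //; try exact/measurable_EFinP.
  by apply: filterS h => x -> _.
Qed.

Lemma sq_ae u v : cmeas u -> cmeas v -> {ae mu, forall x, u x = v x} -> sq u = sq v.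
Proof.
move=> a b h; apply: ae_eq_integral => //; try exact/measurable_EFinP/measurable_abs2.
by apply: filterS h => x -> _.
Qed.

Lemma sq_ge0 u : (0 <= sq u)%E.
Proof. by apply: integral_ge0 => x _; rewrite lee_fin abs2_ge0. Qed.

Lemma sq0P u : cmeas u -> (sq u <= 0)%E -> {ae mu, forall x, u x = 0}.
Proof.
move=> m h; have /eqP : sq u = 0%E by apply/eqP; rewrite eq_le h sq_ge0.
move=> /eqP e; have := @ae_eq_integral_abs _ _ _ mu setT measurableT (fun x => (abs2 (u x))%:E).
move=> /(_ (iffRL (measurable_EFinP _ _) (measurable_abs2 m)))[+ _].
rewrite (_ : (\int[mu]_x _)%E = sq u); last first.
  by apply: eq_integral => x _ /=; rewrite ger0_norm// abs2_ge0.
move=> /(_ e); apply: filterS => x /(_ I)/= [] /eqP.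
by rewrite abs2_eq0 => /eqP.
Qed.

Lemma le_sq u v (k : R) : 0 <= k -> cmeas u -> cmeas v -> (forall x, abs2 (u x) <= k * abs2 (v x)) ->
  (sq u <= k%:E * sq v)%E.
Proof.
move=> k0 a b h; rewrite /sq -ge0_integralZl//=.
- apply: ge0_le_integral => //.
  + by move=> x _; rewrite lee_fin abs2_ge0.
  + exact/measurable_EFinP/measurable_abs2.
  + by apply/measurable_EFinP; apply: measurable_funM => //; exact: measurable_abs2.
  + by move=> x _; rewrite lee_fin.
- exact/measurable_EFinP/measurable_abs2.
- by move=> x _; rewrite lee_fin abs2_ge0.
Qed.

Lemma sqD u v : cmeas u -> cmeas v ->
  (sq (fun x => (u x + v x)%R) <= 2%:E * sq u + 2%:E * sq v)%E.
Proof.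
move=> a b; have mu' := measurable_abs2 a; have mv' := measurable_abs2 b.
rewrite /sq -!ge0_integralZl//=; try (by move=> x _; rewrite lee_fin abs2_ge0);
  try exact/measurable_EFinP.
rewrite -ge0_integralD//=.
- apply: ge0_le_integral => //.
  + by move=> x _; rewrite lee_fin abs2_ge0.
  + exact/measurable_EFinP/measurable_abs2/cmeasD.
  + by apply/measurable_EFinP; apply: measurable_funD; exact: measurable_funM.
  + by move=> x _; rewrite lee_fin abs2D.
- by move=> x _; rewrite lee_fin mulr_ge0// abs2_ge0.
- by apply/measurable_EFinP; exact: measurable_funM.
- by move=> x _; rewrite lee_fin mulr_ge0// abs2_ge0.
- by apply/measurable_EFinP; exact: measurable_funM.
Qed.

Lemma sqN u : sq (fun x => - u x) = sq u.
Proof. by apply: eq_integral => x _; rewrite abs2N. Qed.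
Lemma sq_conj u : sq (fun x => conjc (u x)) = sq u.
Proof. by apply: eq_integral => x _; rewrite abs2_conj. Qed.
Lemma sqZ (z : R[i]) u : cmeas u -> sq (fun x => z * u x) = ((abs2 z)%:E * sq u)%E.
Proof.
move=> m; rewrite /sq -ge0_integralZl//=; first by apply: eq_integral => x _; rewrite abs2M.
- exact/measurable_EFinP/measurable_abs2.
- by move=> x _; rewrite lee_fin abs2_ge0.
- by rewrite lee_fin abs2_ge0.
Qed.
Lemma L2_meas u : L2 u -> cmeas u. Proof. by case. Qed.
Lemma L2_fin u : L2 u -> sq u = (nsq u)%:E.
Proof. by move=> [_ h]; rewrite /nsq fineK// ge0_fin_numE// sq_ge0. Qed.
Lemma nsq_ge0 u : 0 <= nsq u. Proof. by rewrite /nsq fine_ge0// sq_ge0. Qed.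

Lemma L2D u v : L2 u -> L2 v -> L2 (fun x => u x + v x).
Proof.
move=> a b; split; first by apply: cmeasD; exact: L2_meas.
apply: le_lt_trans (sqD (L2_meas a) (L2_meas b)) _.
by rewrite !L2_fin// -!EFinM -EFinD ltry.
Qed.
Lemma L2N u : L2 u -> L2 (fun x => - u x).
Proof. by move=> [a b]; split; [exact: cmeasN|rewrite sqN]. Qed.
Lemma L2B u v : L2 u -> L2 v -> L2 (fun x => u x - v x).
Proof. by move=> a b; apply: L2D => //; exact: L2N. Qed.
Lemma L2_conj u : L2 u -> L2 (fun x => conjc (u x)).
Proof. by move=> [a b]; split; [exact: cmeas_conj|rewrite sq_conj]. Qed.
Lemma L2Z (z : R[i]) u : L2 u -> L2 (fun x => z * u x).
Proof.
move=> a; split; first by apply: cmeasM; [exact: cmeas_cst|exact: L2_meas].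
by rewrite sqZ ?L2_fin -?EFinM ?ltry//; exact: L2_meas.
Qed.
Lemma L2_ae u v : cmeas v -> {ae mu, forall x, u x = v x} -> L2 u -> L2 v.
Proof. by move=> mv h [a b]; split => //; rewrite -(sq_ae a mv h). Qed.
Lemma L2_bnd u v (k : R) : cmeas u -> L2 v -> 0 <= k -> (forall x, abs2 (u x) <= k * abs2 (v x)) -> L2 u.
Proof.
move=> mu' a k0 h; split => //; apply: le_lt_trans (le_sq k0 mu' (L2_meas a) h) _.
by rewrite L2_fin// -EFinM ltry.
Qed.

Lemma integrable_abs2 u : L2 u -> mu.-integrable setT (EFin \o (fun x => abs2 (u x))).
Proof.
move=> [a b]; apply/integrableP; split; first exact/measurable_EFinP/measurable_abs2.
rewrite (_ : (\int[mu]_x _)%E = sq u)//; apply: eq_integral => x _ /=.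
by rewrite ger0_norm// abs2_ge0.
Qed.

Lemma L2_mulc u v : L2 u -> L2 v -> cintegrable (fun x => u x * conjc (v x)).
Proof.
move=> a b; apply: (cintegrable_le (g := fun x => abs2 (u x) + abs2 (v x))).
- by apply: cmeasM; [exact: L2_meas|apply: cmeas_conj; exact: L2_meas].
- have -> : EFin \o (fun x => abs2 (u x) + abs2 (v x)) = (fun x => (abs2 (u x))%:E + (abs2 (v x))%:E)%E by [].
  by apply: integrableD => //; exact: integrable_abs2.
- by move=> x; have := abs1_mul_le (u x) (v x) (ltr01 : 0 < 1 :> R); rewrite invr1 !mul1r.
Qed.

(** The integrated Young inequality, which takes the place of Cauchy-Schwarz throughout: a suitable
    [k] shows that a pairing is small when one of its factors is, without square roots. *)
Lemma ip_bound u v (k : R) : L2 u -> L2 v -> 0 < k ->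
  abs1 (ip u v) <= k * nsq u + k^-1 * nsq v.
Proof.
move=> a b k0; rewrite -lee_fin; apply: le_trans (abs1_cint (L2_mulc a b)) _.
have ki : 0 <= k^-1 by rewrite invr_ge0 ltW.
have k0' := ltW k0.
have ma := measurable_abs2 (L2_meas a); have mb := measurable_abs2 (L2_meas b).
rewrite EFinD !EFinM -!L2_fin// /sq -!ge0_integralZl//=; try exact/measurable_EFinP;
  try (by move=> x _; rewrite lee_fin abs2_ge0).
rewrite -ge0_integralD//=; try (by apply/measurable_EFinP; apply: measurable_funM);
  try (by move=> x _; rewrite lee_fin mulr_ge0// abs2_ge0).
apply: ge0_le_integral => //.
- by move=> x _; rewrite lee_fin abs1_ge0.
- by apply/measurable_EFinP/measurable_abs1; exact: cintegrable_meas (L2_mulc a b).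
- by apply/measurable_EFinP; apply: measurable_funD; exact: measurable_funM.
- by move=> x _; rewrite lee_fin abs1_mul_le.
Qed.

End complex_integral.
Notation cmeas := (cmeasurable setT).

(** Real-valued integrals are [fine] of extended ones. The infinities are sent to 0, so they belong
    to the preimage of [Y] exactly when 0 lies in [Y]. *)
Lemma measurable_fine (R : realType) : measurable_fun setT (@fine R).
Proof.
move=> _ Y mY; rewrite setTI.
have -> : @fine R @^-1` Y = EFin @` Y `|` ([set +oo%E; -oo%E] `&` [set _ | Y 0]).
  apply/seteqP; split.
  - case=> [r| |] /= h; [by left; exists r|by right; split; [left|]|by right; split; [right|]].
  - by move=> x [[r Yr <-]//|[[->|->] h]].
apply: measurableU; first exact: measurable_image_EFin.
have [h|h] := pselect (Y 0).
- have -> : [set _ | Y 0] = [set: \bar R] by apply/seteqP; split.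
  by rewrite setIT; apply: measurableU.
- have -> : [set _ | Y 0] = set0 :> set (\bar R) by apply/seteqP; split.
  by rewrite setI0.
Qed.

(** * Tonelli and Fubini for complex-valued functions *)

Section product_integrals.
Context d1 d2 (T1 : measurableType d1) (T2 : measurableType d2) (R : realType).
Variable m1 : {sigma_finite_measure set T1 -> \bar R}.
Variable m2 : {sigma_finite_measure set T2 -> \bar R}.
Notation m12 := (sigma_finite_product m1 m2).
Implicit Type u : T1 * T2 -> R[i].

Lemma cmeas_section1 u x : cmeas u -> cmeas (fun y => u (x, y)).
Proof. by apply: cmeas_comp; exact: measurable_pair1. Qed.
Lemma cmeas_section2 u y : cmeas u -> cmeas (fun x => u (x, y)).
Proof. by apply: cmeas_comp; exact: measurable_pair2. Qed.

Lemma sq_tonelli1 u : cmeas u -> sq m12 u = (\int[m1]_x sq m2 (fun y => u (x, y)))%E.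
Proof.
move=> mu'; rewrite /sq (@fubini_tonelli1 _ _ _ _ _ m1 m2 (fun p => (abs2 (u p))%:E))//.
  exact/measurable_EFinP/measurable_abs2.
by move=> p; rewrite lee_fin abs2_ge0.
Qed.
Lemma sq_tonelli2 u : cmeas u -> sq m12 u = (\int[m2]_y sq m1 (fun x => u (x, y)))%E.
Proof.
move=> mu'; rewrite /sq (@fubini_tonelli2 _ _ _ _ _ m1 m2 (fun p => (abs2 (u p))%:E))//.
  exact/measurable_EFinP/measurable_abs2.
by move=> p; rewrite lee_fin abs2_ge0.
Qed.
Lemma l1_tonelli1 u : cmeas u -> l1 m12 u = (\int[m1]_x l1 m2 (fun y => u (x, y)))%E.
Proof.
move=> mu'; rewrite /l1 (@fubini_tonelli1 _ _ _ _ _ m1 m2 (fun p => (abs1 (u p))%:E))//.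
  exact/measurable_EFinP/measurable_abs1.
by move=> p; rewrite lee_fin abs1_ge0.
Qed.
Lemma l1_tonelli2 u : cmeas u -> l1 m12 u = (\int[m2]_y l1 m1 (fun x => u (x, y)))%E.
Proof.
move=> mu'; rewrite /l1 (@fubini_tonelli2 _ _ _ _ _ m1 m2 (fun p => (abs1 (u p))%:E))//.
  exact/measurable_EFinP/measurable_abs1.
by move=> p; rewrite lee_fin abs1_ge0.
Qed.
Lemma measurable_sq1 u : cmeas u -> measurable_fun setT (fun x => sq m2 (fun y => u (x, y))).
Proof.
move=> mu'; apply: (@measurable_fun_fubini_tonelli_F _ _ _ _ _ m2 (fun p => (abs2 (u p))%:E)).
  exact/measurable_EFinP/measurable_abs2.
by move=> p; rewrite lee_fin abs2_ge0.
Qed.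
Lemma measurable_sq2 u : cmeas u -> measurable_fun setT (fun y => sq m1 (fun x => u (x, y))).
Proof.
move=> mu'; apply: (@measurable_fun_fubini_tonelli_G _ _ _ _ _ m1 (fun p => (abs2 (u p))%:E)).
  exact/measurable_EFinP/measurable_abs2.
by move=> p; rewrite lee_fin abs2_ge0.
Qed.

(** No integrability is assumed: the inner integral is a difference of two Tonelli integrals,
    measurable with whatever convention holds for infinity minus infinity, and [fine] is
    measurable. *)
Let mint1 (f : T1 * T2 -> R) : measurable_fun setT f ->
  measurable_fun setT (fun x => \int[m2]_y f (x, y)).
Proof.
move=> mf; rewrite /Rintegral; apply: measurableT_comp; first exact: measurable_fine.
have mF : measurable_fun setT (EFin \o f) by exact/measurable_EFinP.
under eq_fun do rewrite integralE.
apply: emeasurable_funB.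
- rewrite [X in measurable_fun _ X](_ : _ = fubini_F m2 ((EFin \o f)^\+)%E).
    by apply: measurable_fun_fubini_tonelli_F => //; exact: measurable_funepos.
  by apply/funext => x; apply: eq_integral => y _; rewrite !funeposE.
- rewrite [X in measurable_fun _ X](_ : _ = fubini_F m2 ((EFin \o f)^\-)%E).
    by apply: measurable_fun_fubini_tonelli_F => //; exact: measurable_funeneg.
  by apply/funext => x; apply: eq_integral => y _; rewrite !funenegE.
Qed.
Let mint2 (f : T1 * T2 -> R) : measurable_fun setT f ->
  measurable_fun setT (fun y => \int[m1]_x f (x, y)).
Proof.
move=> mf; rewrite /Rintegral; apply: measurableT_comp; first exact: measurable_fine.
have mF : measurable_fun setT (EFin \o f) by exact/measurable_EFinP.
under eq_fun do rewrite integralE.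
apply: emeasurable_funB.
- rewrite [X in measurable_fun _ X](_ : _ = fubini_G m1 ((EFin \o f)^\+)%E).
    by apply: measurable_fun_fubini_tonelli_G => //; exact: measurable_funepos.
  by apply/funext => x; apply: eq_integral => y _; rewrite !funeposE.
- rewrite [X in measurable_fun _ X](_ : _ = fubini_G m1 ((EFin \o f)^\-)%E).
    by apply: measurable_fun_fubini_tonelli_G => //; exact: measurable_funeneg.
  by apply/funext => x; apply: eq_integral => y _; rewrite !funenegE.
Qed.

Lemma cmeas_cint1 u : cmeas u -> cmeas (fun x => cint m2 (fun y => u (x, y))).
Proof.
by move=> [a b]; split; [exact: (mint1 a)|exact: (mint1 b)].
Qed.
Lemma cmeas_cint2 u : cmeas u -> cmeas (fun y => cint m1 (fun x => u (x, y))).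
Proof.
by move=> [a b]; split; [exact: (mint2 a)|exact: (mint2 b)].
Qed.

Let fub1 (f : T1 * T2 -> R) : m12.-integrable setT (EFin \o f) ->
  \int[m12]_z f z = \int[m1]_x \int[m2]_y f (x, y).
Proof.
move=> i; rewrite /Rintegral -integral12_prod_meas1//; congr fine.
have mf : measurable_fun setT f by move/measurable_int/measurable_EFinP : i.
apply: ae_eq_integral => //.
- exact: (measurable_fubini_F i).
- by apply/measurable_EFinP; exact: mint1.
apply: filterS (ae_integrable1 i) => x ix _ /=.
by rewrite fineK//; exact: integrable_fin_num.
Qed.
Let fub2 (f : T1 * T2 -> R) : m12.-integrable setT (EFin \o f) ->
  \int[m12]_z f z = \int[m2]_y \int[m1]_x f (x, y).
Proof.
move=> i; rewrite /Rintegral -integral21_prod_meas1//; congr fine.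
have mf : measurable_fun setT f by move/measurable_int/measurable_EFinP : i.
apply: ae_eq_integral => //.
- exact: (measurable_fubini_G i).
- by apply/measurable_EFinP; exact: mint2.
apply: filterS (ae_integrable2 i) => x ix _ /=.
by rewrite fineK//; exact: integrable_fin_num.
Qed.

Lemma cint_fubini1 u : cintegrable m12 u ->
  cint m12 u = cint m1 (fun x => cint m2 (fun y => u (x, y))).
Proof.
by move=> [a b]; apply: complex_ext; rewrite !(Re_cint, Im_cint); exact: fub1.
Qed.
Lemma cint_fubini2 u : cintegrable m12 u ->
  cint m12 u = cint m2 (fun y => cint m1 (fun x => u (x, y))).
Proof.
by move=> [a b]; apply: complex_ext; rewrite !(Re_cint, Im_cint); exact: fub2.
Qed.
Lemma cint_swap u : cintegrable m12 u ->
  cint m1 (fun x => cint m2 (fun y => u (x, y))) = cint m2 (fun y => cint m1 (fun x => u (x, y))).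
Proof. by move=> i; rewrite -cint_fubini1 ?cint_fubini2. Qed.

Lemma cintegrable_ae1 u : cintegrable m12 u -> {ae m1, forall x, cintegrable m2 (fun y => u (x, y))}.
Proof.
move=> [a b]; have := ae_integrable1 a; have := ae_integrable1 b.
by apply: filterS2.
Qed.
Lemma cintegrable_ae2 u : cintegrable m12 u -> {ae m2, forall y, cintegrable m1 (fun x => u (x, y))}.
Proof.
move=> [a b]; have := ae_integrable2 a; have := ae_integrable2 b.
by apply: filterS2.
Qed.

Lemma cintegrable_fubini1 u : cintegrable m12 u ->
  cintegrable m1 (fun x => cint m2 (fun y => u (x, y))).
Proof.
move=> i; have mu' := cintegrable_meas i.
apply: l1_lty; first exact: cmeas_cint1.
apply: le_lt_trans (cintegrable_l1 i); rewrite l1_tonelli1//.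
apply: ae_ge0_le_integral => //.
- by move=> x _; rewrite lee_fin abs1_ge0.
- by apply/measurable_EFinP/measurable_abs1; exact: cmeas_cint1.
- by move=> x _; apply: integral_ge0 => y _; rewrite lee_fin abs1_ge0.
- apply: (@measurable_fun_fubini_tonelli_F _ _ _ _ _ m2 (fun p => (abs1 (u p))%:E)).
    exact/measurable_EFinP/measurable_abs1.
  by move=> p; rewrite lee_fin abs1_ge0.
by apply: filterS (cintegrable_ae1 i) => x ix _; exact: abs1_cint.
Qed.
Lemma cintegrable_fubini2 u : cintegrable m12 u ->
  cintegrable m2 (fun y => cint m1 (fun x => u (x, y))).
Proof.
move=> i; have mu' := cintegrable_meas i.
apply: l1_lty; first exact: cmeas_cint2.
apply: le_lt_trans (cintegrable_l1 i); rewrite l1_tonelli2//.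
apply: ae_ge0_le_integral => //.
- by move=> x _; rewrite lee_fin abs1_ge0.
- by apply/measurable_EFinP/measurable_abs1; exact: cmeas_cint2.
- by move=> x _; apply: integral_ge0 => y _; rewrite lee_fin abs1_ge0.
- apply: (@measurable_fun_fubini_tonelli_G _ _ _ _ _ m1 (fun p => (abs1 (u p))%:E)).
    exact/measurable_EFinP/measurable_abs1.
  by move=> p; rewrite lee_fin abs1_ge0.
by apply: filterS (cintegrable_ae2 i) => x ix _; exact: abs1_cint.
Qed.

Lemma L2_ae1 u : L2 m12 u -> {ae m1, forall x, L2 m2 (fun y => u (x, y))}.
Proof.
move=> [a b]; rewrite sq_tonelli1// in b.
have : m1.-integrable setT (fun x => sq m2 (fun y => u (x, y))).
  apply/integrableP; split; first exact: measurable_sq1.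
  rewrite (eq_integral (fun x => sq m2 (fun y => u (x, y))))// => x _.
  by rewrite gee0_abs// sq_ge0.
move=> /(integrable_ae measurableT); apply: filterS => x /(_ I) h; split.
  exact: cmeas_section1.
by rewrite -ge0_fin_numE// sq_ge0.
Qed.
Lemma L2_ae2 u : L2 m12 u -> {ae m2, forall y, L2 m1 (fun x => u (x, y))}.
Proof.
move=> [a b]; rewrite sq_tonelli2// in b.
have : m2.-integrable setT (fun y => sq m1 (fun x => u (x, y))).
  apply/integrableP; split; first exact: measurable_sq2.
  rewrite (eq_integral (fun y => sq m1 (fun x => u (x, y))))// => x _.
  by rewrite gee0_abs// sq_ge0.
move=> /(integrable_ae measurableT); apply: filterS => x /(_ I) h; split.
  exact: cmeas_section2.
by rewrite -ge0_fin_numE// sq_ge0.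
Qed.

(** The measure of a null set is the integral of the measures of its sections, so almost all of them
    are null. *)
Lemma ae_section1 (P : T1 -> T2 -> Prop) : {ae m12, forall p, P p.1 p.2} ->
  {ae m1, forall x, {ae m2, forall y, P x y}}.
Proof.
move=> [N [mN N0 hN]].
have mf : measurable_fun setT (fun x => m2 (xsection N x)) by exact: measurable_fun_xsection.
have : (\int[m1]_x `|m2 (xsection N x)|)%E = 0%E.
  rewrite -[RHS]N0; apply: eq_integral => x _; by rewrite gee0_abs.
move=> /(ae_eq_integral_abs _ measurableT mf); apply: filterS => x /(_ I) h.
exists (xsection N x); split => //; first exact: measurable_xsection.
move=> y /= Pxy; rewrite /xsection /= inE; apply: hN => /=; exact: Pxy.
Qed.
Lemma ae_section2 (P : T1 -> T2 -> Prop) : {ae m12, forall p, P p.1 p.2} ->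
  {ae m2, forall y, {ae m1, forall x, P x y}}.
Proof.
move=> [N [mN N0 hN]].
have mf : measurable_fun setT (fun y => m1 (ysection N y)) by exact: measurable_fun_ysection.
have : (\int[m2]_y `|m1 (ysection N y)|)%E = 0%E.
  rewrite -[RHS]N0.
  transitivity (\int[m2]_y fubini_G m1 (EFin \o \1_N) y)%E.
    apply: eq_integral => y _; rewrite gee0_abs//.
    by rewrite indic_fubini_tonelli_GE.
  rewrite -indic_fubini_tonelli// -indic_fubini_tonelli1// integral_indic// setIT.
  by [].
move=> /(ae_eq_integral_abs _ measurableT mf); apply: filterS => y /(_ I) h.
exists (ysection N y); split => //; first exact: measurable_ysection.
move=> x /= Pxy; rewrite /ysection /= inE; apply: hN => /=; exact: Pxy.
Qed.

Lemma cintegrable_tensor (u : T1 -> R[i]) (v : T2 -> R[i]) : cintegrable m1 u -> cintegrable m2 v ->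
  cintegrable m12 (fun p => u p.1 * v p.2).
Proof.
move=> iu iv; have mu' := cintegrable_meas iu; have mv := cintegrable_meas iv.
have m : cmeas (fun p : T1 * T2 => u p.1 * v p.2).
  by apply: cmeasM; [apply: (cmeas_comp (f := fst))|apply: (cmeas_comp (f := snd))].
apply: l1_lty => //; rewrite l1_tonelli1//=.
have fv := cintegrable_l1 iv.
have lv0 : (0 <= l1 m2 v)%E by apply: integral_ge0 => y _; rewrite lee_fin abs1_ge0.
apply: (@le_lt_trans _ _ (\int[m1]_x ((abs1 (u x))%:E * l1 m2 v))%E).
  apply: ge0_le_integral => //.
  - by move=> x _; apply: integral_ge0 => y _; rewrite lee_fin abs1_ge0.
  - apply: (@measurable_fun_fubini_tonelli_F _ _ _ _ _ m2 (fun p => (abs1 (u p.1 * v p.2))%:E)).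
      exact/measurable_EFinP/measurable_abs1.
    by move=> p; rewrite lee_fin abs1_ge0.
  - apply: emeasurable_funM; last exact: measurable_cst.
    exact/measurable_EFinP/measurable_abs1.
  - move=> x _; rewrite /l1 -ge0_integralZl//.
    + apply: ge0_le_integral => //.
      * by move=> y _; rewrite lee_fin abs1_ge0.
      * apply/measurable_EFinP/measurable_abs1; apply: cmeasM => //; exact: cmeas_cst.
      * apply/measurable_EFinP; apply: measurable_funM => //; exact: measurable_abs1.
      * by move=> y _; rewrite lee_fin abs1M.
    + exact/measurable_EFinP/measurable_abs1.
    + by move=> y _; rewrite lee_fin abs1_ge0.
    + by rewrite lee_fin abs1_ge0.
under eq_integral do rewrite muleC.
rewrite ge0_integralZl//; first by rewrite lte_mul_pinfty ?ge0_fin_numE//; exact: cintegrable_l1.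
- exact/measurable_EFinP/measurable_abs1.
- by move=> x _; rewrite lee_fin abs1_ge0.
Qed.

Lemma cint_tensor (u : T1 -> R[i]) (v : T2 -> R[i]) : cintegrable m1 u -> cintegrable m2 v ->
  cint m12 (fun p => u p.1 * v p.2) = cint m1 u * cint m2 v.
Proof.
move=> iu iv; rewrite cint_fubini1 /=; last exact: cintegrable_tensor.
by under [X in cint m1 X]eq_fun do rewrite cintZ//; rewrite cintZr.
Qed.

Lemma L2_tensor (u : T1 -> R[i]) (v : T2 -> R[i]) : L2 m1 u -> L2 m2 v ->
  L2 m12 (fun p => u p.1 * v p.2).
Proof.
move=> lu lv; have m : cmeas (fun p : T1 * T2 => u p.1 * v p.2).
  by apply: cmeasM; [apply: (cmeas_comp (f := fst))|apply: (cmeas_comp (f := snd))] => //;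
    [exact: L2_meas lu|exact: L2_meas lv].
split => //; rewrite sq_tonelli1//=.
under eq_integral do rewrite (sqZ _ _ (L2_meas lv)) (L2_fin lv) muleC.
rewrite ge0_integralZl//.
- by rewrite -/(sq m1 u) (L2_fin lu) -EFinM ltry.
- by apply/measurable_EFinP/measurable_abs2; exact: L2_meas lu.
- by move=> x _; rewrite lee_fin abs2_ge0.
- by rewrite lee_fin nsq_ge0.
Qed.

End product_integrals.

(** * The inner product of L2 *)

Section L2_identities.
Context d (T : measurableType d) (R : realType) (mu : {measure set T -> \bar R}).
Implicit Types u v : T -> R[i].

Lemma nsqE u : nsq mu u = \int[mu]_x abs2 (u x). Proof. by []. Qed.

Lemma nsqDip u v : L2 mu u -> L2 mu v ->
  nsq mu (fun x => u x + v x) = nsq mu u + 2 * cRe (ip mu u v) + nsq mu v.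
Proof.
move=> a b; have [i _] := L2_mulc a b; rewrite /ip Re_cint !nsqE.
have i2 : mu.-integrable setT (EFin \o (fun x => 2 * cRe (u x * conjc (v x)))).
  have -> : EFin \o (fun x => 2 * cRe (u x * conjc (v x))) =
     (fun x => 2%:E * (cRe (u x * conjc (v x)))%:E)%E by [].
  exact: integrableZl.
have ia := integrable_abs2 a; have ib := integrable_abs2 b.
rewrite -RintegralZl// -RintegralD// -RintegralD//; last first.
  have -> : EFin \o (fun x => abs2 (u x) + 2 * cRe (u x * conjc (v x))) =
     (fun x => (abs2 (u x))%:E + (2 * cRe (u x * conjc (v x)))%:E)%E by [].
  exact: integrableD.
by apply: eq_Rintegral => x _; rewrite /abs2 !cE; ring.
Qed.

Lemma ipNr u v : L2 mu u -> L2 mu v -> ip mu u (fun x => - v x) = - ip mu u v.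
Proof.
move=> a b; rewrite /ip -cintN; last exact: L2_mulc.
by congr cint; apply/funext => x; rewrite conjcN mulrN.
Qed.
Lemma ipC u v : L2 mu u -> L2 mu v -> ip mu u v = conjc (ip mu v u).
Proof.
move=> a b; rewrite /ip -cint_conj; last exact: L2_mulc.
by congr cint; apply/funext => x; rewrite conjcM conjcc mulrC.
Qed.
Lemma ipBl u v w : L2 mu u -> L2 mu v -> L2 mu w ->
  ip mu (fun x => u x - v x) w = ip mu u w - ip mu v w.
Proof.
move=> a b c; rewrite /ip -cintB; try exact: L2_mulc.
by congr cint; apply/funext => x; rewrite mulrBl.
Qed.
Lemma ipDl u v w : L2 mu u -> L2 mu v -> L2 mu w ->
  ip mu (fun x => u x + v x) w = ip mu u w + ip mu v w.
Proof.
move=> a b c; rewrite /ip -cintD; try exact: L2_mulc.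
by congr cint; apply/funext => x; rewrite mulrDl.
Qed.
Lemma ipBr u v w : L2 mu u -> L2 mu v -> L2 mu w ->
  ip mu w (fun x => u x - v x) = ip mu w u - ip mu w v.
Proof.
move=> a b c; rewrite /ip -cintB; try exact: L2_mulc.
by congr cint; apply/funext => x; rewrite conjcD conjcN mulrBr.
Qed.
Lemma ipZl (z : R[i]) u v : L2 mu u -> L2 mu v -> ip mu (fun x => z * u x) v = z * ip mu u v.
Proof.
move=> a b; rewrite /ip -cintZ; try exact: L2_mulc.
by congr cint; apply/funext => x; rewrite mulrA.
Qed.
Lemma ipZr (z : R[i]) u v : L2 mu u -> L2 mu v -> ip mu u (fun x => z * v x) = conjc z * ip mu u v.
Proof.
move=> a b; rewrite /ip -cintZ; try exact: L2_mulc.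
by congr cint; apply/funext => x; rewrite conjcM mulrCA.
Qed.
Lemma ip_diag u : L2 mu u -> ip mu u u = (nsq mu u)%:C%C.
Proof.
move=> a; rewrite /ip; under [X in cint _ X]eq_fun do rewrite mul_conj.
apply: complex_ext; rewrite ?Re_cint ?Im_cint//=.
by rewrite Rintegral_cst// mul0r.
Qed.
Lemma nsqN u : nsq mu (fun x => - u x) = nsq mu u.
Proof. by rewrite /nsq sqN. Qed.
Lemma nsqBip u v : L2 mu u -> L2 mu v ->
  nsq mu (fun x => u x - v x) = nsq mu u - 2 * cRe (ip mu u v) + nsq mu v.
Proof.
move=> a b; rewrite nsqDip//; last exact: L2N.
by rewrite ipNr// cReN nsqN mulrN.
Qed.
Lemma nsqZ z u : L2 mu u -> nsq mu (fun x => z * u x) = abs2 z * nsq mu u.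
Proof. by move=> a; rewrite /nsq sqZ ?(L2_fin a)//; exact: L2_meas a. Qed.
Lemma nsqD_le u v : L2 mu u -> L2 mu v ->
  nsq mu (fun x => u x + v x) <= 2 * nsq mu u + 2 * nsq mu v.
Proof.
move=> a b; rewrite -lee_fin EFinD !EFinM -!L2_fin//; last exact: L2D.
exact: sqD (L2_meas a) (L2_meas b).
Qed.
Lemma nsq0P u : L2 mu u -> nsq mu u <= 0 -> {ae mu, forall x, u x = 0}.
Proof. by move=> a h; apply: sq0P (L2_meas a) _; rewrite L2_fin. Qed.

(** The common end of the approximation arguments based on [ip_bound]: [k] is fixed first so that
    [k * A] is at most [a / 4], then [e] is chosen depending on [k], which defeats the factor
    [k^-1]. Together this gives [a <= a / 2]. *)
Lemma small0 (a A B : R) : 0 <= a -> 0 <= A ->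
  (forall k e : R, 0 < k -> 0 < e -> a <= k * A + k^-1 * e + e * B) -> a = 0.
Proof.
move=> a0 A0 h; apply/eqP; rewrite eq_le a0 andbT leNgt; apply/negP => a1.
have k0 : 0 < a / (4 * (A + 1)) by rewrite divr_gt0// mulr_gt0// ltr_wpDl.
set k := a / _ in k0.
have kA : k * A <= a / 4.
  rewrite /k -mulrA ler_wpM2l ?(ltW a1)// invfM -mulrA ler_piMr// ?invr_ge0//.
  by rewrite mulrC ler_pdivrMr ?mul1r; lra.
have B0 : 0 <= `|B| by [].
have e0 : 0 < a / (4 * (k^-1 + `|B|)).
  by rewrite divr_gt0// mulr_gt0// ltr_wpDr// invr_gt0.
set e := a / _ in e0.
have ek : k^-1 * e + e * B <= a / 4.
  apply: (@le_trans _ _ (e * (k^-1 + `|B|))).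
    by rewrite mulrDr mulrC lerD2l ler_wpM2l ?(ltW e0)// ler_norm.
  rewrite /e invfM mulrA -mulrA mulVf ?mulr1// gt_eqF// ltr_wpDr// invr_gt0//.
by have := h _ _ k0 e0; lra.
Qed.

Lemma Re_ip_polar u v : L2 mu u -> L2 mu v ->
  4 * cRe (ip mu u v) = nsq mu (fun x => u x + v x) - nsq mu (fun x => u x - v x).
Proof. by move=> a b; rewrite nsqDip// nsqBip//; ring. Qed.

End L2_identities.

(** * The Fourier transform on an abstract Plancherel space *)

Lemma cvge0P (R : realType) (S : Type) (G : set_system S) (FG : Filter G) (f : S -> \bar R) :
  (forall x, (0 <= f x)%E) -> (forall e : R, 0 < e -> \forall x \near G, (f x <= e%:E)%E) ->
  f x @[x --> G] --> 0%E.
Proof.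
move=> f0 h; apply/fine_cvgP; split.
  by apply: filterS (h 1 ltr01) => x hx; rewrite ge0_fin_numE// (le_lt_trans hx)// ltry.
suff : fine (f x) @[x --> G] --> (0 : R) by [].
apply/cvgrPdist_le => e e0; apply: filterS (h e e0) => x hx /=.
have : f x \is a fin_num by rewrite ge0_fin_numE// (le_lt_trans hx)// ltry.
by move=> /fineK <- /=; rewrite sub0r normrN ger0_norm ?fine_ge0// -lee_fin fineK// ge0_fin_numE// (le_lt_trans hx)// ltry.
Qed.

Section cut.
Context d (T : measurableType d) (R : realType).
Implicit Type u : T -> R[i].

Definition cut (A : set T) u : T -> R[i] := fun x => if x \in A then u x else 0.

Let Re_cut u (A : set T) : (fun x => cRe (cut A u x)) = (fun x => cRe (u x)) \_ A.
Proof. by apply/funext => x; rewrite /cut /patch; case: ifP. Qed.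
Let Im_cut u (A : set T) : (fun x => cIm (cut A u x)) = (fun x => cIm (u x)) \_ A.
Proof. by apply/funext => x; rewrite /cut /patch; case: ifP. Qed.

Lemma cmeas_cut u (A : set T) : measurable A -> cmeasurable A u -> cmeas (cut A u).
Proof.
by move=> mA [a b]; split; rewrite ?(Re_cut, Im_cut); apply/(measurable_restrictT _ mA).
Qed.

Lemma cmeas_cutT u (A : set T) : measurable A -> cmeas u -> cmeas (cut A u).
Proof. by move=> mA [a b]; apply: cmeas_cut => //; split; exact: measurable_funTS. Qed.

Lemma cint_cut (mu : {measure set T -> \bar R}) u (A : set T) : measurable A ->
  cintegral mu A u = cint mu (cut A u).
Proof.
move=> mA; apply: complex_ext; rewrite ?(Re_cint, Im_cint) /cintegral /= Rintegral_mkcond.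
- by rewrite -Re_cut.
- by rewrite -Im_cut.
Qed.
End cut.

Section L2norm.
Context d (T : measurableType d) (R : realType) (mu : {measure set T -> \bar R}).
Implicit Types u v w : T -> R[i].

Lemma L2norm_poweR u : (L2norm mu u `^ 2 = sq mu u)%E.
Proof.
rewrite /L2norm poweR_Lnorm//; apply: eq_integral => x _.
rewrite -abs2_normc abse_EFin poweR_EFin; congr EFin.
by rewrite powR_mulrn// real_normK// num_real.
Qed.

Lemma L2norm_ge0 u : (0 <= L2norm mu u)%E. Proof. exact: Lnorm_ge0. Qed.

Lemma L2norm_sqrt u : (sq mu u < +oo)%E -> L2norm mu u = (Num.sqrt (nsq mu u))%:E.
Proof.
move=> h; have := L2norm_poweR u; have := L2norm_ge0 u.
case: (L2norm mu u) => [r| |]//; last first.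
  by move=> _ e; move: h; rewrite -e poweRyr// ltxx.
rewrite lee_fin poweR_EFin => r0 e; congr EFin.
rewrite /nsq -e /= powR_mulrn// sqrtr_sqr ger0_norm//.
Qed.

Lemma L2norm_lty u : (L2norm mu u < +oo)%E = (sq mu u < +oo)%E.
Proof.
apply/idP/idP => h; last by rewrite L2norm_sqrt// ltry.
rewrite -L2norm_poweR; have := L2norm_ge0 u; move: h.
by case: (L2norm mu u) => [r| |]// _ _; rewrite poweR_EFin ltry.
Qed.

Lemma in_L2E u : in_L2 mu u <-> L2 mu u.
Proof. by rewrite /in_L2 L2norm_lty. Qed.

Lemma L2norm_le u (k : R) : 0 <= k -> (L2norm mu u <= k%:E)%E -> (sq mu u <= (k ^+ 2)%:E)%E.
Proof.
move=> k0 h; have hy : (sq mu u < +oo)%E by rewrite -L2norm_lty (le_lt_trans h)// ltry.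
move: h; rewrite L2norm_sqrt// lee_fin => h.
rewrite -(fineK (x := sq mu u)) ?ge0_fin_numE ?sq_ge0// -/(nsq mu u) lee_fin.
by rewrite -(sqr_sqrtr (nsq_ge0 mu u)) ler_pXn2r// nnegrE ?sqrtr_ge0.
Qed.

End L2norm.

Definition fourier d (T : measurableType d) (R : realType) (mu : {measure set T -> \bar R})
  (dot : T -> T -> R) (u : T -> R[i]) (xi : T) : R[i] :=
  cint mu (fun x => u x * cis (- dot x xi)).

(** Plancherel's identity on integrable and square integrable functions, with an unspecified
    constant. The notion is stable under products, so that R^2, R^3, R^4 and R^5 reduce to the line;
    balls of finite measure make truncations of [L2] functions integrable. *)
Record plancherel_space d (T : measurableType d) (R : realType)
    (mu : {measure set T -> \bar R}) (dot : T -> T -> R) (C : R) : Prop := PlancherelSpace {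
  dot_meas : measurable_fun setT (fun p : T * T => dot p.1 p.2) ;
  dot_sym : forall x y, dot x y = dot y x ;
  dot_ge0 : forall x, 0 <= dot x x ;
  ball_fin : forall r : R, (mu [set x | (dot x x <= r ^+ 2)%R] < +oo)%E ;
  planch_gt0 : 0 < C ;
  planch : forall u, cintegrable mu u -> L2 mu u -> sq mu (fourier mu dot u) = (C%:E * sq mu u)%E }.

(** * The Fourier transform on L2, characterised by duality *)

Section fourier_L2.
Context d (T : measurableType d) (R : realType).
Variables (mu : {sigma_finite_measure set T -> \bar R}) (dot : T -> T -> R) (C : R).
Hypothesis P : plancherel_space mu dot C.
Implicit Types u v w k : T -> R[i].
Local Notation F := (fourier mu dot).
Local Notation L12 u := (cintegrable mu u /\ L2 mu u).
Let C0 : 0 < C := planch_gt0 P.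

Lemma dot_measl (y : T) : measurable_fun setT (fun x => dot x y).
Proof. exact: (measurableT_comp (dot_meas P) (measurable_pair2 y)). Qed.

Lemma dot_diag_meas : measurable_fun setT (fun x => dot x x).
Proof.
have : measurable_fun setT (fun x : T => (x, x)) by exact: measurable_fun_pair.
exact: (measurableT_comp (dot_meas P)).
Qed.

Let kernel_meas : cmeas (fun p : T * T => cis (- dot p.1 p.2)).
Proof. by apply: cmeas_cis; apply: measurableT_comp => //; exact: (dot_meas P). Qed.

Lemma cmeas_cisl y : cmeas (fun x => cis (- dot x y)).
Proof. by apply: cmeas_cis; apply: measurableT_comp => //; exact: dot_measl. Qed.

Lemma cintegrable_cis u xi : cintegrable mu u -> cintegrable mu (fun x => u x * cis (- dot x xi)).
Proof.
move=> i; apply: (cintegrableM i (k := 2)); first exact: cmeas_cisl.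
by move=> x; exact: abs1_cis.
Qed.

Lemma F_meas u : cmeas u -> cmeas (F u).
Proof.
move=> m; apply: (@cmeas_cint2 _ _ _ _ _ mu (fun p : T * T => u p.1 * cis (- dot p.1 p.2))).
by apply: cmeasM => //; apply: (cmeas_comp (f := fst)).
Qed.

Lemma F_L2 u : L12 u -> L2 mu (F u).
Proof.
move=> [i l]; split; first exact: F_meas (cintegrable_meas i).
by rewrite (planch P i l) L2_fin// -EFinM ltry.
Qed.

Lemma nsq_F u : L12 u -> nsq mu (F u) = C * nsq mu u.
Proof. by move=> [i l]; rewrite /nsq (planch P i l) (L2_fin l). Qed.

Lemma FD u v : cintegrable mu u -> cintegrable mu v -> F (fun x => u x + v x) = fun xi => F u xi + F v xi.
Proof.
move=> a b; apply/funext => xi; rewrite /fourier -cintD; try exact: cintegrable_cis.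
by congr cint; apply/funext => x; rewrite mulrDl.
Qed.
Lemma FZ z u : cintegrable mu u -> F (fun x => z * u x) = fun xi => z * F u xi.
Proof.
move=> a; apply/funext => xi; rewrite /fourier -cintZ; try exact: cintegrable_cis.
by congr cint; apply/funext => x; rewrite mulrA.
Qed.
Lemma FB u v : cintegrable mu u -> cintegrable mu v -> F (fun x => u x - v x) = fun xi => F u xi - F v xi.
Proof.
move=> a b; apply/funext => xi; rewrite /fourier -cintB; try exact: cintegrable_cis.
by congr cint; apply/funext => x; rewrite mulrBl.
Qed.

Let L12D u v : L12 u -> L12 v -> L12 (fun x => u x + v x).
Proof. by move=> [a b] [a' b']; split; [exact: cintegrableD|exact: L2D]. Qed.
Let L12B u v : L12 u -> L12 v -> L12 (fun x => u x - v x).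
Proof. by move=> [a b] [a' b']; split; [exact: cintegrableB|exact: L2B]. Qed.
Let L12Z z u : L12 u -> L12 (fun x => z * u x).
Proof. by move=> [a b]; split; [exact: cintegrableZ|exact: L2Z]. Qed.

Let polarRe u v : L12 u -> L12 v -> cRe (ip mu (F u) (F v)) = C * cRe (ip mu u v).
Proof.
move=> a b; have h0 : (4 : R) != 0 by [].
apply: (mulfI h0); rewrite Re_ip_polar; try exact: F_L2.
rewrite mulrCA Re_ip_polar; try by case: a; case: b.
rewrite mulrBr -!nsq_F; [|exact: L12B|exact: L12D].
by rewrite FD ?FB//; case: a; case: b.
Qed.

Lemma polar u v : L12 u -> L12 v -> ip mu (F u) (F v) = C%:C%C * ip mu u v.
Proof.
move=> a b; apply: complex_ext; first by rewrite polarRe// cReM cRe_real cIm_real mul0r subr0.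
rewrite cImM cRe_real cIm_real mul0r addr0.
(* The imaginary part of a pairing is the real part after multiplication of the first factor by
   [-i], which reduces the claim to [polarRe]. *)
have e w w' : L2 mu w -> L2 mu w' -> cIm (ip mu w w') = cRe (ip mu (fun x => (0 +i* (-1))%C * w x) w').
  by move=> lw lw'; rewrite ipZl// cReM cRe_pair cIm_pair mul0r sub0r mulN1r opprK.
rewrite (e (F u))//; try exact: F_L2.
rewrite e; try by case: a; case: b.
have := polarRe (L12Z (0 +i* (-1))%C a) b; rewrite FZ//.
by case: a.
Qed.

Lemma mult_formula u v : cintegrable mu u -> cintegrable mu v ->
  cint mu (fun x => F u x * v x) = cint mu (fun x => u x * F v x).
Proof.
move=> a b.
have i : cintegrable (sigma_finite_product mu mu) (fun p : T * T => u p.1 * v p.2 * cis (- dot p.1 p.2)).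
  apply: (cintegrableM (cintegrable_tensor a b) kernel_meas (k := 2)) => p; exact: abs1_cis.
have := cint_swap i => /= h.
transitivity (cint mu (fun y => cint mu (fun x => u x * v y * cis (- dot x y)))).
  congr cint; apply/funext => y; rewrite -cintZr; last exact: cintegrable_cis.
  by congr cint; apply/funext => x; ring.
rewrite -h; congr cint; apply/funext => x; rewrite -cintZ; last exact: cintegrable_cis.
by congr cint; apply/funext => y; rewrite (dot_sym P y x); ring.
Qed.

Definition trunc (r : R) u : T -> R[i] := fun x => if dot x x <= r ^+ 2 then u x else 0.

Lemma ball_meas (r : R) : measurable [set x | dot x x <= r ^+ 2].
Proof.
rewrite (_ : [set x | _] = (fun x => dot x x) @^-1` `]-oo, r ^+ 2]%classic).
  by rewrite -[X in measurable X]setTI; exact: dot_diag_meas.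
by apply/seteqP; split => x /=; rewrite in_itv.
Qed.

Lemma truncE r u : trunc r u = cut [set x | dot x x <= r ^+ 2] u.
Proof.
apply/funext => x; rewrite /trunc /cut.
case: ifPn => h; first by rewrite mem_set.
by rewrite memNset//; exact/negP.
Qed.

Lemma trunc_meas r u : cmeas u -> cmeas (trunc r u).
Proof.
move=> [a b]; rewrite truncE; apply: cmeas_cut; first exact: ball_meas.
by split; exact: measurable_funTS.
Qed.

Lemma truncated_fourierE r u : truncated_fourier mu dot r u = F (trunc r u).
Proof.
apply/funext => xi; rewrite /truncated_fourier cint_cut; last exact: ball_meas.
by rewrite /fourier truncE; congr cint; apply/funext => x; rewrite /cut; case: ifP; rewrite ?mul0r.
Qed.

Lemma abs2_trunc r u x : abs2 (trunc r u x) <= abs2 (u x).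
Proof. by rewrite /trunc; case: ifP => // _; rewrite abs20 abs2_ge0. Qed.

Lemma trunc_L2 r u : L2 mu u -> L2 mu (trunc r u).
Proof.
move=> l; apply: (L2_bnd _ l (ler01 : 0 <= 1 :> R)); first exact: trunc_meas (L2_meas l).
by move=> x; rewrite mul1r abs2_trunc.
Qed.

Lemma ball_indic_L2 r : L2 mu (trunc r (fun _ => 1)).
Proof.
split; first by apply: trunc_meas; exact: cmeas_cst.
apply: le_lt_trans (ball_fin P r).
rewrite -[X in (_ <= mu X)%E]setIT -integral_indic//; last exact: ball_meas.
apply: ge0_le_integral => //.
- by move=> x _; rewrite lee_fin abs2_ge0.
- apply/measurable_EFinP/measurable_abs2/trunc_meas; exact: cmeas_cst.
- by apply/measurable_EFinP; apply: measurable_indic; exact: ball_meas.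
- move=> x _; rewrite lee_fin /trunc indicE.
  case: ifPn => h; last by rewrite abs20.
  by rewrite mem_set//= /abs2 /= expr1n expr0n/= addr0.
Qed.

Lemma trunc_L1 r u : L2 mu u -> cintegrable mu (trunc r u).
Proof.
move=> l; have := L2_mulc (trunc_L2 r l) (ball_indic_L2 r).
congr (cintegrable mu _); apply/funext => x.
rewrite /trunc; case: ifP => _; last by rewrite mul0r.
by rewrite (_ : conjc 1 = 1) ?mulr1//; apply: complex_ext; rewrite !cE /= ?oppr0.
Qed.

Lemma trunc_L12 r u : L2 mu u -> L12 (trunc r u).
Proof. by move=> l; split; [exact: trunc_L1|exact: trunc_L2]. Qed.

Lemma ip_trunc r u : L2 mu u -> ip mu u (trunc r u) = (nsq mu (trunc r u))%:C%C.
Proof.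
move=> l; rewrite -ip_diag; last exact: trunc_L2.
congr cint; apply/funext => x; rewrite /trunc; case: ifP => // _.
by rewrite (_ : conjc 0 = 0) ?mulr0//; apply: complex_ext; rewrite !cE /= ?oppr0.
Qed.

Lemma nsq_sub_trunc r u : L2 mu u -> nsq mu (fun x => u x - trunc r u x) = nsq mu u - nsq mu (trunc r u).
Proof.
move=> l; rewrite nsqBip// ?ip_trunc//; last exact: trunc_L2.
by rewrite cRe_real; ring.
Qed.

(** Dominated convergence along integer radii; the error decreases with the radius, which extends
    the bound to all real [r]. *)
Lemma trunc_cvg u (e : R) : L2 mu u -> 0 < e -> exists N : R, 0 <= N /\
  forall r, N <= r -> nsq mu (fun x => u x - trunc r u x) < e.
Proof.
move=> l e0.
pose g (n : nat) x := (abs2 (u x - trunc n%:R u x))%:E.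
have mg n : measurable_fun setT (g n).
  apply/measurable_EFinP/measurable_abs2/cmeasB; first exact: L2_meas l.
  exact: trunc_meas (L2_meas l).
have h1 : {ae mu, forall x, setT x -> g n x @[n --> \oo] --> (cst 0%E : T -> \bar R) x}.
  apply/nearW => x _; apply: cvg_near_cst.
  have /ltW b := archi_boundP (dot_ge0 P x).
  exists (Num.bound (dot x x)) => // n /= hn.
  rewrite /g /trunc ifT ?subrr ?abs20//.
  have b1 : dot x x <= n%:R by rewrite (le_trans b)// ler_nat.
  have [n0|n1] := leqP n 0.
    by move: n0 b1; rewrite leqn0 => /eqP ->; rewrite expr0n.
  by rewrite (le_trans b1)// -natrX ler_nat -{1}(expn1 n) leq_pexp2l.
have h2 : {ae mu, forall x, forall n, setT x -> (`|g n x| <= (abs2 (u x))%:E)%E}.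
  apply/nearW => x n _; rewrite /g gee0_abs ?lee_fin ?abs2_ge0// /trunc.
  by case: ifP => _; rewrite ?subrr ?subr0// abs20 abs2_ge0.
have [_ _] := dominated_convergence measurableT mg (measurable_cst 0%E) h1 (integrable_abs2 l) h2.
rewrite integral0 => cvg0.
move/fine_cvgP : cvg0 => [_ /cvgrPdist_lt/(_ e e0)[N _ hN]].
exists N%:R; split => // r Nr.
have := hN N (leqnn N); rewrite /= sub0r normrN.
rewrite -/(sq mu (fun x => u x - trunc N%:R u x)) -/(nsq mu (fun x => u x - trunc N%:R u x)).
rewrite ger0_norm ?nsq_ge0//; apply: le_lt_trans.
have lN := L2B l (trunc_L2 N%:R l); have lr := L2B l (trunc_L2 r l).
rewrite -lee_fin -!L2_fin//.
have := le_sq mu (k := 1) ler01 (L2_meas lr) (L2_meas lN); rewrite mul1e; apply=> x.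
rewrite mul1r /trunc; case: ifPn => h; first by rewrite subrr abs20 abs2_ge0.
rewrite ifF//; apply: contraNF h => /le_trans; apply.
by rewrite ler_pXn2r// nnegrE// (le_trans _ Nr).
Qed.

(** A weak form of [is_fourier], tested on transforms of integrable functions only. It determines
    each member of the pair from the other, and with the norm identity it gives back
    [is_fourier]. *)
Definition fourier_pair u w := [/\ L2 mu u, L2 mu w &
  forall k, L12 k -> ip mu w (F k) = C%:C%C * ip mu u k].

(** The transforms are dense although no inversion formula is at hand. For a truncation [q] of [w],
    the function [p = conj (F (conj q))] represents the functional [k |-> <F k, q>] and has square
    norm [C * nsq q]. Expanding the square, [F kk] is close to [C q] when [kk] is a large truncation
    of [p]. Since [w] is orthogonal to [F kk], the pairing of [w] with [C q], which is [C * nsq q],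
    is arbitrarily small. *)
Lemma density w : L2 mu w -> (forall k, L12 k -> ip mu w (F k) = 0) -> {ae mu, forall x, w x = 0}.
Proof.
move=> lw hw; apply: (nsq0P lw); rewrite leNgt; apply/negP => w0.
suff h r : nsq mu (trunc r w) = 0.
  have [N [_ hN]] := trunc_cvg lw w0.
  by have := hN _ (lexx N); rewrite nsq_sub_trunc// h subr0 ltxx.
pose q := trunc r w; rewrite -/q.
have [iq lq] : L12 q by exact: trunc_L12.
have cq : L12 (fun x => conjc (q x)) by split; [exact: cintegrable_conj|exact: L2_conj].
pose p x := conjc (F (fun x => conjc (q x)) x).
have lp : L2 mu p by apply: L2_conj; exact: F_L2.
have np : nsq mu p = C * nsq mu q by rewrite /nsq sq_conj -/(nsq mu (F _)) nsq_F// /nsq sq_conj.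
have main k : L12 k -> ip mu (F k) q = ip mu k p.
  move=> [ik lk]; rewrite /ip mult_formula//; last by case: cq.
  by congr cint; apply/funext => x; rewrite /p conjcc.
suff : C * nsq mu q = 0 by move/eqP; rewrite mulf_eq0 gt_eqF//= => /eqP.
have Cr := ltW C0.
apply: (@small0 R _ (C * nsq mu w) 0); rewrite ?mulr_ge0 ?nsq_ge0//.
move=> k e k0 e0.
have [N [_ hN]] := trunc_cvg lp e0; have := hN _ (lexx N) => {hN}.
rewrite nsq_sub_trunc// => hN.
have lk := trunc_L12 N lp; set kk := trunc N p in hN lk.
have ipk : ip mu (F kk) q = (nsq mu kk)%:C%C.
  rewrite main// ipC//; last by case: lk.
  by rewrite ip_trunc// conjc_real.
have lF := F_L2 lk.
have lCq : L2 mu (fun x => (C%:C)%C * q x) by exact: L2Z.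
have e1 : nsq mu (fun x => F kk x - (C%:C)%C * q x) = C * (nsq mu p - nsq mu kk).
  rewrite nsqBip// nsq_F// ipZr// ipk nsqZ// conjc_real abs2_real np cReM !cRe_real !cIm_real.
  by ring.
have e2 : ip mu w (fun x => F kk x - (C%:C)%C * q x) = - (C * nsq mu q)%:C%C.
  rewrite ipBr// hw// sub0r ipZr// /q ip_trunc// conjc_real.
  by apply: complex_ext; rewrite !cE /=; ring.
have := ip_bound lw (L2B lF lCq) (mulr_gt0 C0 k0).
rewrite e2 e1 abs1N abs1_real ger0_norm; last by rewrite mulr_ge0 ?nsq_ge0// ltW.
move=> h.
have h2 : (C * k)^-1 * (C * (nsq mu p - nsq mu kk)) = k^-1 * (nsq mu p - nsq mu kk).
  by field; rewrite !gt_eqF.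
rewrite h2 in h.
have h3 : k^-1 * (nsq mu p - nsq mu kk) <= k^-1 * e.
  by rewrite ler_wpM2l// ?invr_ge0 ltW.
have h4 : C * nsq mu q <= C * k * nsq mu w + k^-1 * e by lra.
by lra.
Qed.

Lemma pair_uniq_r u w w' : fourier_pair u w -> fourier_pair u w' -> {ae mu, forall x, w x = w' x}.
Proof.
move=> [lu lw h] [_ lw' h'].
have : {ae mu, forall x, w x - w' x = 0}.
  apply: density; first exact: L2B.
  by move=> k k12; have lF := F_L2 k12; rewrite ipBl// h// h'// subrr.
by apply: filterS => x /eqP; rewrite subr_eq0 => /eqP.
Qed.

Lemma ip_test0 u : L2 mu u -> (forall k, L12 k -> ip mu u k = 0) -> {ae mu, forall x, u x = 0}.
Proof.
move=> lu h; apply: (nsq0P lu); rewrite leNgt; apply/negP => u0.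
have [N [_ hN]] := trunc_cvg lu u0; have := hN _ (lexx N).
rewrite nsq_sub_trunc//; have := h _ (trunc_L12 N lu).
by rewrite ip_trunc// => -[->]; rewrite subr0 ltxx.
Qed.

Lemma pair_uniq_l u u' w w' : fourier_pair u w -> fourier_pair u' w' ->
  {ae mu, forall x, w x = w' x} -> {ae mu, forall x, u x = u' x}.
Proof.
move=> [lu lw h] [lu' lw' h'] ww.
have : {ae mu, forall x, u x - u' x = 0}.
  apply: ip_test0; first exact: L2B.
  move=> k k12; rewrite ipBl//; last by case: k12.
  have nC : (C%:C)%C != 0 :> R[i] by apply/eqP => -[] /eqP; rewrite gt_eqF.
  apply: (mulfI nC); rewrite mulr0 mulrBr -h// -h'// /ip.
  have lF := F_L2 k12.
  rewrite (cint_ae (v := fun x => w' x * conjc (F k x))) ?subrr//.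
  - exact: cintegrable_meas (L2_mulc lw lF).
  - exact: cintegrable_meas (L2_mulc lw' lF).
  - by apply: filterS ww => x ->.
by apply: filterS => x /eqP; rewrite subr_eq0 => /eqP.
Qed.

Lemma pair_F u : L12 u -> fourier_pair u (F u).
Proof. by move=> h; split; [case: h|exact: F_L2|move=> k hk; exact: polar]. Qed.

Lemma pair_nsq_sub u w r : fourier_pair u w ->
  nsq mu (fun x => w x - F (trunc r u) x) = nsq mu w - C * nsq mu (trunc r u).
Proof.
move=> [lu lw h]; have lt := trunc_L12 r lu.
rewrite nsqBip//; last exact: F_L2.
rewrite h// ip_trunc// nsq_F// cReM !cRe_real !cIm_real; ring.
Qed.

Lemma is_fourier_small u w : is_fourier mu dot u w ->
  forall e N : R, 0 < e -> exists r, N <= r /\ nsq mu (fun x => w x - F (trunc r u) x) < e.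
Proof.
move=> [/in_L2E lu /in_L2E lw cv] e N e0.
have s0 : 0 < Num.sqrt e / 2 by rewrite divr_gt0// sqrtr_gt0.
have /= := cv [set y | (y < (Num.sqrt e / 2)%:E)%E].
have nb : nbhs 0%E [set y : \bar R | (y < (Num.sqrt e / 2)%:E)%E].
  by apply: open_nbhs_nbhs; split; [exact: open_ereal_lt_ereal|rewrite /= lte_fin].
move=> /(_ nb) [M [_ hM]].
have h := hM (Num.max N (M + 1)).
exists (Num.max N (M + 1)); split; first by rewrite le_max lexx.
have := h; rewrite lt_max ltrDl ltr01 orbT => /(_ isT) /ltW.
rewrite truncated_fourierE => /(L2norm_le (ltW s0)).
have lt := F_L2 (trunc_L12 (Num.max N (M + 1)) lu).
rewrite (L2_fin (L2B lw lt)) lee_fin => /le_lt_trans; apply.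
rewrite expr_div_n sqr_sqrtr ?(ltW e0)//; lra.
Qed.

Lemma is_fourier_pair u w : is_fourier mu dot u w -> fourier_pair u w.
Proof.
move=> H; have [/in_L2E lu /in_L2E lw _] := H; split => // k k12.
have lF := F_L2 k12; have lk : L2 mu k by case: k12.
apply/eqP; rewrite -subr_eq0; apply/eqP.
suff h : abs1 (ip mu w (F k) - C%:C%C * ip mu u k) = 0.
  apply/eqP; rewrite -abs2_eq0; apply/eqP/le_anti; rewrite abs2_ge0 andbT.
  by apply: (le_trans (abs2_le_abs1 _)); rewrite h expr0n.
apply: (@small0 R _ (nsq mu (F k) + C * nsq mu k) 0); first exact: abs1_ge0.
  by rewrite addr_ge0 ?nsq_ge0// mulr_ge0 ?nsq_ge0// ltW.
move=> a e a0 e0.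
have ai : 0 < a^-1 by rewrite invr_gt0.
have e2 : 0 < e / 2 by rewrite divr_gt0.
have e3 : 0 < e / (2 * C) by rewrite divr_gt0// mulr_gt0.
have [N [_ hN]] := trunc_cvg lu e3.
have [r [Nr hr]] := is_fourier_small H N e2.
have {hN} hN := hN r Nr.
have lt := trunc_L12 r lu; have lFt := F_L2 lt; have lt2 : L2 mu (trunc r u) by case: lt.
have -> : ip mu w (F k) - C%:C%C * ip mu u k =
  ip mu (fun x => w x - F (trunc r u) x) (F k) - C%:C%C * ip mu (fun x => u x - trunc r u x) k.
  by rewrite !ipBl// polar//; ring.
apply: (le_trans (abs1D _ _)); rewrite abs1N.
have h1 := ip_bound (L2B lw lFt) lF ai; rewrite invrK in h1.
have h2 := ip_bound (L2B lu lt2) lk ai; rewrite invrK in h2.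
have h3 := abs1M (C%:C)%C (ip mu (fun x => u x - trunc r u x) k).
rewrite abs1_real (gtr0_norm C0) in h3.
have h4 : C * abs1 (ip mu (fun x => u x - trunc r u x) k) <= C * (a^-1 * (e / (2 * C)) + a * nsq mu k).
  rewrite ler_wpM2l ?(ltW C0)//; apply: (le_trans h2).
  by rewrite lerD2r ler_wpM2l ?(ltW ai)// ltW.
have h5 : a^-1 * nsq mu (fun x => w x - F (trunc r u) x) <= a^-1 * (e / 2).
  by rewrite ler_wpM2l ?(ltW ai)// ltW.
have h6 : C * (a^-1 * (e / (2 * C)) + a * nsq mu k) = a^-1 * (e / 2) + C * a * nsq mu k.
  by field; rewrite !gt_eqF.
lra.
Qed.

Lemma is_fourier_nsq u w : is_fourier mu dot u w -> nsq mu w = C * nsq mu u.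
Proof.
move=> H; have HP := is_fourier_pair H; have [lu lw _] := HP.
suff h (e : R) : 0 < e -> `|nsq mu w - C * nsq mu u| <= e.
  apply/eqP; rewrite -subr_eq0 -normr_eq0 eq_le normr_ge0 andbT leNgt; apply/negP => h0.
  have h2 : 0 < `|nsq mu w - C * nsq mu u| / 2 by rewrite divr_gt0.
  by have := h _ h2; lra.
move=> e0; have e2 : 0 < e / 2 by rewrite divr_gt0.
have e3 : 0 < e / (2 * C) by rewrite divr_gt0// mulr_gt0.
have [N [_ hN]] := trunc_cvg lu e3.
have [r [Nr hr]] := is_fourier_small H N e2.
have := hN r Nr; rewrite nsq_sub_trunc// => h1.
rewrite pair_nsq_sub// in hr.
have h0 : 0 <= nsq mu w - C * nsq mu (trunc r u) by rewrite -pair_nsq_sub// nsq_ge0.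
have h0' : 0 <= nsq mu u - nsq mu (trunc r u) by rewrite -nsq_sub_trunc// nsq_ge0.
have h3 : C * (nsq mu u - nsq mu (trunc r u)) <= e / 2.
  by have := ltW h1; rewrite -(ler_pM2l C0) => /le_trans; apply; rewrite le_eqVlt; apply/orP; left; apply/eqP; field; rewrite gt_eqF.
have h4 : 0 <= C * (nsq mu u - nsq mu (trunc r u)) by rewrite mulr_ge0// ltW.
by rewrite ler_norml; apply/andP; split; lra.
Qed.

(** By [pair_nsq_sub] the squared error of the truncated transform is [nsq w - C * nsq (trunc r u)];
    the norm identity is what makes it tend to 0. *)
Lemma pair_is_fourier u w : fourier_pair u w -> nsq mu w = C * nsq mu u -> is_fourier mu dot u w.
Proof.
move=> HP e; have [lu lw _] := HP; split; try exact/in_L2E.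
apply: cvge0P => [r|ee e0]; first exact: L2norm_ge0.
have e3 : 0 < ee ^+ 2 / C by rewrite divr_gt0// exprn_gt0.
have [N [N0 hN]] := trunc_cvg lu e3.
exists N; split => [|r /ltW Nr]; first exact: num_real.
have lt := trunc_L12 r lu.
rewrite truncated_fourierE L2norm_sqrt; last by case: (L2B lw (F_L2 lt)).
rewrite lee_fin -(ger0_norm (ltW e0)) -sqrtr_sqr ler_wsqrtr// pair_nsq_sub// e -mulrBr -nsq_sub_trunc//.
by rewrite mulrC -ler_pdivlMr// ltW// hN.
Qed.

End fourier_L2.

Definition image_measure d1 d2 (T1 : measurableType d1) (T2 : measurableType d2) (R : realType)
    (mu : {measure set T1 -> \bar R}) (f : T1 -> T2) (mf : measurable_fun setT f) :
    {measure set T2 -> \bar R} :=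
  measure_function_pushforward__canonical__measure_function_Measure mu mf.

Ltac mfun := repeat first
  [ assumption
  | exact: measurable_fst | exact: measurable_snd | exact: measurable_id | exact: measurable_cst
  | apply: measurable_fun_pair
  | apply: measurable_funD | apply: measurable_funM | apply: measurable_funB
  | match goal with
    | |- measurable_fun _ (fun x => fst _) => apply: (measurableT_comp measurable_fst)
    | |- measurable_fun _ (fun x => snd _) => apply: (measurableT_comp measurable_snd)
    | H : measurable_fun setT ?f |- measurable_fun setT (fun x => ?f _) => apply: (measurableT_comp H)
    end ].

(** * Measure-preserving changes of variables *)

Section measure_preserving.
Context d (T : measurableType d) (R : realType).

Definition measure_preserving (mu : {measure set T -> \bar R}) (phi : T -> T) :=
  measurable_fun setT phi /\ forall A, measurable A -> mu (phi @^-1` A) = mu A.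

Variable mu : {measure set T -> \bar R}.
Variable phi : T -> T.
Hypothesis mp : measure_preserving mu phi.
Let mphi : measurable_fun setT phi := mp.1.

Lemma mp_ge0_integral (f : T -> \bar R) : measurable_fun setT f -> (forall x, 0 <= f x)%E ->
  (\int[mu]_x f (phi x) = \int[mu]_x f x)%E.
Proof.
move=> mf f0; have := ge0_integral_pushforward mphi mu measurableT mf (fun x _ => f0 x).
rewrite preimage_setT => /esym -> /=.
by apply: eq_measure_integral => A mA _; rewrite /= /pushforward mp.2.
Qed.

Lemma mp_cmeas (u : T -> R[i]) : cmeas u -> cmeas (fun x => u (phi x)).
Proof. exact: cmeas_comp. Qed.

Lemma mp_sq (u : T -> R[i]) : cmeas u -> sq mu (fun x => u (phi x)) = sq mu u.
Proof.
move=> m; apply: (mp_ge0_integral (f := fun x => (abs2 (u x))%:E)).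
  exact/measurable_EFinP/measurable_abs2.
by move=> x; rewrite lee_fin abs2_ge0.
Qed.

Lemma mp_l1 (u : T -> R[i]) : cmeas u -> l1 mu (fun x => u (phi x)) = l1 mu u.
Proof.
move=> m; apply: (mp_ge0_integral (f := fun x => (abs1 (u x))%:E)).
  exact/measurable_EFinP/measurable_abs1.
by move=> x; rewrite lee_fin abs1_ge0.
Qed.

Lemma mp_cintegrable (u : T -> R[i]) : cintegrable mu u -> cintegrable mu (fun x => u (phi x)).
Proof.
move=> i; have m := cintegrable_meas i; apply: l1_lty; first exact: mp_cmeas.
by rewrite mp_l1//; exact: cintegrable_l1.
Qed.

Lemma mp_L2 (u : T -> R[i]) : L2 mu u -> L2 mu (fun x => u (phi x)).
Proof. by move=> [a b]; split; [exact: mp_cmeas|rewrite mp_sq]. Qed.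

Let mp_Rintegral (f : T -> R) : mu.-integrable setT (EFin \o f) ->
  \int[mu]_x f (phi x) = \int[mu]_x f x.
Proof.
move=> i; rewrite /Rintegral; congr fine.
have mf : measurable_fun setT (EFin \o f) := measurable_int mu i.
have /integrableP[_ h] := i.
have ip : mu.-integrable setT ((EFin \o f) \o phi).
  apply/integrableP; split; first exact: (measurableT_comp mf mphi).
  rewrite (mp_ge0_integral (f := fun x => `|(f x)%:E|%E))//.
  by exact: measurableT_comp.
have := integral_pushforward (mu := mu) mphi mf _ measurableT.
rewrite preimage_setT => /(_ ip) /esym; rewrite /comp => ->.
by apply: eq_measure_integral => A mA _; rewrite /= /pushforward mp.2.
Qed.

Lemma mp_cint (u : T -> R[i]) : cintegrable mu u -> cint mu (fun x => u (phi x)) = cint mu u.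
Proof.
move=> [a b]; apply: complex_ext; rewrite ?Re_cint ?Im_cint.
- exact: (mp_Rintegral a).
- exact: (mp_Rintegral b).
Qed.

End measure_preserving.

Lemma mp_prod d1 d2 (T1 : measurableType d1) (T2 : measurableType d2) (R : realType)
    (m1 : {sigma_finite_measure set T1 -> \bar R}) (m2 : {sigma_finite_measure set T2 -> \bar R})
    phi1 phi2 : measure_preserving m1 phi1 -> measure_preserving m2 phi2 ->
  measure_preserving (sigma_finite_product m1 m2) (fun p => (phi1 p.1, phi2 p.2)).
Proof.
move=> [mp1 e1] [mp2 e2].
have mphi : measurable_fun setT (fun p : T1 * T2 => (phi1 p.1, phi2 p.2)).
  by mfun.
split => // A mA.
apply: esym.
apply: (@product_measure_unique _ _ _ _ _ m1 m2 (image_measure (sigma_finite_product m1 m2) mphi)) => // B D mB mD.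
rewrite /image_measure /= /pushforward.
have -> : (fun p : T1 * T2 => (phi1 p.1, phi2 p.2)) @^-1` (B `*` D) = (phi1 @^-1` B) `*` (phi2 @^-1` D).
  by apply/seteqP; split => -[x y].
rewrite -e1// -e2// -product_measure1E//.
- by rewrite -[X in measurable X]setTI; exact: mp1.
- by rewrite -[X in measurable X]setTI; exact: mp2.
Qed.

Section lebesgue_invariance.
Variable R : realType.
Notation mu := (@lebesgue_measure R).

Lemma mp_shift (a : R) : measure_preserving mu (fun x : R => x + a).
Proof.
have mf : measurable_fun setT ((fun x => x + a) : measurableTypeR R -> measurableTypeR R) by exact: measurable_funD.
split=> // A mA; apply/esym.
pose M : {measure set (measurableTypeR R) -> \bar R} := image_measure mu mf.
apply: (@lebesgue_measure_unique R M) => // X.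
move=> [[x1 x2] _ <-].
rewrite [RHS](_ : _ = mu `]x1 - a, x2 - a]%classic).
  rewrite !lebesgue_measure_itv /= !lte_fin ltrD2r; case: ifP => // _.
  by rewrite -!EFinD; congr EFin; ring.
rewrite /M /image_measure /= /pushforward; congr mu; apply/seteqP; split => x /=; rewrite !in_itv /= => /andP[h1 h2]; apply/andP; split; lra.
Qed.

Lemma mp_opp : measure_preserving mu (fun x : R => - x).
Proof.
have mf : measurable_fun setT ((fun x => - x) : measurableTypeR R -> measurableTypeR R).
  exact: (@oppr_measurable R).
split=> // A mA; apply/esym.
pose M : {measure set (measurableTypeR R) -> \bar R} := image_measure mu mf.
apply: (@lebesgue_measure_unique R M) => // X.
move=> [[x1 x2] _ <-].
rewrite [RHS](_ : _ = mu `[- x2, - x1[%classic).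
  rewrite !lebesgue_measure_itv /= !lte_fin ltrN2; case: ifP => // _.
  by rewrite -!EFinD; congr EFin; ring.
rewrite /M /image_measure /= /pushforward; congr mu; apply/seteqP; split => x /=; rewrite !in_itv /= => /andP[h1 h2]; apply/andP; split; lra.
Qed.

End lebesgue_invariance.

(** * Plancherel's theorem in products *)

Section plancherel_product.
Context d1 d2 (T1 : measurableType d1) (T2 : measurableType d2) (R : realType).
Variable m1 : {sigma_finite_measure set T1 -> \bar R}.
Variable m2 : {sigma_finite_measure set T2 -> \bar R}.
Variables (dot1 : T1 -> T1 -> R) (dot2 : T2 -> T2 -> R) (C1 C2 : R).
Hypothesis P1 : plancherel_space m1 dot1 C1.
Hypothesis P2 : plancherel_space m2 dot2 C2.
Notation m12 := (sigma_finite_product m1 m2).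
Let dot (x y : T1 * T2) := dot1 x.1 y.1 + dot2 x.2 y.2.

Definition partial_fourier1 (u : T1 * T2 -> R[i]) (p : T1 * T2) : R[i] :=
  fourier m1 dot1 (fun x => u (x, p.2)) p.1.
Definition partial_fourier2 (u : T1 * T2 -> R[i]) (p : T1 * T2) : R[i] :=
  fourier m2 dot2 (fun y => u (p.1, y)) p.2.

Lemma partial_fourier1_meas u : cmeas u -> cmeas (partial_fourier1 u).
Proof.
move=> m; apply: (@cmeas_cint2 _ _ T1 (T1 * T2)%type _ m1
  (fun q : T1 * (T1 * T2) => u (q.1, q.2.2) * cis (- dot1 q.1 q.2.1))).
apply: cmeasM.
- apply: (cmeas_comp (f := fun q : T1 * (T1 * T2) => (q.1, q.2.2))) => //.
  by mfun.
- apply: cmeas_cis; apply: measurableT_comp => //.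
  apply: (measurableT_comp (dot_meas P1) (g := fun q : T1 * (T1 * T2) => (q.1, q.2.1))).
  by mfun.
Qed.

Lemma partial_fourier2_meas u : cmeas u -> cmeas (partial_fourier2 u).
Proof.
move=> m; apply: (@cmeas_cint2 _ _ T2 (T1 * T2)%type _ m2
  (fun q : T2 * (T1 * T2) => u (q.2.1, q.1) * cis (- dot2 q.1 q.2.2))).
apply: cmeasM.
- apply: (cmeas_comp (f := fun q : T2 * (T1 * T2) => (q.2.1, q.1))) => //.
  by mfun.
- apply: cmeas_cis; apply: measurableT_comp => //.
  apply: (measurableT_comp (dot_meas P2) (g := fun q : T2 * (T1 * T2) => (q.1, q.2.2))).
  by mfun.
Qed.

Lemma sq_partial_fourier1 u : cmeas u ->
  {ae m2, forall y, cintegrable m1 (fun x => u (x, y)) /\ L2 m1 (fun x => u (x, y))} ->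
  sq m12 (partial_fourier1 u) = (C1%:E * sq m12 u)%E.
Proof.
move=> m h; rewrite !sq_tonelli2//; last exact: partial_fourier1_meas.
rewrite -ge0_integralZl//.
- apply: ae_eq_integral => //.
  + exact: (measurable_sq2 m1 (partial_fourier1_meas m)).
  + by apply: emeasurable_funM; [exact: measurable_cst|exact: measurable_sq2].
  + by apply: filterS h => y [h1 h2] _; rewrite -(planch P1).
- exact: measurable_sq2.
- by move=> x _; exact: sq_ge0.
- by rewrite lee_fin ltW// (planch_gt0 P1).
Qed.

Lemma sq_partial_fourier2 u : cmeas u ->
  {ae m1, forall x, cintegrable m2 (fun y => u (x, y)) /\ L2 m2 (fun y => u (x, y))} ->
  sq m12 (partial_fourier2 u) = (C2%:E * sq m12 u)%E.
Proof.
move=> m h; rewrite !sq_tonelli1//; last exact: partial_fourier2_meas.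
rewrite -ge0_integralZl//.
- apply: ae_eq_integral => //.
  + exact: (measurable_sq1 m2 (partial_fourier2_meas m)).
  + by apply: emeasurable_funM; [exact: measurable_cst|exact: measurable_sq1].
  + by apply: filterS h => y [h1 h2] _; rewrite -(planch P2).
- exact: measurable_sq1.
- by move=> x _; exact: sq_ge0.
- by rewrite lee_fin ltW// (planch_gt0 P2).
Qed.

Lemma partial_fourier1_integrand u xi : cintegrable m12 u ->
  cintegrable m12 (fun p => u p * cis (- dot1 p.1 xi)).
Proof.
move=> iu; apply: (cintegrableM iu (k := 2)); last by move=> ?; exact: abs1_cis.
by apply: (cmeas_comp (f := fst) (u := fun x => cis (- dot1 x xi))) => //; exact: (cmeas_cisl P1 xi).
Qed.

Lemma partial_fourier1_integrable u xi : cintegrable m12 u ->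
  cintegrable m2 (fun y => partial_fourier1 u (xi, y)).
Proof. by move=> iu; exact: (cintegrable_fubini2 (partial_fourier1_integrand xi iu)). Qed.

Lemma partial_fourier1_L2 u : cintegrable m12 u -> L2 m12 u -> L2 m12 (partial_fourier1 u).
Proof.
move=> iu lu; split; first exact: partial_fourier1_meas (cintegrable_meas iu).
rewrite sq_partial_fourier1 ?(L2_fin lu) -?EFinM ?ltry//; first exact: cintegrable_meas iu.
by apply: filterS2 (cintegrable_ae2 iu) (L2_ae2 lu).
Qed.

Lemma fourier_prodE u : cintegrable m12 u -> fourier m12 dot u = partial_fourier2 (partial_fourier1 u).
Proof.
move=> iu; have i1 xi := partial_fourier1_integrand xi iu.
have i2 xi1 xi2 : cintegrable m12 (fun p => u p * cis (- dot1 p.1 xi1) * cis (- dot2 p.2 xi2)).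
  apply: (cintegrableM (i1 xi1) (k := 2)); last by move=> ?; exact: abs1_cis.
  by apply: (cmeas_comp (f := snd) (u := fun x => cis (- dot2 x xi2))) => //; exact: (cmeas_cisl P2 xi2).
apply/funext => -[xi1 xi2]; rewrite /partial_fourier2 /partial_fourier1 /fourier /=.
transitivity (cint m12 (fun p => u p * cis (- dot1 p.1 xi1) * cis (- dot2 p.2 xi2))).
  by congr cint; apply/funext => p; rewrite /dot opprD cisD mulrA.
rewrite cint_fubini2//; apply: cint_ae.
- exact: (cintegrable_meas (cintegrable_fubini2 (i2 xi1 xi2))).
- apply: cmeasM; last exact: (cmeas_cisl P2 xi2).
  exact: (cintegrable_meas (cintegrable_fubini2 (i1 xi1))).
- by apply: filterS (cintegrable_ae2 (i1 xi1)) => y hy /=; rewrite cintZr.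
Qed.

(** The transform is the composite of the two partial ones. After the first, every section in the
    other variable is integrable by Fubini and almost every one is square integrable, so
    Plancherel's identity applies a second time. A ball of the product lies in the product of the
    balls of the same radius. *)
Lemma plancherel_prod : plancherel_space m12 dot (C1 * C2).
Proof.
have md : measurable_fun setT (fun p : (T1 * T2) * (T1 * T2) => dot p.1 p.2).
  apply: measurable_funD.
  - apply: (measurableT_comp (dot_meas P1) (g := fun p : (T1 * T2) * (T1 * T2) => (p.1.1, p.2.1))).
    by mfun.
  - apply: (measurableT_comp (dot_meas P2) (g := fun p : (T1 * T2) * (T1 * T2) => (p.1.2, p.2.2))).
    by mfun.
split => //.
- by move=> x y; rewrite /dot (dot_sym P1) (dot_sym P2).
- by move=> x; rewrite /dot addr_ge0// ?(dot_ge0 P1) ?(dot_ge0 P2).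
- move=> r; have mb1 := ball_meas P1 r; have mb2 := ball_meas P2 r.
  have mD : measurable [set x : T1 * T2 | dot x x <= r ^+ 2].
    have mdd : measurable_fun setT (fun x : T1 * T2 => dot x x).
      by apply: (measurableT_comp md (g := fun x : T1 * T2 => (x, x))); mfun.
    rewrite (_ : [set x | _] = (fun x => dot x x) @^-1` `]-oo, r ^+ 2]%classic).
      by rewrite -[X in measurable X]setTI; exact: mdd.
    by apply/seteqP; split => x /=; rewrite in_itv.
  apply: (@le_lt_trans _ _ (m12 ([set x | dot1 x x <= r ^+ 2] `*` [set x | dot2 x x <= r ^+ 2]))).
    apply: le_measure; rewrite ?inE//; first exact: measurableX.
    move=> x /= h; have := dot_ge0 P1 x.1; have := dot_ge0 P2 x.2.
    by move: h; rewrite /dot => h a b; split => /=; lra.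
  rewrite /sigma_finite_product product_measure1E// lte_mul_pinfty ?(ball_fin P2)//.
  by rewrite ge0_fin_numE// (ball_fin P1).
- by rewrite mulr_gt0 ?(planch_gt0 P1) ?(planch_gt0 P2).
move=> u iu lu; have m := cintegrable_meas iu.
have h1 : {ae m2, forall y, cintegrable m1 (fun x => u (x, y)) /\ L2 m1 (fun x => u (x, y))}.
  by apply: filterS2 (cintegrable_ae2 iu) (L2_ae2 lu).
have lv := partial_fourier1_L2 iu lu.
rewrite fourier_prodE// sq_partial_fourier2.
- by rewrite sq_partial_fourier1// muleA -EFinM [C2 * _]mulrC.
- exact: L2_meas lv.
- by apply: filterS (L2_ae1 lv) => x hx; split => //; exact: partial_fourier1_integrable.
Qed.

End plancherel_product.

(** * Plancherel's theorem *)

Section derivation_rules.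
Variable R : realType.
Implicit Types (f g : R -> R) (x a b : R).

Lemma der_eq f x a b : is_derive x 1 f a -> a = b -> is_derive x 1 f b.
Proof. by move=> h <-. Qed.
Lemma derD f g x a b : is_derive x 1 f a -> is_derive x 1 g b ->
  is_derive x 1 (fun t => f t + g t) (a + b).
Proof. by move=> h k; exact: is_deriveD. Qed.
Lemma derB f g x a b : is_derive x 1 f a -> is_derive x 1 g b ->
  is_derive x 1 (fun t => f t - g t) (a - b).
Proof. by move=> h k; exact: is_deriveB. Qed.
Lemma derN f x a : is_derive x 1 f a -> is_derive x 1 (fun t => - f t) (- a).
Proof. by move=> h; exact: is_deriveN. Qed.
Lemma derM f g x a b : is_derive x 1 f a -> is_derive x 1 g b ->
  is_derive x 1 (fun t => f t * g t) (a * g x + f x * b).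
Proof.
move=> h k; have := is_deriveM h k => /der_eq; apply.
by rewrite /GRing.scale /= addrC mulrC.
Qed.
Lemma dercst (c : R) x : is_derive x 1 (fun=> c) 0.
Proof. exact: is_derive_cst. Qed.
Lemma derid x : is_derive x 1 (fun t : R => t) 1.
Proof. exact: is_derive_id. Qed.
Lemma derZ (c : R) f x a : is_derive x 1 f a -> is_derive x 1 (fun t => c * f t) (c * a).
Proof. by move=> h; apply: der_eq (derM (dercst c x) h) _; rewrite mul0r add0r. Qed.
Lemma dercomp f g x a b : is_derive x 1 g b -> is_derive (g x) 1 f a ->
  is_derive x 1 (fun t => f (g t)) (a * b).
Proof. by move=> h k; exact: is_derive1_comp. Qed.
Lemma der_cont f x a : is_derive x 1 f a -> {for x, continuous f}.
Proof. by move=> h; apply/differentiable_continuous/derivable1_diffP; exact: ex_derive. Qed.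
Lemma der_derive1 f x a : is_derive x 1 f a -> derive1 f x = a.
Proof. by move=> h; rewrite derive1E; exact: derive_val. Qed.
Lemma der_derivable f x a : is_derive x 1 f a -> derivable f x 1.
Proof. by move=> h; exact: ex_derive. Qed.
End derivation_rules.

Section continuity_rules.
Variable R : realType.
Implicit Types f g : R -> R.
Lemma contcst (c : R) : continuous (fun _ : R => c).
Proof. by move=> x; exact: cvg_cst. Qed.
Lemma contid : continuous (fun x : R => x).
Proof. by move=> x; exact: cvg_id. Qed.
Lemma contD f g : continuous f -> continuous g -> continuous (fun x => f x + g x).
Proof. by move=> a b x; apply: cvgD; [exact: a|exact: b]. Qed.
Lemma contN f : continuous f -> continuous (fun x => - f x).
Proof. by move=> a x; apply: cvgN; exact: a. Qed.
Lemma contB f g : continuous f -> continuous g -> continuous (fun x => f x - g x).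
Proof. by move=> a b; apply: contD => //; exact: contN. Qed.
Lemma contM f g : continuous f -> continuous g -> continuous (fun x => f x * g x).
Proof. by move=> a b x; apply: cvgM; [exact: a|exact: b]. Qed.
Lemma contcomp f g : continuous f -> continuous g -> continuous (fun x => f (g x)).
Proof. by move=> a b x; exact: (continuous_comp (b x) (a _)). Qed.
Lemma contabs f : continuous f -> continuous (fun x => `|f x|).
Proof. by move=> a x; apply: cvg_norm; exact: a. Qed.
Lemma contV f : continuous f -> (forall x, f x != 0) -> continuous (fun x => (f x)^-1).
Proof. by move=> a h x; apply: cvgV => //; exact: a. Qed.
Lemma contX f n : continuous f -> continuous (fun x => f x ^+ n).
Proof. by move=> a x; exact: (continuous_comp (a x) (@exprn_continuous R n _)). Qed.
Lemma contmeas f : continuous f -> measurable_fun setT (f : R1 R -> R).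
Proof. exact: continuous_measurable_fun. Qed.
End continuity_rules.

Ltac cont := repeat lazymatch goal with
  | |- continuous (fun _ => ?c) => exact: contcst
  | |- continuous (fun x => x) => exact: contid
  | |- continuous (fun x => expR (@?g x)) => refine (contcomp (f := expR) (g := g) _ _); first exact: continuous_expR
  | |- continuous (fun x => sin (@?g x)) => refine (contcomp (f := sin) (g := g) _ _); first exact: continuous_sin
  | |- continuous (fun x => cos (@?g x)) => refine (contcomp (f := cos) (g := g) _ _); first exact: continuous_cos
  | |- continuous (fun x => @?f x + @?g x) => refine (contD (f := f) (g := g) _ _)
  | |- continuous (fun x => @?f x * @?g x) => refine (contM (f := f) (g := g) _ _)
  | |- continuous (fun x => - @?f x) => refine (contN (f := f) _)
  | |- continuous (fun x => `| @?f x |) => refine (contabs (f := f) _)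
  | |- continuous (fun x => @?f x ^+ ?n) => refine (contX (f := f) (n := n) _)
  | |- continuous (fun x => (@?f x)^-1) => refine (contV (f := f) _ _)
  end; try assumption.

(** * The Poisson kernel *)

Section poisson_kernel.
Variable R : realType.
Implicit Types e z x d : R.
Notation mu := (@lebesgue_measure R).

(** The Fourier transform of [exp (- e |x|)], that is [2 pi] times the Poisson kernel: its mass is
    [2 pi] for every [e], and it concentrates at 0 as [e] tends to 0. *)
Definition pk (e z : R) : R := 2 * e / (e ^+ 2 + z ^+ 2).

Lemma pk_den (e z : R) : 0 < e -> 0 < e ^+ 2 + z ^+ 2.
Proof. by move=> e0; rewrite ltr_wpDr ?sqr_ge0// exprn_gt0. Qed.

Lemma pk_ge0 e z : 0 < e -> 0 <= pk e z.
Proof. by move=> e0; rewrite divr_ge0 ?mulr_ge0 ?(ltW e0)// ltW// pk_den. Qed.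

Lemma pk_even e z : pk e (- z) = pk e z.
Proof. by rewrite /pk sqrrN. Qed.

Lemma der_pk e z : 0 < e -> is_derive z 1 (fun t => 2 * atan (e^-1 * t)) (pk e z).
Proof.
move=> e0; apply: der_eq.
rewrite /pk /GRing.scale /=; field; rewrite (gt_eqF (pk_den z e0)) gt_eqF//=.
Qed.

Lemma continuous_pk e : 0 < e -> continuous (pk e).
Proof.
by move=> e0; rewrite /pk; cont => x; rewrite gt_eqF// pk_den.
Qed.

Lemma poisson_mass e : 0 < e -> (\int[mu]_z (pk e z)%:E = (2 * pi)%:E)%E.
Proof.
move=> e0; rewrite ge0_symfun_integralT//; last 3 first.
- by move=> z; exact: pk_ge0.
- exact: continuous_pk.
- by move=> z /=; rewrite pk_even.
rewrite -set_itvcy (@ge0_continuous_FTC2y R (pk e) (fun t => 2 * atan (e^-1 * t)) 0 pi).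
- by rewrite mulr0 atan0 mulr0 sube0.
- by move=> z _; exact: pk_ge0.
- exact/continuous_subspaceT/continuous_pk.
- rewrite (_ : pi = 2 * (pi / 2)); last by field.
  apply: cvgM; first exact: cvg_cst.
  apply: (cvg_comp _ _ _ (@cvgy_atan R)).
  by apply: gt0_cvgMry; [rewrite invr_gt0|exact: cvg_id].
- by move=> x _; exact: der_derivable (der_pk x e0).
- by apply: cvg_at_right_filter; exact: der_cont (der_pk 0 e0).
- by move=> x _; exact: der_derive1 (der_pk x e0).
Qed.

Let prim (e z x : R) : R := expR (- (e * x)) *
  ((z * sin (z * x) - e * cos (z * x)) / (e ^+ 2 + z ^+ 2) - e^-1).

Let der_prim e z x : 0 < e ->
  is_derive x 1 (prim e z) (expR (- (e * x)) * (1 + cos (z * x))).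
Proof.
move=> e0; apply: der_eq.
by rewrite /GRing.scale /=; field; rewrite (gt_eqF (pk_den z e0)) gt_eqF.
Qed.

Let prim_cvg e z : 0 < e -> prim e z x @[x --> +oo] --> 0.
Proof.
move=> e0; pose B := (`|z| + e) / (e ^+ 2 + z ^+ 2) + e^-1.
have h1 : expR (- (e * x)) @[x --> +oo] --> (0 : R).
  by apply: (cvg_comp (fun x => e * x) _ _ (@cvgr_expR R)); apply: gt0_cvgMry; [|exact: cvg_id].
have h2 : B * expR (- (e * x)) @[x --> +oo] --> (0 : R).
  by rewrite -[X in _ --> X](mulr0 B); apply: cvgM h1; exact: cvg_cst.
apply: (squeeze_cvgr _ _ h2); last first.
  rewrite -[X in _ --> X]oppr0; exact: cvgN h2.
apply: nearW => x; rewrite -ler_norml /prim normrM (ger0_norm (expR_ge0 _)) mulrC.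
rewrite ler_wpM2r ?expR_ge0//; apply: (le_trans (ler_normB _ _)).
rewrite (@gtr0_norm _ e^-1) ?invr_gt0// /B lerD2r.
rewrite normrM (@gtr0_norm _ (_^-1)) ?invr_gt0 ?pk_den//.
rewrite ler_wpM2r// ?invr_ge0 ?(ltW (pk_den _ _))//.
apply: (le_trans (ler_normB _ _)); rewrite !normrM (gtr0_norm e0).
rewrite lerD//; first by rewrite ler_piMr// ler_norml sin_geN1 sin_le1.
by rewrite ler_piMr// ?(ltW e0)// ler_norml cos_geN1 cos_le1.
Qed.

(** Adding 1 to the cosine makes the integrand nonnegative, as the fundamental theorem of calculus
    on a half-line asks here; the integral of the bare exponential is subtracted again in
    [fourier_expR_abs]. *)
Let int_expcos1 e z : 0 < e ->
  (\int[mu]_x (expR (- (e * `|x|)) * (1 + cos (z * x)))%:E = (2 / e + pk e z)%:E)%E.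
Proof.
move=> e0.
have c : continuous (fun x : R => expR (- (e * `|x|)) * (1 + cos (z * x))).
  by cont.
have g0 x : 0 <= expR (- (e * `|x|)) * (1 + cos (z * x)).
  by rewrite mulr_ge0 ?expR_ge0//; have := cos_geN1 (z * x); lra.
rewrite ge0_symfun_integralT//; last first.
  by move=> x /=; rewrite normrN mulrN cosN.
rewrite -set_itvcy.
transitivity (2%:E * \int[mu]_(x in `[0%R, +oo[) (expR (- (e * x)) * (1 + cos (z * x)))%:E)%E.
  congr (_ * _)%E; apply: eq_integral => x; rewrite inE /= in_itv /= andbT => x0.
  by rewrite ger0_norm.
rewrite (@ge0_continuous_FTC2y R _ (prim e z) 0 0).
- rewrite /prim !mulr0 sin0 cos0 oppr0 expR0 -!EFinB -EFinM; congr EFin.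
  by rewrite /pk; field; rewrite (gt_eqF (pk_den z e0)) gt_eqF.
- by move=> x x0; have := g0 x; rewrite ger0_norm.
- by apply: continuous_subspaceT; cont.
- exact: prim_cvg.
- by move=> x _; exact: der_derivable (der_prim z x e0).
- by apply: cvg_at_right_filter; exact: der_cont (der_prim z 0 e0).
- by move=> x _; exact: der_derive1 (der_prim z x e0).
Qed.

Let mexp e : measurable_fun setT (fun x : R1 R => expR (- (e * `|x|))).
Proof. by apply: contmeas; cont. Qed.

Let int_exp e : 0 < e -> (\int[mu]_x (expR (- (e * `|x|)))%:E = (2 / e)%:E)%E.
Proof.
move=> e0; have := int_expcos1 0 e0.
have p0 (x : R1 R) : setT x -> (0 <= (expR (- (e * `|x|)))%:E)%E by rewrite lee_fin expR_ge0.
have mE : measurable_fun setT (fun x : R1 R => (expR (- (e * `|x|)))%:E).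
  by apply/measurable_EFinP; exact: mexp.
have k0 : (0 <= (1 + 1 : R)%:E)%E by rewrite lee_fin.
have Z := ge0_integralZl mu measurableT mE p0 k0.
under eq_integral do rewrite mul0r cos0 mulrC EFinM.
rewrite Z.
move=> h; have : ((1 + 1)^-1%:E * ((1 + 1)%:E * \int[mu]_x (expR (- (e * `|x|)))%:E) = (2 / e)%:E)%E.
  rewrite h -EFinM; congr EFin; rewrite /pk expr0n /= addr0; field.
  by rewrite gt_eqF.
by rewrite muleA -EFinM mulVf ?mul1e.
Qed.

Lemma integrable_expR_abs e : 0 < e -> cintegrable mu (fun x : R1 R => (expR (- (e * `|x|)))%:C%C).
Proof.
move=> e0; apply: l1_lty; first exact: (cmeas_real (mexp e)).
rewrite /l1; under eq_integral do rewrite abs1_real ger0_norm ?expR_ge0//.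
by rewrite int_exp// ltry.
Qed.

Lemma fourier_expR_abs e z : 0 < e ->
  cint mu (fun x : R1 R => (expR (- (e * `|x|)))%:C%C * cis (z * x)) = (pk e z)%:C%C.
Proof.
move=> e0; have ie := integrable_expR_abs e0.
have mc : cmeas (fun x : measurableTypeR R => cis (z * x)).
  by apply: cmeas_cis; exact: measurable_funM.
have i : cintegrable mu (fun x : R1 R => (expR (- (e * `|x|)))%:C%C * cis (z * x)).
  by apply: (cintegrableM ie mc (k := 2)) => x; exact: abs1_cis.
apply: complex_ext; rewrite ?(Re_cint, Im_cint).
- rewrite cRe_real.
  have h1 : \int[mu]_x (expR (- (e * `|x|)) * (1 + cos (z * x))) = 2 / e + pk e z.
    by rewrite /Rintegral int_expcos1.
  have h2 : \int[mu]_x expR (- (e * `|x|)) = 2 / e by rewrite /Rintegral int_exp.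
  have : \int[mu]_x (expR (- (e * `|x|)) + cRe ((expR (- (e * `|x|)))%:C%C * cis (z * x))) = 2 / e + pk e z.
    rewrite -h1; apply: eq_Rintegral => x _; rewrite cReM cRe_real cIm_real /cis /=; ring.
  rewrite RintegralD//; [|by case: ie|by case: i].
  by rewrite h2 => /addrI.
- rewrite cIm_real.
  (* The reflection [x |-> - x] preserves the measure and changes the sign of the imaginary part,
     which is therefore 0. *)
  have := congr1 (@complex.Im R) (mp_cint (mp_opp R) i); rewrite !Im_cint.
  set I := (X in _ = X -> _) => h.
  have : I = - I.
    rewrite -{1}h /I -[RHS]mulN1r -RintegralZl//; last by case: i.
    by apply: eq_Rintegral => x _; rewrite normrN mulrN cisN !cE; ring.
  by move=> /eqP; rewrite -subr_eq0 opprK -mulr2n mulrn_eq0 /= => /eqP.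
Qed.

(** Away from 0 the kernel is [e] times a fixed integrable function, for which the kernel of width 1
    serves. *)
Lemma pk_tail e (d z : R) : 0 < e -> 0 < d -> d <= `|z| -> pk e z <= e * (1 + (d ^+ 2)^-1) * pk 1 z.
Proof.
move=> e0 d0 dz.
have z2 : d ^+ 2 <= z ^+ 2 by rewrite -(real_normK (num_real z)) ler_pXn2r// nnegrE// ltW.
have d2 : 0 < d ^+ 2 by rewrite exprn_gt0.
have zz : 0 < z ^+ 2 by exact: lt_le_trans z2.
rewrite /pk expr1n mulr1.
rewrite ler_pdivrMr ?pk_den//.
rewrite (_ : e * (1 + d ^- 2) * (2 / (1 + z ^+ 2)) * (e ^+ 2 + z ^+ 2) = 2 * e * ((1 + d ^- 2) * (e ^+ 2 + z ^+ 2) / (1 + z ^+ 2))); last by ring.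
rewrite ler_pMr; last by rewrite mulr_gt0.
rewrite ler_pdivlMr; last by rewrite ltr_wpDr ?sqr_ge0.
rewrite mul1r.
have h : 1 <= (d ^+ 2)^-1 * z ^+ 2 by rewrite mulrC ler_pdivlMr// mul1r.
have he := exprn_gt0 2 e0.
have hd : 0 < (d ^+ 2)^-1 by rewrite invr_gt0.
rewrite mulrDl mul1r mulrDr.
have : 0 <= (d ^+ 2)^-1 * e ^+ 2 by rewrite mulr_ge0// ltW.
lra.
Qed.

End poisson_kernel.

Section dominated_L2.
Context d (T : measurableType d) (R : realType) (mu : {measure set T -> \bar R}).

Lemma sq_dominated_cvg (v : nat -> T -> R[i]) (b : T -> R) : (forall n, cmeas (v n)) ->
  mu.-integrable setT (EFin \o b) -> (forall n x, abs2 (v n x) <= b x) ->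
  (forall x, abs2 (v n x) @[n --> \oo] --> (0 : R)) ->
  forall e : R, 0 < e -> exists N : nat, forall n, (N <= n)%N -> (sq mu (v n) < e%:E)%E.
Proof.
move=> mv ib bd pw e e0.
pose g n x := (abs2 (v n x))%:E.
have mg n : measurable_fun setT (g n) by exact/measurable_EFinP/measurable_abs2.
have h1 : {ae mu, forall x, setT x -> g n x @[n --> \oo] --> (cst 0%E : T -> \bar R) x}.
  by apply/nearW => x _; apply/fine_cvgP; split; [exact: nearW|exact: pw].
have h2 : {ae mu, forall x, forall n, setT x -> (`|g n x| <= (EFin \o b) x)%E}.
  by apply/nearW => x n _; rewrite /g gee0_abs ?lee_fin ?abs2_ge0.
have [_ _] := dominated_convergence measurableT mg (measurable_cst 0%E) h1 ib h2.
rewrite integral0 => /fine_cvgP[[N1 _ hN1] /cvgrPdist_lt/(_ e e0)[N _ hN]].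
exists (maxn N N1) => n; rewrite geq_max => /andP[Nn N1n].
have := hN n Nn; have := hN1 n N1n; rewrite /= sub0r normrN -/(sq mu (v n)) => f.
by rewrite ger0_norm ?fine_ge0 ?sq_ge0// -lte_fin fineK.
Qed.
End dominated_L2.

(** * Continuity of translations in L2 *)

Section translation_continuity.
Variable R : realType.
Notation mu := (@lebesgue_measure R).
Implicit Types (u : R1 R -> R[i]) (e z : R).

Definition tent (N : nat) (x : R) : R := Num.max 0 (Num.min 1 (N.+1%:R - `|x|)).
Definition clamp (B x : R) : R := Num.max (- B) (Num.min B x).

Lemma clamp_norm B x : 0 <= B -> `|clamp B x| <= B.
Proof.
move=> B0; rewrite ler_norml /clamp; apply/andP; split; first by rewrite le_max lexx.
by rewrite ge_max ge_min lexx /= andbT; lra.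
Qed.

Lemma clamp_lip B x y : 0 <= B -> `|x| <= B -> `|x - clamp B y| <= `|x - y|.
Proof.
move=> B0; rewrite ler_norml => /andP[h1 h2]; rewrite /clamp.
have [a|a] := leP y (- B).
  rewrite (min_r (y := y)); last by lra.
  by rewrite (max_l a) !ger0_norm; lra.
have [b|b] := leP B y.
  rewrite (max_r (x := - B)); last by lra.
  by rewrite ![`|x - _|]distrC !ger0_norm; lra.
by rewrite (max_r (ltW a)).
Qed.

Lemma tent_ge0 N x : 0 <= tent N x. Proof. by rewrite le_max lexx. Qed.
Lemma tent_le1 N x : tent N x <= 1.
Proof. by rewrite ge_max ler01 ge_min lexx. Qed.
Lemma tent1 N x : `|x| <= N%:R -> tent N x = 1.
Proof.
move=> h; rewrite /tent min_l; first by rewrite max_r.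
by rewrite -natr1; lra.
Qed.
Lemma tent0 N x : N.+1%:R <= `|x| -> tent N x = 0.
Proof. by move=> h; rewrite /tent max_l// ge_min subr_le0 h orbT. Qed.
Lemma continuous_tent N : continuous (tent N).
Proof.
move=> x; apply: (@continuous_max R R (fun=> 0) _ x); first exact: cvg_cst.
apply: (@continuous_min R R (fun=> 1) _ x); first exact: cvg_cst.
by apply: cvgB; [exact: cvg_cst|exact: norm_continuous].
Qed.
Lemma continuous_clamp B : continuous (clamp B).
Proof.
move=> x; apply: (@continuous_max R R (fun=> - B) _ x); first exact: cvg_cst.
by apply: (@continuous_min R R (fun=> B) _ x); [exact: cvg_cst|exact: cvg_id].
Qed.

Lemma itv_indic_integrable (N : nat) (k : R) :
  mu.-integrable setT (EFin \o (fun x => k * \1_(`[- N%:R, N%:R]%classic : set (R1 R)) x)).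
Proof.
have -> : EFin \o (fun x => k * \1_(`[- N%:R, N%:R]%classic : set (R1 R)) x) =
  (fun x => k%:E * (\1_(`[- N%:R, N%:R]%classic : set (R1 R)) x)%:E)%E by [].
by apply: integrableZl => //; exact: integrable_indic_itv.
Qed.

Lemma indic_norm_itv (N : nat) (x : R) :
  \1_(`[- N%:R, N%:R]%classic : set (R1 R)) (x : R1 R) = (`|x| <= N%:R :> R)%:R :> R.
Proof. rewrite indicE; suff -> : (x \in (`[- N%:R, N%:R]%classic : set (R1 R))) = (`|x| <= N%:R :> R) by [].
by apply/idP/idP; rewrite inE /= in_itv /= ler_norml. Qed.

(** Arguing by contradiction replaces the continuous shift by a sequence of bad shifts tending to 0,
    for which dominated convergence is available. The shifts stay below 1, so that all supports lie
    in one interval. *)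
Lemma shift_cont_nice (h1 h2 : R -> R) (B : R) (N : nat) : continuous h1 -> continuous h2 ->
  (forall x, abs2 (h1 x +i* h2 x)%C <= B) -> (forall x, N%:R <= `|x| -> h1 x = 0 /\ h2 x = 0) ->
  forall e, 0 < e -> exists d : R, 0 < d /\ forall z, `|z| < d ->
   (sq mu (fun y : R1 R => ((h1 (z + y)) +i* (h2 (z + y)))%C - (h1 y +i* h2 y)%C)%R < e%:E)%E.
Proof.
move=> c1 c2 hB h0 e e0; apply: contrapT => /forallNP H.
have B0 : 0 <= B by apply: le_trans (hB 0); exact: abs2_ge0.
have {}H n : exists z : R, `|z| < n.+1%:R^-1 /\
   (e%:E <= sq mu (fun y : R1 R => ((h1 (z + y)) +i* (h2 (z + y)))%C - (h1 y +i* h2 y)%C)%R)%E.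
  have := H n.+1%:R^-1 => /not_andP[]; first by rewrite invr_gt0.
  by move=> /existsNP[z /not_implyP[zn /negP]]; rewrite -leNgt => ?; exists z.
pose zz n := projT1 (cid (H n)); have hz n := projT2 (cid (H n)).
have mh (f : R -> R) : continuous f -> measurable_fun setT (f : R1 R -> R) by exact: contmeas.
pose v n (y : R1 R) := ((h1 (zz n + y)) +i* (h2 (zz n + y)))%C - (h1 y +i* h2 y)%C.
have A1 n : cmeas (v n).
  apply: cmeasB; split => /=.
  + exact: (mh _ (contcomp c1 (contD (@contcst R (zz n)) (@contid R)))).
  + exact: (mh _ (contcomp c2 (contD (@contcst R (zz n)) (@contid R)))).
  + exact: mh.
  + exact: mh.
have A2 n x : abs2 (v n x) <= 4 * B * \1_(`[- N.+1%:R, N.+1%:R]%classic : set (R1 R)) x.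
  rewrite indic_norm_itv; have [xN|Nx] := leP `|x| N.+1%:R.
    rewrite mulr1; apply: (le_trans (abs2D _ _)); rewrite abs2N.
    by have := hB (zz n + x); have := hB x; lra.
  have [a _] := hz n; have a1 : `|zz n| < 1.
    by apply: (lt_le_trans a); rewrite invf_le1// ler1n.
  have Nr : N.+1%:R = N%:R + 1 :> R by rewrite -natr1.
  have xN : N%:R <= `|x| by lra.
  rewrite /v; have [-> ->] := h0 x xN.
  have := ler_normB (zz n + x) (zz n); rewrite (addrC (zz n)) addrK => t.
  have xN' : N%:R <= `|x + zz n| by lra.
  have [-> ->] := h0 (x + zz n) xN'.
  by rewrite subrr abs20 mulr0.
have A3 x : abs2 (v n x) @[n --> \oo] --> (0 : R).
  have zc : zz n + x @[n --> \oo] --> x.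
    rewrite -[X in _ --> X]add0r; apply: cvgD; last exact: cvg_cst.
    apply/cvgr0Pnorm_lt => ee ee0.
    have [K _ hK] := near_infty_natSinv_lt (PosNum ee0).
    by exists K => // n /= Kn; have [a _] := hz n; apply: (lt_trans a); exact: hK.
  have L (f : R -> R) : continuous f -> (f (zz n + x) - f x) ^+ 2 @[n --> \oo] --> (0 : R).
    move=> cf; rewrite (_ : 0 = (f x - f x) ^+ 2 :> R); last by rewrite subrr expr0n.
    rewrite expr2; under eq_fun do rewrite expr2.
    have : f (zz n + x) - f x @[n --> \oo] --> f x - f x.
      by apply: cvgB; [exact: (cvg_comp _ _ zc (cf x))|exact: cvg_cst].
    by move=> c; apply: cvgM.
  rewrite (_ : 0 = 0 + 0 :> R); last by rewrite addr0.
  rewrite /abs2; under eq_fun do rewrite cReD cImD cReN cImN !cRe_pair !cIm_pair.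
  by apply: (cvgD (L _ c1) (L _ c2)).
have [M hM] := sq_dominated_cvg A1 (itv_indic_integrable N.+1 (4 * B)) A2 A3 e0.
have := hM M (leqnn M); have [_] := hz M.
by rewrite -/(zz M) => a b; have := le_lt_trans a b; rewrite ltxx.
Qed.

Lemma le_2D (a b : \bar R) (x y : R) : (a <= x%:E)%E -> (b <= y%:E)%E ->
  (2%:E * a + 2%:E * b <= (2 * x + 2 * y)%:E)%E.
Proof.
move=> h k; apply: (@le_trans _ _ (2%:E * x%:E + 2%:E * y%:E)%E).
  by rewrite leeD// lee_wpmul2l.
by rewrite -!EFinM -EFinD.
Qed.
Lemma lt_2D (a b : \bar R) (x y : R) : (a <= x%:E)%E -> (b < y%:E)%E ->
  (2%:E * a + 2%:E * b < (2 * x + 2 * y)%:E)%E.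
Proof.
move=> h k; apply: (@le_lt_trans _ _ (2%:E * x%:E + 2%:E * b)%E).
  by rewrite leeD2r// lee_wpmul2l.
rewrite [X in (_ < X)%E]EFinD !EFinM lteD2lE//.
by rewrite lte_pmul2l.
Qed.

(** The function is first cut to the set where [|x|] and [|u|^2] are bounded, then its parts are
    approximated in [L1] by continuous functions, which are clamped and multiplied by a tent.
    Between functions bounded by [N + 1], the squared difference is at most [2 (N + 1)] times the
    difference, so [L1] approximation suffices. *)
Lemma L2_nice_approx u e : L2 mu u -> 0 < e -> exists (h1 h2 : R -> R) (B : R) (N : nat),
  [/\ continuous h1, continuous h2, (forall x, abs2 (h1 x +i* h2 x)%C <= B),
   (forall x, N%:R <= `|x| -> h1 x = 0 /\ h2 x = 0) &
   (sq mu (fun x : R1 R => u x - (h1 x +i* h2 x)%C)%R <= e%:E)%E].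
Proof.
move=> lu e0; have mu' := L2_meas lu.
pose A n : set (R1 R) := [set x : R1 R | (`|x| <= n%:R) && (abs2 (u x) <= n%:R)].
have mA n : measurable (A n).
  have -> : A n = `[- n%:R, n%:R]%classic `&` (fun x => abs2 (u x)) @^-1` `]-oo, n%:R]%classic.
    by apply/seteqP; split => x; rewrite /A /= !in_itv /= ler_norml => /andP.
  apply: measurableI => //; rewrite -[X in measurable X]setTI.
  by apply: measurable_abs2.
have e4 : 0 < e / 4 by rewrite divr_gt0.
have [N hN] : exists N : nat, forall n, (N <= n)%N -> (sq mu (fun x => u x - cut (A n) u x)%R < (e / 4)%:E)%E.
  apply: (@sq_dominated_cvg _ _ R mu _ (fun x => abs2 (u x)) _ (integrable_abs2 lu) _ _ _ e4).
  - by move=> n; apply: cmeasB => //; exact: cmeas_cutT.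
  - by move=> n x; rewrite /cut; case: ifP => _; rewrite ?subrr ?subr0 ?abs20 ?abs2_ge0.
  - move=> x; apply: cvg_near_cst.
    exists (Num.bound (`|x| + abs2 (u x))) => // n /= hn.
    have b : `|x| + abs2 (u x) < n%:R.
      apply: lt_le_trans (archi_boundP _) _; first by rewrite addr_ge0 ?abs2_ge0.
      by rewrite ler_nat.
    rewrite /cut ifT ?subrr ?abs20//; rewrite inE /A /=.
    have := abs2_ge0 (u x); have := normr_ge0 x => p q.
    by apply/andP; split; lra.
have {hN} := hN N (leqnn N) => hN.
pose v := cut (A N) u.
have mv : cmeas v by exact: cmeas_cutT.
have vN x : abs2 (v x) <= N%:R.
  rewrite /v /cut; case: ifPn; last by rewrite abs20.
  by rewrite inE => /andP[].
have v0 x : N%:R < `|x| -> v x = 0.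
  move=> h; rewrite /v /cut; case: ifPn => //; rewrite inE => /andP[q _].
  by move: h; rewrite ltNge q.
have N1 : (0 : R) <= N%:R + 1 by rewrite addr_ge0.
have comp_le (a b : R) : a ^+ 2 + b ^+ 2 <= N%:R -> `|a| <= N%:R + 1.
  move=> h; rewrite -(ler_pXn2r (n := 2)) ?nnegrE// real_normK ?num_real//.
  have := sqr_ge0 b; have : (0 : R) <= N%:R by []; move=> p q.
  by rewrite sqrrD1; have := sqr_ge0 (N%:R : R); lra.
have vRe x : `|cRe (v x)| <= N%:R + 1 by apply: comp_le (vN x).
have vIm x : `|cIm (v x)| <= N%:R + 1.
  by apply: (comp_le _ (cRe (v x))); rewrite addrC; exact: vN.
pose E : set (R1 R) := `[- N.+1%:R, N.+1%:R]%classic.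
have mE : measurable E by exact: measurable_itv.
have Efin : (mu E < +oo)%E.
  by rewrite /E lebesgue_measure_itv /=; case: ifP => _; rewrite ?ltry.
have iE (f : R1 R -> R) : measurable_fun setT f -> (forall x, `|f x| <= N%:R + 1) -> mu.-integrable E (EFin \o f).
  move=> mf hf.
  have mf' : measurable_fun E (EFin \o f).
    by apply: measurable_funTS; apply/measurable_EFinP.
  have ic : mu.-integrable E (fun _ : R1 R => (N%:R + 1)%:E).
    apply/integrableP; split; first exact: measurable_cst.
    under eq_integral do rewrite /= (ger0_norm N1).
    rewrite [X in (X < _)%E](@integral_cst _ _ _ mu E mE).
    by apply: lte_mul_pinfty => //; rewrite lee_fin.
  have bd (x : R1 R) : E x -> (`|(EFin \o f) x| <= `|(N%:R + 1)%:E|)%E.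
    by move=> _ /=; rewrite lee_fin (ger0_norm N1).
  exact: (le_integrable mE mf' bd ic).
(* Multiplied by [2 (N + 1)] this leaves [e / 8] for each of the two parts, hence [e / 4] for the
   cut function; the other [e / 4] is the error of cutting, and [sqD] doubles both. *)
have e8 : 0 < e / (16 * (N%:R + 1)).
  by rewrite divr_gt0// mulr_gt0// ltr_wpDl.
have approx (f : R1 R -> R) : measurable_fun setT f -> (forall x, `|f x| <= N%:R + 1) ->
    exists g : R -> R, continuous g /\ (\int[mu]_(z in E) `|(f z - g z)%:E| < (e / (16 * (N%:R + 1)))%:E)%E.
  move=> mf hf.
  have [g_ [cg ig cv]] := approximation_continuous_integrable mE Efin (iE f mf hf).
  move/fine_cvgP : cv => [[K1 _ hK1] /cvgrPdist_lt/(_ _ e8)[K _ hK]].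
  exists (g_ (maxn K K1)); split => //.
  have := hK (maxn K K1) (leq_maxl _ _); have := hK1 (maxn K K1) (leq_maxr _ _).
  rewrite /= sub0r normrN => f1; rewrite ger0_norm; last by apply: fine_ge0; exact: integral_ge0.
  by rewrite -lte_fin fineK.
have [g1 [cg1 hg1]] := approx _ mv.1 vRe.
have [g2 [cg2 hg2]] := approx _ mv.2 vIm.
pose h (g : R -> R) x := tent N x * clamp (N%:R + 1) (g x).
have ch g : continuous g -> continuous (h g).
  move=> cg; apply: contM; first exact: continuous_tent.
  by apply: contcomp => //; exact: continuous_clamp.
have hb g x : `|h g x| <= N%:R + 1.
  rewrite /h normrM ger0_norm ?tent_ge0// -[X in _ <= X]mul1r ler_pM ?tent_ge0 ?tent_le1//.
  exact: clamp_norm.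
have key (f : R1 R -> R) g : (forall x, `|f x| <= N%:R + 1) -> (forall x, N%:R < `|x| -> f x = 0) ->
   forall x, (f x - h g x) ^+ 2 <= 2 * (N%:R + 1) * (`|f x - g x| * \1_E x).
  move=> fb f0 x; rewrite indic_norm_itv.
  have [xE|Ex] := leP `|x| N.+1%:R; last first.
    rewrite f0 ?/h ?tent0 ?(ltW Ex)//; last by apply: lt_trans Ex; rewrite ltr_nat.
    by rewrite mul0r subrr expr0n /= !mulr0.
  have d1 : `|f x - h g x| <= `|f x - g x|.
    have [xN|Nx] := leP `|x| N%:R.
      by rewrite /h tent1// mul1r clamp_lip.
    rewrite f0// !sub0r !normrN /h normrM ger0_norm ?tent_ge0//.
    apply: (@le_trans _ _ `|clamp (N%:R + 1) (g x)|).
      by rewrite ler_piMl// tent_le1.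
    by have := @clamp_lip (N%:R + 1) 0 (g x) N1; rewrite normr0 !sub0r !normrN; apply.
  rewrite mulr1 -(real_normK (num_real _)) expr2 ler_pM//.
  by apply: (le_trans (ler_normB _ _)); have := fb x; have := hb g x; lra.
have int_le (f : R1 R -> R) g : measurable_fun setT f -> continuous g ->
   (forall x, `|f x| <= N%:R + 1) -> (forall x, N%:R < `|x| -> f x = 0) ->
   (\int[mu]_(z in E) `|(f z - g z)%:E| < (e / (16 * (N%:R + 1)))%:E)%E ->
   (\int[mu]_x ((f x - h g x) ^+ 2)%:E <= (e / 8)%:E)%E.
  move=> mf cg fb f0 hg.
  have mg : measurable_fun setT (g : R1 R -> R) by exact: contmeas.
  have mhg : measurable_fun setT (h g : R1 R -> R) by apply: contmeas; exact: ch.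
  apply: (@le_trans _ _ ((2 * (N%:R + 1))%:E * \int[mu]_(z in E) `|(f z - g z)%:E|)%E).
    rewrite [X in (_ <= _ * X)%E]integral_mkcond.
    have mr : measurable_fun setT ((fun z : R1 R => `|(f z - g z)%:E|%E) \_ E).
      apply/(measurable_restrictT _ mE); apply: measurable_funTS.
      by apply: measurableT_comp => //; apply/measurable_EFinP; exact: measurable_funB.
    have r0 x : setT x -> (0 <= ((fun z : R1 R => `|(f z - g z)%:E|%E) \_ E) x)%E.
      by move=> _; rewrite /patch; case: ifP => // _; exact: abse_ge0.
    have k0 : (0 <= (2 * (N%:R + 1) : R)%:E)%E by rewrite lee_fin mulr_ge0.
    rewrite -(ge0_integralZl mu measurableT mr r0 k0).
    apply: ge0_le_integral => //.
    - by move=> x _; rewrite lee_fin sqr_ge0.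
    - by apply/measurable_EFinP; apply: measurable_funX; exact: measurable_funB.
    - by apply: emeasurable_funM => //; exact: measurable_cst.
    - move=> x _; apply: (@le_trans _ _ (2 * (N%:R + 1) * (`|f x - g x| * \1_E x))%:E).
        by rewrite lee_fin; exact: key.
      by rewrite EFinM lee_wpmul2l// /patch indicE; case: ifP => _; rewrite ?mulr1 ?mulr0.
  apply: (@le_trans _ _ ((2 * (N%:R + 1))%:E * (e / (16 * (N%:R + 1)))%:E)%E).
    by rewrite lee_wpmul2l ?lee_fin ?mulr_ge0// ltW.
  rewrite -EFinM lee_fin le_eqVlt; apply/orP; left; apply/eqP; field.
  by rewrite gt_eqF// ltr_wpDl.
have mh g : continuous g -> measurable_fun setT (h g : R1 R -> R).
  by move=> cg; apply: contmeas; exact: ch.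
exists (h g1), (h g2), (2 * (N%:R + 1) ^+ 2), N.+1; split; try exact: ch.
- move=> x; rewrite /abs2 /=.
  have H g : h g x ^+ 2 <= (N%:R + 1) ^+ 2.
    by rewrite -(real_normK (num_real (h g x))) ler_pXn2r// nnegrE.
  by have := H g1; have := H g2; lra.
- by move=> x hx; rewrite /h tent0// !mul0r.
have vh : (sq mu (fun x : R1 R => v x - (h g1 x +i* h g2 x)%C)%R <= (e / 4)%:E)%E.
  rewrite /sq /abs2.
  under eq_integral do rewrite cReD cImD cReN cImN cRe_pair cIm_pair EFinD.
  rewrite ge0_integralD//=.
  - rewrite (_ : e / 4 = e / 8 + e / 8); last by field.
    rewrite EFinD leeD//; apply: int_le => //; [exact: mv.1| |exact: mv.2|].
      by move=> x /v0 ->.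
    by move=> x /v0 ->.
  - by move=> x _; rewrite lee_fin sqr_ge0.
  - by apply/measurable_EFinP; apply: measurable_funX; apply: measurable_funB; [exact: mv.1|exact: mh].
  - by move=> x _; rewrite lee_fin sqr_ge0.
  - by apply/measurable_EFinP; apply: measurable_funX; apply: measurable_funB; [exact: mv.2|exact: mh].
have m1 : cmeas (fun x : R1 R => u x - v x) by exact: cmeasB.
have m2 : cmeas (fun x : R1 R => v x - (h g1 x +i* h g2 x)%C).
  by apply: cmeasB => //; split; exact: mh.
have := sqD mu m1 m2.
under [X in sq mu X]eq_fun do rewrite addrA subrK.
move=> /le_trans; apply.
rewrite (_ : e = 2 * (e / 4) + 2 * (e / 4)); last by field.
by apply: le_2D => //; exact: ltW.
Qed.

Lemma L2_shift_cont u : L2 mu u -> forall e, 0 < e -> exists d : R, 0 < d /\ forall z, `|z| < d ->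
  (sq mu (fun y : R1 R => u (z + y) - u y)%R < e%:E)%E.
Proof.
move=> lu e e0; have e16 : 0 < e / 16 by rewrite divr_gt0.
have e4 : 0 < e / 4 by rewrite divr_gt0.
have [h1 [h2 [B [N [c1 c2 hB h0 happ]]]]] := L2_nice_approx lu e16.
have [d [d0 hd]] := shift_cont_nice c1 c2 hB h0 e4.
exists d; split => // z zd.
have {}hd := hd z zd.
pose w (x : R1 R) := u x - (h1 x +i* h2 x)%C.
have mh : cmeas (fun x : R1 R => (h1 x +i* h2 x)%C) by split; exact: contmeas.
have mw : cmeas w by apply: cmeasB => //; exact: L2_meas lu.
have mpz := mp_shift z.
have sw : sq mu (fun y : R1 R => w (z + y)) = sq mu w.
  rewrite -[RHS](mp_sq mpz)//; by congr sq; apply/funext => y; rewrite addrC.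
have mwz : cmeas (fun y : R1 R => w (z + y)).
  have := mp_cmeas mpz mw; by under eq_fun do rewrite addrC.
have mhz : cmeas (fun y : R1 R => ((h1 (z + y)) +i* (h2 (z + y)))%C).
  have := mp_cmeas mpz mh; by under eq_fun do rewrite addrC.
have mww : cmeas (fun y : R1 R => w (z + y) - w y) by exact: cmeasB.
have mhh : cmeas (fun y : R1 R => ((h1 (z + y)) +i* (h2 (z + y)))%C - (h1 y +i* h2 y)%C) by exact: cmeasB.
have -> : (fun y : R1 R => u (z + y) - u y) = (fun y : R1 R => (w (z + y) - w y) +
   (((h1 (z + y)) +i* (h2 (z + y)))%C - (h1 y +i* h2 y)%C)).
  by apply/funext => y; rewrite /w; ring.
apply: le_lt_trans (sqD mu mww mhh) _.
have h3 : (sq mu (fun y : R1 R => (w (z + y) - w y)%R) <= (e / 4)%:E)%E.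
  apply: le_trans (sqD mu mwz (cmeasN mw)) _.
  rewrite sqN sw (_ : e / 4 = 2 * (e / 16) + 2 * (e / 16)); last by field.
  exact: le_2D.
rewrite [X in (_ < X%:E)%E](_ : e = 2 * (e / 4) + 2 * (e / 4)); last by field.
exact: lt_2D.
Qed.

End translation_continuity.

(** * Plancherel's theorem on the line *)

Section plancherel_line.
Variable R : realType.
Notation mu := (@lebesgue_measure R).
Notation m11 := (sigma_finite_product mu mu).
Implicit Types (e z : R).

Definition dot1 (x y : R1 R) : R := x * y.
Let sp e z : R := Num.sqrt (pk e z).

Let sp2 e z : 0 < e -> sp e z ^+ 2 = pk e z.
Proof. by move=> e0; rewrite sqr_sqrtr// pk_ge0. Qed.

Let mpk e : 0 < e -> measurable_fun setT (pk e : R1 R -> R).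
Proof. by move=> e0; apply: contmeas; exact: continuous_pk. Qed.

Let intk e (k : R) : 0 < e -> 0 <= k ->
  (\int[mu]_z (k%:E * (pk e z)%:E) = (k * (2 * pi))%:E)%E.
Proof.
move=> e0 k0; have m : measurable_fun setT (fun z : R1 R => (pk e z)%:E).
  by apply/measurable_EFinP; exact: mpk.
have p0 (z : R1 R) : setT z -> (0 <= (pk e z)%:E)%E by rewrite lee_fin pk_ge0.
have k0' : (0 <= k%:E)%E by rewrite lee_fin.
by rewrite (ge0_integralZl mu measurableT m p0 k0') poisson_mass.
Qed.

Let msp e : 0 < e -> measurable_fun setT (sp e : R1 R -> R).
Proof.
move=> e0; apply: contmeas; apply: (contcomp (f := Num.sqrt)); first exact: sqrt_continuous.
exact: continuous_pk.
Qed.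

Let sq_sp e : 0 < e -> sq mu (fun y : R1 R => (sp e y)%:C%C) = (2 * pi)%:E.
Proof.
by move=> e0; rewrite -(poisson_mass e0); apply: eq_integral => y _; rewrite abs2_real sp2.
Qed.

Let mspC e : 0 < e -> cmeas (fun y : R1 R => (sp e y)%:C%C).
Proof. by move=> e0; apply: cmeas_real; exact: msp. Qed.

Let sq_sp1 e (x : R1 R) : 0 < e -> sq mu (fun y : R1 R => (sp e (x - y))%:C%C) = (2 * pi)%:E.
Proof.
move=> e0; have m1 := mp_cmeas (mp_shift x) (mspC e0).
rewrite -(sq_sp e0) -(mp_sq (mp_shift x) (mspC e0)) -(mp_sq (mp_opp R) m1).
by congr sq; apply/funext => y; rewrite addrC.
Qed.

Let sq_sp2 e (y : R1 R) : 0 < e -> sq mu (fun x : R1 R => (sp e (x - y))%:C%C) = (2 * pi)%:E.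
Proof. by move=> e0; rewrite -(sq_sp e0) -(mp_sq (mp_shift (- y)) (mspC e0)). Qed.

Let msp12 e : 0 < e -> cmeas (fun p : R1 R * R1 R => (sp e (p.1 - p.2))%:C%C).
Proof.
move=> e0; apply: cmeas_real.
apply: (measurableT_comp (msp e0) (g := fun p : R1 R * R1 R => p.1 - p.2 : R1 R)).
by apply: measurable_funB.
Qed.

Variables (u : R1 R -> R[i]).
Hypotheses (iu : cintegrable mu u) (lu : L2 mu u).
Let mu' : cmeas u := L2_meas lu.
Let pi2 : 0 < 2 * pi :> R. Proof. by rewrite mulr_gt0// pi_gt0. Qed.

(** The integral of [|F u|^2] damped by [exp (- e |x|)] is the double integral of [u(x) conj(u(y))]
    against the kernel at [x - y]. Splitting the kernel into two square roots turns it into the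
    inner product of [a] and [b], each of square norm [2 pi * nsq u]; the defect in Plancherel's
    identity is then half the square norm of [a - b]. *)
Let a e (p : R1 R * R1 R) : R[i] := u p.1 * (sp e (p.1 - p.2))%:C%C.
Let b e (p : R1 R * R1 R) : R[i] := u p.2 * (sp e (p.1 - p.2))%:C%C.

Let ma e : 0 < e -> cmeas (a e).
Proof. by move=> e0; apply: cmeasM; [exact: (cmeas_comp (f := fst))|exact: msp12]. Qed.
Let mb e : 0 < e -> cmeas (b e).
Proof. by move=> e0; apply: cmeasM; [exact: (cmeas_comp (f := snd))|exact: msp12]. Qed.

Let int2pi : (\int[mu]_x ((2 * pi)%:E * (abs2 (u x))%:E) = (2 * pi * nsq mu u)%:E)%E.
Proof.
rewrite ge0_integralZl//.
- by rewrite -/(sq mu u) (L2_fin lu).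
- exact/measurable_EFinP/measurable_abs2.
- by move=> x _; rewrite lee_fin abs2_ge0.
- by rewrite lee_fin ltW.
Qed.

Let sqa e : 0 < e -> sq m11 (a e) = (2 * pi * nsq mu u)%:E.
Proof.
move=> e0; rewrite sq_tonelli1; last exact: ma.
rewrite -int2pi; apply: eq_integral => x _.
rewrite /a /= sqZ ?sq_sp1// 1?muleC//.
exact: (cmeas_section1 x (msp12 e0)).
Qed.

Let sqb e : 0 < e -> sq m11 (b e) = (2 * pi * nsq mu u)%:E.
Proof.
move=> e0; rewrite sq_tonelli2; last exact: mb.
rewrite -int2pi; apply: eq_integral => y _.
rewrite /b /= sqZ ?sq_sp2// 1?muleC//.
exact: (cmeas_section2 y (msp12 e0)).
Qed.

Let la e : 0 < e -> L2 m11 (a e).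
Proof. by move=> e0; split; [exact: ma|rewrite sqa// ltry]. Qed.
Let lb e : 0 < e -> L2 m11 (b e).
Proof. by move=> e0; split; [exact: mb|rewrite sqb// ltry]. Qed.

Let E e (x : R1 R) : R := expR (- (e * `|x|)).
Let F := fourier mu dot1 u.

Let H e (q : (R1 R * R1 R) * R1 R) : R[i] :=
  u q.1.1 * conjc (u q.1.2) * (E e q.2)%:C%C * cis ((q.1.2 - q.1.1) * q.2).

Let iH e : 0 < e -> cintegrable (sigma_finite_product m11 mu) (H e).
Proof.
move=> e0; apply: (cintegrableM (k := 2)); last by move=> q; exact: abs1_cis.
  have t := cintegrable_tensor (cintegrable_tensor iu (cintegrable_conj iu)) (integrable_expR_abs e0).
  exact: t.
apply: cmeas_cis; apply: measurable_funM; last exact: measurable_snd.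
by apply: measurable_funB; mfun.
Qed.

Let iE e : 0 < e -> cintegrable mu (fun x => (E e x)%:C%C).
Proof. exact: integrable_expR_abs. Qed.

Let inner1 e p : 0 < e -> cint mu (fun xi => H e (p, xi)) = a e p * conjc (b e p).
Proof.
move=> e0; rewrite /H /=.
transitivity (cint mu (fun xi => u p.1 * conjc (u p.2) * ((E e xi)%:C%C * cis ((p.2 - p.1) * xi)))).
  by congr cint; apply/funext => xi; rewrite -!mulrA.
rewrite cintZ; last first.
  apply: (cintegrableM (iE e0) (k := 2)); last by move=> ?; exact: abs1_cis.
  by apply: cmeas_cis; exact: measurable_funM.
rewrite fourier_expR_abs// -(opprB p.1) pk_even -sp2// /a /b conjcM conjc_real rmorphXn /= expr2.
ring.
Qed.

Let ic1 (xi : R1 R) : cintegrable mu (fun x => u x * cis (- dot1 x xi)).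
Proof.
apply: (cintegrableM iu (k := 2)); last by move=> ?; exact: abs1_cis.
by apply: cmeas_cis; apply: measurableT_comp => //; exact: measurable_funM.
Qed.

Let inner2 e xi : 0 < e -> cint m11 (fun p => H e (p, xi)) = (E e xi * abs2 (F xi))%:C%C.
Proof.
move=> e0; rewrite /H /=.
transitivity (cint m11 (fun p => (E e xi)%:C%C * ((u p.1 * cis (- dot1 p.1 xi)) * conjc (u p.2 * cis (- dot1 p.2 xi))))).
  congr cint; apply/funext => p; rewrite conjcM -cisN opprK /dot1 mulrBl cisD.
  ring.
have t := cintegrable_tensor (ic1 xi) (cintegrable_conj (ic1 xi)).
rewrite cintZ// (cint_tensor (ic1 xi) (cintegrable_conj (ic1 xi))) cint_conj//.
by rewrite mul_conj rmorphM.
Qed.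

Let ipab e : 0 < e -> ip m11 (a e) (b e) = cint mu (fun xi => (E e xi * abs2 (F xi))%:C%C).
Proof.
move=> e0; transitivity (cint m11 (fun p => cint mu (fun xi => H e (p, xi)))).
  by congr cint; apply/funext => p; rewrite inner1.
rewrite (cint_swap (iH e0)); congr cint; apply/funext => xi; exact: inner2.
Qed.

Let i_EF e : 0 < e -> mu.-integrable setT (EFin \o (fun xi => E e xi * abs2 (F xi))).
Proof.
move=> e0; have := cintegrable_fubini2 (iH e0).
by under [X in cintegrable mu X]eq_fun do rewrite inner2//; case.
Qed.

Let D e (p : R1 R * R1 R) := a e p - b e p.

Let regularized e : 0 < e ->
  \int[mu]_xi (E e xi * abs2 (F xi)) = 2 * pi * nsq mu u - nsq m11 (D e) / 2.
Proof.
move=> e0; have := nsqBip (la e0) (lb e0).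
rewrite -/(nsq m11 (D e)).
have -> : nsq m11 (a e) = 2 * pi * nsq mu u by rewrite {1}/nsq sqa.
have -> : nsq m11 (b e) = 2 * pi * nsq mu u by rewrite {1}/nsq sqb.
by rewrite ipab// Re_cint => ->; field.
Qed.

(** The substitution [x = z + y] leaves a kernel in [z] alone, so that the defect is a kernel
    average of the translation differences of [u]. *)
Let sqD_shift e : 0 < e ->
  sq m11 (D e) = (\int[mu]_z ((pk e z)%:E * sq mu (fun y : R1 R => u (z + y) - u y)%R))%E.
Proof.
move=> e0; have mD : cmeas (D e) by apply: cmeasB; [exact: ma|exact: mb].
pose H2 (p : R1 R * R1 R) := (sp e p.1)%:C%C * (u (p.1 + p.2) - u p.2).
have mH : cmeas H2.
  apply: cmeasM; first by apply: (cmeas_comp (f := fst) (u := fun z : R1 R => (sp e z)%:C%C)) => //; exact: mspC.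
  apply: cmeasB; last exact: (cmeas_comp (f := snd)).
  by apply: (cmeas_comp (f := fun p : R1 R * R1 R => p.1 + p.2 : R1 R)) => //; apply: measurable_funD.
rewrite (sq_tonelli2 mu mu mD).
transitivity (sq m11 H2).
  rewrite (sq_tonelli2 mu mu mH); apply: eq_integral => y _.
  rewrite -(mp_sq (mp_shift y) (cmeas_section2 y mD)).
  congr sq; apply/funext => z; rewrite /D /a /b /H2 /= addrK; ring.
rewrite (sq_tonelli1 mu mu mH); apply: eq_integral => z _; rewrite /H2 /= sqZ.
  by rewrite abs2_real sp2.
apply: cmeasB => //.
have := mp_cmeas (mp_shift z) mu'; by under eq_fun do rewrite addrC.
Qed.

Let D_small (eta : R) : 0 < eta -> exists e0 : R, 0 < e0 /\ forall e, 0 < e -> e <= e0 ->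
  nsq m11 (D e) <= eta.
Proof.
move=> eta0; have k0 : 0 < eta / (4 * pi) by rewrite divr_gt0// mulr_gt0// pi_gt0.
have [d [d0 hd]] := L2_shift_cont lu k0.
(* The region [|z| < d] contributes at most [2 pi] times [eta / (4 pi)], that is [eta / 2]. On the
   rest the translation differences are at most [4 * nsq u], and [pk_tail] gives [e * (M - 1)]; the
   added 1 keeps [M] positive. *)
pose M := 8 * pi * nsq mu u * (1 + (d ^+ 2)^-1) + 1.
have d2 : 0 < (d ^+ 2)^-1 by rewrite invr_gt0 exprn_gt0.
have M0 : 0 < M.
  rewrite ltr_wpDl// !mulr_ge0 ?nsq_ge0//; first exact: pi_ge0.
  by rewrite addr_ge0// ltW.
exists (eta / 2 / M); split; first by rewrite !divr_gt0.
move=> e e0 ee.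
have lD : L2 m11 (D e) by apply: L2B; [exact: la|exact: lb].
rewrite -lee_fin -L2_fin// sqD_shift//.
pose c := 4 * nsq mu u * (e * (1 + (d ^+ 2)^-1)).
have c0 : 0 <= c by rewrite /c !mulr_ge0 ?nsq_ge0 ?(ltW e0)// addr_ge0// ltW.
have mz z : cmeas (fun y : R1 R => u (z + y)).
  have := mp_cmeas (mp_shift z) mu'; by under eq_fun do rewrite addrC.
apply: (@le_trans _ _ (\int[mu]_z ((eta / (4 * pi))%:E * (pk e z)%:E + c%:E * (pk 1 z)%:E))%E).
  apply: ge0_le_integral => //.
  - by move=> z _; rewrite mule_ge0 ?sq_ge0// lee_fin pk_ge0.
  - apply: emeasurable_funM; first by apply/measurable_EFinP; exact: mpk.
    pose H3 (p : R1 R * R1 R) := u (p.1 + p.2) - u p.2.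
    have mH3 : cmeas H3.
      apply: cmeasB; last exact: (cmeas_comp (f := snd)).
      by apply: (cmeas_comp (f := fun p : R1 R * R1 R => p.1 + p.2 : R1 R)) => //; apply: measurable_funD.
    exact: (measurable_sq1 mu mH3).
  - apply: emeasurable_funD; apply: emeasurable_funM; try exact: measurable_cst.
    + by apply/measurable_EFinP; exact: mpk.
    + by apply/measurable_EFinP; exact: mpk.
  - move=> z _.
    have [zd|dz] := ltP `|z| d.
      apply: (@le_trans _ _ ((eta / (4 * pi))%:E * (pk e z)%:E)%E).
        by rewrite muleC lee_wpmul2r ?lee_fin ?pk_ge0// ltW// hd.
      by rewrite leeDl// -EFinM lee_fin mulr_ge0// pk_ge0.
    apply: (@le_trans _ _ (c%:E * (pk 1 z)%:E)%E); last first.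
      by rewrite leeDr// -EFinM lee_fin mulr_ge0// ?(ltW k0)// pk_ge0.
    have h4 : (sq mu (fun y : R1 R => (u (z + y) - u y)%R) <= (4 * nsq mu u)%:E)%E.
      apply: le_trans (sqD mu (mz z) (cmeasN mu')) _.
      have -> : sq mu (fun y : R1 R => u (z + y)) = sq mu u.
        by rewrite -[RHS](mp_sq (mp_shift z))//; congr sq; apply/funext => y; rewrite addrC.
      by rewrite sqN (L2_fin lu) -!EFinM -EFinD lee_fin; lra.
    apply: (@le_trans _ _ ((pk e z)%:E * (4 * nsq mu u)%:E)%E).
      by rewrite lee_wpmul2l// lee_fin pk_ge0.
    rewrite -!EFinM lee_fin.
    rewrite (_ : pk e z * (4 * nsq mu u) = 4 * nsq mu u * pk e z); last by ring.
    rewrite (_ : c * pk 1 z = 4 * nsq mu u * (e * (1 + (d ^+ 2)^-1) * pk 1 z)); last by rewrite /c; ring.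
    by rewrite ler_wpM2l ?mulr_ge0 ?nsq_ge0//; exact: pk_tail.
have mk (k : R) e' : 0 < e' -> measurable_fun setT (fun z : R1 R => k%:E * (pk e' z)%:E)%E.
  move=> e'0; apply: emeasurable_funM; first exact: measurable_cst.
  by apply/measurable_EFinP; exact: mpk.
have pp (k : R) e' : 0 <= k -> 0 < e' -> forall z : R1 R, setT z -> (0 <= k%:E * (pk e' z)%:E)%E.
  by move=> h h' z _; rewrite -EFinM lee_fin mulr_ge0// pk_ge0.
rewrite (ge0_integralD mu measurableT (pp _ _ (ltW k0) e0) (mk _ _ e0) (pp _ _ c0 ltr01) (mk _ _ ltr01)).
rewrite !intk//; last exact: ltW.
rewrite -EFinD lee_fin.
have fp (p : R) : p != 0 -> eta / (4 * p) * (2 * p) = eta / 2 by move=> p0; field.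
rewrite fp ?gt_eqF ?pi_gt0//.
have -> : c * (2 * pi) = e * (M - 1) by rewrite /c /M; ring.
have h5 : e * M <= eta / 2 by rewrite -ler_pdivlMr.
by rewrite mulrBr mulr1; lra.
Qed.

(** The damping factors increase to 1, so that monotone convergence reaches the integral of [|F|^2]
    without knowing beforehand that it is finite; [regularized] and [D_small] compute the limit. *)
Lemma plancherel_line_sq : sq mu F = ((2 * pi)%:E * sq mu u)%E.
Proof.
pose g (n : nat) xi := (E n.+1%:R^-1 xi * abs2 (F xi))%:E.
have n0 n : 0 < n.+1%:R^-1 :> R by rewrite invr_gt0.
have mF : cmeas F.
  apply: (@cmeas_cint2 _ _ _ _ _ mu (fun p : R1 R * R1 R => u p.1 * cis (- dot1 p.1 p.2))).
  apply: cmeasM; first exact: (cmeas_comp (f := fst)).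
  by apply: cmeas_cis; apply: measurableT_comp => //; exact: measurable_funM.
have mg n : measurable_fun setT (g n) by apply: (measurable_int mu); exact: i_EF.
have g0 n x : setT x -> (0 <= g n x)%E by move=> _; rewrite lee_fin mulr_ge0 ?abs2_ge0// expR_ge0.
have gm x : setT x -> {homo g^~ x : n m / (n <= m)%N >-> (n <= m)%E}.
  move=> _ n m nm; rewrite lee_fin ler_wpM2r ?abs2_ge0// ler_expR lerN2 ler_wpM2r//.
  by rewrite lef_pV2 ?posrE// ler_nat.
have := cvg_monotone_convergence (mu := mu) measurableT mg g0 gm.
have -> : (fun x => limn (g^~ x)) = (fun x => (abs2 (F x))%:E).
  apply/funext => x; apply/cvg_lim => //; apply/fine_cvgP; split; first exact: nearW.
  rewrite -[X in _ --> X]mul1r; apply: cvgM; last exact: cvg_cst.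
  have lim0 : - (n.+1%:R^-1 * `|x|) @[n --> \oo] --> (0 : R).
    rewrite -[X in _ --> X]oppr0; apply: cvgN; rewrite -[X in _ --> X](mul0r `|x|).
    by apply: cvgM; [exact: cvg_harmonic|exact: cvg_cst].
  have lim1 := cvg_comp _ _ lim0 (@continuous_expR R 0); rewrite expR0 in lim1.
  exact: lim1.
rewrite -/(sq mu F) (L2_fin lu) -EFinM => cv.
apply: (cvg_unique (@ereal_hausdorff R) cv); apply/fine_cvgP; split.
  by apply: nearW => n; apply: integrable_fin_num => //; exact: i_EF.
apply/cvgrPdist_le => eta eta0.
have eta2 : 0 < 2 * eta by rewrite mulr_gt0.
have [e0 [e00 he]] := D_small eta2.
have [K _ hK] := near_infty_natSinv_lt (PosNum e00).
exists K => // n Kn /=.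
have -> : fine (\int[mu]_x g n x)%E = \int[mu]_xi (E n.+1%:R^-1 xi * abs2 (F xi)) by [].
rewrite regularized// opprB addrC subrK ger0_norm ?divr_ge0 ?nsq_ge0//.
by rewrite ler_pdivrMr// mulrC he// ltW// hK.
Qed.

End plancherel_line.

Section plancherel_spaces.
Variable R : realType.

Lemma plancherel1 : plancherel_space (leb1 R) (@dot1 R) (2 * pi).
Proof.
split.
- exact: measurable_funM.
- by move=> x y; rewrite /dot1 mulrC.
- by move=> x; rewrite /dot1 -expr2 sqr_ge0.
- move=> r; apply: (@le_lt_trans _ _ (leb1 R `[- `|r|, `|r|]%classic)).
    apply: le_measure; rewrite ?inE//.
      rewrite (_ : [set x | _] = (fun x : R1 R => dot1 x x) @^-1` `]-oo, r ^+ 2]%classic).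
        rewrite -[X in measurable X]setTI.
        by apply: (measurable_funM (@measurable_id _ _ _) (@measurable_id _ _ _)).
      by apply/seteqP; split => x /=; rewrite in_itv.
    move=> x /=; rewrite /dot1 -expr2 in_itv /= -ler_norml => h.
    by rewrite -(ler_pXn2r (n := 2)) ?nnegrE// !real_normK ?num_real.
  by rewrite lebesgue_measure_itv /=; case: ifP => _; rewrite ?ltry.
- by rewrite mulr_gt0// pi_gt0.
- by move=> u iu lu; exact: plancherel_line_sq.
Qed.

Lemma plancherel2 : plancherel_space (leb2 R) dot2 (2 * pi * (2 * pi)).
Proof. exact: (plancherel_prod plancherel1 plancherel1). Qed.
Lemma plancherel3 : plancherel_space (leb3 R) dot3 (2 * pi * (2 * pi) * (2 * pi)).
Proof. exact: (plancherel_prod plancherel2 plancherel1). Qed.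
Lemma plancherel4 : plancherel_space (leb4 R) dot4 (2 * pi * (2 * pi * (2 * pi) * (2 * pi))).
Proof. exact: (plancherel_prod plancherel1 plancherel3). Qed.
Lemma plancherel5 : plancherel_space (leb5 R) dot5
  (2 * pi * (2 * pi) * (2 * pi) * (2 * pi * (2 * pi))).
Proof. exact: (plancherel_prod plancherel3 plancherel2). Qed.

End plancherel_spaces.

(** * Smooth functions *)

Section smooth_functions.
Variable R : realType.
Implicit Types (f g : R -> R) (A : set (R -> R)) (x e : R).

(** Smoothness as membership in some set of functions closed under differentiation, which avoids
    iterated derivatives. *)
Definition smooth1 f := exists A, A f /\
  forall g, A g -> exists g', A g' /\ forall x : R, is_derive x (1 : R) g (g' x).

Inductive algebra_gen A : (R -> R) -> Prop :=
| alg_in f : A f -> algebra_gen A f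
| alg_cst (c : R) : algebra_gen A (fun=> c)
| alg_add f g : algebra_gen A f -> algebra_gen A g -> algebra_gen A (fun x => f x + g x)
| alg_mul f g : algebra_gen A f -> algebra_gen A g -> algebra_gen A (fun x => f x * g x).

(** By the Leibniz rule it is enough to differentiate the generators inside the algebra that they
    generate. Products, sums, reciprocals and affine substitutions are obtained by enlarging the set
    of generators. *)
Lemma smooth1_gen A : (forall g, A g -> exists g', algebra_gen A g' /\ forall x : R, is_derive x (1 : R) g (g' x)) ->
  forall f, algebra_gen A f -> smooth1 f.
Proof.
move=> h f Af; exists (algebra_gen A); split => // g; elim=> {g}.
- by move=> g /h.
- move=> c; exists (fun=> 0); split; first exact: alg_cst.
  by move=> x; exact: dercst.
- move=> u v _ [u' [Au' du]] _ [v' [Av' dv]]; exists (fun x => u' x + v' x); split; first exact: alg_add.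
  by move=> x; exact: derD.
- move=> u v Au [u' [Au' du]] Av [v' [Av' dv]]; exists (fun x => u' x * v x + u x * v' x); split.
    by apply: alg_add; exact: alg_mul.
  by move=> x; exact: derM.
Qed.

Lemma smooth1_der f : smooth1 f -> exists f', smooth1 f' /\ forall x : R, is_derive x (1 : R) f (f' x).
Proof. by move=> [A [Af hA]]; have [f' [Af' d]] := hA f Af; exists f'; split => //; exists A. Qed.

Lemma smooth1_cont f : smooth1 f -> continuous f.
Proof. by move=> /smooth1_der[f' [_ d]] x; exact: der_cont (d x). Qed.

Lemma smooth1M f g : smooth1 f -> smooth1 g -> smooth1 (fun x => f x * g x).
Proof.
move=> [A [Af hA]] [B [Bg hB]]; apply: (@smooth1_gen (A `|` B)); last first.
  by apply: alg_mul; apply: alg_in; [left|right].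
move=> u [/hA|/hB] [u' [h d]]; exists u'; split => //; apply: alg_in; [by left|by right].
Qed.

Lemma smooth1D f g : smooth1 f -> smooth1 g -> smooth1 (fun x => f x + g x).
Proof.
move=> [A [Af hA]] [B [Bg hB]]; apply: (@smooth1_gen (A `|` B)); last first.
  by apply: alg_add; apply: alg_in; [left|right].
move=> u [/hA|/hB] [u' [h d]]; exists u'; split => //; apply: alg_in; [by left|by right].
Qed.

Lemma smooth1_cst (c : R) : smooth1 (fun=> c).
Proof. by apply: (@smooth1_gen set0) => //; exact: alg_cst. Qed.

Lemma smooth1V f : smooth1 f -> (forall x, f x != 0) -> smooth1 (fun x => (f x)^-1).
Proof.
move=> [A [Af hA]] f0; apply: (@smooth1_gen (A `|` [set (fun x => (f x)^-1)])); last first.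
  by apply: alg_in; right.
move=> u [/hA[u' [h d]]|->].
  by exists u'; split => //; apply: alg_in; left.
have [f' [Af' d]] := hA f Af.
exists (fun x => -1 * (f' x * ((f x)^-1 * (f x)^-1))); split.
  apply: alg_mul; first exact: alg_cst.
  apply: alg_mul; first by apply: alg_in; left.
  by apply: alg_mul; apply: alg_in; right.
move=> x; have [fx fx'] := d x; split; first exact: derivableV.
have -> : 'D_1 (fun t => (f t)^-1) x = - (f x) ^- 2 *: 'D_1 f x by exact: deriveV.
by rewrite fx' /GRing.scale /= expr2 invfM; ring.
Qed.

Lemma smooth1_affine f (a b : R) : smooth1 f -> smooth1 (fun x => f (a * x + b)).
Proof.
move=> [A [Af hA]]; apply: (@smooth1_gen [set u | exists2 g, A g & u = fun x => g (a * x + b)]); last first.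
  by apply: alg_in; exists f.
move=> u [g /hA[g' [Ag' d]] ->]; exists (fun x => g' (a * x + b) * a); split.
  by apply: alg_mul; [apply: alg_in; exists g'|exact: alg_cst].
move=> x; apply: (dercomp (f := g)) => //.
by apply: der_eq (derD (derZ a (derid x)) (dercst b x)) _; rewrite mulr1 addr0.
Qed.

(** The family containing [flat] that is closed under differentiation: for [x > 0] the derivative of
    [p(1/x) exp(-1/x)] has the same form with [X^2 (p - p')]. At 0 the exponential dominates
    [X^2 p], which gives a bound by [h^2] and hence the derivative 0. *)
Let flatp (p : {poly R}) (x : R) : R := if 0 < x then p.[x^-1] * expR (- x^-1) else 0.

Let pow_exp_bound (i : nat) (y : R) : 0 <= y -> y ^+ i <= i`!%:R * expR y.
Proof.
move=> y0; case: i => [|n]; first by rewrite expr0 fact0 mul1r; have := expR_ge1Dx y; lra.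
have h := expR_ge1Dxn n y0.
have f0 : 0 < n.+1`!%:R :> R by rewrite ltr0n fact_gt0.
by rewrite mulrC -ler_pdivrMr//; lra.
Qed.

Let poly_exp_bound (p : {poly R}) : exists C : R, 0 <= C /\ forall y, 0 <= y -> `|p.[y]| <= C * expR y.
Proof.
exists (\sum_(i < size p) `|p`_i| * i`!%:R); split; first by apply: sumr_ge0 => i _; rewrite mulr_ge0.
move=> y y0; rewrite horner_coef mulr_suml; apply: (le_trans (ler_norm_sum _ _ _)).
apply: ler_sum => i _; rewrite normrM (@ger0_norm _ (y ^+ _)) ?exprn_ge0//.
by rewrite -mulrA ler_wpM2l// pow_exp_bound.
Qed.

Lemma der0_sq f (C : R) : f 0 = 0 -> (forall h, `|f h| <= C * h ^+ 2) -> is_derive (0 : R) (1 : R) f 0.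
Proof.
move=> f0 hf.
have cv : h^-1 *: (f (h *: (1 : R) + 0) - f 0) @[h --> 0^'] --> (0 : R).
  have c0 : C * `|h| @[h --> (0:R)^'] --> (0 : R).
    have ct : continuous (fun h : R => C * `|h|) by cont.
    have := ct 0; rewrite /continuous_at (@normr0 R R) mulr0 => h; exact: cvg_within_filter h.
  apply: (squeeze_cvgr _ _ c0); last by rewrite -[X in _ --> X]oppr0; exact: cvgN c0.
  apply: nearW => h; rewrite -ler_norml f0 subr0 addr0 /GRing.scale /= mulr1 normrM normfV.
  have [->|h0] := eqVneq h 0; first by rewrite !normr0 invr0 mul0r mulr0.
  rewrite mulrC ler_pdivrMr ?normr_gt0//.
  by apply: (le_trans (hf h)); rewrite -mulrA -expr2 real_normK ?num_real.
split; first by apply/cvg_ex; exists 0.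
exact: cvg_lim cv.
Qed.

Let flatp_sq (p : {poly R}) : exists C : R, forall h, `|flatp p h| <= C * h ^+ 2.
Proof.
have [C [C0 hC]] := poly_exp_bound ('X^2 * p)%R.
exists C => h; rewrite /flatp; case: ifPn => h0; last by rewrite normr0 mulr_ge0// sqr_ge0.
have hi : 0 <= h^-1 by rewrite invr_ge0 ltW.
have := hC _ hi; rewrite hornerM hornerXn normrM (ger0_norm (exprn_ge0 _ hi)) exprVn.
rewrite normrM (ger0_norm (expR_ge0 _)) expRN => hh.
rewrite ler_pdivrMr ?expR_gt0// -mulrA [h ^+ 2 * _]mulrC mulrA -ler_pdivrMr ?exprn_gt0//.
by rewrite mulrC.
Qed.

Let der_flatp (p : {poly R}) (x : R) : is_derive x (1 : R) (flatp p) (flatp ('X^2 * (p - p^`())) x).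
Proof.
case: (ltgtP (0 : R) x) => [x0|x0|<-].
- have d : is_derive x (1 : R) (fun t => p.[t^-1] * expR (- t^-1)) (flatp ('X^2 * (p - p^`())) x).
    have xn : x != 0 by rewrite gt_eqF.
    have di : is_derive x (1 : R) (fun t : R => t^-1) (- (x ^- 2)).
      split; first by apply: derivableV => //; exact: derivable_id.
      by rewrite deriveV// derive_val /GRing.scale /= mulr1.
    by apply: der_eq; rewrite /flatp x0 !hornerE /GRing.scale /=; field.
  apply: near_eq_is_derive d; near=> t; rewrite /flatp ifT//.
  by near: t; exact: lt_nbhsr.
- have d : is_derive x (1 : R) (fun _ : R => 0 : R) (flatp ('X^2 * (p - p^`())) x).
    by rewrite /flatp ltNge (ltW x0) /=; exact: dercst.
  apply: near_eq_is_derive d; near=> t; rewrite /flatp ifF//.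
  by apply/negbTE; rewrite -leNgt ltW//; near: t; exact: lt_nbhsl.
- have [C hC] := flatp_sq p.
  by rewrite {2}/flatp ltxx; apply: (der0_sq (C := C)) => //; rewrite /flatp ltxx.
Unshelve. all: by end_near. Qed.

Lemma smooth1_flat : smooth1 (@flat R).
Proof.
exists (range flatp); split.
  by exists 1 => //; apply/funext => x; rewrite /flatp /flat hornerC mul1r.
by move=> _ [p _ <-]; exists (flatp ('X^2 * (p - p^`()))); split => // x; exact: der_flatp.
Qed.

Lemma flat_ge0 (x : R) : 0 <= flat x.
Proof. by rewrite /flat; case: ifP => // _; exact: expR_ge0. Qed.
Lemma flat_gt0 (x : R) : 0 < x -> 0 < flat x.
Proof. by rewrite /flat => ->; exact: expR_gt0. Qed.
Lemma flat_eq0 (x : R) : x <= 0 -> flat x = 0.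
Proof. by rewrite leNgt /flat => /negbTE ->. Qed.

Definition csupp f := exists N : R, forall x, N <= `|x| -> f x = 0.

Lemma csupp_der f f' : (forall x : R, is_derive x (1 : R) f (f' x)) -> csupp f -> csupp f'.
Proof.
move=> d [N hN]; exists (N + 1) => x Nx.
have d0 : is_derive x (1 : R) f 0.
  apply: near_eq_is_derive (@dercst R 0 x).
  near=> t; rewrite hN//.
  have tx : `|x - t| < 1 by near: t; exact: cvgr_dist_lt.
  have := ler_normD (x - t) t; rewrite subrK; lra.
by have [_ <-] := d x; have [_ <-] := d0.
Unshelve. all: by end_near. Qed.

Definition step (x : R) : R := flat (1 + x) / (flat (1 + x) + flat (1 - x)).

Lemma step_den (x : R) : 0 < flat (1 + x) + flat (1 - x).
Proof.
have [h|h] := ltP 0 (1 + x); first by rewrite ltr_pwDl ?flat_gt0 ?flat_ge0.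
by rewrite ltr_wpDl ?flat_ge0// flat_gt0//; lra.
Qed.

Lemma step0 (x : R) : x <= -1 -> step x = 0.
Proof. by move=> h; rewrite /step flat_eq0 ?mul0r//; lra. Qed.
Lemma step1 (x : R) : 1 <= x -> step x = 1.
Proof.
move=> h; rewrite /step (@flat_eq0 (1 - x)); last by lra.
by rewrite addr0 divff// gt_eqF// flat_gt0//; lra.
Qed.

Let smooth1_flat_affine (a b : R) : smooth1 (fun x => flat (a * x + b)).
Proof. exact: (smooth1_affine a b smooth1_flat). Qed.

Lemma smooth1_step : smooth1 step.
Proof.
have e1 : (fun x : R => flat (1 + x)) = (fun x => flat (1 * x + 1)).
  by apply/funext => x; rewrite mul1r addrC.
have e2 : (fun x : R => flat (1 - x)) = (fun x => flat (-1 * x + 1)).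
  by apply/funext => x; rewrite mulN1r addrC.
have s1 : smooth1 (fun x : R => flat (1 + x)) by rewrite e1.
have s2 : smooth1 (fun x : R => flat (1 - x)) by rewrite e2.
apply: smooth1M => //; apply: (smooth1V (smooth1D s1 s2)) => x.
by rewrite gt_eqF// step_den.
Qed.

(* A smooth approximation of the indicator of [[a, b]], with transition layers of half-width [e]. *)
Definition plateau (e a b x : R) : R := step (e^-1 * (x - a)) - step (e^-1 * (x - b)).

Lemma smooth1_plateau e a b : smooth1 (plateau e a b).
Proof.
have aff (d : R) : smooth1 (fun x => step (e^-1 * (x - d))).
  have -> : (fun x => step (e^-1 * (x - d))) = (fun x => step (e^-1 * x + - (e^-1 * d))).
    by apply/funext => x; rewrite mulrBr.
  exact: (smooth1_affine _ _ smooth1_step).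
apply: smooth1D (aff a) _.
have -> : (fun x => - step (e^-1 * (x - b))) = (fun x => -1 * step (e^-1 * (x - b))).
  by apply/funext => x; rewrite mulN1r.
by apply: smooth1M (aff b); exact: smooth1_cst.
Qed.

Let step_scale1 (e u : R) : 0 < e -> e <= u -> step (e^-1 * u) = 1.
Proof.
move=> e0 h; rewrite step1// -(@mulVf _ e) ?gt_eqF//.
by rewrite ler_wpM2l// invr_ge0 ltW.
Qed.

Let step_scale0 (e u : R) : 0 < e -> u <= - e -> step (e^-1 * u) = 0.
Proof.
move=> e0 h; rewrite step0// -(@mulVf _ e) ?gt_eqF// -mulrN.
by rewrite ler_wpM2l// invr_ge0 ltW.
Qed.

Lemma plateau_out (e a b x : R) : 0 < e -> a <= b -> x <= a - e \/ b + e <= x -> plateau e a b x = 0.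
Proof.
move=> e0 ab h; rewrite /plateau; case: h => h.
  by rewrite !step_scale0 ?subrr//; lra.
by rewrite !step_scale1 ?subrr//; lra.
Qed.

Lemma plateau_in (e a b x : R) : 0 < e -> a + e <= x -> x <= b - e -> plateau e a b x = 1.
Proof. by move=> e0 h h'; rewrite /plateau step_scale1 ?step_scale0 ?subr0//; lra. Qed.

Definition bump (e x : R) : R := flat (e^-1 * x + 1) * flat (- e^-1 * x + 1).

Lemma smooth1_bump e : smooth1 (bump e).
Proof. by apply: smooth1M; exact: smooth1_flat_affine. Qed.

Lemma bump_ge0 e x : 0 <= bump e x.
Proof. by rewrite mulr_ge0// flat_ge0. Qed.

Lemma bump_out (e x : R) : 0 < e -> e <= `|x| -> bump e x = 0.
Proof.
move=> e0; have ei : 0 < e^-1 by rewrite invr_gt0.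
have ee : e^-1 * e = 1 by rewrite mulVf// gt_eqF.
rewrite /bump; have [x0|x0] := leP 0 x => h.
- rewrite (@flat_eq0 (- e^-1 * x + 1)) ?mulr0// mulNr.
  have : e^-1 * e <= e^-1 * x by rewrite ler_wpM2l ?(ltW ei)//; rewrite ger0_norm in h.
  by rewrite ee; lra.
- rewrite flat_eq0 ?mul0r//.
  have : e^-1 * e <= e^-1 * - x by rewrite ler_wpM2l ?(ltW ei)//; rewrite ltr0_norm in h.
  by rewrite ee mulrN; lra.
Qed.

Lemma bump_csupp e : 0 < e -> csupp (bump e).
Proof. by move=> e0; exists e => x; exact: bump_out. Qed.

End smooth_functions.

(** * Fourier transforms of compactly supported functions of one variable *)

Section compactly_supported.
Variable R : realType.
Notation mu := (leb1 R).
Implicit Types (f g : R -> R) (x e xi : R).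
Local Notation C_ f := (fun x : R1 R => (f x)%:C%C).

Lemma csupp_bounded f : continuous f -> csupp f -> exists (B : R) (N : nat), 0 <= B /\
  forall x, `|f x| <= B /\ (N%:R <= `|x| -> f x = 0).
Proof.
move=> cf [M hM]; pose N := Num.bound `|M|.
have MN : M <= N%:R by apply: (le_trans (ler_norm M)); apply/ltW/archi_boundP.
have N0 : - N%:R <= N%:R :> R by rewrite -subr_ge0 opprK addr_ge0// ler0n.
have [c _ hc] := EVT_max N0 (continuous_subspaceT (contabs cf)).
exists `|f c|, N; split => // x; split; last by move=> h; apply: hM; exact: le_trans h.
have [h|h] := leP `|x| N%:R; first by apply: hc; rewrite in_itv /= -ler_norml.
by rewrite hM ?normr0//; apply: (le_trans MN); exact: ltW.
Qed.

Lemma csuppM f g : csupp f -> csupp (fun x => f x * g x).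
Proof. by move=> [N hN]; exists N => x /hN ->; rewrite mul0r. Qed.

Lemma csupp_integrable f : continuous f -> csupp f -> mu.-integrable setT (EFin \o (f : R1 R -> R)).
Proof.
move=> cf sf; have [B [N [B0 hB]]] := csupp_bounded cf sf.
have mf : measurable_fun setT (EFin \o (f : R1 R -> R)) by apply/measurable_EFinP; apply: contmeas; exact: cf.
refine (le_integrable measurableT mf _ (itv_indic_integrable N B)).
move=> x _ /=; rewrite lee_fin indic_norm_itv normrM (ger0_norm B0) normr_nat.
have [hx h0] := hB x; have [h|h] := leP `|x| N%:R; first by rewrite mulr1.
by rewrite h0 ?normr0 ?mulr0// ltW.
Qed.

Lemma csupp_L12 f : continuous f -> csupp f -> cintegrable mu (C_ f) /\ L2 mu (C_ f).
Proof.
move=> cf sf.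
have L1 g : continuous g -> csupp g -> cintegrable mu (C_ g).
  move=> cg sg; split; first exact: csupp_integrable.
  exact: integrable0.
split; first exact: L1.
split; first by apply: cmeas_real; exact: contmeas.
have := cintegrable_l1 (L1 _ (contM cf cf) (csuppM f sf)).
rewrite /l1 /sq; congr (_ < _)%E; apply: eq_integral => x _.
by rewrite abs1_real abs2_real expr2 ger0_norm// -expr2 sqr_ge0.
Qed.

Lemma int_der f f' (a b : R) : a < b -> (forall x : R, is_derive x (1 : R) f (f' x)) -> continuous f' ->
  (forall x, x \notin `[a, b] -> f' x = 0) -> \int[mu]_x f' x = f b - f a.
Proof.
move=> ab d cf' f'0.
have cf : continuous f by move=> x; exact: der_cont (d x).
have -> : \int[mu]_x f' x = \int[mu]_(x in `[a, b]) f' x.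
  rewrite [RHS]Rintegral_mkcond; congr Rintegral; apply/funext => x; rewrite patchE.
  by case: ifPn => //; rewrite notin_setE /= => /negP; exact: f'0.
rewrite /Rintegral (continuous_FTC2 ab (continuous_subspaceT cf') (F := f))//.
- split; first by move=> x _; exact: der_derivable (d x).
  + by apply: cvg_at_right_filter; exact: cf.
  + by apply: cvg_at_left_filter; exact: cf.
- by move=> x _; rewrite /= (der_derive1 (d x)).
Qed.

Lemma csupp_int_der f f' : (forall x : R, is_derive x (1 : R) f (f' x)) -> continuous f' ->
  csupp f -> \int[mu]_x f' x = 0.
Proof.
move=> d cf' sf; have [N1 h1] := sf; have [N2 h2] := csupp_der d sf.
pose N : R := Num.max 1 (Num.max N1 N2).
have N0 : 0 < N by rewrite lt_max ltr01.
have NN : - N < N by rewrite -subr_gt0 opprK addr_gt0.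
have N1N : N1 <= N by rewrite !le_max lexx !orbT.
have N2N : N2 <= N by rewrite !le_max lexx !orbT.
rewrite (int_der NN d cf') => [|x].
  by rewrite !h1 ?subrr// ?normrN gtr0_norm.
by rewrite in_itv /= -ler_norml -ltNge => /ltW h; apply: h2; exact: le_trans h.
Qed.

Lemma fourier_der f f' xi : (forall x : R, is_derive x (1 : R) f (f' x)) -> continuous f' -> csupp f ->
  fourier mu (@dot1 R) (C_ f') xi = (0 +i* xi)%C * fourier mu (@dot1 R) (C_ f) xi.
Proof.
move=> d cf' sf; have sf' := csupp_der d sf.
have cf : continuous f by move=> x; exact: der_cont (d x).
pose c x : R := cos (- (x * xi)); pose s x : R := sin (- (x * xi)).
have cc : continuous c by rewrite /c; cont.
have cs : continuous s by rewrite /s; cont.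
have da x : is_derive x (1 : R) (fun x : R => - (x * xi)) (- xi).
  by apply: der_eq (derN (derM (derid x) (dercst xi x))) _; rewrite mul1r mulr0 addr0.
have dc x : is_derive x (1 : R) c (s x * xi).
  by apply: der_eq (dercomp (f := cos) (da x) _) _; rewrite mulrNN.
have ds x : is_derive x (1 : R) s (- (c x * xi)).
  by apply: der_eq (dercomp (f := sin) (da x) _) _; rewrite mulrN.
have int g h : continuous g -> continuous h -> csupp g -> mu.-integrable setT (EFin \o (fun x : R1 R => g x * h x)).
  by move=> cg ch sg; apply: csupp_integrable (contM cg ch) (csuppM h sg).
have I1 : \int[mu]_x (f' x * c x) = - (\int[mu]_x (f x * s x) * xi).
  have := csupp_int_der (fun x => derM (d x) (dc x)) _ (csuppM c sf).
  under eq_Rintegral do rewrite mulrA.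
  rewrite RintegralD ?RintegralZr//; try exact: int.
  - by move=> h; apply/eqP; rewrite -addr_eq0 h//; cont.
  - under eq_fun do rewrite -mulrA; apply: (int f (fun x => s x * xi)) => //; cont.
have I2 : \int[mu]_x (f' x * s x) = \int[mu]_x (f x * c x) * xi.
  have := csupp_int_der (fun x => derM (d x) (ds x)) _ (csuppM s sf).
  under eq_Rintegral do rewrite mulrN mulrA.
  rewrite RintegralB ?RintegralZr//; try exact: int.
  - by move=> h; apply/eqP; rewrite -subr_eq0 h//; cont.
  - under eq_fun do rewrite -mulrA; apply: (int f (fun x => c x * xi)) => //; cont.
have E g : fourier mu (@dot1 R) (C_ g) xi = ((\int[mu]_x (g x * c x)) +i* (\int[mu]_x (g x * s x)))%C.
  rewrite /fourier /cint /cintegral /dot1 /cis; congr (_ +i* _)%C; apply: eq_Rintegral => x _;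
  by rewrite !cE ?mul0r ?subr0 ?addr0.
rewrite !E I1 I2; apply: complex_ext; rewrite !cE ?mul0r ?add0r ?addr0 ?sub0r ?(mulrC xi)//.
Qed.

Lemma sin_le_abs x : `|sin x| <= `|x|.
Proof.
suff h (y : R) : 0 <= y -> `|sin y| <= y.
  have [x0|x0] := leP 0 x; first by rewrite (ger0_norm x0) h.
  by rewrite -normrN -sinN (ltr0_norm x0) h// oppr_ge0 ltW.
rewrite le_eqVlt => /orP[/eqP <-|y0]; first by rewrite sin0 normr0.
have [t _] := MVT y0 (fun t _ => is_derive_sin t) (continuous_subspaceT (@continuous_sin R)).
rewrite sin0 !subr0 => ->; rewrite normrM (gtr0_norm y0).
by rewrite ler_piMl ?(ltW y0)// cos_max.
Qed.

Lemma cos_ge_half x : `|x| <= 1 -> 2^-1 <= cos x.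
Proof.
move=> h; have -> : x = (x / 2) *+ 2 by rewrite -mulr_natr; field.
rewrite cos_mulr2n; have := cos2Dsin2 (x / 2).
have : sin (x / 2) ^+ 2 <= 4^-1.
  have := sin_le_abs (x / 2); rewrite normrM (@ger0_norm _ 2^-1) ?invr_ge0// => h1.
  have h2 : `|sin (x / 2)| <= 2^-1 by lra.
  have : `|sin (x / 2)| ^+ 2 <= (2^-1) ^+ 2 by rewrite lerXn2r ?nnegrE ?invr_ge0.
  by rewrite real_normK ?num_real//; lra.
rewrite -[_ *+ 2]mulr_natl; lra.
Qed.

Lemma flat_ge (x : R) : 2^-1 <= x -> expR (- 2) <= flat x.
Proof.
move=> h; have x0 : 0 < x by lra.
rewrite /flat x0 ler_expR lerN2 -[leRHS]invrK lef_pV2// posrE//.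
Qed.

(** On the support of the bump [|x xi| <= 1], so the cosine is at least one half; on the middle
    interval of length [e] each factor of the bump is at least [exp(-2)]. Such a lower bound makes
    it possible to divide by the transform on a ball of frequencies. *)
Lemma fourier_bump_ge e xi : 0 < e -> `|xi| * e <= 1 ->
  expR (- 2) ^+ 2 * (e / 2) <= cRe (fourier mu (@dot1 R) (C_ (bump e)) xi).
Proof.
move=> e0 hxi; rewrite /fourier Re_cint.
have -> : \int[mu]_x cRe ((bump e x)%:C%C * cis (- dot1 x xi)) = \int[mu]_x (bump e x * cos (x * xi)).
  by apply: eq_Rintegral => x _; rewrite /dot1 /cis !cE mul0r subr0 cosN.
have -> : expR (- 2) ^+ 2 * (e / 2) =
    \int[mu]_x (expR (- 2) ^+ 2 / 2 * \1_(`[- (e / 2), e / 2]%classic : set (R1 R)) x).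
  have -> : (fun x => expR (- 2) ^+ 2 / 2 * \1_`[- (e / 2), e / 2]%classic x) =
     (cst (expR (- 2) ^+ 2 / 2)) \_ `[- (e / 2), e / 2] :> (R1 R -> R).
    by apply/funext => x; rewrite patchE indicE /=; case: (_ \in _); rewrite ?mulr1 ?mulr0.
  rewrite -Rintegral_mkcond Rintegral_cst//= lebesgue_measure_itv /= lte_fin ifT; last by lra.
  by rewrite /=; field.
have cb : continuous (bump e) := smooth1_cont (smooth1_bump e).
apply: le_Rintegral => //.
- have ii := @integrable_indic_itv R (- (e / 2)) (e / 2) true false.
  have := @integrableZl _ _ _ _ setT measurableT (expR (- 2) ^+ 2 / 2) _ ii.
  exact.
- by apply: csupp_integrable; [cont|exact: csuppM (bump_csupp e0)].
have c2 x : `|x| <= e -> 2^-1 <= cos (x * xi).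
  move=> h; apply: cos_ge_half; rewrite normrM mulrC; apply: le_trans hxi.
  by rewrite ler_wpM2l.
move=> x _; rewrite indicE; case: (boolP (_ \in _)); rewrite ?inE ?notin_setE /= in_itv /= -ler_norml => h.
  have ei : 0 < e^-1 by rewrite invr_gt0.
  have h1 : `|e^-1 * x| <= 2^-1.
    rewrite normrM (gtr0_norm ei) mulrC ler_pdivrMr//; lra.
  move: h1; rewrite ler_norml => /andP[h1 h2].
  have b1 : expR (- 2) <= flat (e^-1 * x + 1) by apply: flat_ge; lra.
  have b2 : expR (- 2) <= flat (- e^-1 * x + 1) by apply: flat_ge; rewrite mulNr; lra.
  rewrite mulr1; apply: ler_pM; rewrite ?mulr_ge0 ?expR_ge0//.
    by rewrite expr2 /bump ler_pM// expR_ge0.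
  by apply: c2; lra.
rewrite mulr0; have [h'|/ltW h'] := leP e `|x|; first by rewrite bump_out ?mul0r.
by rewrite mulr_ge0 ?bump_ge0//; apply: le_trans (c2 _ h').
Qed.

End compactly_supported.

(** * Tensor products as test functions *)

Section tensors.
Variable R : realType.
Implicit Types (f g h : R -> R).
Local Notation C_ f := (fun x => (f x)%:C%C).

Definition tens3 f g h (x : R3 R) : R := f x.1.1 * g x.1.2 * h x.2.

Lemma shift3_mp (y : R3 R) : measure_preserving (leb3 R) (fun x => x + y).
Proof.
exact: (mp_prod (mp_prod (mp_shift y.1.1) (mp_shift y.1.2)) (mp_shift y.2)).
Qed.

Lemma tens3_L12 f g h : continuous f -> continuous g -> continuous h -> csupp f -> csupp g -> csupp h ->
  cintegrable (leb3 R) (C_ (tens3 f g h)) /\ L2 (leb3 R) (C_ (tens3 f g h)).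
Proof.
move=> cf cg ch sf sg sh.
have [f1 f2] := csupp_L12 cf sf; have [g1 g2] := csupp_L12 cg sg; have [h1 h2] := csupp_L12 ch sh.
have -> : C_ (tens3 f g h) = fun x : R3 R => ((f x.1.1)%:C%C * (g x.1.2)%:C%C) * (h x.2)%:C%C.
  by apply/funext => x; rewrite /tens3 !rmorphM.
split.
  exact: (cintegrable_tensor (cintegrable_tensor f1 g1) h1).
exact: (L2_tensor (L2_tensor f2 g2) h2).
Qed.

Lemma fourier_tens3 f g h (xi : R3 R) : continuous f -> continuous g -> continuous h ->
  csupp f -> csupp g -> csupp h -> fourier (leb3 R) dot3 (C_ (tens3 f g h)) xi =
    fourier (leb1 R) (@dot1 R) (C_ f) xi.1.1 * fourier (leb1 R) (@dot1 R) (C_ g) xi.1.2 *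
    fourier (leb1 R) (@dot1 R) (C_ h) xi.2.
Proof.
move=> cf cg ch sf sg sh.
have P1 := plancherel1 R.
have I k (z : R1 R) : continuous k -> csupp k -> cintegrable (leb1 R) (fun x => (k x)%:C%C * cis (- dot1 x z)).
  by move=> ck sk; apply: (cintegrable_cis P1); exact: (csupp_L12 ck sk).1.
rewrite /fourier -(cint_tensor (I _ _ cf sf) (I _ _ cg sg)).
rewrite -(cint_tensor (cintegrable_tensor (I _ _ cf sf) (I _ _ cg sg)) (I _ _ ch sh)).
congr cint; apply/funext => x /=; rewrite /tens3 /dot3 /dot2 /dot1 !opprD !cisD !rmorphM /=; ring.
Qed.

Lemma fourier_shift3 (u : R3 R -> R[i]) (y xi : R3 R) : cintegrable (leb3 R) u ->
  fourier (leb3 R) dot3 (fun x => u (x - y)) xi = cis (- dot3 y xi) * fourier (leb3 R) dot3 u xi.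
Proof.
move=> iu; have P3 := plancherel3 R.
have iu' := cintegrable_cis P3 xi iu.
rewrite /fourier -(cintZ _ iu') -(mp_cint (shift3_mp (- y)) (cintegrableZ _ iu')).
congr cint; apply/funext => x /=; rewrite mulrCA -cisD.
congr (_ * cis _); rewrite /dot3 /dot2 /=; ring.
Qed.

End tensors.

Section test_functions.
Variable R : realType.
Implicit Types (f g h : R -> R).

(** A class of functions of four variables stable under every directional derivative, so that all
    iterated derivatives exist by induction on the list of directions. *)
Inductive tensor_span : (R4 R -> R) -> Prop :=
| span_tens f (g h k : R -> R) : smooth1 f -> smooth1 g -> smooth1 h -> smooth1 k ->
    tensor_span (fun p => f p.1 * tens3 g h k p.2)
| span_add u v : tensor_span u -> tensor_span v -> tensor_span (fun p => u p + v p)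
| span_scale (a : R) u : tensor_span u -> tensor_span (fun p => a * u p).

Lemma derive_line (V : normedModType R) (u : V -> R) (v x : V) (d : R) :
  is_derive (0 : R) (1 : R) (fun t : R => u (t *: v + x)) d -> 'D_v u x = d.
Proof.
move=> [_ <-]; rewrite /derive.
suff -> : (fun h : R => h^-1 *: ((u \o shift x) (h *: v) - u x)) = (fun h : R => h^-1 *:
    (((fun t : R => u (t *: v + x)) \o shift 0) (h *: 1) - u (0 *: v + x))) by [].
apply/funext => t /=; rewrite scale0r add0r addr0; congr (_ *: (u (_ *: v + x) - u x)).
by rewrite /GRing.scale /= mulr1.
Qed.

Lemma derive_tensor f g h k f' g' h' k' :
  (forall x : R, is_derive x (1 : R) f (f' x)) -> (forall x : R, is_derive x (1 : R) g (g' x)) ->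
  (forall x : R, is_derive x (1 : R) h (h' x)) -> (forall x : R, is_derive x (1 : R) k (k' x)) ->
  forall v : R4 R, 'D_v (fun p : R4 R => f p.1 * tens3 g h k p.2) =
   (fun p => v.1 * (f' p.1 * tens3 g h k p.2) + (v.2.1.1 * (f p.1 * tens3 g' h k p.2) +
   (v.2.1.2 * (f p.1 * tens3 g h' k p.2) + v.2.2 * (f p.1 * tens3 g h k' p.2)))).
Proof.
move=> df dg dh dk v; apply/funext => p; apply: derive_line.
have aff (a b : R) : is_derive (0 : R) (1 : R) (fun t => t * a + b) a.
  by apply: der_eq (derD (derM (derid 0) (dercst a 0)) (dercst b 0)) _; rewrite mul1r mulr0 !addr0.
have comp (u u' : R -> R) (a b : R) : (forall x : R, is_derive x (1 : R) u (u' x)) ->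
    is_derive (0 : R) (1 : R) (fun t => u (t * a + b)) (u' b * a).
  move=> du; apply: dercomp (aff a b) _.
  by have := du b; rewrite -{1}[b]add0r -{1}(mul0r a).
apply: der_eq (derM (comp _ _ v.1 p.1 df) (derM (derM (comp _ _ v.2.1.1 p.2.1.1 dg)
  (comp _ _ v.2.1.2 p.2.1.2 dh)) (comp _ _ v.2.2 p.2.2 dk))) _.
by rewrite !mul0r !add0r /tens3; ring.
Qed.

Lemma differentiable_tensor f g h k (p : R4 R) : smooth1 f -> smooth1 g -> smooth1 h -> smooth1 k ->
  differentiable (fun p : R4 R => f p.1 * tens3 g h k p.2) p.
Proof.
have D1 (V : normedModType R) (l : V -> R) u x : smooth1 u -> differentiable l x ->
    differentiable (fun q => u (l q)) x.
  move=> /smooth1_der[u' [_ d]] dl.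
  apply: (@differentiable_comp _ _ _ _ l u) => //.
  by apply/derivable1_diffP; exact: der_derivable (d _).
have fstd (V W : normedModType R) (x : V * W) : differentiable (fun q : V * W => q.1) x.
  by apply: (@linear_differentiable _ _ _ (fst : {linear _ -> _})) => y; exact: cvg_fst.
have sndd (V W : normedModType R) (x : V * W) : differentiable (fun q : V * W => q.2) x.
  by apply: (@linear_differentiable _ _ _ (snd : {linear _ -> _})) => y; exact: cvg_snd.
move=> sf sg sh sk.
have d2 : differentiable (fun q : R4 R => q.2) p := sndd _ _ _.
have d21 : differentiable (fun q : R4 R => q.2.1) p by apply: (differentiable_comp d2); exact: fstd.
have d211 : differentiable (fun q : R4 R => q.2.1.1) p by apply: (differentiable_comp d21); exact: fstd.
have d212 : differentiable (fun q : R4 R => q.2.1.2) p by apply: (differentiable_comp d21); exact: sndd.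
have d22 : differentiable (fun q : R4 R => q.2.2) p by apply: (differentiable_comp d2); exact: sndd.
apply: differentiableM; first by apply: D1 => //; exact: fstd.
apply: differentiableM; last exact: D1.
by apply: differentiableM; exact: D1.
Qed.

Lemma tensor_span_differentiable u p : tensor_span u -> differentiable u p.
Proof.
elim=> [f g h k sf sg sh sk|v w _ dv _ dw|a v _ dv]; first exact: differentiable_tensor.
- exact: differentiableD.
- exact: (differentiableZ a dv).
Qed.

Lemma tensor_span_derive u v : tensor_span u -> tensor_span ('D_v u).
Proof.
elim=> [f g h k sf sg sh sk|u1 u2 s1 i1 s2 i2|a u1 s1 i1].
- have [f' [sf' df]] := smooth1_der sf; have [g' [sg' dg]] := smooth1_der sg.
  have [h' [sh' dh]] := smooth1_der sh; have [k' [sk' dk]] := smooth1_der sk.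
  rewrite (derive_tensor df dg dh dk).
  by do !apply: span_add; apply: span_scale; exact: span_tens.
- have -> : 'D_v (fun p => u1 p + u2 p) = (fun p => 'D_v u1 p + 'D_v u2 p).
    apply/funext => p; apply: deriveD; apply: diff_derivable; exact: tensor_span_differentiable.
  exact: span_add.
- have -> : 'D_v (fun p => a * u1 p) = (fun p => a * 'D_v u1 p).
    apply/funext => p; apply: (deriveZ a); apply: diff_derivable; exact: tensor_span_differentiable.
  exact: span_scale.
Qed.

Lemma tensor_span_smooth u : tensor_span u -> smooth u.
Proof.
move=> su vs x; apply: tensor_span_differentiable.
by elim: vs => //= v vs ih; exact: tensor_span_derive.
Qed.

Definition tens4 f g h k (p : R4 R) : R := f p.1 * tens3 g h k p.2.

Section second_derivatives.
Variables (f g h k f' g' h' k' f2 g2 h2 k2 : R -> R).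
Hypotheses (df : forall x : R, is_derive x (1 : R) f (f' x)) (dg : forall x : R, is_derive x (1 : R) g (g' x)).
Hypotheses (dh : forall x : R, is_derive x (1 : R) h (h' x)) (dk : forall x : R, is_derive x (1 : R) k (k' x)).

Lemma derive_tens4_0 : 'D_((1, 0) : R4 R) (tens4 f g h k) = tens4 f' g h k.
Proof.
apply: (eq_trans (derive_tensor df dg dh dk ((1, 0) : R4 R))).
by apply/funext => p; rewrite /tens4 /=; ring.
Qed.

Lemma derive_tens4_1 : 'D_((0, (1, 0, 0)) : R4 R) (tens4 f g h k) = tens4 f g' h k.
Proof.
apply: (eq_trans (derive_tensor df dg dh dk ((0, (1, 0, 0)) : R4 R))).
by apply/funext => p; rewrite /tens4 /=; ring.
Qed.

Lemma derive_tens4_2 : 'D_((0, (0, 1, 0)) : R4 R) (tens4 f g h k) = tens4 f g h' k.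
Proof.
apply: (eq_trans (derive_tensor df dg dh dk ((0, (0, 1, 0)) : R4 R))).
by apply/funext => p; rewrite /tens4 /=; ring.
Qed.

Lemma derive_tens4_3 : 'D_((0, (0, 0, 1)) : R4 R) (tens4 f g h k) = tens4 f g h k'.
Proof.
apply: (eq_trans (derive_tensor df dg dh dk ((0, (0, 0, 1)) : R4 R))).
by apply/funext => p; rewrite /tens4 /=; ring.
Qed.

End second_derivatives.

Let sum_basis3 (F : R3 R -> R) :
  \sum_(e <- basis3) F e = F (1, 0, 0) + (F (0, 1, 0) + F (0, 0, 1)).
Proof. by rewrite /basis3 !big_cons big_nil addr0. Qed.

Let wave_opE (c : R) (u : R4 R -> R) (p : R4 R) : wave_op c u p = 'D_((1, 0) : R4 R) ('D_((1, 0) : R4 R) u) p -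
  c ^+ 2 * ('D_((0, (1, 0, 0)) : R4 R) ('D_((0, (1, 0, 0)) : R4 R) u) p +
   ('D_((0, (0, 1, 0)) : R4 R) ('D_((0, (0, 1, 0)) : R4 R) u) p +
    'D_((0, (0, 0, 1)) : R4 R) ('D_((0, (0, 0, 1)) : R4 R) u) p)).
Proof. by congr (_ - _ * _); exact: sum_basis3. Qed.

Lemma wave_op_tens4 (c : R) f g h k f' g' h' k' f2 g2 h2 k2 :
  (forall x : R, is_derive x (1 : R) f (f' x)) -> (forall x : R, is_derive x (1 : R) g (g' x)) ->
  (forall x : R, is_derive x (1 : R) h (h' x)) -> (forall x : R, is_derive x (1 : R) k (k' x)) ->
  (forall x : R, is_derive x (1 : R) f' (f2 x)) -> (forall x : R, is_derive x (1 : R) g' (g2 x)) ->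
  (forall x : R, is_derive x (1 : R) h' (h2 x)) -> (forall x : R, is_derive x (1 : R) k' (k2 x)) ->
  forall p : R4 R, wave_op c (tens4 f g h k) p = tens4 f2 g h k p -
    c ^+ 2 * (tens4 f g2 h k p + (tens4 f g h2 k p + tens4 f g h k2 p)).
Proof.
move=> df dg dh dk df' dg' dh' dk' p.
rewrite wave_opE; congr (_ - _ * (_ + (_ + _))).
- apply: (eq_trans (congr1 (fun u : R4 R -> R => 'D_((1, 0) : R4 R) u p) (derive_tens4_0 df dg dh dk))).
  exact: (congr1 (fun u : R4 R -> R => u p) (derive_tens4_0 df' dg dh dk)).
- apply: (eq_trans (congr1 (fun u : R4 R -> R => 'D_((0, (1, 0, 0)) : R4 R) u p) (derive_tens4_1 df dg dh dk))).
  exact: (congr1 (fun u : R4 R -> R => u p) (derive_tens4_1 df dg' dh dk)).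
- apply: (eq_trans (congr1 (fun u : R4 R -> R => 'D_((0, (0, 1, 0)) : R4 R) u p) (derive_tens4_2 df dg dh dk))).
  exact: (congr1 (fun u : R4 R -> R => u p) (derive_tens4_2 df dg dh' dk)).
- apply: (eq_trans (congr1 (fun u : R4 R -> R => 'D_((0, (0, 0, 1)) : R4 R) u p) (derive_tens4_3 df dg dh dk))).
  exact: (congr1 (fun u : R4 R -> R => u p) (derive_tens4_3 df dg dh dk')).
Qed.

End test_functions.

(** * Linearity and isometry of the Fourier transform on L2 *)

Section fourier_isometry.
Context d (T : measurableType d) (R : realType).
Variables (mu : {sigma_finite_measure set T -> \bar R}) (dot : T -> T -> R) (C : R).
Hypothesis P : plancherel_space mu dot C.
Implicit Types u v w k : T -> R[i].
Local Notation F := (fourier mu dot).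
Let C0 : 0 < C := planch_gt0 P.

Lemma is_fourier_L2l u w : is_fourier mu dot u w -> L2 mu u.
Proof. by move=> [/in_L2E]. Qed.
Lemma is_fourier_L2r u w : is_fourier mu dot u w -> L2 mu w.
Proof. by move=> [_ /in_L2E]. Qed.

Lemma is_fourier_polar u w u' w' : is_fourier mu dot u w -> is_fourier mu dot u' w' ->
  ip mu w w' = C%:C%C * ip mu u u'.
Proof.
move=> h h'; have lu := is_fourier_L2l h; have lw := is_fourier_L2r h.
have lu' := is_fourier_L2l h'; have lw' := is_fourier_L2r h'.
have [_ _ hp] := is_fourier_pair P h.
apply/eqP; rewrite -subr_eq0 -abs2_eq0 -sqrf_eq0; apply/eqP.
suff -> : abs2 (ip mu w w' - C%:C%C * ip mu u u') = 0 by rewrite expr0n.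
suff e0 : abs1 (ip mu w w' - C%:C%C * ip mu u u') = 0.
  apply/eqP; rewrite eq_le abs2_ge0 andbT; apply: (le_trans (abs2_le_abs1 _)).
  by rewrite e0 expr0n.
have CA : 0 <= nsq mu w + C * nsq mu u by rewrite addr_ge0 ?mulr_ge0 ?nsq_ge0// ltW.
apply: (small0 (abs1_ge0 _) CA (B := 0)) => k e k0 e0; rewrite mulr0 addr0.
have e2 : 0 < e / 2 / C by rewrite !divr_gt0.
have [N [_ hN]] := trunc_cvg P lu' e2; have {}hN := hN N (lexx _).
set v := trunc dot N u' in hN *.
have lv : cintegrable mu v /\ L2 mu v := trunc_L12 P N lu'.
have lFv := F_L2 P lv.
have -> : ip mu w w' - C%:C%C * ip mu u u' =
    ip mu w (fun x => w' x - F v x) - C%:C%C * ip mu u (fun x => u' x - v x).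
  rewrite (ipBr lw' lFv lw) (ipBr lu' lv.2 lu) hp//; ring.
have h1 : nsq mu (fun x => w' x - F v x) <= e / 2.
  rewrite (pair_nsq_sub P N (is_fourier_pair P h')) (is_fourier_nsq P h') -mulrBr.
  rewrite -(nsq_sub_trunc P N lu') mulrC -ler_pdivlMr//; exact: ltW.
have b1 := ip_bound lw (L2B lw' lFv) k0; have b2 := ip_bound lu (L2B lu' lv.2) k0.
apply: (le_trans (abs1D _ _)); rewrite abs1N.
have b3 : abs1 (C%:C%C * ip mu u (fun x => u' x - v x)) <= C * abs1 (ip mu u (fun x => u' x - v x)).
  by apply: (le_trans (abs1M _ _)); rewrite abs1_real gtr0_norm.
have b4 : C * abs1 (ip mu u (fun x => u' x - v x)) <= k * (C * nsq mu u) + k^-1 * (e / 2).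
  have : C * abs1 (ip mu u (fun x => u' x - v x)) <= C * (k * nsq mu u + k^-1 * (e / 2 / C)).
    rewrite ler_wpM2l ?(ltW C0)//; apply: (le_trans b2); rewrite lerD2l ler_wpM2l ?invr_ge0 ?(ltW k0)//.
    exact: ltW.
  congr (_ <= _); field; by rewrite !gt_eqF.
have b5 : k^-1 * nsq mu (fun x => w' x - F v x) <= k^-1 * (e / 2) by rewrite ler_wpM2l ?invr_ge0 ?(ltW k0).
have -> : k^-1 * e = k^-1 * (e / 2) + k^-1 * (e / 2) by field; rewrite gt_eqF.
rewrite mulrDr; lra.
Qed.

Lemma is_fourierB u w u' w' : is_fourier mu dot u w -> is_fourier mu dot u' w' ->
  is_fourier mu dot (fun x => u x - u' x) (fun x => w x - w' x).
Proof.
move=> h h'; have lu := is_fourier_L2l h; have lw := is_fourier_L2r h.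
have lu' := is_fourier_L2l h'; have lw' := is_fourier_L2r h'.
apply: (pair_is_fourier P).
  split; [exact: L2B|exact: L2B|move=> k lk].
  have [_ _ hp] := is_fourier_pair P h; have [_ _ hp'] := is_fourier_pair P h'.
  by rewrite (ipBl lw lw' (F_L2 P lk)) (ipBl lu lu' lk.2) hp// hp'// mulrBr.
rewrite (nsqBip lw lw') (nsqBip lu lu') (is_fourier_nsq P h) (is_fourier_nsq P h').
by rewrite (is_fourier_polar h h') !cE mul0r subr0; ring.
Qed.

Lemma is_fourierZ z u w : is_fourier mu dot u w -> is_fourier mu dot (fun x => z * u x) (fun x => z * w x).
Proof.
move=> h; have lu := is_fourier_L2l h; have lw := is_fourier_L2r h.
apply: (pair_is_fourier P).
  split; [exact: L2Z|exact: L2Z|move=> k lk].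
  have [_ _ hp] := is_fourier_pair P h.
  by rewrite (ipZl _ lw (F_L2 P lk)) (ipZl _ lu lk.2) hp// mulrCA.
by rewrite (nsqZ _ lw) (nsqZ _ lu) (is_fourier_nsq P h) mulrCA.
Qed.

Lemma nsq_ae u v : cmeas u -> cmeas v -> {ae mu, forall x, u x = v x} -> nsq mu u = nsq mu v.
Proof. by move=> mu_ mv h; rewrite /nsq (sq_ae mu_ mv h). Qed.

Lemma ip_ae_l u u' k : L2 mu u -> L2 mu u' -> cmeas k -> {ae mu, forall x, u x = u' x} ->
  ip mu u k = ip mu u' k.
Proof.
move=> lu lu' mk h; apply: cint_ae.
- by apply: cmeasM (L2_meas lu) _; exact: cmeas_conj.
- by apply: cmeasM (L2_meas lu') _; exact: cmeas_conj.
- by apply: filterS h => x ->.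
Qed.

Lemma is_fourier_ae u u' w : cmeas u' -> {ae mu, forall x, u x = u' x} -> is_fourier mu dot u w ->
  is_fourier mu dot u' w.
Proof.
move=> mu' e h; have lu := is_fourier_L2l h; have lu' := L2_ae mu' e lu.
apply: (pair_is_fourier P).
  split => //; [exact: is_fourier_L2r h|move=> k lk].
  have [_ _ ->//] := is_fourier_pair P h.
  by rewrite (ip_ae_l lu lu' (L2_meas lk.2) e).
by rewrite (is_fourier_nsq P h) (nsq_ae (L2_meas lu) mu' e).
Qed.

Lemma is_fourier_ae_r u w w' : cmeas w' -> {ae mu, forall x, w x = w' x} -> is_fourier mu dot u w ->
  is_fourier mu dot u w'.
Proof.
move=> mw' e h; have lw := is_fourier_L2r h; have lw' := L2_ae mw' e lw.
apply: (pair_is_fourier P).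
  split => //; [exact: is_fourier_L2l h|move=> k lk].
  have [_ _ <-//] := is_fourier_pair P h.
  by rewrite (ip_ae_l lw lw' (L2_meas (F_L2 P lk)) e).
by rewrite -(is_fourier_nsq P h) (nsq_ae (L2_meas lw) mw' e).
Qed.

Lemma sobolev_weight_meas (sigma : R) : measurable_fun setT (fun xi => (1 + dot xi xi) `^ (sigma / 2)).
Proof.
apply: (@measurableT_comp _ _ _ _ _ _ (fun x : R => x `^ (sigma / 2)) _ (fun xi => 1 + dot xi xi)).
  exact: measurable_powR.
by apply: measurable_funD => //; exact: (dot_diag_meas P).
Qed.

Lemma sobolev_weight_ge1 (sigma : R) xi : 0 <= sigma -> 1 <= (1 + dot xi xi) `^ (sigma / 2).
Proof.
move=> s0; have d0 := dot_ge0 P xi.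
rewrite -[leLHS](powRr0 (1 + dot xi xi)); apply: ler_powR; last by rewrite divr_ge0.
by rewrite lerDl.
Qed.

Lemma sobolev_lt (sigma : R) u (k : R) : 0 <= sigma -> (sobolev_norm mu dot sigma u < k%:E)%E ->
  exists w, [/\ is_fourier mu dot u w, 0 < k &
    (sq mu (fun xi => ((1 + dot xi xi) `^ (sigma / 2))%:C%C * w xi)%R < (k ^+ 2)%:E)%E].
Proof.
move=> s0 /ereal_inf_lt[_ [w fw <-] wk]; exists w; split => //.
  by rewrite -lte_fin; apply: le_lt_trans wk; exact: L2norm_ge0.
have wf : (sq mu (fun xi => ((1 + dot xi xi) `^ (sigma / 2))%:C%C * w xi)%R < +oo)%E.
  by rewrite -L2norm_lty; apply: (lt_trans wk); rewrite ltry.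
move: wk; rewrite (L2norm_sqrt wf) lte_fin => wk.
rewrite -(@fineK _ (sq mu _)); last by rewrite ge0_fin_numE ?sq_ge0.
rewrite lte_fin -[fine _]sqr_sqrtr ?fine_ge0 ?sq_ge0//.
by rewrite ltrXn2r ?nnegrE ?sqrtr_ge0//; apply: le_trans (ltW wk); exact: sqrtr_ge0.
Qed.

Lemma sobolev_nsq (sigma : R) u (k : R) : 0 <= sigma -> (sobolev_norm mu dot sigma u < k%:E)%E ->
  L2 mu u /\ C * nsq mu u <= k ^+ 2.
Proof.
move=> s0 /(sobolev_lt s0)[w [fw k0 wk]]; have lw := is_fourier_L2r fw.
split; first exact: is_fourier_L2l fw.
rewrite -(is_fourier_nsq P fw) -lee_fin -(L2_fin lw); apply: le_trans (ltW wk).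
apply: ge0_le_integral => //.
- by move=> x _; rewrite lee_fin abs2_ge0.
- exact/measurable_EFinP/measurable_abs2/(L2_meas lw).
- apply/measurable_EFinP/measurable_abs2/cmeasM; last exact: (L2_meas lw).
  exact/cmeas_real/sobolev_weight_meas.
- move=> xi _; rewrite lee_fin abs2M abs2_real ler_peMl ?abs2_ge0//.
  by rewrite exprn_ege1// sobolev_weight_ge1.
Qed.

Lemma abs1_fourier u xi : cintegrable mu u -> abs1 (F u xi) <= 2 * fine (l1 mu u).
Proof.
move=> iu; have ic := cintegrable_cis P xi iu.
rewrite -lee_fin; apply: (le_trans (abs1_cint ic)).
have l0 v : (0 <= l1 mu v)%E by apply: integral_ge0 => x _; rewrite lee_fin abs1_ge0.
have lf : l1 mu u \is a fin_num by rewrite ge0_fin_numE//; exact: cintegrable_l1.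
rewrite EFinM fineK// /l1 -ge0_integralZl//.
- apply: ge0_le_integral => //.
  + by move=> x _; rewrite lee_fin abs1_ge0.
  + exact/measurable_EFinP/measurable_abs1/(cintegrable_meas ic).
  + apply/measurable_EFinP/measurable_funM => //; exact/measurable_abs1/(cintegrable_meas iu).
  + move=> x _; rewrite -EFinM lee_fin; apply: (le_trans (abs1M _ _)); rewrite mulrC.
    by rewrite ler_wpM2r ?abs1_ge0// abs1_cis.
- exact/measurable_EFinP/measurable_abs1/(cintegrable_meas iu).
- by move=> x _; rewrite lee_fin abs1_ge0.
Qed.

End fourier_isometry.

(** Carathéodory's criterion for differentiability, with the continuous slope function given
    explicitly. *)
Lemma der_quot (R : realType) (r g : R -> R) (t : R) : {for t, continuous g} ->
  (forall s, r s - r t = (s - t) * g s) -> is_derive t (1 : R) r (g t).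
Proof.
move=> cg hr.
have cv : h^-1 *: (r (h *: (1 : R) + t) - r t) @[h --> 0^'] --> g t.
  have c : continuous (fun h : R => h + t) by cont.
  have gc : g (h + t) @[h --> (0 : R)] --> g t.
    apply: (@cvg_comp _ _ _ (fun h : R => h + t) g _ (nbhs t)) => //.
    by have := c 0; rewrite /continuous_at add0r.
  have cw : g (h + t) @[h --> (0 : R)^'] --> g t by exact: cvg_within_filter gc.
  apply: cvg_trans cw; apply: near_eq_cvg; near=> h.
  have hn : h != 0 by near: h; exact: nbhs_dnbhs_neq.
  by rewrite /= hr /GRing.scale /= mulr1 addrK mulKf.
split; first by apply/cvg_ex; exists (g t).
exact: cvg_lim cv.
Unshelve. all: by end_near. Qed.

(** * Curves in L2 *)

Section L2_curves.
Context d (T : measurableType d) (R : realType) (mu : {measure set T -> \bar R}).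
Implicit Types (A B : R -> T -> R[i]) (u v : T -> R[i]) (t r e : R).

Definition rip u v : R := cRe (ip mu u v).

Lemma rip_bound u v (k : R) : L2 mu u -> L2 mu v -> 0 < k ->
  `|rip u v| <= k * nsq mu u + k^-1 * nsq mu v.
Proof.
by move=> lu lv k0; apply: le_trans (ip_bound lu lv k0); rewrite /abs1 lerDl.
Qed.

Lemma ripBl u v w : L2 mu u -> L2 mu v -> L2 mu w -> rip (fun x => u x - v x) w = rip u w - rip v w.
Proof. by move=> lu lv lw; rewrite /rip ipBl// !cE. Qed.
Lemma ripBr u v w : L2 mu u -> L2 mu v -> L2 mu w -> rip w (fun x => u x - v x) = rip w u - rip w v.
Proof. by move=> lu lv lw; rewrite /rip ipBr// !cE. Qed.
Lemma ripZr (a : R) u v : L2 mu u -> L2 mu v -> rip u (fun x => a%:C%C * v x) = a * rip u v.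
Proof. by move=> lu lv; rewrite /rip ipZr// conjc_real !cE mul0r subr0. Qed.
Definition L2cont_at A t := forall e, 0 < e -> exists d : R, 0 < d /\
  forall r, `|r - t| < d -> nsq mu (fun x => A r x - A t x) < e.

Lemma nsq_subxx u : nsq mu (fun x => u x - u x) = 0.
Proof.
rewrite /nsq /sq (_ : (fun x => _) = cst 0%E) ?integral0//.
by apply/funext => x; rewrite subrr abs20.
Qed.

Lemma L2cont_cst u t : L2 mu u -> L2cont_at (fun=> u) t.
Proof.
move=> lu e e0; exists 1; split => // r _.
by rewrite nsq_subxx.
Qed.

Lemma rip_cvg A B t : (forall s, L2 mu (A s)) -> (forall s, L2 mu (B s)) ->
  L2cont_at A t -> L2cont_at B t -> forall e, 0 < e -> exists d : R, 0 < d /\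
  forall r, `|r - t| < d -> `|rip (A r) (B r) - rip (A t) (B t)| < e.
Proof.
move=> lA lB cA cB e e0.
pose K := nsq mu (A t) + nsq mu (B t) + 1.
have K0 : 0 < K by rewrite ltr_wpDl// addr_ge0 ?nsq_ge0.
(* Then [k * K = e / 8]. The difference of the pairings expands into three pairings with the
   increments, each of which costs at most [e / 4] by [rip_bound], one half from each factor. *)
pose k := e / (8 * K).
have k0 : 0 < k by rewrite divr_gt0// mulr_gt0.
have ke : 0 < k * e / 8 by rewrite divr_gt0// mulr_gt0.
pose m := Num.min (k * e / 8) 1.
have m0 : 0 < m by rewrite lt_min ke ltr01.
have m1 : m <= k * e / 8 by rewrite ge_min lexx.
have m2 : m <= 1 by rewrite ge_min lexx orbT.
have [d1 [d10 h1]] := cA _ m0; have [d2 [d20 h2]] := cB _ m0.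
exists (Num.min d1 d2); split; first by rewrite lt_min d10.
move=> r; rewrite lt_min => /andP[/h1 {}h1 /h2 {}h2].
set a := (fun x => _) in h1; set b := (fun x => _) in h2.
have la : L2 mu a := L2B (lA r) (lA t); have lb : L2 mu b := L2B (lB r) (lB t).
have -> : rip (A r) (B r) - rip (A t) (B t) = rip a (B t) + rip (A t) b + rip a b.
  rewrite /a /b (ripBl (lA r) (lA t) lb) (ripBl (lA r) (lA t) (lB t)).
  by rewrite !(ripBr (lB r) (lB t))//; ring.
have k1 : 0 < k^-1 by rewrite invr_gt0.
have b1 := rip_bound la (lB t) k1; have b2 := rip_bound (lA t) lb k0.
have b3 := rip_bound la lb k1.
rewrite invrK in b1 b3.
have kk x : x < m -> k^-1 * x < e / 8.
  move=> xm; rewrite mulrC ltr_pdivrMr// [e / 8 * k]mulrAC [_ * k]mulrC; exact: lt_le_trans xm m1.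
have c1 := kk _ h1; have c2 := kk _ h2.
have c3 : k * nsq mu b <= k * K.
  rewrite ler_wpM2l ?(ltW k0)//; apply: (le_trans (ltW h2)); apply: (le_trans m2).
  by rewrite /K lerDr addr_ge0 ?nsq_ge0.
have n0 u := nsq_ge0 mu u.
have c4 : k * nsq mu (B t) <= k * K by rewrite ler_wpM2l ?(ltW k0)// /K; have := n0 (A t); lra.
have c5 : k * nsq mu (A t) <= k * K by rewrite ler_wpM2l ?(ltW k0)// /K; have := n0 (B t); lra.
have kK : k * K = e / 8 by rewrite /k; field; rewrite gt_eqF.
have := ler_normD (rip a (B t) + rip (A t) b) (rip a b); have := ler_normD (rip a (B t)) (rip (A t) b); lra.
Qed.

Lemma rip_continuous A B t : (forall s, L2 mu (A s)) -> (forall s, L2 mu (B s)) ->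
  L2cont_at A t -> L2cont_at B t -> {for t, continuous (fun s => rip (A s) (B s))}.
Proof.
move=> lA lB cA cB; apply/cvgrPdist_lt => e e0.
have [dl [d0 h]] := rip_cvg lA lB cA cB e0.
near=> r; rewrite distrC; apply: h; rewrite distrC; near: r; exact: cvgr_dist_lt.
Unshelve. all: by end_near. Qed.

(* [A] is only weakly differentiable here; strong continuity of [A] and strong differentiability of
   [B] make up for it. *)
Lemma rip_derive A B (B' : T -> R[i]) t (a : R) : (forall s, L2 mu (A s)) -> (forall s, L2 mu (B s)) ->
  L2 mu B' -> L2cont_at A t ->
  (forall e, 0 < e -> exists dl : R, 0 < dl /\ forall r, r != t -> `|r - t| < dl ->
     nsq mu (fun x => ((r - t)^-1)%:C%C * (B r x - B t x) - B' x) < e) ->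
  is_derive t (1 : R) (fun s => rip (A s) (B t)) a ->
  is_derive t (1 : R) (fun s => rip (A s) (B s)) (a + rip (A t) B').
Proof.
move=> lA lB lB' cA dB dA.
(* The difference quotient of [B], completed by [B'] at [t], is strongly continuous at [t]; its
   pairing with [A] is the slope function for [der_quot]. *)
pose D (r : R) (x : T) := if r == t then B' x else ((r - t)^-1)%:C%C * (B r x - B t x).
have lD r : L2 mu (D r) by rewrite /D; case: eqP => _ //; apply: L2Z; exact: L2B.
have cD : L2cont_at D t.
  move=> e e0; have [dl [dl0 h]] := dB e e0; exists dl; split => // r rt; rewrite /D eqxx.
  by case: eqP => [_|/eqP rn]; [rewrite nsq_subxx|exact: h].
have cr : {for t, continuous (fun s => rip (A s) (D s))} by exact: rip_continuous.
have dr : is_derive t (1 : R) (fun s => rip (A s) (B s) - rip (A s) (B t)) (rip (A t) B').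
  have -> : rip (A t) B' = rip (A t) (D t) by rewrite /D eqxx.
  apply: (der_quot (g := fun s => rip (A s) (D s))) => // s; rewrite subrr subr0 -(ripBr (lB s) (lB t) (lA s)).
  rewrite /D; case: eqP => [->|/eqP st].
    by rewrite subrr mul0r ripBr// subrr.
  by rewrite (ripZr _ (lA s) (L2B (lB s) (lB t))) mulVKf// subr_eq0.
have := derD dA dr; congr (is_derive _ _ _ _).
by apply/funext => s; rewrite addrC subrK.
Qed.

End L2_curves.

(** * The wave equation on the Fourier side *)

Section weak_derivative.
Variable R : realType.
Notation mu := (leb1 R).
Implicit Types (f g z n : R -> R) (x e a b : R).

Lemma csupp_primitive n : continuous n -> csupp n -> exists G : R -> R, forall x : R, is_derive x (1 : R) G (n x).
Proof.
move=> cn sn; exists (fun x => \int[mu]_(t in [set` `]-oo, x]]) n t) => x.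
have h := @continuous_FTC1 R n -oo%O x (x + 1).
have := h; rewrite ltrDl => /(_ ltr01).
have ii : mu.-integrable [set` `]-oo, (x + 1)]] (EFin \o n).
  by apply: (integrableS measurableT) => //; exact: csupp_integrable.
move=> /(_ ii) /= /(_ (ltNyr x) (cn x)) [dx e].
by rewrite derive1E in e; split; [exact: dx|exact: e].
Qed.

Lemma abs_int_le f (k a b : R) : a <= b -> 0 <= k -> continuous f -> (forall x, `|f x| <= k) ->
  (forall x, x \notin `[a, b] -> f x = 0) -> `|\int[mu]_x f x| <= k * (b - a).
Proof.
move=> ab k0 cf fk f0.
pose h (c : R) (x : R1 R) : R := c * \1_`[a, b]%classic x.
have ih c : mu.-integrable setT (EFin \o h c).
  have := @integrableZl _ _ _ _ setT measurableT c _ (@integrable_indic_itv R a b true false).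
  exact.
have Ih c : \int[mu]_x h c x = c * (b - a).
  have -> : h c = (cst c) \_ `[a, b] :> (R1 R -> R).
    by apply/funext => x; rewrite patchE /h indicE /=; case: (_ \in _); rewrite ?mulr1 ?mulr0.
  rewrite -Rintegral_mkcond Rintegral_cst//= lebesgue_measure_itv /= lte_fin.
  by case: ltgtP ab => // -> _; rewrite subrr mulr0.
have fi : mu.-integrable setT (EFin \o (f : R1 R -> R)).
  apply: csupp_integrable => //; exists (Num.max `|a| `|b| + 1) => x hx; apply: f0.
  rewrite in_itv /=; apply/negP => /andP[xa xb].
  have h1 : `|a| <= Num.max `|a| `|b| by rewrite le_max lexx.
  have h2 : `|b| <= Num.max `|a| `|b| by rewrite le_max lexx orbT.
  have h3 := ler_norm b; have h4 := ler_norm (- a); rewrite normrN in h4.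
  have : `|x| <= Num.max `|a| `|b| by rewrite ler_norml; lra.
  lra.
have hE c x : h c x = if x \in `[a, b] then c else 0.
  rewrite /h indicE (_ : (x \in `[a, b]%classic) = (x \in `[a, b])) ?mem_setE//.
  by case: ifP; rewrite ?mulr1 ?mulr0.
rewrite ler_norml -mulNr -!Ih; apply/andP; split; apply: le_Rintegral => // x _; rewrite hE.
- by case: ifPn => [_|/f0 ->//]; have := fk x; rewrite ler_norml => /andP[].
- by case: ifPn => [_|/f0 ->//]; have := fk x; rewrite ler_norml => /andP[].
Qed.

Lemma der_step0 x : 1 < `|x| -> is_derive x (1 : R) (@step R) 0.
Proof.
move=> h; have [x0|x0] := leP 0 x.
- rewrite ger0_norm// in h; apply: near_eq_is_derive (dercst 1 x); near=> t.
  by rewrite step1// ltW//; near: t; exact: lt_nbhsr.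
- rewrite ltr0_norm// in h; apply: near_eq_is_derive (dercst 0 x); near=> t.
  rewrite step0// ltW//; near: t; apply: lt_nbhsl; lra.
Unshelve. all: by end_near. Qed.

(* Du Bois-Reymond: the test functions are smooth plateaus over [[a, b]], whose derivatives tend to the
   difference of the Dirac masses at [a] and [b]. *)
Lemma du_bois_reymond (t0 t1 : R) (y : R -> R) : continuous y ->
  (forall f f' : R -> R, (forall x : R, is_derive x (1 : R) f (f' x)) -> smooth1 f -> smooth1 f' ->
    (exists a b, [/\ t0 < a, b < t1 & forall x, x \notin `[a, b] -> f x = 0]) ->
    \int[mu]_x (f' x * y x) = 0) ->
  forall a b, t0 < a -> a < b -> b < t1 -> y a = y b.
Proof.
move=> cy hy a b ta ab bt.
have [s' [ss' ds]] := smooth1_der (smooth1_step R).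
have cs' := smooth1_cont ss'.
have s'0 x : 1 < `|x| -> s' x = 0.
  move=> h; have dc := der_step0 h.
  by have [_ <-] := ds x; have [_ <-] := dc.
have [S S0 hS] : exists2 S : R, 0 < S & forall x, `|s' x| <= S.
  have sc : csupp s' by exists 2 => x h; apply: s'0; lra.
  have [B [N' [B0 hB]]] := csupp_bounded cs' sc.
  by exists (B + 1) => [|x]; [lra|have := (hB x).1; lra].
(* The derivative of one transition layer: a smooth kernel of mass 1 at [d] of width proportional to
   [e]. *)
pose kap e (d x : R) := e^-1 * s' (e^-1 * (x - d)).
have dk e d x : is_derive x (1 : R) (fun x => step (e^-1 * (x - d))) (kap e d x).
  have da : is_derive x (1 : R) (fun t => e^-1 * (t - d)) e^-1.
    by apply: der_eq (derZ e^-1 (derB (derid x) (dercst d x))) _; rewrite subr0 mulr1.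
  by apply: der_eq (dercomp da (ds _)) _; rewrite /kap mulrC.
have ck e d : continuous (kap e d).
  by rewrite /kap; apply: contM; [cont|apply: (contcomp (f := s')) => //; cont].
have kout e d x : 0 < e -> x \notin `[d - 2 * e, d + 2 * e] -> kap e d x = 0.
  move=> e0; rewrite in_itv /= => h; rewrite /kap s'0 ?mulr0// normrM gtr0_norm ?invr_gt0//.
  rewrite mulrC ltr_pdivlMr// mul1r ltNge; apply: contra h; rewrite ler_norml; lra.
have kint e d : 0 < e -> \int[mu]_x kap e d x = 1.
  move=> e0; have de : d - 2 * e < d + 2 * e by lra.
  rewrite (int_der de (dk e d) (ck e d)) => [|x hx]; last exact: kout.
  have -> : e^-1 * (d + 2 * e - d) = 2 by field; rewrite gt_eqF.
  have -> : e^-1 * (d - 2 * e - d) = - 2 by field; rewrite gt_eqF.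
  by rewrite step1 ?step0 ?subr0//; lra.
have kc e d : 0 < e -> csupp (kap e d).
  move=> e0; exists (`|d| + 2 * e + 1) => x hx; apply: kout => //; rewrite in_itv /=; apply/negP => /andP[h1 h2].
  have h3 := ler_norm d; have h4 := ler_norm (- d); rewrite normrN in h4.
  have : `|x| <= `|d| + 2 * e by rewrite ler_norml; lra.
  lra.
have appr d (dl : R) : 0 < dl -> exists e0 : R, 0 < e0 /\ forall e, 0 < e -> e < e0 ->
    `|\int[mu]_x (kap e d x * y x) - y d| <= dl.
  move=> dl0.
  have eta0 : 0 < dl / (4 * S) by rewrite divr_gt0// mulr_gt0.
  have := cy d => /cvgrPdist_lt /(_ _ eta0) /nbhs_ballP[r /= r0 hr].
  exists (r / 2); split; first by rewrite divr_gt0.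
  move=> e e0 er.
  have yd : \int[mu]_x (kap e d x * y d) = y d.
    by rewrite RintegralZr ?kint ?mul1r//; apply: csupp_integrable => //; exact: kc.
  rewrite -[X in _ - X]yd -RintegralB//; last 2 first.
  - by apply: csupp_integrable; [apply: contM|apply: csuppM; exact: kc].
  - by apply: csupp_integrable; [apply: contM => //; exact: contcst|apply: csuppM; exact: kc].
  have de : d - 2 * e <= d + 2 * e by lra.
  (* A bound [e^-1 * S] for the kernel, a bound [dl / (4 * S)] for the oscillation of [y] on its
     support, and the length [4 * e] of the interval. *)
  have -> : dl = e^-1 * S * (dl / (4 * S)) * (d + 2 * e - (d - 2 * e)) by field; rewrite !gt_eqF.
  have kp : 0 <= e^-1 * S * (dl / (4 * S)).
    by apply: mulr_ge0; [apply: mulr_ge0; rewrite ?invr_ge0 ltW|exact: ltW].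
  apply: abs_int_le => //.
  - by apply: contB; apply: contM => //; exact: contcst.
  - move=> x; rewrite -mulrBr normrM.
    have [/(kout _ _ _ e0) ->|] := boolP (x \notin `[d - 2 * e, d + 2 * e]).
      by rewrite normr0 mul0r.
    rewrite negbK in_itv /= => /andP[h1 h2].
    apply: ler_pM => //.
      rewrite /kap normrM gtr0_norm ?invr_gt0// ler_wpM2l ?invr_ge0 ?(ltW e0)//.
    rewrite distrC; apply/ltW/hr; rewrite /ball /= ltr_norml; lra.
  - by move=> x hx; rewrite kout// !mul0r subrr.
apply/eqP; rewrite -subr_eq0 -normr_le0; apply/ler_addgt0Pl => dl dl0; rewrite addr0.
have d2 : 0 < dl / 2 by rewrite divr_gt0.
have [ea [ea0 ha]] := appr a _ d2; have [eb [eb0 hb]] := appr b _ d2.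
pose e := Num.min (Num.min ea eb) (Num.min (a - t0) (t1 - b)) / 2.
have m0 : 0 < Num.min (Num.min ea eb) (Num.min (a - t0) (t1 - b)) by rewrite !lt_min ea0 eb0 !subr_gt0 ta.
have e0 : 0 < e by rewrite divr_gt0.
have [e1 e2 e3 e4] : [/\ e < ea, e < eb, t0 < a - e & b + e < t1].
  have h c : Num.min (Num.min ea eb) (Num.min (a - t0) (t1 - b)) <= c -> e < c by rewrite /e; lra.
  have h1 := h ea; have h2 := h eb; have h3 := h (a - t0); have h4 := h (t1 - b).
  by rewrite !ge_min !lexx ?orbT in h1 h2 h3 h4; split; [exact: h1|exact: h2|have := h3 isT|have := h4 isT]; lra.
have := hy (plateau e a b) (fun x => kap e a x - kap e b x).
have -> : \int[mu]_x ((kap e a x - kap e b x) * y x) =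
    \int[mu]_x (kap e a x * y x) - \int[mu]_x (kap e b x * y x).
  rewrite -RintegralB//; first by apply: eq_Rintegral => x _; rewrite mulrBl.
  - by apply: csupp_integrable; [apply: contM|apply: csuppM; exact: kc].
  - by apply: csupp_integrable; [apply: contM|apply: csuppM; exact: kc].
move=> h.
have {}h : \int[mu]_x (kap e a x * y x) - \int[mu]_x (kap e b x * y x) = 0.
  have d1 x : is_derive x (1 : R) (plateau e a b) (kap e a x - kap e b x) := derB (dk e a x) (dk e b x).
  apply: (h d1).
  - exact: smooth1_plateau.
  - have sk d : smooth1 (kap e d).
      apply: smooth1M; first exact: smooth1_cst.
      have -> : (fun x => s' (e^-1 * (x - d))) = (fun x => s' (e^-1 * x + - (e^-1 * d))).
        by apply/funext => x; rewrite mulrBr.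
      exact: smooth1_affine.
    apply: smooth1D => //.
    have -> : (fun x => - kap e b x) = (fun x => -1 * kap e b x) by apply/funext => x; rewrite mulN1r.
    by apply: smooth1M => //; exact: smooth1_cst.
  - exists (a - e), (b + e); split => // x; rewrite in_itv /= => hx.
    apply: plateau_out => //; first exact: ltW.
    have [h1|h1] := leP x (a - e); [by left|right].
    by rewrite leNgt; apply: contra hx => h2; rewrite !ltW.
have := ha e e0 e1; have := hb e e0 e2.
move: h; set Ia := \int[mu]_x _; set Ib := \int[mu]_x _ => h h1 h2.
have -> : y a - y b = (Ib - y b) - (Ia - y a) by rewrite (subr0_eq h); ring.
have := ler_normB (Ib - y b) (Ia - y a); lra.
Qed.

(** Adding [k] times a primitive of [n] to [z] gives a function of vanishing weak derivative, which
    is constant by [du_bois_reymond]. The plateau [chi] makes [n] compactly supported, so that a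
    primitive exists on the whole line, and is 1 on [[t0, t1]]. *)
Lemma weak_derivative (t0 t1 k : R) (z n : R -> R) : continuous z -> continuous n ->
  (forall f f' : R -> R, (forall x : R, is_derive x (1 : R) f (f' x)) -> smooth1 f -> smooth1 f' ->
    (exists a b, [/\ t0 < a, b < t1 & forall x, x \notin `[a, b] -> f x = 0]) ->
    \int[mu]_x (f' x * z x) = k * \int[mu]_x (f x * n x)) ->
  forall t, t0 < t < t1 -> is_derive t (1 : R) z (- k * n t).
Proof.
move=> cz cn hz t /andP[t0t tt1].
pose chi := plateau 1 (t0 - 1) (t1 + 1).
have cchi : continuous chi := smooth1_cont (smooth1_plateau 1 (t0 - 1) (t1 + 1)).
have chi1 x : t0 <= x -> x <= t1 -> chi x = 1.
  by move=> h1 h2; apply: plateau_in => //; lra.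
have schi : csupp (fun x => chi x * n x).
  apply: csuppM; exists (`|t0| + `|t1| + 3) => x hx.
  have h1 := ler_norm t1; have h2 := ler_norm (- t0); rewrite normrN in h2.
  have h3 := normr_ge0 t0; have h4 := normr_ge0 t1.
  apply: plateau_out => //; first lra.
  have [x0|x0] := leP 0 x; [rewrite (ger0_norm x0) in hx; right; lra|rewrite (ltr0_norm x0) in hx; left; lra].
have cchin : continuous (fun x => chi x * n x) by exact: contM.
have [G dG] := csupp_primitive cchin schi.
have cG : continuous G by move=> x; exact: der_cont (dG x).
pose y x := z x + k * G x.
have cy : continuous y by apply: contD => //; apply: contM => //; exact: contcst.
have yc a b : t0 < a -> a < b -> b < t1 -> y a = y b.
  apply: du_bois_reymond cy _ a b => f f' df sf sf' supp.
  have [a' [b' [ta' b't f0]]] := supp.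
  have cf := smooth1_cont sf; have cf' := smooth1_cont sf'.
  have scf : csupp f.
    exists (`|a'| + `|b'| + 1) => x hx; apply: f0; rewrite in_itv /=; apply/negP => /andP[h1 h2].
    have h3 := ler_norm b'; have h4 := ler_norm (- a'); rewrite normrN in h4.
    have h5 := normr_ge0 a'; have h6 := normr_ge0 b'.
    have : `|x| <= `|a'| + `|b'| by rewrite ler_norml; lra.
    lra.
  have sf'c := csupp_der df scf.
  have ci g : continuous g -> mu.-integrable setT (EFin \o (fun x : R1 R => f' x * g x)).
    by move=> cg; apply: csupp_integrable; [exact: contM|exact: csuppM].
  have ci' g : continuous g -> mu.-integrable setT (EFin \o (fun x : R1 R => f x * g x)).
    by move=> cg; apply: csupp_integrable; [exact: contM|exact: csuppM].
  have i1 : \int[mu]_x (f' x * G x) = - \int[mu]_x (f x * n x).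
    have := csupp_int_der (fun x => derM (df x) (dG x)) _ (csuppM G scf).
    rewrite RintegralD//; [|exact: ci|exact: ci'].
    have -> : \int[mu]_x (f x * (chi x * n x)) = \int[mu]_x (f x * n x).
      apply: eq_Rintegral => x _; have [xI|xI] := boolP (x \in `[a', b']); last by rewrite f0 ?mul0r.
      by move: xI; rewrite in_itv /= => /andP[h1 h2]; rewrite chi1 ?mul1r//; lra.
    by move=> h; apply/eqP; rewrite -addr_eq0 h//; apply: contD; exact: contM.
  have -> : \int[mu]_x (f' x * y x) = \int[mu]_x (f' x * z x) + k * \int[mu]_x (f' x * G x).
    rewrite -RintegralZl//; last exact: ci.
    rewrite -RintegralD//; [|exact: ci|].
      by apply: eq_Rintegral => x _; rewrite /y; ring.
    have ck : continuous (fun x => k * G x) by apply: contM => //; exact: contcst.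
    have := ci _ ck; congr (mu.-integrable _ (EFin \o _)).
    by apply/funext => x; rewrite mulrCA.
  by rewrite hz// i1 mulrN subrr.
have dz : is_derive t (1 : R) (fun x => y t - k * G x) (- k * n t).
  apply: der_eq (derB (dercst (y t) t) (derZ k (dG t))) _.
  by rewrite chi1 ?(ltW t0t) ?(ltW tt1)//; ring.
apply: near_eq_is_derive dz; near=> x.
have -> : y t = y x.
  have x0 : t0 < x by near: x; exact: lt_nbhsr.
  have x1 : x < t1 by near: x; exact: lt_nbhsl.
  by have [xt|xt|->//] := ltgtP x t; [apply/esym|]; apply: yc.
by rewrite /y addrK.
Unshelve. all: by end_near. Qed.

End weak_derivative.

Section zero_integrand.
Context d (T : measurableType d) (R : realType) (mu : {measure set T -> \bar R}).

(** Used for the times outside the slab, where the slices are extended by 0. *)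
Lemma cint0 : cint mu (fun=> 0) = 0.
Proof.
by apply: complex_ext; rewrite ?Re_cint ?Im_cint /= /Rintegral integral0.
Qed.

Lemma ip0l v : ip mu (fun=> 0) v = 0.
Proof. by rewrite /ip (_ : (fun x => _) = fun=> 0) ?cint0//; apply/funext => x; rewrite mul0r. Qed.

End zero_integrand.

(** * Pairing with the translates of a kernel *)

Section kernel_pairing.
Context d (T : measurableType d) (R : realType).
Variables (mu : {sigma_finite_measure set T -> \bar R}) (dot : T -> T -> R) (C : R).
Hypothesis P : plancherel_space mu dot C.
Local Notation F := (fourier mu dot).
Let C0 : 0 < C := planch_gt0 P.
Variables (u w : T -> R[i]) (chi : T -> T -> R[i]) (m : T -> R[i]) (B : R).
Hypothesis fw : is_fourier mu dot u w.
Hypothesis lchi : forall y, cintegrable mu (chi y) /\ L2 mu (chi y).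
Hypothesis Fchi : forall y xi, F (chi y) xi = cis (- dot y xi) * m xi.
Hypotheses (lm : L2 mu m) (B0 : 0 <= B) (mB : forall xi, abs2 (m xi) <= B).

Let v xi := conjc (w xi) * m xi.

Lemma pairing_L12 : cintegrable mu v /\ L2 mu v.
Proof.
have lw := is_fourier_L2r fw; have lcw := L2_conj lw.
split.
  have := L2_mulc lm lw; congr (cintegrable _ _); apply/funext => xi; by rewrite /v mulrC.
apply: (L2_bnd (k := B) _ lw) => //; first exact: cmeasM (L2_meas lcw) (L2_meas lm).
by move=> xi; rewrite /v abs2M abs2_conj mulrC ler_wpM2r ?abs2_ge0.
Qed.

Let p y := ip mu u (chi y).

(** As a function of the translation [y] the pairing is a convolution. Since the kernels have
    transforms [cis(-y.xi) * m], the pair [(u, w)] exhibits it as the conjugate transform of the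
    integrable function [v], up to the constant; hence it is in [L2], and testing it against [F q]
    amounts to testing [v] against [q]. *)
Lemma pairingE y : p y = (C^-1)%:C%C * conjc (F v y).
Proof.
have [_ _ hp] := is_fourier_pair P fw.
have CC : C%:C%C != 0 :> R[i] by apply/eqP => /(congr1 (@cRe R)) /= h; move: C0; rewrite h ltxx.
have e1 : (C^-1)%:C%C * C%:C%C = 1 :> R[i] by rewrite -rmorphM /= mulVf ?gt_eqF.
rewrite -[LHS]mul1r -e1 -mulrA -(hp _ (lchi y)); congr (_ * _).
have iv := pairing_L12.1.
rewrite -(cint_conj (cintegrable_cis P y iv)) /ip; congr cint; apply/funext => xi.
by rewrite Fchi /v !conjcM conjcc (dot_sym P y xi); ring.
Qed.

Lemma pairing_L2 : L2 mu p.
Proof.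
have -> : p = fun y => (C^-1)%:C%C * conjc (F v y) by apply/funext; exact: pairingE.
by apply: L2Z; apply: L2_conj; apply: (F_L2 P); exact: pairing_L12.
Qed.

Lemma pairing_nsq : nsq mu p <= C^-1 * B * nsq mu w.
Proof.
have lw := is_fourier_L2r fw; have lv := pairing_L12.
have lF := F_L2 P lv.
have -> : p = fun y => (C^-1)%:C%C * conjc (F v y) by apply/funext; exact: pairingE.
rewrite nsqZ; last exact: L2_conj.
have -> : nsq mu (fun x => conjc (F v x)) = C * nsq mu v by rewrite /nsq sq_conj -(nsq_F P lv).
rewrite abs2_real (_ : C^-1 ^+ 2 * (C * nsq mu v) = C^-1 * nsq mu v); last first.
  by field; rewrite gt_eqF.
rewrite -mulrA ler_wpM2l ?invr_ge0 ?(ltW C0)//.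
rewrite -lee_fin EFinM -(L2_fin lv.2) -(L2_fin lw); apply: le_sq => //; [exact: L2_meas lv.2|exact: L2_meas lw|].
by move=> xi; rewrite /v abs2M abs2_conj mulrC ler_wpM2r ?abs2_ge0.
Qed.

Lemma pairing_test q : cintegrable mu q /\ L2 mu q -> cint mu (fun y => p y * F q y) = ip mu q v.
Proof.
move=> lq; have lv := pairing_L12.
have e1 : (C^-1)%:C%C * C%:C%C = 1 :> R[i] by rewrite -rmorphM /= mulVf ?gt_eqF.
rewrite -[RHS]mul1r -e1 -mulrA -(polar P lq lv) /ip.
have iFF := L2_mulc (F_L2 P lq) (F_L2 P lv).
by rewrite -(cintZ _ iFF); congr cint; apply/funext => y; rewrite pairingE; ring.
Qed.

End kernel_pairing.

Section slabs.
Variable R : realType.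
Variables (t0 t1 : R).
Hypothesis t01 : t0 < t1.
Implicit Types (t r : R).

(** Projecting times onto [[t0, t1]] makes the slices a curve defined and continuous on the whole
    line. *)
Definition clip t := Num.max t0 (Num.min t t1).

Lemma clip_in t : t0 <= clip t <= t1.
Proof. by rewrite /clip le_max lexx /= ge_max (ltW t01) ge_min lexx orbT. Qed.

Lemma clipE t : t0 <= t <= t1 -> clip t = t.
Proof. by move=> /andP[h1 h2]; rewrite /clip (min_idPl h2) (max_idPr h1). Qed.

Lemma clip_lip t r : `|clip r - clip t| <= `|r - t|.
Proof.
have mx (a x y : R) : `|Num.max a x - Num.max a y| <= `|x - y|.
  have h1 := ler_norm (x - y); have h2 := ler_norm (- (x - y)); rewrite normrN in h2.
  by rewrite /Num.max; case: (ltP a x) => ?; case: (ltP a y) => ?; rewrite ?subrr ?normr0// ler_norml; lra.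
have mn (a x y : R) : `|Num.min x a - Num.min y a| <= `|x - y|.
  have h1 := ler_norm (x - y); have h2 := ler_norm (- (x - y)); rewrite normrN in h2.
  by rewrite /Num.min; case: (ltP x a) => ?; case: (ltP y a) => ?; rewrite ?subrr ?normr0// ler_norml; lra.
exact: le_trans (mx _ _ _) (mn _ _ _).
Qed.

Lemma L2_slab (u : R4 R -> R[i]) (K : R) : cmeas u ->
  (forall t, t0 <= t <= t1 -> (sq (leb3 R) (fun x => u (t, x)) <= K%:E)%E) ->
  (forall t x, ~~ (t0 <= t <= t1) -> u (t, x) = 0) -> L2 (leb4 R) u.
Proof.
move=> mu_ hK h0; split => //.
have K0 : 0 <= K.
  by rewrite -lee_fin; apply: le_trans (hK t0 _); [exact: sq_ge0|rewrite lexx ltW].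
rewrite (sq_tonelli1 (leb1 R) (leb3 R) mu_).
have hb : ((\int[leb1 R]_x sq (leb3 R) (fun y => u (x, y))) <= \int[leb1 R]_x ((cst K%:E) \_ `[t0, t1]) x)%E.
  apply: ge0_le_integral => //.
  - by move=> x _; exact: sq_ge0.
  - exact: (measurable_sq1 (leb3 R) mu_).
  - by apply/(measurable_restrictT _ (measurable_itv `[t0, t1])); exact: measurable_cst.
  - move=> t _; rewrite patchE; case: ifPn => [|]; first by rewrite inE /= in_itv /=; exact: hK.
    rewrite notin_setE /= in_itv /= => /negP ht.
    rewrite (_ : (fun y => u (t, y)) = fun=> 0); last by apply/funext => x; exact: h0.
    by rewrite /sq (_ : (fun x => _) = cst 0%E) ?integral0//; apply/funext => x; rewrite abs20.
apply: (le_lt_trans hb); rewrite -integral_mkcond integral_cst//= lebesgue_measure_itv /= lte_fin t01.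
by rewrite -EFinB -EFinM ltry.
Qed.

End slabs.

(** * Fourier transforms of the time slices *)

Section wave_slices.
Variable R : realType.
Variables (t0 t1 c s : R).
Hypotheses (t01 : t0 < t1) (s0 : 0 <= s).
Local Notation C3 := (2 * pi * (2 * pi) * (2 * pi) : R).
Local Notation clip := (clip t0 t1).
Local Notation mu3 := (leb3 R).
Let P3 := plancherel3 R.
Let C30 : 0 < C3 := planch_gt0 P3.
Implicit Types (f g : R4 R -> R[i]) (t r : R).

Lemma ereal_cvg0_lt (S : Type) (G : set_system S) (h : S -> \bar R) (e : R) : 0 < e ->
  h x @[x --> G] --> 0%E -> \forall x \near G, (h x < e%:E)%E.
Proof.
move=> e0 /(_ [set y | (y < e%:E)%E]); apply.
by apply: open_nbhs_nbhs; split; [exact: open_ereal_lt_ereal|rewrite /= lte_fin].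
Qed.

Lemma within_cvg0_lt (D : set R) (t : R) (h : R -> \bar R) (e : R) : 0 < e ->
  h r @[r --> within D (nbhs t)] --> 0%E ->
  exists dl : R, 0 < dl /\ forall r, `|r - t| < dl -> D r -> (h r < e%:E)%E.
Proof.
move=> e0 hc.
have hN : nbhs t [set r | D r -> (h r < e%:E)%E] := ereal_cvg0_lt e0 hc.
have [dl /= dl0 hdl] := (@nbhs_ballP R R t _).1 hN.
by exists dl; split => // r rt; apply: hdl; rewrite /ball /= distrC.
Qed.

Lemma dwithin_cvg0_lt (D : set R) (t : R) (h : R -> \bar R) (e : R) : 0 < e ->
  h r @[r --> within D t^'] --> 0%E ->
  exists dl : R, 0 < dl /\ forall r, `|r - t| < dl -> r != t -> D r -> (h r < e%:E)%E.
Proof.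
move=> e0 hc.
have hN : nbhs t [set r | r != t -> D r -> (h r < e%:E)%E] := ereal_cvg0_lt e0 hc.
have [dl /= dl0 hdl] := (@nbhs_ballP R R t _).1 hN.
by exists dl; split => // r rt; apply: hdl; rewrite /ball /= distrC.
Qed.

(** The transforms are chosen independently at each time; the isometry still makes them a continuous
    curve in [L2], since the difference of two of them is a transform of the difference of the
    slices. *)
Lemma continuous_in_sobolev_fourier (sigma : R) f : 0 <= sigma -> continuous_in_sobolev t0 t1 sigma f ->
  exists W : R -> R3 R -> R[i], (forall t, is_fourier mu3 dot3 (fun x => f (clip t, x)) (W t)) /\
    forall t, L2cont_at mu3 W t.
Proof.
move=> sg0 cf.
have ex t : exists w, is_fourier mu3 dot3 (fun x => f (clip t, x)) w.
  by have [/ereal_inf_lt[_ [w hw _] _] _] := cf _ (clip_in t01 t); exists w.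
pose W t := projT1 (cid (ex t)).
have hW t : is_fourier mu3 dot3 (fun x => f (clip t, x)) (W t) := projT2 (cid (ex t)).
exists W; split => // t e e0.
have [_ hc] := cf _ (clip_in t01 t).
have k0 : 0 < Num.sqrt (e / 2) by rewrite sqrtr_gt0 divr_gt0.
have [dl [dl0 hdl]] := within_cvg0_lt k0 hc.
exists dl; split => // r rt.
have := hdl (clip r) (le_lt_trans (clip_lip t0 t1 t r) rt).
rewrite /= in_itv /= => /(_ (clip_in t01 r)) /(sobolev_nsq P3 sg0)[_].
rewrite sqr_sqrtr ?divr_ge0 ?(ltW e0)// => hn.
by rewrite (is_fourier_nsq P3 (is_fourierB P3 (hW r) (hW t))); lra.
Qed.

(** Near an interior time the clipping is the identity, so the quotients of the chosen transforms
    are transforms of the quotients of the slices. The square root of [e / 2] is undone by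
    [sobolev_nsq], which bounds squared norms. *)
Lemma time_derivative_fourier f g W Z :
  (forall t, is_fourier mu3 dot3 (fun x => f (clip t, x)) (W t)) ->
  (forall t, is_fourier mu3 dot3 (fun x => g (clip t, x)) (Z t)) ->
  time_derivative_in_sobolev t0 t1 s f g ->
  forall t, t0 < t < t1 -> forall e, 0 < e -> exists dl : R, 0 < dl /\ forall r, r != t ->
    `|r - t| < dl -> nsq mu3 (fun x => ((r - t)^-1)%:C%C * (W r x - W t x) - Z t x) < e.
Proof.
move=> hW hZ hd t /andP[tt0 tt1] e e0.
have k0 : 0 < Num.sqrt (e / 2) by rewrite sqrtr_gt0 divr_gt0.
have It : t0 <= t <= t1 by rewrite !ltW.
have [dl [dl0 hdl]] := dwithin_cvg0_lt k0 (hd t It).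
exists (Num.min dl (Num.min (t - t0) (t1 - t))); split.
  by rewrite !lt_min dl0 !subr_gt0 tt0.
move=> r rt; rewrite !lt_min => /and3P[r1 r2 r3].
have Ir : t0 <= r <= t1.
  by have := ler_norm (r - t); have := ler_norm (- (r - t)); rewrite normrN; lra.
have := hdl r r1 rt.
rewrite /= in_itv /= => /(_ Ir) /(sobolev_nsq P3 s0)[_].
rewrite sqr_sqrtr ?divr_ge0 ?(ltW e0)// => hn.
have hWr := hW r; have hWt := hW t; have hZt := hZ t.
rewrite !(clipE _) // in hWr hWt hZt.
by rewrite (is_fourier_nsq P3 (is_fourierB P3 (is_fourierZ P3 _ (is_fourierB P3 hWr hWt)) hZt)); lra.
Qed.

Section weak_form.
Variables (f : R4 R -> R[i]) (W : R -> R3 R -> R[i]).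
Hypothesis mf : cmeasurable (M t0 t1) f.
Hypothesis hW : forall t, is_fourier mu3 dot3 (fun x => f (clip t, x)) (W t).
Hypothesis cW : forall t, L2cont_at mu3 W t.
Local Notation F := (fourier mu3 dot3).

Lemma slice_L2 t : L2 mu3 (W t).
Proof. exact: is_fourier_L2r (hW t). Qed.

Lemma measurable_M : measurable (M t0 t1 : set (R4 R)).
Proof.
have := @measurable_fst _ _ (R1 R) (R3 R) measurableT _ (measurable_itv `[t0, t1]).
by rewrite setTI; congr measurable; apply/seteqP; split => p /=; rewrite in_itv.
Qed.

Lemma slice_bound : exists2 K : R, 0 < K & forall t, t0 <= t <= t1 -> nsq mu3 (W t) <= K.
Proof.
have ct : continuous (fun t => rip mu3 (W t) (W t)).
  by move=> t; apply: rip_continuous => //; exact: slice_L2.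
have [t' _ ht'] := EVT_max (ltW t01) (continuous_subspaceT ct).
exists (`|rip mu3 (W t') (W t')| + 1); first by rewrite ltr_wpDl.
move=> t It; have := ht' t; rewrite in_itv /= => /(_ It).
rewrite /rip (ip_diag (slice_L2 t)) /= => h.
by apply: (le_trans h); rewrite ler_wpDr//; exact: ler_norm.
Qed.

Definition slab_part : R4 R -> R[i] := cut (M t0 t1) f.

Lemma slab_part_in t : t0 <= t <= t1 -> (fun x => slab_part (t, x)) = (fun x => f (t, x)).
Proof. by move=> It; apply/funext => x; rewrite /slab_part /cut mem_set. Qed.

Lemma slab_part_out t : ~~ (t0 <= t <= t1) -> (fun x => slab_part (t, x)) = fun=> 0.
Proof. by move=> It; apply/funext => x; rewrite /slab_part /cut memNset//=; exact/negP. Qed.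

Lemma slab_part_fourier t : t0 <= t <= t1 -> is_fourier mu3 dot3 (fun x => slab_part (t, x)) (W t).
Proof. by move=> It; rewrite slab_part_in//; have := hW t; rewrite clipE. Qed.

Lemma slab_part_meas : cmeas slab_part.
Proof. exact: cmeas_cut measurable_M mf. Qed.

Lemma L2_0 : L2 mu3 (fun=> 0).
Proof.
split; first exact: cmeas_cst.
by rewrite /sq (_ : (fun x => _) = cst 0%E) ?integral0//; apply/funext => x; rewrite abs20.
Qed.

Lemma slab_part_slice_L2 t : L2 mu3 (fun x => slab_part (t, x)).
Proof.
have [It|It] := boolP (t0 <= t <= t1); first exact: is_fourier_L2l (slab_part_fourier It).
by rewrite slab_part_out//; exact: L2_0.
Qed.

Lemma slab_part_L2 : L2 (leb4 R) slab_part.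
Proof.
have [K K0 hK] := slice_bound.
apply: (L2_slab t01 (K := C3^-1 * K)); first exact: slab_part_meas.
- move=> t It; have h := slab_part_fourier It.
  rewrite (L2_fin (is_fourier_L2l h)) lee_fin mulrC ler_pdivlMr// mulrC -(is_fourier_nsq P3 h).
  exact: hK.
- by move=> t x /slab_part_out /(congr1 (fun k => k x)).
Qed.

Section kernel.
Variables (chi : R3 R -> R[i]) (B : R).
Hypothesis lchi : cintegrable mu3 chi /\ L2 mu3 chi.
Hypothesis rchi : forall x, conjc (chi x) = chi x.
Hypothesis B0 : 0 <= B.
Hypothesis mB : forall xi, abs2 (F chi xi) <= B.

Let ch (y x : R3 R) : R[i] := chi (x - y).

Let lch y : cintegrable mu3 (ch y) /\ L2 mu3 (ch y).
Proof.
split; first exact: (mp_cintegrable (shift3_mp (- y)) lchi.1).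
exact: (mp_L2 (shift3_mp (- y)) lchi.2).
Qed.

Let Fch y xi : F (ch y) xi = cis (- dot3 y xi) * F chi xi.
Proof. exact: fourier_shift3 lchi.1. Qed.

Let PP (p : R4 R) : R[i] := ip mu3 (fun x => slab_part (p.1, x)) (ch p.2).

Let PP_meas : cmeas PP.
Proof.
apply: (cmeas_cint1 mu3
  (u := fun q : R4 R * R3 R => slab_part (q.1.1, q.2) * conjc (ch q.1.2 q.2))).
apply: cmeasM.
  by apply: (cmeas_comp (f := fun q : R4 R * R3 R => (q.1.1, q.2)) _ slab_part_meas); mfun.
apply: cmeas_conj.
apply: (cmeas_comp (f := fun q : R4 R * R3 R => q.2 - q.1.2) _ (L2_meas lchi.2)).
rewrite (_ : (fun q : R4 R * R3 R => q.2 - q.1.2) = fun q =>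
  ((q.2.1.1 - q.1.2.1.1, q.2.1.2 - q.1.2.1.2), q.2.2 - q.1.2.2)); last by [].
by do 2?[apply: measurable_fun_pair]; apply: measurable_funB; mfun.
Qed.

Let PP_L2 t : L2 mu3 (fun y => PP (t, y)).
Proof.
have [It|It] := boolP (t0 <= t <= t1).
  exact: (pairing_L2 P3 (slab_part_fourier It) lch Fch (F_L2 P3 lchi) B0 mB).
rewrite /PP /= slab_part_out//.
have -> : (fun y => ip mu3 (fun=> 0) (ch y)) = fun=> 0 by apply/funext => y; exact: ip0l.
exact: L2_0.
Qed.

Let PP_L2' : L2 (leb4 R) PP.
Proof.
have [K K0 hK] := slice_bound.
apply: (L2_slab t01 (K := C3^-1 * B * K)); first exact: PP_meas.
- move=> t It; rewrite (L2_fin (PP_L2 t)) lee_fin.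
  apply: (le_trans (pairing_nsq P3 (slab_part_fourier It) lch Fch (F_L2 P3 lchi) B0 mB)).
  by rewrite ler_wpM2l ?hK// mulr_ge0// invr_ge0 ltW.
- move=> t x It; rewrite /PP /= slab_part_out//; exact: ip0l.
Qed.

Variables (eta : R -> R) (q : R3 R -> R[i]).
Hypotheses (ceta : continuous eta) (seta : csupp eta) (lq : cintegrable mu3 q /\ L2 mu3 q).
Local Notation eC := (fun t : R1 R => (eta t)%:C%C).

Let J (y : R3 R) : R[i] := cint (leb4 R) (fun p => slab_part p * (eC p.1 * ch y p.2)).

Let iJ y : cintegrable (leb4 R) (fun p => slab_part p * (eC p.1 * ch y p.2)).
Proof.
have := L2_mulc slab_part_L2 (L2_tensor (csupp_L12 ceta seta).2 (lch y).2).
by congr cintegrable; apply/funext => p; rewrite conjcM conjc_real rchi.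
Qed.

Lemma weak_kernel_integrable y :
  cintegrable (leb4 R) (fun p => slab_part p * (eC p.1 * chi (p.2 - y))).
Proof. exact: iJ. Qed.

Let inner t y : cint mu3 (fun x => slab_part (t, x) * (eC t * ch y x)) = eC t * PP (t, y).
Proof.
rewrite /PP /ip -cintZ; last exact: L2_mulc (slab_part_slice_L2 t) (lch y).2.
by congr cint; apply/funext => x; rewrite rchi mulrCA.
Qed.

Let G (p : R4 R) : R[i] := eC p.1 * PP p * F q p.2.

Let iG : cintegrable (leb4 R) G.
Proof.
have := L2_mulc PP_L2' (L2_conj (L2_tensor (csupp_L12 ceta seta).2 (F_L2 P3 lq))).
by congr cintegrable; apply/funext => p; rewrite conjcc /G; ring.
Qed.

Let JF y : J y * F q y = cint (leb1 R) (fun t => G (t, y)).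
Proof.
rewrite /J (cint_fubini1 (iJ y)).
rewrite -(cintZr _ (cintegrable_fubini1 (iJ y))); congr cint; apply/funext => t /=.
by rewrite inner.
Qed.

Lemma weak_term_integrable :
  cintegrable mu3 (fun y => cint (leb4 R) (fun p => slab_part p * (eC p.1 * chi (p.2 - y))) * F q y).
Proof.
rewrite (_ : (fun y => _) = fun y => cint (leb1 R) (fun t => G (t, y))); last by apply/funext.
exact: cintegrable_fubini2 iG.
Qed.

(** The weak equation tested with a kernel centred at [y] is a function of [y]. Integrating it
    against the weight [F q] and exchanging the integrals leaves, at each time, the pairing computed
    in [pairing_test]. *)
Lemma weak_term :
  cint mu3 (fun y => cint (leb4 R) (fun p => slab_part p * (eC p.1 * chi (p.2 - y))) * F q y) =
  cint (leb1 R) (fun t => eC t * (if t0 <= t <= t1 then ip mu3 q (fun xi => conjc (W t xi) * F chi xi) else 0)).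
Proof.
rewrite (_ : (fun y => _) = fun y => cint (leb1 R) (fun t => G (t, y))); last by apply/funext.
rewrite -(cint_swap iG); congr cint; apply/funext => t.
have -> : (fun y => G (t, y)) = fun y => eC t * (PP (t, y) * F q y).
  by apply/funext => y; rewrite /G /= mulrA.
rewrite cintZ; last first.
  have := L2_mulc (PP_L2 t) (L2_conj (F_L2 P3 lq)); congr cintegrable.
  by apply/funext => y; rewrite conjcc.
congr (_ * _); case: ifPn => It.
  exact: (pairing_test P3 (slab_part_fourier It) lch Fch (F_L2 P3 lchi) B0 mB lq).
rewrite (_ : (fun y => _) = fun=> 0) ?cint0//; apply/funext => y.
by rewrite /PP /= slab_part_out// ip0l mul0r.
Qed.

End kernel.
Lemma fourier_bound (chi : R3 R -> R[i]) xi : cintegrable mu3 chi ->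
  abs2 (F chi xi) <= (2 * fine (l1 mu3 chi)) ^+ 2.
Proof.
move=> ic; apply: (le_trans (abs2_le_abs1 _)).
have h := abs1_fourier P3 xi ic.
by rewrite lerXn2r ?nnegrE ?abs1_ge0//; apply: le_trans h; exact: abs1_ge0.
Qed.

Lemma der_supp (h h' : R -> R) (a b : R) : (forall x : R, is_derive x (1 : R) h (h' x)) ->
  (forall x, x \notin `[a, b] -> h x = 0) -> forall x, x \notin `[a, b] -> h' x = 0.
Proof.
move=> dh h0 x xab.
have d0 : is_derive x (1 : R) h 0.
  move: xab; rewrite in_itv /= negb_and -!ltNge => /orP[xa|bx].
  - apply: near_eq_is_derive (@dercst R 0 x); near=> y; rewrite h0// in_itv /= negb_and -!ltNge.
    by apply/orP; left; near: y; exact: lt_nbhsl.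
  - apply: near_eq_is_derive (@dercst R 0 x); near=> y; rewrite h0// in_itv /= negb_and -!ltNge.
    by apply/orP; right; near: y; exact: lt_nbhsr.
by have [_ <-] := dh x; have [_ <-] := d0.
Unshelve. all: by end_near. Qed.

End weak_form.
End wave_slices.

Lemma csupp_itv (R : realType) (h : R -> R) (a b : R) : (forall x, x \notin `[a, b] -> h x = 0) -> csupp h.
Proof.
move=> h0; exists (`|a| + `|b| + 1) => x hx; apply: h0; rewrite in_itv /=; apply/negP => /andP[h1 h2].
have h3 := ler_norm b; have h4 := ler_norm (- a); rewrite normrN in h4.
have h5 := normr_ge0 a; have h6 := normr_ge0 b.
have : `|x| <= `|a| + `|b| by rewrite ler_norml; lra.
lra.
Qed.

Lemma cRe_scale (R : realType) (a : R) (z : R[i]) : cRe (a%:C%C * z) = a * cRe z.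
Proof. by rewrite cReM cRe_real cIm_real mul0r subr0. Qed.

Lemma Re_cint_scale d (T : measurableType d) (R : realType) (mu : {measure set T -> \bar R})
    (h : T -> R) (z : T -> R[i]) :
  cRe (cint mu (fun t => (h t)%:C%C * z t)) = \int[mu]_t (h t * cRe (z t)).
Proof. by rewrite Re_cint; apply: eq_Rintegral => t _; rewrite cRe_scale. Qed.

Lemma rip_cst_continuous d (T : measurableType d) (R : realType) (mu : {measure set T -> \bar R})
    (A : R -> T -> R[i]) (v : T -> R[i]) : (forall t, L2 mu (A t)) -> (forall t, L2cont_at mu A t) ->
  L2 mu v -> continuous (fun t => rip mu (A t) v).
Proof.
move=> lA cA lv t.
exact: (rip_continuous (B := fun=> v) lA (fun=> lv) (cA t) (L2cont_cst t lv)).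
Qed.

(** * From the weak wave equation to an ordinary differential equation in time *)

Section weak_form.
Variable R : realType.
Variables (t0 t1 c : R).
Hypotheses (t01 : t0 < t1).
Local Notation clip := (clip t0 t1).
Local Notation mu3 := (leb3 R).
Let P3 := plancherel3 R.
Variables (f : R4 R -> R[i]) (W : R -> R3 R -> R[i]).
Hypothesis mf : cmeasurable (M t0 t1) f.
Hypothesis hW : forall t, is_fourier mu3 dot3 (fun x => f (clip t, x)) (W t).
Hypothesis cW : forall t, L2cont_at mu3 W t.
Local Notation F := (fourier mu3 dot3).
Local Notation slab_part := (slab_part t0 t1 f).

Variables (N : R) (q : R3 R -> R[i]).
Hypotheses (N0 : 0 <= N) (lq : L2 mu3 q) (q0 : forall xi, N ^+ 2 < dot3 xi xi -> q xi = 0).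
(** With this width [|z| * e <= 1] for [|z| <= N], so that [fourier_bump_ge] bounds the transform of
    the bump from below in each of the three variables. *)
Let e : R := (N + 1)^-1.
Let e0 : 0 < e. Proof. by rewrite /e invr_gt0 ltr_wpDl. Qed.
Let rho := bump e.
Variables (rho1 rho2 : R -> R).
Hypotheses (srho1 : smooth1 rho1) (srho2 : smooth1 rho2).
Hypotheses (drho : forall x : R, is_derive x (1 : R) rho (rho1 x))
  (drho1 : forall x : R, is_derive x (1 : R) rho1 (rho2 x)).

Let crho : continuous rho := smooth1_cont (smooth1_bump e).
Let crho1 : continuous rho1 := smooth1_cont srho1.
Let crho2 : continuous rho2 := smooth1_cont srho2.
Let supp : csupp rho := bump_csupp e0.
Let supp1 : csupp rho1 := csupp_der drho supp.
Let supp2 : csupp rho2 := csupp_der drho1 supp1.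

Let psi (x : R3 R) : R[i] := (tens3 rho rho rho x)%:C%C.
Let lap (x : R3 R) : R[i] :=
  (tens3 rho2 rho rho x)%:C%C + ((tens3 rho rho2 rho x)%:C%C + (tens3 rho rho rho2 x)%:C%C).
Let hat := fourier (leb1 R) (@dot1 R) (fun x : R1 R => (rho x)%:C%C).

Let lpsi : cintegrable mu3 psi /\ L2 mu3 psi. Proof. exact: tens3_L12. Qed.

Let l1 : cintegrable mu3 (fun x => (tens3 rho2 rho rho x)%:C%C) /\
  L2 mu3 (fun x => (tens3 rho2 rho rho x)%:C%C).
Proof. exact: tens3_L12. Qed.
Let l2 : cintegrable mu3 (fun x => (tens3 rho rho2 rho x)%:C%C) /\
  L2 mu3 (fun x => (tens3 rho rho2 rho x)%:C%C).
Proof. exact: tens3_L12. Qed.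
Let l3 : cintegrable mu3 (fun x => (tens3 rho rho rho2 x)%:C%C) /\
  L2 mu3 (fun x => (tens3 rho rho rho2 x)%:C%C).
Proof. exact: tens3_L12. Qed.

Let llap : cintegrable mu3 lap /\ L2 mu3 lap.
Proof.
split; first exact: cintegrableD l1.1 (cintegrableD l2.1 l3.1).
exact: L2D l1.2 (L2D l2.2 l3.2).
Qed.

Let hat2 z : fourier (leb1 R) (@dot1 R) (fun x : R1 R => (rho2 x)%:C%C) z = (- z ^+ 2)%:C%C * hat z.
Proof.
rewrite (fourier_der z drho1 crho2 supp1) (fourier_der z drho crho1 supp) mulrA; congr (_ * _).
by apply: complex_ext; rewrite !cE ?(mul0r, mulr0, add0r, addr0, sub0r) ?expr2.
Qed.

Let Fpsi xi : F psi xi = hat xi.1.1 * hat xi.1.2 * hat xi.2.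
Proof. exact: fourier_tens3. Qed.

Let Flap xi : F lap xi = (- dot3 xi xi)%:C%C * F psi xi.
Proof.
rewrite (FD P3 l1.1 (cintegrableD l2.1 l3.1)) (FD P3 l2.1 l3.1).
rewrite !fourier_tens3// !hat2 -/hat.
have -> : - dot3 xi xi = - xi.1.1 ^+ 2 + (- xi.1.2 ^+ 2 + - xi.2 ^+ 2) by rewrite /dot3 /dot2; ring.
by rewrite !rmorphD /=; ring.
Qed.

Let Fpsi_ge : exists2 D : R, 0 < D & forall xi, dot3 xi xi <= N ^+ 2 -> D <= abs2 (F psi xi).
Proof.
have [dl dl0 hat_ge] : exists2 dl : R, 0 < dl & forall z : R, `|z| <= N -> dl <= abs2 (hat z).
  exists ((expR (- 2) ^+ 2 * (e / 2)) ^+ 2).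
    by apply: exprn_gt0; apply: mulr_gt0; [apply: exprn_gt0; exact: expR_gt0|exact: divr_gt0].
  move=> z zN.
  have d0 : 0 <= expR (- 2) ^+ 2 * (e / 2) :> R.
    by apply: mulr_ge0; [apply: exprn_ge0; exact: expR_ge0|apply: divr_ge0 => //; exact: ltW].
  have h : expR (- 2) ^+ 2 * (e / 2) <= cRe (hat z).
    apply: fourier_bump_ge => //; rewrite /e ler_pdivrMr; [lra|by rewrite ltr_wpDl].
  apply: (@le_trans _ _ (cRe (hat z) ^+ 2)); last by rewrite /abs2 lerDl sqr_ge0.
  by rewrite lerXn2r ?nnegrE//; apply: le_trans h.
exists (dl * dl * dl); first by rewrite !mulr_gt0.
move=> xi h; have {}h : xi.1.1 ^+ 2 + xi.1.2 ^+ 2 + xi.2 ^+ 2 <= N ^+ 2 by rewrite !expr2.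
have c' (a b d : R) : a ^+ 2 + b ^+ 2 + d ^+ 2 <= N ^+ 2 -> `|a| <= N.
  move=> h'; rewrite -(@ler_pXn2r _ 2) ?nnegrE// real_normK ?num_real//.
  by have := sqr_ge0 b; have := sqr_ge0 d; lra.
rewrite Fpsi !abs2M; have dd := ltW dl0.
have h1 : dl <= abs2 (hat xi.1.1) by apply: hat_ge; exact: c' h.
have h2 : dl <= abs2 (hat xi.1.2) by apply: hat_ge; apply: (c' _ xi.1.1 xi.2); lra.
have h3 : dl <= abs2 (hat xi.2) by apply: hat_ge; apply: (c' _ xi.1.1 xi.1.2); lra.
by apply: ler_pM h3 => //; [exact: mulr_ge0|exact: ler_pM].
Qed.

(** The quotient of [conj q] by the conjugate of [F psi], written with a real denominator. It is in
    [L2] because [F psi] is bounded below where [q] does not vanish, and integrable because its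
    support is bounded. *)
Let k (xi : R3 R) : R[i] := conjc (q xi) * (F psi xi * ((abs2 (F psi xi))^-1)%:C%C).

Let kE xi : k xi * conjc (F psi xi) = conjc (q xi).
Proof.
rewrite /k; have [h|/q0 ->] := leP (dot3 xi xi) (N ^+ 2); last by rewrite !conjc0 !mul0r.
have [D D0 hD] := Fpsi_ge; have a0 : abs2 (F psi xi) != 0 by rewrite gt_eqF//; apply: lt_le_trans (hD _ h).
rewrite -mulrA mulrAC mul_conj -rmorphM /= divff// mulr1//.
Qed.

Let k_meas : cmeas k.
Proof.
apply: cmeasM; first exact: cmeas_conj (L2_meas lq).
have mF := L2_meas (F_L2 P3 lpsi).
have mI : measurable_fun setT (fun xi => (abs2 (F psi xi))^-1).
  rewrite (_ : (fun xi => _) = fun xi => (abs2 (F psi xi)) `^ (-1)); last first.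
    by apply/funext => xi; rewrite powR_inv1// abs2_ge0.
  apply: (@measurableT_comp _ _ _ _ _ _ (fun x : R => x `^ (-1))); first exact: measurable_powR.
  exact: measurable_abs2.
exact: (cmeasM mF (cmeas_real mI)).
Qed.

Let k_L2 : L2 mu3 k.
Proof.
have [D D0 hD] := Fpsi_ge.
have Di : 0 <= D^-1 by rewrite invr_ge0 ltW.
apply: (L2_bnd k_meas lq Di).
move=> xi; rewrite /k !abs2M abs2_conj abs2_real.
have [h|/q0 ->] := leP (dot3 xi xi) (N ^+ 2); last by rewrite abs20 mul0r mulr0.
have h' := hD _ h; have a0 := lt_le_trans D0 h'.
rewrite mulrC ler_wpM2r ?abs2_ge0// exprVn expr2 invfM mulrA divff ?gt_eqF// mul1r.
by rewrite lef_pV2 ?posrE.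
Qed.

Let k_L12 : cintegrable mu3 k /\ L2 mu3 k.
Proof.
split => //; have := trunc_L1 P3 N k_L2.
rewrite (_ : trunc dot3 N k = k)//; apply/funext => xi.
rewrite /trunc; case: ifPn => //; rewrite -ltNge => /q0 h.
by rewrite /k h conjc0 mul0r.
Qed.

Lemma bounded_support_L2 : L2 mu3 (fun xi => (dot3 xi xi)%:C%C * q xi).
Proof.
apply: (L2_bnd (k := (N ^+ 2) ^+ 2) _ lq); rewrite ?sqr_ge0//.
  apply: cmeasM (L2_meas lq); exact: cmeas_real (dot_diag_meas P3).
move=> xi; rewrite abs2M abs2_real.
have [h|/q0 ->] := leP (dot3 xi xi) (N ^+ 2); last by rewrite abs20 !mulr0.
by rewrite ler_wpM2r ?abs2_ge0// lerXn2r ?nnegrE ?sqr_ge0// (dot_ge0 P3).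
Qed.
Let lhq := bounded_support_L2.

Hypothesis wf : weak_wave_equation t0 t1 c f.
Variables (eta eta1 eta2 : R -> R) (a b : R).
Hypotheses (seta : smooth1 eta) (seta1 : smooth1 eta1) (seta2 : smooth1 eta2).
Hypotheses (deta : forall x : R, is_derive x (1 : R) eta (eta1 x))
  (deta1 : forall x : R, is_derive x (1 : R) eta1 (eta2 x)).
Hypotheses (ta : t0 < a) (bt : b < t1) (eta0 : forall x, x \notin `[a, b] -> eta x = 0).

Let eta20 : forall x, x \notin `[a, b] -> eta2 x = 0.
Proof. exact: der_supp deta1 (der_supp deta eta0). Qed.

Let sh (h : R -> R) (y x : R) : R := h (x - y).

Let smooth_sh h y : smooth1 h -> smooth1 (sh h y).
Proof.
move=> sh_; have := smooth1_affine 1 (- y) sh_; congr smooth1.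
by apply/funext => x; rewrite /sh mul1r.
Qed.

Let der_sh (h h' : R -> R) y : (forall x : R, is_derive x (1 : R) h (h' x)) ->
  forall x : R, is_derive x (1 : R) (sh h y) (sh h' y x).
Proof.
move=> dh x; have da : is_derive x (1 : R) (fun t => t - y) 1.
  by apply: der_eq (derB (derid x) (dercst y x)) _; rewrite subr0.
by apply: der_eq (dercomp da (dh (x - y))) _; rewrite mulr1.
Qed.

Let phi (y : R3 R) := tens4 eta (sh rho y.1.1) (sh rho y.1.2) (sh rho y.2).

Let phi_test y : test_function t0 t1 (phi y).
Proof.
split.
  apply: tensor_span_smooth; apply: span_tens => //; apply: smooth_sh; exact: smooth1_bump.
exists (`[a, b] `*` ((`[y.1.1 - e, y.1.1 + e] `*` `[y.1.2 - e, y.1.2 + e]) `*` `[y.2 - e, y.2 + e])); split.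
- by do !apply: compact_setX; exact: segment_compact.
- have ta' := ta; have bt' := bt.
  by move=> [t x] [/=]; rewrite in_itv /= => /andP[h1 h2] _; apply/andP; split; lra.
- have out (z x : R) : ~ (x \in `[z - e, z + e]) -> sh rho z x = 0.
    rewrite in_itv /= => h; apply: bump_out => //; rewrite leNgt; apply/negP.
    by rewrite ltr_norml => h'; apply: h; lra.
  move=> [t [[x1 x2] x3]] h; rewrite /phi /tens4 /tens3 /=.
  have [h0|/eta0 ->] := boolP (t \in `[a, b]); last by rewrite mul0r.
  have [h1|/negP/out ->] := boolP (x1 \in `[y.1.1 - e, y.1.1 + e]); last by rewrite !mul0r mulr0.
  have [h2|/negP/out ->] := boolP (x2 \in `[y.1.2 - e, y.1.2 + e]); last by rewrite mulr0 mul0r mulr0.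
  have [h3|/negP/out ->] := boolP (x3 \in `[y.2 - e, y.2 + e]); last by rewrite !mulr0.
  by exfalso; apply: h.
Qed.

Let rpsi x : conjc (psi x) = psi x. Proof. exact: conjc_real. Qed.
Let rlap x : conjc (lap x) = lap x. Proof. by rewrite /lap !conjcD !conjc_real. Qed.

Let ceta := smooth1_cont seta.
Let ceta2 := smooth1_cont seta2.
Let I1 y := weak_kernel_integrable t01 mf hW cW lpsi rpsi ceta2 (csupp_itv eta20) y.
Let I2 y := weak_kernel_integrable t01 mf hW cW llap rlap ceta (csupp_itv eta0) y.

Let weak_at y :
  cint (leb4 R) (fun p => slab_part p * ((eta2 p.1)%:C%C * psi (p.2 - y))) =
  (c ^+ 2)%:C%C * cint (leb4 R) (fun p => slab_part p * ((eta p.1)%:C%C * lap (p.2 - y))).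
Proof.
have := wf (phi_test y); rewrite (cint_cut _ _ (measurable_M t0 t1)).
rewrite -(cintZ _ (I2 y)) => h; apply/eqP; rewrite -subr_eq0 -cintB//; last exact: cintegrableZ.
apply/eqP; rewrite -[RHS]h; congr cint; apply/funext => p.
rewrite /cut /slab_part /cut; case: ifPn => _; last by rewrite !mul0r mulr0 subr0.
rewrite (wave_op_tens4 c deta (der_sh y.1.1 drho) (der_sh y.1.2 drho) (der_sh y.2 drho) deta1
  (der_sh y.1.1 drho1) (der_sh y.1.2 drho1) (der_sh y.2 drho1)).
have E (h1 h2 h3 h4 : R -> R) : tens4 h1 (sh h2 y.1.1) (sh h3 y.1.2) (sh h4 y.2) p =
  h1 p.1 * tens3 h2 h3 h4 (p.2 - y) by [].
rewrite !E /psi /lap; move: (tens3 _ _ _ _) (tens3 rho2 _ _ _) (tens3 _ rho2 _ _) (tens3 _ _ rho2 _).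
move: (f p) (eta2 p.1) (eta p.1) => z x1 x2 y1 y2 y3 y4.
by apply: complex_ext; rewrite !cE; ring.
Qed.

Let ext (h : R -> R) t z : (forall x, x \notin `[a, b] -> h x = 0) ->
  (h t)%:C%C * (if t0 <= t <= t1 then z else 0) = (h t)%:C%C * z :> R[i].
Proof.
move=> h0; case: ifPn => // It; rewrite h0 ?mul0r//.
have ta' := ta; have bt' := bt.
by apply: contra It; rewrite in_itv /= => /andP[h1 h2]; apply/andP; split; lra.
Qed.

(** Testing with [eta(t) psi(x - y)] smooths the solution in space; the weight [F k] in [y] undoes
    the smoothing and leaves the pairing with [q]. The Laplacian falls on the kernel and yields the
    factor [- |xi|^2]. *)
Lemma weak_ode : \int[leb1 R]_t (eta2 t * rip mu3 (W t) q) +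
  c ^+ 2 * \int[leb1 R]_t (eta t * rip mu3 (W t) (fun xi => (dot3 xi xi)%:C%C * q xi)) = 0.
Proof.
have T1 := weak_term t01 mf hW cW lpsi rpsi (sqr_ge0 _) (fun xi => fourier_bound xi lpsi.1) ceta2 (csupp_itv eta20) k_L12.
have T2 := weak_term t01 mf hW cW llap rlap (sqr_ge0 _) (fun xi => fourier_bound xi llap.1) ceta (csupp_itv eta0) k_L12.
have i2 := weak_term_integrable t01 mf hW cW llap rlap (sqr_ge0 _) (fun xi => fourier_bound xi llap.1) ceta (csupp_itv eta0) k_L12.
have ipk t : ip mu3 k (fun xi => conjc (W t xi) * F psi xi) = ip mu3 (W t) q.
  by congr cint; apply/funext => xi; rewrite conjcM conjcc mulrCA kE.
have ipl t : ip mu3 k (fun xi => conjc (W t xi) * F lap xi) =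
    ip mu3 (W t) (fun xi => - ((dot3 xi xi)%:C%C * q xi)).
  congr cint; apply/funext => xi.
  have -> : k xi * conjc (conjc (W t xi) * F lap xi) =
      W t xi * ((- dot3 xi xi)%:C%C * (k xi * conjc (F psi xi))).
    by rewrite Flap !conjcM conjcc conjc_real; ring.
  by rewrite kE conjcN conjcM conjc_real rmorphN /=; ring.
have e1 : cint (leb1 R) (fun t => (eta2 t)%:C%C * ip mu3 (W t) q) = (c ^+ 2)%:C%C *
    cint (leb1 R) (fun t => (eta t)%:C%C * ip mu3 (W t) (fun xi => - ((dot3 xi xi)%:C%C * q xi))).
  have -> : (fun t => (eta2 t)%:C%C * ip mu3 (W t) q) = fun t => (eta2 t)%:C%C *
      (if t0 <= t <= t1 then ip mu3 k (fun xi => conjc (W t xi) * F psi xi) else 0).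
    by apply/funext => t; rewrite ext// ipk.
  have -> : (fun t => (eta t)%:C%C * ip mu3 (W t) (fun xi => - ((dot3 xi xi)%:C%C * q xi))) = fun t => (eta t)%:C%C *
      (if t0 <= t <= t1 then ip mu3 k (fun xi => conjc (W t xi) * F lap xi) else 0).
    by apply/funext => t; rewrite ext// ipl.
  apply: (eq_trans (esym T1)).
  apply: (eq_trans _ (congr1 (fun z => (c ^+ 2)%:C%C * z) T2)).
  apply: (eq_trans _ (cintZ _ i2)); congr cint; apply/funext => y.
  by rewrite weak_at mulrA.
have lW t : L2 mu3 (W t) := is_fourier_L2r (hW t).
have crip : continuous (fun t => rip mu3 (W t) (fun xi => (dot3 xi xi)%:C%C * q xi)).
  exact: rip_cst_continuous.
have r1 : \int[leb1 R]_t (eta2 t * rip mu3 (W t) q) = cRe (cint (leb1 R) (fun t => (eta2 t)%:C%C * ip mu3 (W t) q)).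
  exact: esym (Re_cint_scale _ _ _).
rewrite r1 e1 cRe_scale Re_cint_scale -mulrDr.
have -> : \int[leb1 R]_t (eta t * cRe (ip mu3 (W t) (fun xi => - ((dot3 xi xi)%:C%C * q xi)))) =
    -1 * \int[leb1 R]_t (eta t * rip mu3 (W t) (fun xi => (dot3 xi xi)%:C%C * q xi)).
  rewrite -RintegralZl//; last by apply: csupp_integrable; [exact: contM|exact: csuppM (csupp_itv eta0)].
  by apply: eq_Rintegral => t _; rewrite ipNr// cReN mulN1r mulrN.
by rewrite mulN1r addNr mulr0.
Qed.

End weak_form.

Section mean_value.
Variable R : realType.
Implicit Types (f : R -> R) (r t x L w T : R).

Lemma mean_value_le f f' r t L : (forall x : R, is_derive x (1 : R) f (f' x)) ->
  (forall x, `|x - t| <= `|r - t| -> `|f' x| <= L) -> `|f r - f t| <= L * `|r - t|.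
Proof.
move=> df hL; have cf : continuous f by move=> x; exact: der_cont (df x).
have mv a b : a < b -> (forall x, a <= x -> x <= b -> `|f' x| <= L) -> `|f b - f a| <= L * (b - a).
  move=> ab h; have [x] := MVT ab (fun x _ => df x) (continuous_subspaceT cf).
  rewrite in_itv /= => /andP[ax xb] ->; rewrite normrM (@ger0_norm _ (b - a)); last by rewrite subr_ge0 ltW.
  by rewrite ler_wpM2r ?h ?subr_ge0// ltW.
case: (ltgtP r t) => [rt|tr|->]; last by rewrite !subrr !normr0 mulr0.
- rewrite distrC [`|r - t|]distrC (@ger0_norm _ (t - r)); last by rewrite subr_ge0 ltW.
  apply: mv => // x rx xt; apply: hL; rewrite distrC [`|r - t|]distrC !ger0_norm ?subr_ge0//; [lra|exact: ltW].
- rewrite (@ger0_norm _ (r - t)); last by rewrite subr_ge0 ltW.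
  by apply: mv => // x tx xr; apply: hL; rewrite !ger0_norm ?subr_ge0//; [lra|exact: ltW].
Qed.

(** The mean value inequality applied twice; the constant is twice the optimal one. *)
Lemma taylor_le f f' f2 r t L : (forall x : R, is_derive x (1 : R) f (f' x)) ->
  (forall x : R, is_derive x (1 : R) f' (f2 x)) -> 0 <= L -> (forall x, `|f2 x| <= L) ->
  `|f r - f t - (r - t) * f' t| <= L * `|r - t| * `|r - t|.
Proof.
move=> df df' L0 hL.
have -> : f r - f t - (r - t) * f' t = (f r - f' t * r) - (f t - f' t * t) by ring.
apply: (@mean_value_le (fun x => f x - f' t * x) (fun x => f' x - f' t)).
  by move=> x; apply: der_eq (derB (df x) (derZ (f' t) (derid x))) _; rewrite mulr1.
move=> x hx; apply: (@le_trans _ _ (L * `|x - t|)); last by rewrite ler_wpM2l.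
by apply: (mean_value_le df') => y _; exact: hL.
Qed.

(** The solution of [u'' = - w^2 u] with [u(0) = 0] and [u'(0) = 1], which includes the limit case
    [w = 0]. *)
Definition sincw (w x : R) : R := if w == 0 then x else sin (w * x) / w.

Lemma der_scale w x : is_derive x (1 : R) (fun t : R => w * t) w.
Proof. by apply: der_eq (derZ w (derid x)) _; rewrite mulr1. Qed.

Lemma der_sincw w x : is_derive x (1 : R) (sincw w) (cos (w * x)).
Proof.
rewrite /sincw; have [->|w0] := eqVneq w 0; first by rewrite mul0r cos0; exact: derid.
apply: der_eq (derM (dercomp (f := sin) (der_scale w x) _) (dercst w^-1 x)) _.
by rewrite mulr0 addr0 mulfK.
Qed.

Lemma der_cosw w x : is_derive x (1 : R) (fun t => cos (w * t)) (- (w ^+ 2 * sincw w x)).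
Proof.
apply: der_eq (dercomp (f := cos) (der_scale w x) _) _; rewrite /sincw.
by have [->|w0] := eqVneq w 0; [rewrite mulr0 expr0n mul0r oppr0|field].
Qed.

Lemma sincw_le w x : `|sincw w x| <= `|x|.
Proof.
rewrite /sincw; case: eqVneq => [_|w0]; first exact: lexx.
rewrite normrM normfV ler_pdivrMr ?normr_gt0// mulrC -normrM; exact: sin_le_abs.
Qed.

Lemma sincw0 w : sincw w 0 = 0.
Proof. by rewrite /sincw mulr0 sin0 mul0r if_same. Qed.

End mean_value.

(** * The solution formula on the Fourier side *)

Section wave_solution_formula.
Variable R : realType.
Variables (t0 t1 c : R).
Hypotheses (t01 : t0 < t1) (c0 : 0 < c).
Local Notation mu3 := (leb3 R).
Let P3 := plancherel3 R.
Implicit Types (t r T N : R) (q : R3 R -> R[i]).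

Definition omega (xi : R3 R) : R := c * Num.sqrt (dot3 xi xi).

Lemma omega_ge0 xi : 0 <= omega xi.
Proof. by rewrite mulr_ge0 ?sqrtr_ge0// ltW. Qed.

Lemma omega_sq xi : omega xi ^+ 2 = c ^+ 2 * dot3 xi xi.
Proof. by rewrite exprMn sqr_sqrtr// (dot_ge0 P3). Qed.

Lemma omega_meas : measurable_fun setT omega.
Proof.
apply: measurable_funM => //; apply: (measurableT_comp (contmeas (@sqrt_continuous R))).
exact: dot_diag_meas P3.
Qed.

(** Propagators of the dual problem, run backwards from the final time [T]: at [t = T] they are 1
    and 0, and at [t = t0] they are the coefficients of the solution formula. *)
Definition cosT T t (xi : R3 R) : R := cos (omega xi * (T - t)).
Definition sinT T t (xi : R3 R) : R := sincw (omega xi) (T - t).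

Lemma cosT_meas T t : measurable_fun setT (cosT T t).
Proof.
apply: (measurableT_comp (contmeas (@continuous_cos R))); apply: measurable_funM => //; exact: omega_meas.
Qed.

Lemma sincw_meas d (T : measurableType d) (a b : T -> R) : measurable_fun setT a -> measurable_fun setT b ->
  (forall x, 0 <= a x) -> measurable_fun setT (fun x => sincw (a x) (b x)).
Proof.
move=> ma mb a0.
rewrite (_ : (fun x => _) = fun x => b x * \1_[set (0 : R)] (a x : R1 R) +
    sin (a x * b x) * (a x) `^ (-1)); last first.
  apply/funext => x; rewrite powR_inv1// indicE /sincw.
  have [->|w0] := eqVneq (a x) 0; first by rewrite mem_set// mulr1 invr0 mulr0 addr0.
  by rewrite memNset ?mulr0 ?add0r//= => /eqP; rewrite (negbTE w0).
apply: measurable_funD; apply: measurable_funM => //.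
- apply: (measurableT_comp (f := \1_[set (0 : R)] : R1 R -> R) _ ma); exact: measurable_indic.
- by apply: (measurableT_comp (contmeas (@continuous_sin R))); exact: measurable_funM.
- by apply: (@measurableT_comp _ _ _ _ _ _ (fun x : R => x `^ (-1)) _ a) => //; exact: measurable_powR.
Qed.

Lemma sinT_meas T t : measurable_fun setT (sinT T t).
Proof. by apply: sincw_meas => //; [exact: omega_meas|exact: omega_ge0]. Qed.
Lemma mult_L2 (h : R3 R -> R) (B : R) q : measurable_fun setT h -> L2 mu3 q ->
  (forall xi, q xi != 0 -> `|h xi| <= B) -> L2 mu3 (fun xi => (h xi)%:C%C * q xi).
Proof.
move=> mh lq hB; apply: (L2_bnd (k := B ^+ 2) _ lq); rewrite ?sqr_ge0//.
  by apply: cmeasM (L2_meas lq); exact: cmeas_real.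
move=> xi; rewrite abs2M abs2_real; have [->|/hB h0] := eqVneq (q xi) 0; first by rewrite abs20 !mulr0.
rewrite ler_wpM2r ?abs2_ge0// -[leLHS]real_normK ?num_real//.
by rewrite lerXn2r ?nnegrE//; apply: le_trans h0.
Qed.

Lemma cosT_L2 T t q : L2 mu3 q -> L2 mu3 (fun xi => (cosT T t xi)%:C%C * q xi).
Proof. by move=> lq; apply: (mult_L2 (B := 1) (cosT_meas T t) lq) => xi _; exact: cos_max. Qed.

Lemma sinT_L2 T t q : L2 mu3 q -> L2 mu3 (fun xi => (sinT T t xi)%:C%C * q xi).
Proof. by move=> lq; apply: (mult_L2 (B := `|T - t|) (sinT_meas T t) lq) => xi _; exact: sincw_le. Qed.

Lemma mult_nsq (h : R3 R -> R) (B : R) q : measurable_fun setT h -> L2 mu3 q -> 0 <= B ->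
  (forall xi, q xi != 0 -> `|h xi| <= B) -> nsq mu3 (fun xi => (h xi)%:C%C * q xi) <= B ^+ 2 * nsq mu3 q.
Proof.
move=> mh lq B0 hB; have lh := mult_L2 mh lq hB.
rewrite -lee_fin -(L2_fin lh) EFinM -(L2_fin lq); apply: le_sq.
- exact: sqr_ge0.
- exact: L2_meas lh.
- exact: L2_meas lq.
- move=> xi; rewrite abs2M abs2_real; have [->|/hB h0] := eqVneq (q xi) 0; first by rewrite abs20 !mulr0.
  rewrite ler_wpM2r ?abs2_ge0// -[leLHS]real_normK ?num_real//.
  by rewrite lerXn2r ?nnegrE//; apply: le_trans h0.
Qed.

Let small_square (B a e : R) : 0 <= B -> 0 <= a -> 0 < e -> exists dl : R, 0 < dl /\
  forall d : R, 0 <= d -> d < dl -> (B * d) ^+ 2 * a < e.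
Proof.
move=> B0 a0 e0; have K0 : 0 < B ^+ 2 * a + 1 by rewrite ltr_wpDl// mulr_ge0 ?sqr_ge0.
exists (Num.min 1 (e / (B ^+ 2 * a + 1))); split; first by rewrite lt_min ltr01 divr_gt0.
move=> d d0; rewrite lt_min => /andP[d1 de].
rewrite ltr_pdivlMr// in de; apply: le_lt_trans de.
apply: (@le_trans _ _ (d * (B ^+ 2 * a))); last by rewrite ler_wpM2l// lerDl.
rewrite exprMn -mulrA mulrCA ler_wpM2r ?mulr_ge0 ?sqr_ge0//.
by rewrite expr2 ler_piMr// ltW.
Qed.

Lemma mult_strong_derivative (th th' : R -> R3 R -> R) (B : R) q t : (forall r, measurable_fun setT (th r)) ->
  measurable_fun setT (th' t) -> L2 mu3 q -> 0 <= B ->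
  (forall r xi, q xi != 0 -> `|th r xi - th t xi - (r - t) * th' t xi| <= B * `|r - t| * `|r - t|) ->
  forall e, 0 < e -> exists dl : R, 0 < dl /\ forall r, r != t -> `|r - t| < dl ->
    nsq mu3 (fun xi => ((r - t)^-1)%:C%C * ((th r xi)%:C%C * q xi - (th t xi)%:C%C * q xi) - (th' t xi)%:C%C * q xi) < e.
Proof.
move=> mth mth' lq B0 hB e e0.
have [dl [dl0 hdl]] := small_square B0 (nsq_ge0 mu3 q) e0.
exists dl; split => // r rt r1.
pose h xi := (r - t)^-1 * (th r xi - th t xi - (r - t) * th' t xi).
have rt0 : r - t != 0 by rewrite subr_eq0.
rewrite (_ : (fun xi => _) = fun xi => (h xi)%:C%C * q xi); last first.
  apply/funext => xi; rewrite -mulrBl -rmorphB mulrA -rmorphM -mulrBl -rmorphB; congr (_%:C%C * _).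
  by rewrite /h; field.
have mh : measurable_fun setT h.
  by rewrite /h; apply: measurable_funM => //; apply: measurable_funB; [exact: measurable_funB|exact: measurable_funM].
apply: le_lt_trans (hdl _ (normr_ge0 _) r1); apply: mult_nsq => //; first by rewrite mulr_ge0.
by move=> xi qx; rewrite /h normrM normfV mulrC ler_pdivrMr ?normr_gt0//; exact: hB.
Qed.

Lemma mult_L2cont (th : R -> R3 R -> R) (L : R) q t : (forall r, measurable_fun setT (th r)) -> L2 mu3 q -> 0 <= L ->
  (forall r xi, q xi != 0 -> `|th r xi - th t xi| <= L * `|r - t|) ->
  L2cont_at mu3 (fun r xi => (th r xi)%:C%C * q xi) t.
Proof.
move=> mth lq L0 hL e e0.
have [dl [dl0 hdl]] := small_square L0 (nsq_ge0 mu3 q) e0.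
exists dl; split => // r r1.
rewrite (_ : (fun xi => _) = fun xi => (th r xi - th t xi)%:C%C * q xi); last first.
  by apply/funext => xi; rewrite -mulrBl -rmorphB.
apply: le_lt_trans (hdl _ (normr_ge0 _) r1); apply: mult_nsq => //; [exact: measurable_funB|exact: mulr_ge0|exact: hL].
Qed.

Section propagators.
Variables (N : R) (q : R3 R -> R[i]) (T : R).
Hypotheses (N0 : 0 <= N) (lq : L2 mu3 q) (q0 : forall xi, N ^+ 2 < dot3 xi xi -> q xi = 0).

(** Where [q] does not vanish [omega <= c * N], and [1 + x^2] dominates both [x] and [x^2]. *)
Let L := 1 + (c * N) ^+ 2.
Let L0 : 0 <= L. Proof. by rewrite addr_ge0// sqr_ge0. Qed.

Let omega_le xi : q xi != 0 -> omega xi <= L /\ omega xi ^+ 2 <= L.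
Proof.
move=> qx; have h : dot3 xi xi <= N ^+ 2 by rewrite leNgt; apply: contra qx => /q0 ->.
have h2 : omega xi ^+ 2 <= (c * N) ^+ 2 by rewrite omega_sq exprMn ler_wpM2l ?sqr_ge0.
have := omega_ge0 xi; rewrite /L; move: (omega xi) h2 => w h2 w0; split; [nra|lra].
Qed.

Let der_back (h : R -> R) (x d : R) : is_derive (T - x) (1 : R) h d ->
  is_derive x (1 : R) (fun t => h (T - t)) (- d).
Proof.
move=> dh; have da : is_derive x (1 : R) (fun t => T - t) (-1).
  by apply: der_eq (derB (dercst T x) (derid x)) _; rewrite sub0r.
by apply: der_eq (dercomp da dh) _; rewrite mulrN1.
Qed.

Let dcosT xi x : is_derive x (1 : R) (fun t => cosT T t xi) (omega xi ^+ 2 * sinT T x xi).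
Proof.
by apply: der_eq (der_back (der_cosw (omega xi) (T - x))) _; rewrite opprK.
Qed.

Let dsinT xi x : is_derive x (1 : R) (fun t => sinT T t xi) (- cosT T x xi).
Proof. exact: (der_back (der_sincw (omega xi) (T - x))). Qed.

Let dcosT2 xi x : is_derive x (1 : R) (fun t => - cosT T t xi) (- (omega xi ^+ 2 * sinT T x xi)).
Proof. exact: (derN (dcosT xi x)). Qed.

Let w2sin xi x : omega xi ^+ 2 * sinT T x xi = omega xi * sin (omega xi * (T - x)).
Proof.
by rewrite /sinT /sincw; case: eqVneq => [->|w0]; [rewrite expr0n !mul0r|field].
Qed.

Let w2sin_le xi x : q xi != 0 -> `|omega xi ^+ 2 * sinT T x xi| <= L.
Proof.
move=> /omega_le[h _]; rewrite w2sin normrM ger0_norm ?omega_ge0//.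
by apply: le_trans h; rewrite ler_piMr ?omega_ge0// sin_max.
Qed.

Let dw2sin xi x : is_derive x (1 : R) (fun t => omega xi ^+ 2 * sinT T t xi) (- (omega xi ^+ 2 * cosT T x xi)).
Proof. by apply: der_eq (derZ (omega xi ^+ 2) (dsinT xi x)) _; rewrite mulrN. Qed.

Lemma cosT_L2cont t : L2cont_at mu3 (fun r xi => (cosT T r xi)%:C%C * q xi) t.
Proof.
apply: (mult_L2cont (L := L) (th := cosT T)) => //; first exact: cosT_meas.
by move=> r xi qx; apply: (mean_value_le (dcosT xi)) => x _; exact: w2sin_le.
Qed.

Lemma sinT_L2cont t : L2cont_at mu3 (fun r xi => (sinT T r xi)%:C%C * q xi) t.
Proof.
apply: (mult_L2cont (L := 1) (th := sinT T)) => //; first exact: sinT_meas.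
by move=> r xi qx; apply: (mean_value_le (dsinT xi)) => x _; rewrite normrN cos_max.
Qed.

Lemma cosT_derivative t e : 0 < e -> exists dl : R, 0 < dl /\ forall r, r != t -> `|r - t| < dl ->
  nsq mu3 (fun xi => ((r - t)^-1)%:C%C * ((cosT T r xi)%:C%C * q xi - (cosT T t xi)%:C%C * q xi) -
    (omega xi ^+ 2 * sinT T t xi)%:C%C * q xi) < e.
Proof.
apply: (mult_strong_derivative (B := L) (th := cosT T) (th' := fun t xi => omega xi ^+ 2 * sinT T t xi)) => //.
- exact: cosT_meas.
- by apply: measurable_funM; [apply: measurable_funX; exact: omega_meas|exact: sinT_meas].
- move=> r xi qx; apply: (taylor_le r t (dcosT xi) (dw2sin xi)) => // x.
  rewrite normrN normrM ger0_norm ?sqr_ge0//; have [_ h] := omega_le qx.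
  by apply: le_trans h; rewrite ler_piMr ?sqr_ge0// cos_max.
Qed.

Lemma sinT_derivative t e : 0 < e -> exists dl : R, 0 < dl /\ forall r, r != t -> `|r - t| < dl ->
  nsq mu3 (fun xi => ((r - t)^-1)%:C%C * ((sinT T r xi)%:C%C * q xi - (sinT T t xi)%:C%C * q xi) -
    (- cosT T t xi)%:C%C * q xi) < e.
Proof.
apply: (mult_strong_derivative (B := L) (th := sinT T) (th' := fun t xi => - cosT T t xi)) => //.
- exact: sinT_meas.
- by apply: measurableT_comp => //; exact: cosT_meas.
- move=> r xi qx; apply: (taylor_le r t (dsinT xi) (dcosT2 xi)) => // x.
  by rewrite normrN w2sin_le.
Qed.

End propagators.

Section slices.
Variables (W Z : R -> R3 R -> R[i]).
Hypotheses (lW : forall t, L2 mu3 (W t)) (lZ : forall t, L2 mu3 (Z t)).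
Hypotheses (cW : forall t, L2cont_at mu3 W t) (cZ : forall t, L2cont_at mu3 Z t).
Hypothesis dW : forall t, t0 < t < t1 -> forall e, 0 < e -> exists dl : R, 0 < dl /\
  forall r, r != t -> `|r - t| < dl ->
    nsq mu3 (fun x => ((r - t)^-1)%:C%C * (W r x - W t x) - Z t x) < e.
Hypothesis ode : forall N q, 0 <= N -> L2 mu3 q -> (forall xi, N ^+ 2 < dot3 xi xi -> q xi = 0) ->
  forall eta eta1 eta2 : R -> R, smooth1 eta -> smooth1 eta1 -> smooth1 eta2 ->
  (forall x : R, is_derive x (1 : R) eta (eta1 x)) -> (forall x : R, is_derive x (1 : R) eta1 (eta2 x)) ->
  forall a b, t0 < a -> b < t1 -> (forall x, x \notin `[a, b] -> eta x = 0) ->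
  \int[leb1 R]_t (eta2 t * rip mu3 (W t) q) +
  c ^+ 2 * \int[leb1 R]_t (eta t * rip mu3 (W t) (fun xi => (dot3 xi xi)%:C%C * q xi)) = 0.

Let ripC u v : L2 mu3 u -> L2 mu3 v -> rip mu3 u v = rip mu3 v u.
Proof. by move=> lu lv; rewrite /rip ipC// cRe_conj. Qed.

Lemma slice_derivative q t : L2 mu3 q -> t0 < t < t1 ->
  is_derive t (1 : R) (fun s => rip mu3 (W s) q) (rip mu3 (Z t) q).
Proof.
move=> lq It.
have := rip_derive (A := fun=> q) (fun=> lq) lW (lZ t) (L2cont_cst t lq) (dW It) (dercst _ t).
rewrite add0r ripC//; congr is_derive; apply/funext => s; exact: ripC.
Qed.

(** For a test function [f], integration by parts gives that the integrals of [f'' <W, q>] and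
    [f' <Z, q>] cancel. Comparing with the weak equation shows that [<Z, q>] has the required weak
    derivative, and it is continuous. *)
Lemma slice_derivative2 N q t : 0 <= N -> L2 mu3 q -> (forall xi, N ^+ 2 < dot3 xi xi -> q xi = 0) -> t0 < t < t1 -> is_derive t (1 : R) (fun s => rip mu3 (Z s) q)
  (- c ^+ 2 * rip mu3 (W t) (fun xi => (dot3 xi xi)%:C%C * q xi)).
Proof.
move=> N0 lq q0 It; have lhq := bounded_support_L2 lq q0.
have cz := rip_cst_continuous lZ cZ lq; have cw := rip_cst_continuous lW cW lq.
apply: (weak_derivative (t0 := t0) (t1 := t1) cz (rip_cst_continuous lW cW lhq)) => //.
move=> f f' df sf sf' [a [b [ta bt f0]]].
have [f2 [sf2 df']] := smooth1_der sf'.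
have f'0 := der_supp df f0; have f20 := der_supp df' f'0.
have cf' := smooth1_cont sf'; have cf2 := smooth1_cont sf2.
have supp := fun h => @csupp_itv R h a b.
have h := ode N0 lq q0 sf sf' sf2 df df' ta bt f0.
have gen (x y z : R) : x + z = 0 -> x + y = 0 -> y = z by move=> h1 h2; apply: (addrI x); rewrite h1 h2.
apply: (gen _ _ _ h).
rewrite -RintegralD//; last 2 first.
- by apply: csupp_integrable; [exact: contM|exact: csuppM (supp _ f20)].
- by apply: csupp_integrable; [exact: contM|exact: csuppM (supp _ f'0)].
apply: (csupp_int_der (f := fun t => f' t * rip mu3 (W t) q)); last exact: csuppM (supp _ f'0).
- move=> {It} {}t; have [tab|tab] := boolP (t \in `[a, b]).
    have It' : t0 < t < t1 by move: tab; rewrite in_itv /= => /andP[h1 h2]; rewrite (lt_le_trans ta h1) (le_lt_trans h2 bt).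
    exact: derM (df' t) (slice_derivative lq It').
  rewrite f20// f'0// !mul0r addr0; apply: near_eq_is_derive (@dercst R 0 t).
  move: tab; rewrite in_itv /= negb_and -!ltNge => /orP[tab|tab]; near=> y; rewrite f'0 ?mul0r// in_itv /= negb_and -!ltNge.
  - by apply/orP; left; near: y; exact: lt_nbhsl.
  - by apply/orP; right; near: y; exact: lt_nbhsr.
- by apply: contD; exact: contM.
Unshelve. all: by end_near. Qed.

Section bounded_support.
Variables (N : R) (q : R3 R -> R[i]).
Hypotheses (N0 : 0 <= N) (lq : L2 mu3 q) (q0 : forall xi, N ^+ 2 < dot3 xi xi -> q xi = 0).

(** Duality with the backward evolution: the pairing of the solution and its velocity with the
    propagated [q] has derivative 0, since the two equations are adjoint to each other. Its values
    at [T] and [t0] are the two sides. *)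
Lemma slice_formula_test T : t0 < T <= t1 -> rip mu3 (W T) q =
  rip mu3 (fun xi => (cosT T t0 xi)%:C%C * W t0 xi + (sinT T t0 xi)%:C%C * Z t0 xi) q.
Proof.
move=> /andP[t0T Tt1].
pose Phi t (xi : R3 R) := (cosT T t xi)%:C%C * q xi.
pose Psi t (xi : R3 R) := (sinT T t xi)%:C%C * q xi.
have lPhi t : L2 mu3 (Phi t) by exact: cosT_L2.
have lPsi t : L2 mu3 (Psi t) by exact: sinT_L2.
pose b t := rip mu3 (W t) (Phi t) + rip mu3 (Z t) (Psi t).
have cb : continuous b.
  apply: (contD (f := fun t => rip mu3 (W t) (Phi t)) (g := fun t => rip mu3 (Z t) (Psi t))) => t.
    exact: rip_continuous lW lPhi (cW t) (cosT_L2cont T lq q0 t).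
  exact: rip_continuous lZ lPsi (cZ t) (sinT_L2cont T lq t).
have sPhi t xi : N ^+ 2 < dot3 xi xi -> Phi t xi = 0 by move=> /q0; rewrite /Phi => ->; rewrite mulr0.
have sPsi t xi : N ^+ 2 < dot3 xi xi -> Psi t xi = 0 by move=> /q0; rewrite /Psi => ->; rewrite mulr0.
have db t : t0 < t < T -> is_derive t (1 : R) b 0.
  move=> /andP[t0t tT]; have It : t0 < t < t1 by rewrite t0t (lt_le_trans tT).
  have lh := bounded_support_L2 (lPsi t) (sPsi t).
  have lw : L2 mu3 (fun xi => (omega xi ^+ 2 * sinT T t xi)%:C%C * q xi).
    rewrite (_ : (fun xi => _) = fun xi => (c ^+ 2)%:C%C * ((dot3 xi xi)%:C%C * Psi t xi)); first exact: L2Z.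
    by apply/funext => xi; rewrite omega_sq /Psi !rmorphM /=; ring.
  have lc : L2 mu3 (fun xi => (- cosT T t xi)%:C%C * q xi).
    rewrite (_ : (fun xi => _) = fun xi => - Phi t xi); first exact: L2N.
    by apply/funext => xi; rewrite /Phi rmorphN mulNr.
  have d1 := rip_derive lW lPhi lw (cW t) (cosT_derivative T lq q0 t) (slice_derivative (lPhi t) It).
  have d2 := rip_derive lZ lPsi lc (cZ t) (sinT_derivative T lq q0 t) (slice_derivative2 N0 (lPsi t) (sPsi t) It).
  apply: der_eq (derD d1 d2) _.
  have -> : rip mu3 (W t) (fun xi => (omega xi ^+ 2 * sinT T t xi)%:C%C * q xi) =
      c ^+ 2 * rip mu3 (W t) (fun xi => (dot3 xi xi)%:C%C * Psi t xi).
    rewrite -ripZr//; congr rip; apply/funext => xi.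
    by rewrite omega_sq /Psi !rmorphM /=; ring.
  have -> : rip mu3 (Z t) (fun xi => (- cosT T t xi)%:C%C * q xi) = -1 * rip mu3 (Z t) (Phi t).
    rewrite -ripZr//; congr rip; apply/funext => xi; rewrite /Phi.
    by rewrite !rmorphN /=; ring.
  ring.
have [x] := MVT t0T (fun t It => db t It) (continuous_subspaceT cb).
rewrite mul0r => _ /eqP; rewrite subr_eq0 => /eqP.
have -> : b T = rip mu3 (W T) q.
  rewrite /b; have -> : Phi T = q.
    by apply/funext => xi; rewrite /Phi /cosT subrr mulr0 cos0 mul1r.
  have -> : Psi T = fun xi => (0 : R)%:C%C * q xi.
    by apply/funext => xi; rewrite /Psi /sinT subrr sincw0.
  by rewrite ripZr// mul0r addr0.
move=> ->; rewrite /b /rip -!cReD.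
have l1 := cosT_L2 T t0 (lW t0); have l2 := sinT_L2 T t0 (lZ t0).
rewrite (ipDl l1 l2 lq); congr (cRe (_ + _)); congr cint; apply/funext => xi;
by rewrite ?/Phi ?/Psi conjcM conjc_real mulrA [_ * (_)%:C%C]mulrC.
Qed.

End bounded_support.

Lemma slice_formula T : t0 <= T <= t1 -> {ae mu3, forall xi,
  W T xi = (cosT T t0 xi)%:C%C * W t0 xi + (sinT T t0 xi)%:C%C * Z t0 xi}.
Proof.
move=> /andP[]; rewrite le_eqVlt => /orP[/eqP <- _|t0T Tt1].
  apply: aeW => xi; rewrite /cosT /sinT subrr mulr0 cos0 sincw0 mul1r.
  by rewrite (_ : (0 : R)%:C%C = 0)// mul0r addr0.
pose U xi := (cosT T t0 xi)%:C%C * W t0 xi + (sinT T t0 xi)%:C%C * Z t0 xi.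
have lU : L2 mu3 U := L2D (cosT_L2 T t0 (lW t0)) (sinT_L2 T t0 (lZ t0)).
pose D xi := W T xi - U xi; have lD : L2 mu3 D := L2B (lW T) lU.
(* The truncation of the difference [D] is itself an admissible test function, and the pairing of
   [D] with it is its square norm. *)
have z N : 0 <= N -> nsq mu3 (trunc dot3 N D) = 0.
  move=> N0; have lt := trunc_L2 P3 N lD.
  have tD xi : N ^+ 2 < dot3 xi xi -> trunc dot3 N D xi = 0 by move=> h; rewrite /trunc leNgt h.
  have IT : t0 < T <= t1 by rewrite t0T.
  have h := slice_formula_test N0 lt tD IT.
  apply: (eq_trans (esym (congr1 (@cRe R) (ip_trunc P3 N lD)))).
  by apply: (eq_trans (ripBl (lW T) lU lt)); rewrite h subrr.
have n0 : nsq mu3 D <= 0.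
  apply/ler_addgt0Pl => e e0; rewrite addr0.
  have [N [N0 hN]] := trunc_cvg P3 lD e0.
  have := hN _ (lexx N); rewrite (nsq_sub_trunc P3 N lD) z// subr0; exact: ltW.
by apply: filterS (nsq0P lD n0) => xi /eqP; rewrite subr_eq0 => /eqP.
Qed.

End slices.
End wave_solution_formula.

(** * The light ray transform *)

Section slices_of_solution.
Variable R : realType.
Variables (t0 t1 c s : R).
Hypotheses (t01 : t0 < t1) (c0 : 0 < c) (s0 : 0 <= s).
Local Notation mu3 := (leb3 R).
Let P3 := plancherel3 R.

Definition propagate (w1 w2 : R3 R -> R[i]) (tau : R) (xi : R3 R) : R[i] :=
  (cos (omega c xi * tau))%:C%C * w1 xi + (sincw (omega c xi) tau)%:C%C * w2 xi.

Lemma wave_slices K f1 f2 f : cauchy_data s K f1 f2 -> wave_solution t0 t1 c s f1 f2 f ->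
  exists w1 w2, [/\ is_fourier mu3 dot3 f1 w1, is_fourier mu3 dot3 f2 w2 &
   forall t, t0 <= t <= t1 -> is_fourier mu3 dot3 (fun x => f (t, x)) (propagate w1 w2 (t - t0))].
Proof.
move=> [n12 _ _] [mf [cf [wf [f01 [g [cg dg g02]]]]]].
have s1 : 0 <= s + 1 by rewrite addr_ge0.
have [W [hW cW]] := continuous_in_sobolev_fourier t01 s1 cf.
have [Z [hZ cZ]] := continuous_in_sobolev_fourier t01 s0 cg.
have lW t := is_fourier_L2r (hW t); have lZ t := is_fourier_L2r (hZ t).
have dW := time_derivative_fourier s0 hW hZ dg.
have fin (sigma : R) u : (sobolev_norm3 sigma u < +oo)%E -> exists w, is_fourier mu3 dot3 u w.
  by move=> /ereal_inf_lt[_ [w hw _] _]; exists w.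
have n0 (sigma : R) u : (0 <= sobolev_norm3 sigma u)%E.
  by apply: le_ereal_inf_tmp => _ [w _ <-]; exact: L2norm_ge0.
have [[v1 hv1] [v2 hv2]] : (exists w, is_fourier mu3 dot3 f1 w) /\ (exists w, is_fourier mu3 dot3 f2 w).
  split; apply: fin; apply: le_lt_trans n12; [exact: leeDl|exact: leeDr].
have h0 : t0 <= t0 <= t1 by rewrite lexx ltW.
have hW0 := hW t0; have hZ0 := hZ t0; rewrite !(clipE h0) in hW0 hZ0.
exists (W t0), (Z t0); split.
- exact: (is_fourier_ae P3 (L2_meas (is_fourier_L2l hv1)) f01 hW0).
- exact: (is_fourier_ae P3 (L2_meas (is_fourier_L2l hv2)) g02 hZ0).
move=> t It; have := hW t; rewrite clipE// => hWt.
have lU : L2 mu3 (propagate (W t0) (Z t0) (t - t0)) := L2D (cosT_L2 c t t0 (lW t0)) (sinT_L2 c0 t t0 (lZ t0)).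
apply: (is_fourier_ae_r P3 (L2_meas lU) _ hWt).
apply: (slice_formula c0 lW lZ cW cZ dW _ It).
move=> N q N0 lq q0 eta eta1 eta2 seta seta1 seta2 deta deta1 a b ta bt eta0.
have [rho1 [srho1 drho]] := smooth1_der (smooth1_bump (N + 1)^-1).
have [rho2 [srho2 drho1]] := smooth1_der srho1.
exact: (weak_ode t01 mf hW cW N0 lq q0 srho1 srho2 drho drho1 wf seta seta2 deta deta1 ta bt eta0).
Qed.

End slices_of_solution.

Section light_rays.
Variable R : realType.
Variables (t0 t1 c : R).
Hypotheses (t01 : t0 < t1) (c0 : 0 < c).
Local Notation mu3 := (leb3 R).
Local Notation T := (t1 - t0).
Local Notation C3 := (2 * pi * (2 * pi) * (2 * pi) : R).
Let P3 := plancherel3 R.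
Let C30 : 0 < C3 := planch_gt0 P3.
Let T0 : 0 < T. Proof. by rewrite subr_gt0. Qed.
Variables (f : R4 R -> R[i]) (w1 w2 : R3 R -> R[i]).
Hypothesis mf : cmeasurable (M t0 t1) f.
Hypotheses (lw1 : L2 mu3 w1) (lw2 : L2 mu3 w2).
Local Notation U := (propagate c w1 w2).
Hypothesis hU : forall t, t0 <= t <= t1 -> is_fourier mu3 dot3 (fun x => f (t, x)) (U (t - t0)).
Local Notation F := (fourier mu3 dot3).
Local Notation slab := (cut (M t0 t1) f).
Implicit Types (v : R3 R) (tau : R).

Definition propagate_bound (xi : R3 R) : R := abs1 (w1 xi) + T * abs1 (w2 xi).

Lemma propagate_le tau xi : 0 <= tau <= T -> abs1 (U tau xi) <= propagate_bound xi.
Proof.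
move=> /andP[h1 h2]; apply: (le_trans (abs1D _ _)); rewrite /propagate_bound.
apply: lerD; apply: (le_trans (abs1M _ _)); rewrite abs1_real.
  by rewrite -[leRHS]mul1r ler_wpM2r ?abs1_ge0// cos_max.
rewrite ler_wpM2r ?abs1_ge0//; apply: (le_trans (sincw_le _ _)).
by rewrite ger0_norm.
Qed.

Lemma propagate_meas : cmeas (fun p : R4 R => U p.1 p.2).
Proof.
have mo : measurable_fun setT (fun p : R4 R => omega c p.2).
  by apply: (measurableT_comp (omega_meas c)); exact: measurable_snd.
apply: cmeasD; apply: cmeasM.
- apply: cmeas_real; apply: (measurableT_comp (contmeas (@continuous_cos R))); apply: measurable_funM => //.
- by apply: (cmeas_comp (f := snd) _ (L2_meas lw1)).
- by apply: cmeas_real; apply: sincw_meas => // p; exact: omega_ge0.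
- by apply: (cmeas_comp (f := snd) _ (L2_meas lw2)).
Qed.

Definition ray_data v (p : R4 R) : R[i] := slab (t0 + p.1, p.2 + p.1 *: v).

Lemma in_M tau x : 0 <= tau <= T -> slab (t0 + tau, x) = f (t0 + tau, x).
Proof. by move=> h; rewrite /cut mem_set// /M /=; lra. Qed.
Lemma out_M tau x : ~~ (0 <= tau <= T) -> slab (t0 + tau, x) = 0.
Proof.
move=> h; rewrite /cut memNset//; apply: contraNnot h; rewrite /M /= => /andP[h1 h2]; apply/andP; split; lra.
Qed.

Lemma light_rayE y v : light_ray_transform t0 t1 f y v = cint (leb1 R) (fun tau => ray_data v (tau, y)).
Proof.
rewrite /light_ray_transform cint_cut//; congr cint; apply/funext => tau; rewrite /ray_data /=.
rewrite {1}/cut; case: ifPn => [|]; first by rewrite inE /= in_itv /= => h; rewrite in_M.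
by rewrite notin_setE /= in_itv /= => /negP h; rewrite out_M.
Qed.

Lemma scale3_meas v : measurable_fun setT (fun p : R4 R => (t0 + p.1, p.2 + p.1 *: v) : R4 R).
Proof.
rewrite (_ : (fun p => _) = fun p : R4 R => (t0 + p.1, ((p.2.1.1 + p.1 * v.1.1, p.2.1.2 + p.1 * v.1.2), p.2.2 + p.1 * v.2)))//.
by do 3?[apply: measurable_fun_pair]; apply: measurable_funD; mfun.
Qed.

Lemma slab_meas : cmeas slab.
Proof. exact: cmeas_cut (measurable_M t0 t1) mf. Qed.

Lemma ray_data_meas v : cmeas (ray_data v).
Proof. exact: (cmeas_comp (scale3_meas v) slab_meas). Qed.

Lemma slab_slice tau : 0 <= tau <= T -> is_fourier mu3 dot3 (fun x => slab (t0 + tau, x)) (U tau).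
Proof.
move=> h; have It : t0 <= t0 + tau <= t1 by lra.
have := hU It; rewrite addrAC subrr add0r; congr is_fourier.
by apply/funext => x; rewrite in_M.
Qed.

Lemma U_sq : exists2 K : R, 0 <= K & forall tau, 0 <= tau <= T -> L2 mu3 (U tau) /\ nsq mu3 (U tau) <= K.
Proof.
exists (2 * nsq mu3 w1 + 2 * (T ^+ 2 * nsq mu3 w2)).
  apply: addr_ge0; apply: mulr_ge0 => //; first exact: nsq_ge0.
  apply: mulr_ge0; [exact: sqr_ge0|exact: nsq_ge0].
move=> tau /andP[h1 h2]; have h3 := omega_meas c.
have mc : measurable_fun setT (fun xi => cos (omega c xi * tau)).
  by apply: (measurableT_comp (contmeas (@continuous_cos R))); exact: measurable_funM.
have ms : measurable_fun setT (fun xi => sincw (omega c xi) tau).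
  by apply: sincw_meas => // xi; exact: omega_ge0.
have c1 xi : w1 xi != 0 -> `|cos (omega c xi * tau)| <= 1 by move=> _; exact: cos_max.
have c2 xi : w2 xi != 0 -> `|sincw (omega c xi) tau| <= T.
  by move=> _; apply: (le_trans (sincw_le _ _)); rewrite ger0_norm.
have l1 := mult_L2 mc lw1 c1; have l2 := mult_L2 ms lw2 c2; split; first exact: L2D l1 l2.
apply: (le_trans (nsqD_le l1 l2)).
have b1 := mult_nsq mc lw1 ler01 c1; have b2 := mult_nsq ms lw2 (ltW T0) c2.
rewrite expr1n mul1r in b1; lra.
Qed.

Lemma ray_data_L2 v : L2 (leb4 R) (ray_data v).
Proof.
have [K K0 hK] := U_sq.
apply: (L2_slab T0 (K := C3^-1 * K)); first exact: ray_data_meas.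
- move=> tau h; have hs := slab_slice h.
  have -> : (fun x => ray_data v (tau, x)) = fun x => (fun x => slab (t0 + tau, x)) (x + tau *: v) by [].
  rewrite (mp_sq (shift3_mp (tau *: v)) (L2_meas (is_fourier_L2l hs))) (L2_fin (is_fourier_L2l hs)) lee_fin.
  by rewrite mulrC ler_pdivlMr// mulrC -(is_fourier_nsq P3 hs) (hK _ h).2.
- by move=> tau x h; rewrite /ray_data /= out_M.
Qed.

(** The transform in space of [ray_data v] at a fixed time: moving the slice by [tau v] multiplies
    its transform by [cis (tau xi.v)]. *)
Definition ray_fourier v (p : R4 R) : R[i] :=
  if 0 <= p.1 <= T then cis (p.1 * dot3 p.2 v) * U p.1 p.2 else 0.

Definition ray_symbol (xi v : R3 R) : R[i] := cint (leb1 R) (fun tau => ray_fourier v (tau, xi)).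

Let I01 : R1 R -> R[i] := cut `[0, T]%classic (fun=> 1).
Let I01E tau : I01 tau = if 0 <= tau <= T then 1 else 0.
Proof. by rewrite /I01 /cut (_ : (tau \in _) = (tau \in `[0, T])) ?mem_setE// in_itv. Qed.
Let I01_L2 : L2 (leb1 R) I01.
Proof.
split; first by apply: cmeas_cutT => //; exact: cmeas_cst.
rewrite /sq (_ : (fun x => _) = (cst 1%E) \_ `[0, T]).
  by rewrite -integral_mkcond integral_cst//= lebesgue_measure_itv /= lte_fin T0 mul1e -EFinB ltry.
apply/funext => x; rewrite patchE /I01 /cut; case: ifP => _; last by rewrite abs20.
by rewrite (abs2_real 1) expr1n.
Qed.

(** A product of [u] with a function of space alone is integrable because [u] lives on a bounded
    interval of times: [u] is paired with the tensor product of the indicator of that interval and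
    [k], and both are in [L2]. *)
Lemma slab_swap (u : R4 R -> R[i]) k : L2 (leb4 R) u -> L2 mu3 k ->
  (forall tau x, ~~ (0 <= tau <= T) -> u (tau, x) = 0) ->
  cintegrable (leb4 R) (fun p => u p * conjc (k p.2)) /\
  cint mu3 (fun y => cint (leb1 R) (fun tau => u (tau, y)) * conjc (k y)) =
  cint (leb1 R) (fun tau => cint mu3 (fun y => u (tau, y) * conjc (k y))).
Proof.
move=> lu lk u0.
have uI tau y : u (tau, y) * conjc (I01 tau) = u (tau, y).
  by rewrite I01E; case: ifPn => [_|/u0 ->]; rewrite ?mul0r// conjc1 mulr1.
have iH : cintegrable (leb4 R) (fun p => u p * conjc (k p.2)).
  have := L2_mulc lu (L2_tensor I01_L2 lk); congr cintegrable; apply/funext => -[tau y] /=.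
  by rewrite conjcM mulrA uI.
split => //; rewrite (cint_swap iH); apply: cint_ae.
- apply: cmeasM; last exact: cmeas_conj (L2_meas lk).
  exact: (cmeas_cint2 (leb1 R) (L2_meas lu)).
- exact: (cmeas_cint2 (leb1 R) (cintegrable_meas iH)).
- apply: filterS (L2_ae2 lu) => y ly; rewrite -cintZr//.
  by have := L2_mulc ly I01_L2; congr cintegrable; apply/funext => tau; rewrite uI.
Qed.

Lemma ray_fourier_L2 v : L2 (leb4 R) (ray_fourier v).
Proof.
have [K K0 hK] := U_sq.
apply: (L2_slab T0 (K := K)).
- rewrite (_ : ray_fourier v = cut (M 0 T) (fun p : R4 R => cis (p.1 * dot3 p.2 v) * U p.1 p.2)).
    apply: cmeas_cutT; first exact: measurable_M.
    apply: cmeasM propagate_meas; apply: cmeas_cis; apply: measurable_funM => //.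
    by apply: (measurableT_comp (dot_measl P3 v)); exact: measurable_snd.
  apply/funext => p; rewrite /ray_fourier /cut; case: ifPn => h; first by rewrite mem_set.
  by rewrite memNset//=; exact/negP.
- move=> tau h; rewrite /ray_fourier /= h.
  have -> : sq mu3 (fun x => (cis (tau * dot3 x v) * U tau x)%R) = sq mu3 (U tau).
    by rewrite /sq; apply: eq_integral => x _; rewrite abs2M abs2_cis mul1r.
  by have [lU hb] := hK _ h; rewrite (L2_fin lU) lee_fin.
- by move=> tau x h; rewrite /ray_fourier /= (negbTE h).
Qed.

(** By Fubini the claim reduces to one time, where the displacement by [tau v] is moved to the test
    function and the Fourier pair of the slice applies. In this form no square integrability of the
    light ray transform in [y] is asked for. *)
Lemma xray_pairing v k : cintegrable mu3 k /\ L2 mu3 k ->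
  C3%:C%C * cint mu3 (fun y => light_ray_transform t0 t1 f y v * conjc (k y)) =
  cint mu3 (fun xi => ray_symbol xi v * conjc (F k xi)).
Proof.
move=> lk; have lFk := F_L2 P3 lk.
have d0 tau x : ~~ (0 <= tau <= T) -> ray_data v (tau, x) = 0 by move=> h; rewrite /ray_data /= out_M.
have r0 tau x : ~~ (0 <= tau <= T) -> ray_fourier v (tau, x) = 0 by move=> h; rewrite /ray_fourier /= (negbTE h).
have [iH eH] := slab_swap (ray_data_L2 v) lk.2 d0.
have [iG eG] := slab_swap (ray_fourier_L2 v) lFk r0.
rewrite (_ : (fun y => light_ray_transform t0 t1 f y v * conjc (k y)) =
  fun y => cint (leb1 R) (fun tau => ray_data v (tau, y)) * conjc (k y)); last first.
  by apply/funext => y; rewrite light_rayE.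
rewrite eH eG -(cintZ _ (cintegrable_fubini1 iH)); congr cint; apply/funext => tau /=.
have [h|h] := boolP (0 <= tau <= T); last first.
  rewrite (_ : (fun y => _) = fun=> 0); last by apply/funext => y; rewrite d0// mul0r.
  rewrite [in RHS](_ : (fun y => _) = fun=> 0); last by apply/funext => y; rewrite r0// mul0r.
  by rewrite cint0 mulr0.
pose kt x := k (x - tau *: v).
have lkt : cintegrable mu3 kt /\ L2 mu3 kt.
  by split; [exact: (mp_cintegrable (shift3_mp (- (tau *: v))) lk.1)|exact: (mp_L2 (shift3_mp (- (tau *: v))) lk.2)].
have hs := slab_slice h; have [lsl _ hp] := is_fourier_pair P3 hs.
have e1 : cint mu3 (fun y => ray_data v (tau, y) * conjc (k y)) = ip mu3 (fun x => slab (t0 + tau, x)) kt.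
  rewrite /ip -(mp_cint (shift3_mp (tau *: v)) (L2_mulc lsl lkt.2)).
  by congr cint; apply/funext => y; rewrite /kt addrK.
rewrite e1 -(hp _ lkt); congr cint; apply/funext => xi.
rewrite (fourier_shift3 _ _ lk.1) conjcM -cisN opprK /ray_fourier /= h.
have -> : dot3 (tau *: v) xi = tau * dot3 xi v by rewrite /dot3 /dot2 /= /GRing.scale /=; ring.
ring.
Qed.

Lemma ray_symbol_le xi v : abs1 (ray_symbol xi v) <= 2 * T * propagate_bound xi.
Proof.
have b0 : 0 <= propagate_bound xi by rewrite addr_ge0 ?mulr_ge0 ?abs1_ge0// ltW.
have mr : cmeas (fun tau => ray_fourier v (tau, xi)).
  exact: (cmeas_section2 xi (L2_meas (ray_fourier_L2 v))).
have le1 tau : abs1 (ray_fourier v (tau, xi)) <= 2 * propagate_bound xi * \1_`[0, T]%classic (tau : R1 R).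
  rewrite indicE (_ : (tau \in `[0, T]%classic) = (0 <= tau <= T)); last by rewrite mem_setE in_itv.
  rewrite /ray_fourier /=; case: ifPn => h; last by rewrite mulr0 /abs1 /= normr0 addr0.
  rewrite mulr1; apply: (le_trans (abs1M _ _)); apply: ler_pM; rewrite ?abs1_ge0// ?abs1_cis//.
  exact: propagate_le.
have ii := integrableZl measurableT (2 * propagate_bound xi) (@integrable_indic_itv R 0 T true false).
have ir : cintegrable (leb1 R) (fun tau => ray_fourier v (tau, xi)).
  by apply: (cintegrable_le (g := fun tau : R1 R => 2 * propagate_bound xi * \1_`[0, T]%classic tau) mr _ le1).
rewrite -lee_fin; apply: (le_trans (abs1_cint ir)).
have -> : (2 * T * propagate_bound xi)%:E =
    (\int[leb1 R]_tau ((2 * propagate_bound xi * \1_`[0%R, T]%classic (tau : R1 R))%R)%:E)%E.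
  rewrite (_ : (fun tau : R1 R => _%:E) = (cst (2 * propagate_bound xi)%:E) \_ `[0, T]).
    rewrite -integral_mkcond integral_cst//= lebesgue_measure_itv /= lte_fin T0 -EFinB -EFinM subr0.
    by rewrite mulrAC.
  by apply/funext => tau; rewrite patchE indicE; case: (_ \in _); rewrite ?mulr1 ?mulr0.
apply: ge0_le_integral => //.
- by move=> x _; rewrite lee_fin abs1_ge0.
- by apply/measurable_EFinP; exact: measurable_abs1.
- by apply/measurable_EFinP; apply: measurable_funM => //; exact: measurable_indic.
- by move=> x _; rewrite lee_fin le1.
Qed.

End light_rays.

Lemma measurable_inv_ge0 d (T : measurableType d) (R : realType) (h : T -> R) :
  measurable_fun setT h -> (forall x, 0 <= h x) -> measurable_fun setT (fun x => (h x)^-1).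
Proof.
move=> mh h0; rewrite (_ : (fun x => _) = fun x => (h x) `^ (-1)); last first.
  by apply/funext => x; rewrite powR_inv1.
by apply: (@measurableT_comp _ _ _ _ _ _ (fun x : R => x `^ (-1))) => //; exact: measurable_powR.
Qed.

(** * The charts of the sphere *)

Section chart_functions.
Variable R : realType.
Implicit Types (e : bool) (z : R2 R).

Lemma dot2_ge0 z : 0 <= dot2 z z.
Proof. exact: dot_ge0 (plancherel2 R) z. Qed.

Lemma stereo_den z : 0 < 1 + dot2 z z.
Proof. by rewrite ltr_pwDl// dot2_ge0. Qed.

Lemma dot2_meas : measurable_fun setT (fun z : R2 R => dot2 z z).
Proof. exact: dot_diag_meas (plancherel2 R). Qed.

Lemma stereo_meas e : measurable_fun setT (stereo e : R2 R -> R3 R).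
Proof.
have mi : measurable_fun setT (fun z : R2 R => (1 + dot2 z z)^-1).
  apply: measurable_inv_ge0; last by move=> z; exact/ltW/stereo_den.
  by apply: measurable_funD => //; exact: dot2_meas.
rewrite /stereo; apply: measurable_fun_pair; first apply: measurable_fun_pair.
- by apply: measurable_funM => //; mfun.
- by apply: measurable_funM => //; mfun.
- apply: measurable_funM => //; apply: measurable_funM => //; apply: measurable_funB => //; exact: dot2_meas.
Qed.

Lemma flat_den (a : R) : 0 < flat (2^-1 + a) + flat (2^-1 - a).
Proof.
have [h|h] := ltP 0 (2^-1 + a); first by rewrite ltr_pwDl ?flat_gt0 ?flat_ge0.
by rewrite ltr_wpDl ?flat_ge0// flat_gt0//; lra.
Qed.

Definition chi e z : R := cutoff e (stereo e z).

Lemma cutoff_meas e : measurable_fun setT (@cutoff R e).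
Proof.
have cf : continuous (@flat R) := smooth1_cont (smooth1_flat R).
have ma : measurable_fun setT (fun v : R3 R => (-1) ^+ e * v.2 : R) by apply: measurable_funM => //; exact: measurable_snd.
have m1 : measurable_fun setT (fun v : R3 R => flat (2^-1 + (-1) ^+ e * v.2)).
  by apply: (measurableT_comp (contmeas cf)); exact: measurable_funD.
have m2 : measurable_fun setT (fun v : R3 R => flat (2^-1 - (-1) ^+ e * v.2)).
  by apply: (measurableT_comp (contmeas cf)); exact: measurable_funB.
apply: measurable_funM => //; apply: measurable_inv_ge0; first exact: measurable_funD.
by move=> v; exact/ltW/flat_den.
Qed.

Lemma chi_meas e : measurable_fun setT (chi e).
Proof. exact: (measurableT_comp (cutoff_meas e) (stereo_meas e)). Qed.

Lemma chi_ge0 e z : 0 <= chi e z.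
Proof. by rewrite divr_ge0 ?flat_ge0// ltW// flat_den. Qed.

Lemma chi_le1 e z : chi e z <= 1.
Proof. by rewrite ler_pdivrMr ?flat_den// mul1r lerDl flat_ge0. Qed.

Lemma sign_stereo e z : (-1) ^+ e * (stereo e z).2 = (1 - dot2 z z) / (1 + dot2 z z).
Proof. by rewrite /stereo /= mulrA -exprD addnn -mul2n exprM sqrrN expr1n expr1n mul1r. Qed.

(** [|z|^2 = 3] is the parallel at height [-1/2] in the chart, where the cutoff ends. *)
Lemma chi_out e z : 3 <= dot2 z z -> chi e z = 0.
Proof.
move=> h; rewrite /chi /cutoff flat_eq0 ?mul0r// sign_stereo -lerBrDl sub0r ler_pdivrMr ?stereo_den//; lra.
Qed.

(** [|z|^2 <= 5/3] means height at least [-1/4]; the numerator is then at least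
    [flat (1/4) = exp(-4)], while the denominator is at most 2. *)
Lemma chi_ge e z : dot2 z z <= 5 / 3 -> expR (- 4) / 2 <= chi e z.
Proof.
move=> h; rewrite /chi /cutoff; set a := (-1) ^+ e * _.
have ha : - 4^-1 <= a by rewrite /a sign_stereo ler_pdivlMr ?stereo_den//; lra.
have hf : expR (- 4) <= flat (2^-1 + a).
  have x0 : 0 < 2^-1 + a by lra.
  rewrite /flat x0 ler_expR lerN2 -[leRHS]invrK lef_pV2 ?posrE//; lra.
have f1 (x : R) : flat x <= 1.
  by rewrite /flat; case: ifPn => // x0; rewrite -(@expR0 R) ler_expR oppr_le0 invr_ge0 ltW.
rewrite ler_pdivlMr ?flat_den//; have := f1 (2^-1 + a); have := f1 (2^-1 - a).
have := expR_gt0 (- 4 : R); have := flat_ge0 (2^-1 - a).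
move: hf; move: (expR _) (flat (2^-1 + a)) (flat (2^-1 - a)) => E x y *.
have : E * (x + y) <= E * 2 by rewrite ler_wpM2l//; lra.
lra.
Qed.

End chart_functions.

(** * The symbol of the light ray transform in a chart *)

Section chart_symbols.
Variable R : realType.
Variables (t0 t1 c : R).
Hypotheses (t01 : t0 < t1) (c0 : 0 < c).
Local Notation mu2 := (leb2 R).
Local Notation mu3 := (leb3 R).
Local Notation mu5 := (leb5 R).
Local Notation T := (t1 - t0).
Local Notation C3 := (2 * pi * (2 * pi) * (2 * pi) : R).
Local Notation C2 := (2 * pi * (2 * pi) : R).
Let P2 := plancherel2 R.
Let P3 := plancherel3 R.
Let P5 := plancherel5 R.

Definition chart_symbol (w1 w2 : R3 R -> R[i]) (e : bool) (p : R5 R) : R[i] :=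
  (chi e p.2)%:C%C * ray_symbol t0 t1 c w1 w2 p.1 (stereo e p.2).

Section symbol.
Variables (w1 w2 : R3 R -> R[i]).
Hypotheses (lw1 : L2 mu3 w1) (lw2 : L2 mu3 w2).
Variable e : bool.
Local Notation V := (chart_symbol w1 w2 e).

Lemma chart_symbol_meas : cmeas V.
Proof.
apply: cmeasM.
  by apply: cmeas_real; apply: (measurableT_comp (chi_meas e)); exact: measurable_snd.
apply: (cmeas_cint1 (leb1 R) (u := fun q : R5 R * R1 R => ray_fourier t0 t1 c w1 w2 (stereo e q.1.2) (q.2, q.1.1))).
have m1 : measurable_fun setT (fun q : R5 R * R1 R => (q.2, q.1.1)).
  by apply: measurable_fun_pair; mfun.
have m2 : measurable_fun setT (fun q : R5 R * R1 R => stereo e q.1.2).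
  by apply: (measurableT_comp (stereo_meas e)); mfun.
have mA : measurable [set q : R5 R * R1 R | 0 <= q.2 <= T].
  have := @measurable_snd _ _ (R5 R) (R1 R) measurableT _ (measurable_itv `[0, T]).
  by rewrite setTI; congr measurable; apply/seteqP; split => p /=; rewrite in_itv.
rewrite (_ : (fun q => _) = cut [set q : R5 R * R1 R | 0 <= q.2 <= T]
  (fun q => cis (q.2 * dot3 q.1.1 (stereo e q.1.2)) * propagate c w1 w2 q.2 q.1.1)); last first.
  apply/funext => q; rewrite /ray_fourier /cut /=; case: ifPn => h; first by rewrite mem_set.
  by rewrite memNset//=; exact/negP.
apply: cmeas_cutT => //; apply: cmeasM; last exact: (cmeas_comp m1 (propagate_meas c0 lw1 lw2)).
apply: cmeas_cis; apply: measurable_funM; first exact: measurable_snd.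
by apply: (measurableT_comp (dot_meas P3) (g := fun q : R5 R * R1 R => (q.1.1, stereo e q.1.2))); apply: measurable_fun_pair => //; mfun.
Qed.

(** Radius 2, because [chi] vanishes for [|z|^2 >= 3]. *)
Let ball2 : R2 R -> R[i] := trunc dot2 2 (fun=> 1).
Let ball2_L2 : L2 mu2 ball2 := ball_indic_L2 P2 2.

Let bnd xi : R := abs1 (w1 xi) + T * abs1 (w2 xi).
Let bnd_L2 : L2 mu3 (fun xi => (bnd xi)%:C%C).
Proof.
have h w : L2 mu3 w -> L2 mu3 (fun xi => (abs1 (w xi))%:C%C).
  move=> lw; apply: (L2_bnd (k := 2) _ lw) => //; first by apply: cmeas_real; exact: measurable_abs1 (L2_meas lw).
  by move=> x; rewrite abs2_real; exact: abs1_le_abs2.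
have := L2D (h _ lw1) (L2Z T%:C%C (h _ lw2)); congr L2; apply/funext => xi.
by apply: complex_ext; rewrite /bnd !cE ?(mul0r, mulr0, subr0, addr0, add0r).
Qed.

Let V_le xi z : abs2 (V (xi, z)) <= (2 * T) ^+ 2 * abs2 ((bnd xi)%:C%C * ball2 z).
Proof.
rewrite /chart_symbol /= !abs2M !abs2_real /ball2 /trunc.
have [h|h] := leP 3 (dot2 z z).
  rewrite chi_out// expr0n mul0r; apply: mulr_ge0; first exact: sqr_ge0.
  apply: mulr_ge0; [exact: sqr_ge0|exact: abs2_ge0].
rewrite ifT; last by apply: (le_trans (ltW h)); lra.
rewrite (abs2_real 1) expr1n mulr1 -exprMn.
have T0 : 0 <= 2 * T by rewrite mulr_ge0// ltW// subr_gt0.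
have h1 := ray_symbol_le t01 c0 lw1 lw2 xi (stereo e z).
apply: (@le_trans _ _ (abs1 (ray_symbol t0 t1 c w1 w2 xi (stereo e z)) ^+ 2)).
  apply: le_trans (abs2_le_abs1 _).
  by rewrite ler_piMl ?abs2_ge0// expr_le1// ?chi_le1// chi_ge0.
by rewrite lerXn2r ?nnegrE ?abs1_ge0//; apply: le_trans h1; exact: abs1_ge0.
Qed.

Lemma chart_symbol_L2 : L2 mu5 V.
Proof.
apply: (L2_bnd (k := (2 * T) ^+ 2) chart_symbol_meas (L2_tensor bnd_L2 ball2_L2)); first exact: sqr_ge0.
by move=> -[xi z]; exact: V_le.
Qed.

Lemma chart_symbol_section xi : cintegrable mu2 (fun z => V (xi, z)) /\ L2 mu2 (fun z => V (xi, z)).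
Proof.
have l : L2 mu2 (fun z => V (xi, z)).
  apply: (L2_bnd (k := (2 * T) ^+ 2) (cmeas_section1 xi chart_symbol_meas) (L2Z (bnd xi)%:C%C ball2_L2)); first exact: sqr_ge0.
  by move=> z; exact: V_le.
split => //; have := trunc_L1 P2 2 l; congr cintegrable; apply/funext => z.
rewrite /trunc; case: ifPn => //; rewrite -ltNge => h.
by rewrite /chart_symbol /= chi_out ?mul0r//; lra.
Qed.

Lemma partial_chart_symbol_L2 : L2 mu5 (partial_fourier2 mu2 dot2 V).
Proof.
split; first exact: (partial_fourier2_meas P2 chart_symbol_meas).
rewrite (sq_partial_fourier2 P2 chart_symbol_meas); first by rewrite (L2_fin chart_symbol_L2) -EFinM ltry.
by apply: aeW => xi; exact: chart_symbol_section.
Qed.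

End symbol.
Section chart_pairing.
Variables (f : R4 R -> R[i]) (w1 w2 : R3 R -> R[i]) (e : bool).
Hypothesis mf : cmeasurable (M t0 t1) f.
Hypotheses (lw1 : L2 mu3 w1) (lw2 : L2 mu3 w2).
Hypothesis hU : forall t, t0 <= t <= t1 -> is_fourier mu3 dot3 (fun x => f (t, x)) (propagate c w1 w2 (t - t0)).
Local Notation V := (chart_symbol w1 w2 e).
Local Notation X := (chart_piece e (light_ray_transform t0 t1 f)).
Local Notation C5 := (2 * pi * (2 * pi) * (2 * pi) * (2 * pi * (2 * pi)) : R).
Let lV : L2 mu5 V := chart_symbol_L2 lw1 lw2 e.

Lemma chart_slice_pairing z k : cintegrable mu3 k /\ L2 mu3 k ->
  C3%:C%C * cint mu3 (fun y => X (y, z) * conjc (k y)) =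
  cint mu3 (fun xi => V (xi, z) * conjc (fourier mu3 dot3 k xi)).
Proof.
move=> [ik lk]; pose k' y := (chi e z)%:C%C * k y.
have lk' : cintegrable mu3 k' /\ L2 mu3 k' by split; [exact: cintegrableZ|exact: L2Z].
have := xray_pairing t01 c0 mf lw1 lw2 hU (stereo e z) lk'.
rewrite (FZ P3 _ ik) => h; apply: (eq_trans _ (eq_trans h _)).
  by congr (_ * _); congr cint; apply/funext => y; rewrite /k' conjcM conjc_real /chart_piece /chi /=; ring.
by congr cint; apply/funext => xi; rewrite conjcM conjc_real /chart_symbol /=; ring.
Qed.

(** For each fixed [z] the symbol is the transform in [y] by duality. Fubini in [z] assembles these
    identities, and polarisation in the chart variable on almost every section adds the transform in
    [z]; the two constants multiply to that of R^5. *)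
Lemma chart_pair : L2 mu5 X -> fourier_pair mu5 dot5 C5 X (partial_fourier2 mu2 dot2 V).
Proof.
move=> lX; have lFV := partial_chart_symbol_L2 lw1 lw2 e.
split => // k [ik lk].
have lF : L2 mu5 (partial_fourier1 mu3 dot3 k) := partial_fourier1_L2 P3 ik lk.
have e1 : C3%:C%C * ip mu5 X k = ip mu5 V (partial_fourier1 mu3 dot3 k).
  have iX := L2_mulc lX lk; have iV := L2_mulc lV lF.
  rewrite /ip (cint_fubini2 iX) (cint_fubini2 iV) -(cintZ _ (cintegrable_fubini2 iX)).
  apply: cint_ae.
  - exact: cintegrable_meas (cintegrableZ _ (cintegrable_fubini2 iX)).
  - exact: cintegrable_meas (cintegrable_fubini2 iV).
  - by apply: filterS2 (cintegrable_ae2 ik) (L2_ae2 lk) => z i l; exact: (chart_slice_pairing z (conj i l)).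
have e2 : ip mu5 (partial_fourier2 mu2 dot2 V) (fourier mu5 dot5 k) =
    C2%:C%C * ip mu5 V (partial_fourier1 mu3 dot3 k).
  have E : fourier mu5 dot5 k = partial_fourier2 mu2 dot2 (partial_fourier1 mu3 dot3 k) := fourier_prodE P3 P2 ik.
  have iL := L2_mulc lFV (F_L2 P5 (conj ik lk)); have iV := L2_mulc lV lF.
  rewrite /ip (cint_fubini1 iL) (cint_fubini1 iV) -(cintZ _ (cintegrable_fubini1 iV)).
  apply: cint_ae.
  - exact: cintegrable_meas (cintegrable_fubini1 iL).
  - exact: cintegrable_meas (cintegrableZ _ (cintegrable_fubini1 iV)).
  - apply: filterS (L2_ae1 lF) => xi l.
    have := polar P2 (chart_symbol_section lw1 lw2 e xi) (conj (partial_fourier1_integrable P3 xi ik) l).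
    by rewrite E.
rewrite e2 -e1 mulrA -rmorphM /=; congr (_%:C%C * _); ring.
Qed.

(** Plancherel in the chart variable at almost every fixed [xi]: the square norm of the transform in
    its second frequency is, up to the constant, that of the symbol over the chart, so that lower
    bounds on the symbol can be used directly. *)
Lemma chart_fourier_section we : is_fourier mu5 dot5 X we -> {ae mu3, forall xi,
  sq mu2 (fun zeta => we (xi, zeta)) = (C2%:E * sq mu2 (fun z => V (xi, z)))%E}.
Proof.
move=> hwe; have hp := chart_pair (is_fourier_L2l hwe).
have h5 : {ae mu5, forall p, (fun x y => we (x, y) = partial_fourier2 mu2 dot2 V (x, y)) p.1 p.2}.
  by apply: filterS (pair_uniq_r P5 (is_fourier_pair P5 hwe) hp) => -[xi z].
have h6 : {ae mu3, forall xi, {ae mu2, forall z, we (xi, z) = partial_fourier2 mu2 dot2 V (xi, z)}} := ae_section1 h5.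
apply: filterS h6 => xi h.
have [iV lVx] := chart_symbol_section lw1 lw2 e xi.
rewrite -(planch P2 iV lVx); apply: sq_ae => //.
- exact: cmeas_section1 (L2_meas (is_fourier_L2r hwe)).
- exact: (F_meas P2 (L2_meas lVx)).
Qed.

End chart_pairing.
End chart_symbols.

(** * The frequency estimate *)

Section oscillatory.
Variable R : realType.
Variable T : R.
Hypothesis T0 : 0 < T.
Implicit Types (b w tau x y : R) (z : R[i]).
Local Notation mu := (leb1 R).
Local Notation nc := Normc.normc.

Definition unit_segment : R1 R -> R[i] := cut `[0, T]%classic (fun=> 1).
Definition osc b : R[i] := cint mu (fun tau : R1 R => unit_segment tau * cis (tau * b)).

Lemma unit_segmentE tau : unit_segment tau = if 0 <= tau <= T then 1 else 0.
Proof. by rewrite /unit_segment /cut (_ : (tau \in _) = (tau \in `[0, T])) ?mem_setE// in_itv. Qed.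

Lemma segment_integrable (u : R1 R -> R[i]) (k : R) : cmeas u -> 0 <= k ->
  (forall tau, 0 <= tau <= T -> abs1 (u tau) <= k) ->
  cintegrable mu (fun tau : R1 R => unit_segment tau * u tau) /\
  abs1 (cint mu (fun tau : R1 R => unit_segment tau * u tau)) <= k * T.
Proof.
move=> mu_ k0 hk; pose g (tau : R1 R) : R := k * \1_`[0, T]%classic tau.
have mI : cmeas (fun tau : R1 R => unit_segment tau * u tau).
  by apply: cmeasM => //; apply: cmeas_cutT => //; exact: cmeas_cst.
have ii : mu.-integrable setT (EFin \o g).
  by have := integrableZl measurableT k (@integrable_indic_itv R 0 T true false).
have le1 (tau : R1 R) : (abs1 (unit_segment tau * u tau) <= g tau)%R.
  rewrite /g indicE (_ : (tau \in `[0, T]%classic) = (0 <= tau <= T)); last by rewrite mem_setE in_itv.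
  rewrite unit_segmentE; case: ifPn => h; first by rewrite mul1r mulr1 hk.
  by rewrite mul0r mulr0 /abs1 /= normr0 addr0.
have ir := cintegrable_le mI ii le1; split => //.
rewrite -lee_fin; apply: (le_trans (abs1_cint ir)).
have -> : (k * T)%:E = (\int[mu]_tau (g tau)%:E)%E.
  rewrite (_ : (fun tau : R1 R => _%:E) = (cst k%:E) \_ `[0, T]).
    by rewrite -integral_mkcond integral_cst//= lebesgue_measure_itv /= lte_fin T0 -EFinB -EFinM subr0.
  by apply/funext => tau; rewrite patchE /g indicE; case: (_ \in _); rewrite ?mulr1 ?mulr0.
apply: ge0_le_integral => //.
- by move=> x _; rewrite lee_fin abs1_ge0.
- by apply/measurable_EFinP; exact: measurable_abs1.
- by apply/measurable_EFinP; apply: measurable_funM => //; exact: measurable_indic.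
- by move=> x _; rewrite lee_fin le1.
Qed.

Lemma cis_meas b : cmeas (fun tau : R1 R => cis (tau * b)).
Proof. by apply: cmeas_cis; exact: measurable_funM. Qed.

Lemma osc_integrable b : cintegrable mu (fun tau : R1 R => unit_segment tau * cis (tau * b)).
Proof. by apply: (segment_integrable (cis_meas b) (k := 2) _ _).1 => // tau _; exact: abs1_cis. Qed.

Lemma normc_ge0 z : 0 <= nc z.
Proof. by case: z => a b; exact: sqrtr_ge0. Qed.

Lemma normc_le_abs1 z : nc z <= abs1 z.
Proof.
rewrite -(@ler_pXn2r _ 2) ?nnegrE ?abs1_ge0 ?normc_ge0//.
by rewrite abs2_normc abs2_le_abs1.
Qed.

Lemma normc_real x : nc (x%:C%C) = `|x|.
Proof. by rewrite /Normc.normc /= expr0n addr0 sqrtr_sqr. Qed.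

Lemma cos_lip x y : `|cos x - cos y| <= `|x - y|.
Proof.
rewrite -[leRHS]mul1r; apply: (mean_value_le (f' := fun x => - sin x)) => t _.
by rewrite normrN sin_max.
Qed.

Lemma sin_lip x y : `|sin x - sin y| <= `|x - y|.
Proof.
rewrite -[leRHS]mul1r; apply: (mean_value_le (f' := cos)) => t _.
exact: cos_max.
Qed.

Lemma osc_lip b b' : nc (osc b - osc b') <= 2 * T ^+ 2 * `|b - b'|.
Proof.
apply: (le_trans (normc_le_abs1 _)).
have -> : osc b - osc b' = cint mu (fun tau : R1 R => unit_segment tau * (cis (tau * b) - cis (tau * b'))).
  rewrite /osc -(cintB (osc_integrable b) (osc_integrable b')).
  by congr cint; apply/funext => tau; rewrite mulrBr.
have m : cmeas (fun tau : R1 R => cis (tau * b) - cis (tau * b')) by apply: cmeasB; exact: cis_meas.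
have k0 : 0 <= 2 * T * `|b - b'| by rewrite !mulr_ge0// ltW.
have := (segment_integrable m k0 _).2; rewrite (_ : 2 * T ^+ 2 * _ = 2 * T * `|b - b'| * T); last by ring.
apply=> tau /andP[h0 hT]; rewrite /abs1 /cis !cE.
have hc := cos_lip (tau * b) (tau * b'); have hs := sin_lip (tau * b) (tau * b').
rewrite -mulrBr normrM (ger0_norm h0) in hc hs.
have : tau * `|b - b'| <= T * `|b - b'| by rewrite ler_wpM2r.
lra.
Qed.

Let int_der0T (f f' : R -> R) : (forall x : R, is_derive x (1 : R) f (f' x)) -> continuous f' ->
  \int[mu]_(x in `[0, T]) f' x = f T - f 0.
Proof.
move=> d cf'; have cf : continuous f by move=> x; exact: der_cont (d x).
rewrite /Rintegral (continuous_FTC2 T0 (continuous_subspaceT cf') (F := f))//.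
- split; first by move=> x _; exact: der_derivable (d x).
  + by apply: cvg_at_right_filter; exact: cf.
  + by apply: cvg_at_left_filter; exact: cf.
- by move=> x _; rewrite /= (der_derive1 (d x)).
Qed.

Lemma oscE b : osc b = ((\int[mu]_(tau in `[0, T]) cos (tau * b)) +i* (\int[mu]_(tau in `[0, T]) sin (tau * b)))%C.
Proof.
have -> : osc b = cintegral mu `[0, T] (fun tau => cis (tau * b)).
  rewrite cint_cut//; congr cint; apply/funext => tau; rewrite /unit_segment /cut.
  by case: ifP; rewrite ?mul1r ?mul0r.
by [].
Qed.

Lemma osc0 : osc 0 = T%:C%C.
Proof.
rewrite oscE.
under eq_Rintegral do rewrite mulr0 cos0.
under [X in (_ +i* X)%C]eq_Rintegral do rewrite mulr0 sin0.
by rewrite !Rintegral_cst//= lebesgue_measure_itv /= lte_fin T0 /= subr0 mul1r mul0r.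
Qed.

Lemma osc_normc b : b != 0 -> nc (osc b) = T * `|sin (b * T / 2) / (b * T / 2)|.
Proof.
move=> b0.
have i1 : \int[mu]_(tau in `[0, T]) cos (tau * b) = sin (b * T) / b.
  have d x : is_derive x (1 : R) (fun t => sin (b * t) * b^-1) (cos (x * b)).
    apply: der_eq (derM (dercomp (f := sin) (der_scale b x) _) (dercst b^-1 x)) _.
    by rewrite mulr0 addr0 mulfK// mulrC.
  rewrite (int_der0T d) ?mulr0 ?sin0 ?mul0r ?subr0//; cont.
have i2 : \int[mu]_(tau in `[0, T]) sin (tau * b) = (1 - cos (b * T)) / b.
  have d x : is_derive x (1 : R) (fun t => - (cos (b * t) * b^-1)) (sin (x * b)).
    apply: der_eq (derN (derM (dercomp (f := cos) (der_scale b x) _) (dercst b^-1 x))) _.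
    by rewrite mulr0 addr0 mulrC [x * b]mulrC; field.
  by rewrite (int_der0T d) ?mulr0 ?cos0; [field|cont].
have e2 : b * T = (b * T / 2) *+ 2 by rewrite -mulr_natr; field.
apply/eqP; rewrite -(@eqrXn2 _ 2) ?mulr_ge0 ?normc_ge0 ?(ltW T0)//; apply/eqP.
rewrite abs2_normc oscE i1 i2 /abs2 /= [in RHS]exprMn real_normK ?num_real//.
rewrite [in cos _]e2 [in sin _]e2 sin_mulr2n cos_mulr2n.
have := cos2Dsin2 (b * T / 2); move: (cos _) (sin _) => C S h.
have -> : C ^+ 2 = 1 - S ^+ 2 by rewrite -h addrK.
have -> : (((C * S) *+ 2) / b) ^+ 2 = 4 * (1 - S ^+ 2) * S ^+ 2 / b ^+ 2.
  have -> : 1 - S ^+ 2 = C ^+ 2 by rewrite -h addrK.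
  by rewrite -mulr_natr; field.
rewrite -[(1 - S ^+ 2) *+ 2]mulr_natr; field.
by rewrite b0 gt_eqF.
Qed.

(** The modulus is [T |sin x / x|] at [x = b T / 2]. On [[x1, 3/2]] the quotient is below 1, being a
    value of the cosine at a smaller positive point, and it attains its maximum there; beyond [3/2]
    it is at most [2/3]. The point [3/2] is below 2, up to which the sine is known to be
    positive. *)
Lemma osc_gap (b0 : R) : 0 < b0 -> exists2 k : R, k < T & forall b, b0 <= `|b| -> nc (osc b) <= k.
Proof.
move=> b00; pose x0 := b0 * T / 2; have x00 : 0 < x0 by rewrite divr_gt0// mulr_gt0.
pose x1 := Num.min x0 (3 / 2).
have x10 : 0 < x1 by rewrite lt_min x00 divr_gt0.
have x12 : x1 <= 3 / 2 by rewrite ge_min lexx orbT.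
have strict x : 0 < x -> x <= 3 / 2 -> sin x / x < 1.
  move=> h0 h1; have [t] := MVT h0 (fun t _ => is_derive_sin t) (continuous_subspaceT (@continuous_sin R)).
  rewrite in_itv /= sin0 !subr0 => /andP[t0 tx] ->; rewrite mulfK ?gt_eqF//.
  have st : 0 < sin t by apply: sin2_gt0; rewrite t0 /=; lra.
  have := cos2Dsin2 t; have := exprn_gt0 2 st; have := cos_le1 t; nra.
have cg : {within `[x1, 3 / 2], continuous (fun x : R => sin x / x)}.
  apply: continuous_in_subspaceT => x; rewrite inE /= in_itv /= => /andP[h _].
  by apply: cvgM; [exact: continuous_sin|apply: cvgV => //; rewrite gt_eqF// (lt_le_trans x10)].
have [m mI hm] := EVT_max x12 cg.
have gm : sin m / m < 1.
  by move: mI; rewrite in_itv /= => /andP[h1 h2]; apply: strict => //; exact: lt_le_trans h1.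
exists (T * Num.max (sin m / m) (2 / 3)).
  by rewrite -[ltRHS]mulr1 ltr_pM2l// gt_max gm; lra.
have pos x : x1 <= x -> `|sin x / x| <= Num.max (sin m / m) (2 / 3).
  move=> hx; have xp := lt_le_trans x10 hx; have [h|h] := leP x (3 / 2).
    rewrite ger0_norm; first by rewrite le_max hm// in_itv /= hx.
    by rewrite divr_ge0 ?(ltW xp)//; apply/ltW/sin2_gt0; rewrite xp /=; lra.
  rewrite normrM normfV (gtr0_norm xp) le_max; apply/orP; right.
  rewrite ler_pdivrMr//; apply: (le_trans (sin_max x)); lra.
move=> b hb; have bn : b != 0 by rewrite -normr_gt0; exact: lt_le_trans hb.
rewrite osc_normc// ler_wpM2l ?(ltW T0)//.
have hx : x1 <= `|b * T / 2|.
  rewrite ge_min; apply/orP; left; rewrite normrM (@ger0_norm _ 2^-1) ?invr_ge0// normrM (gtr0_norm T0) /x0.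
  by rewrite ler_wpM2r ?invr_ge0// ler_wpM2r ?(ltW T0).
have -> : `|sin (b * T / 2) / (b * T / 2)| = `|sin `|b * T / 2| / `|b * T / 2| |; last exact: pos.
by case: (ger0P (b * T / 2)) => _//; rewrite sinN mulNr invrN mulrN opprK.
Qed.

End oscillatory.

(** * Interaction of the two travelling waves *)

Section phases.
Variable R : realType.
Variable T : R.
Hypothesis T0 : 0 < T.
Implicit Types (b w : R) (z al be : R[i]).
Local Notation nc := Normc.normc.

Lemma normc_add z z' : nc (z + z') <= nc z + nc z'.
Proof. exact: (@le_normcD R z z'). Qed.

Definition phases al be w b : R[i] := al * osc T (b + w) + be * osc T (b - w).

Lemma phases_lip al be w b b' :
  nc (phases al be w b - phases al be w b') <= 2 * T ^+ 2 * `|b - b'| * (nc al + nc be).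
Proof.
have -> : phases al be w b - phases al be w b' =
    al * (osc T (b + w) - osc T (b' + w)) + be * (osc T (b - w) - osc T (b' - w)).
  by rewrite /phases; ring.
apply: (le_trans (normc_add _ _)); rewrite !Normc.normcM mulrDr.
have h1 := osc_lip T0 (b + w) (b' + w); have h2 := osc_lip T0 (b - w) (b' - w).
rewrite (_ : b + w - (b' + w) = b - b') in h1; last by ring.
rewrite (_ : b - w - (b' - w) = b - b') in h2; last by ring.
apply: lerD; rewrite mulrC; apply: ler_wpM2r => //; exact: normc_ge0.
Qed.

(* At [b = w] and [b = -w] one of the two phases is stationary and the other is not,
   so that the matrix sending [(al, be)] to the two values is diagonally dominant. *)
Lemma phases_ge (eps : R) : 0 < eps -> exists2 g : R, 0 < g & forall al be w, eps <= w ->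
  exists2 b0 : R, b0 = w \/ b0 = - w & forall b, `|b - b0| <= g -> g * (nc al + nc be) <= nc (phases al be w b).
Proof.
move=> eps0; have e20 : 0 < 2 * eps by rewrite mulr_gt0.
have [k kT hk] := osc_gap T0 e20.
have [T20 Tk0] : 0 < 4 * T ^+ 2 /\ 0 < T - k by rewrite mulr_gt0 ?exprn_gt0// subr_gt0.
pose d := (T - k) / 2; have d0 : 0 < d by rewrite divr_gt0.
(* The inequalities at [w] and [-w] add up to [(T - k)] times the sum of the amplitudes, so at one
   of the two points the value is at least [d] times that sum. Within distance [d / (4 * T ^+ 2)]
   the Lipschitz bound loses at most half of it, and [d / 2] is what remains. *)
pose g := Num.min (d / 2) (d / (4 * T ^+ 2)).
have g0 : 0 < g by rewrite lt_min !divr_gt0.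
exists g => // al be w hw; have w0 := lt_le_trans eps0 hw.
have [A0 B0] : 0 <= nc al /\ 0 <= nc be by split; exact: normc_ge0.
have gap b : `|b| = 2 * w -> nc (osc T b) <= k by move=> e; apply: hk; rewrite e ler_wpM2l.
have h1 : nc be * T - nc al * k <= nc (phases al be w w).
  have := normc_add (phases al be w w) (- (al * osc T (w + w))).
  rewrite /phases addrAC subrr add0r subrr osc0 ?normcN// !Normc.normcM normc_real (gtr0_norm T0).
  have : nc al * nc (osc T (w + w)) <= nc al * k.
    by rewrite ler_wpM2l// gap// ger0_norm ?addr_ge0 ?(ltW w0)//; ring.
  lra.
have h2 : nc al * T - nc be * k <= nc (phases al be w (- w)).
  have := normc_add (phases al be w (- w)) (- (be * osc T (- w - w))).
  rewrite /phases addrK addNr osc0 ?normcN// !Normc.normcM normc_real (gtr0_norm T0).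
  have : nc be * nc (osc T (- w - w)) <= nc be * k.
    by rewrite ler_wpM2l// gap// -opprD normrN ger0_norm ?addr_ge0 ?(ltW w0)//; ring.
  lra.
have [b0 hb0 h] : exists2 b0 : R, b0 = w \/ b0 = - w & d * (nc al + nc be) <= nc (phases al be w b0).
  have hd : 2 * d = T - k by rewrite /d mulrC divfK.
  have hs : (T - k) * (nc al + nc be) <= nc (phases al be w w) + nc (phases al be w (- w)) by lra.
  have [h|h] := leP (d * (nc al + nc be)) (nc (phases al be w w)); first by exists w => //; left.
  by exists (- w); [right|move: hs; rewrite -hd -mulrA; lra].
exists b0 => // b hb.
have := normc_add (phases al be w b) (phases al be w b0 - phases al be w b).
have hl := phases_lip al be w b0 b; rewrite addrC subrK => ht; rewrite distrC in hl; move: ht.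
have S0 : 0 <= nc al + nc be by rewrite addr_ge0.
have : 2 * T ^+ 2 * `|b - b0| * (nc al + nc be) <= d / 2 * (nc al + nc be).
  rewrite ler_wpM2r//; have : `|b - b0| <= d / (4 * T ^+ 2) by apply: (le_trans hb); rewrite ge_min lexx orbT.
  by rewrite ler_pdivlMr// => h4; rewrite ler_pdivlMr//; lra.
have : g * (nc al + nc be) <= d / 2 * (nc al + nc be) by rewrite ler_wpM2r// ge_min lexx.
lra.
Qed.

(** Euler's formulas give the amplitudes [(a1 -+ i a2 / w) / 2]. By the parallelogram law the sum of
    their squared moduli is half of [|a1|^2 + |a2|^2 / w^2]. *)
Lemma amplitudes (a1 a2 : R[i]) w : w != 0 -> exists al be,
  [/\ abs2 a1 + abs2 a2 / w ^+ 2 <= 2 * (nc al + nc be) ^+ 2 &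
   forall b tau, cis (tau * b) * ((cos (w * tau))%:C%C * a1 + (sincw w tau)%:C%C * a2) =
     cis (tau * (b + w)) * al + cis (tau * (b - w)) * be].
Proof.
move=> w0; exists ((2^-1)%:C%C * (a1 - ((0 : R) +i* w^-1)%C * a2)), ((2^-1)%:C%C * (a1 + ((0 : R) +i* w^-1)%C * a2)); split.
  have h (p q : R) : 0 <= p -> 0 <= q -> p ^+ 2 + q ^+ 2 <= (p + q) ^+ 2.
    by move=> p0 q0; have := mulr_ge0 p0 q0; rewrite sqrrD; lra.
  have := h _ _ (normc_ge0 ((2^-1)%:C%C * (a1 - ((0 : R) +i* w^-1)%C * a2))) (normc_ge0 ((2^-1)%:C%C * (a1 + ((0 : R) +i* w^-1)%C * a2))).
  rewrite !abs2_normc => hh; apply: (le_trans _ (ler_wpM2l _ hh)) => //.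
  by rewrite le_eqVlt; apply/orP; left; apply/eqP; rewrite /abs2 !cE; field.
move=> b tau; rewrite [tau * (b + w)]mulrDr [tau * (b - w)]mulrBr !cisD cisN.
have -> : cis (tau * w) = ((cos (w * tau))%:C + ((0 : R) +i* w^-1) * (w * sin (w * tau))%:C)%C.
  by apply: complex_ext; rewrite /cis !cE [tau * w]mulrC; [ring|field].
have -> : (sincw w tau)%:C%C = (((0 : R) +i* w^-1) * ((0 : R) +i* - (sin (w * tau))))%C.
  by apply: complex_ext; rewrite /sincw (negPf w0) !cE; field.
by apply: complex_ext; rewrite !cE; field.
Qed.

End phases.

(** * Directions on the sphere *)

Section directions.
Variable R : realType.
Implicit Types (xi u v x y : R3 R) (z d : R2 R).

Lemma dot3_ge0 x : 0 <= dot3 x x.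
Proof. exact: dot_ge0 (plancherel3 R) x. Qed.

Lemma cauchy_schwarz3 x y : dot3 x y ^+ 2 <= dot3 x x * dot3 y y.
Proof.
case: x => -[x1 x2] x3; case: y => -[y1 y2] y3; rewrite /dot3 /dot2 /=.
have := sqr_ge0 (x1 * y2 - x2 * y1); have := sqr_ge0 (x1 * y3 - x3 * y1).
have := sqr_ge0 (x2 * y3 - x3 * y2); nra.
Qed.

Lemma unit_orthogonal xi : exists2 m, sphere m & dot3 xi m = 0.
Proof.
case: xi => -[x1 x2] x3; have [h|h] := eqVneq (x1 ^+ 2 + x2 ^+ 2) 0.
  have [/eqP x10 _] : x1 == 0 /\ x2 == 0.
    by move/eqP: h; rewrite paddr_eq0 ?sqr_ge0// !sqrf_eq0 => /andP[].
  by exists (1, 0, 0); rewrite /sphere /dot3 /dot2 /= ?x10; ring.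
have p : 0 < x1 ^+ 2 + x2 ^+ 2 by rewrite lt0r h addr_ge0 ?sqr_ge0.
have r0 : Num.sqrt (x1 ^+ 2 + x2 ^+ 2) != 0 by rewrite gt_eqF// sqrtr_gt0.
exists (- x2 / Num.sqrt (x1 ^+ 2 + x2 ^+ 2), x1 / Num.sqrt (x1 ^+ 2 + x2 ^+ 2), 0); last first.
  by rewrite /dot3 /dot2 /=; field.
have := sqr_sqrtr (ltW p); rewrite /sphere /dot3 /dot2 /=; move: (Num.sqrt _) r0 => r r0 e.
have -> : - x2 / r * (- x2 / r) + x1 / r * (x1 / r) + 0 * 0 = (x1 ^+ 2 + x2 ^+ 2) / r ^+ 2 by field.
by rewrite -e divff// expf_neq0.
Qed.

(** The unit vector is [k] times the direction of [xi] plus [sqrt (1 - k^2)] times a unit vector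
    orthogonal to it. With [k = c] and [k = - c] this is the geometric use of [c <= 1]. *)
Lemma direction xi (k : R) : 0 < dot3 xi xi -> `|k| <= 1 ->
  exists2 v, sphere v & dot3 xi v = k * Num.sqrt (dot3 xi xi).
Proof.
move=> p hk; have [m hm hxm] := unit_orthogonal xi.
have h0 : Num.sqrt (dot3 xi xi) != 0 by rewrite gt_eqF// sqrtr_gt0.
have hh := sqr_sqrtr (ltW p); move: (Num.sqrt _) h0 hh => h h0 hh.
have k1 : 0 <= 1 - k ^+ 2 by rewrite subr_ge0 -(real_normK (num_real k)) expr_le1.
have hq := sqr_sqrtr k1; move: (Num.sqrt _) hq => q hq.
have dd (a : R) : dot3 xi ((k / h) *: xi + a *: m) = k / h * dot3 xi xi + a * dot3 xi m.
  by case: (xi) (m) => -[? ?] ? [[? ?] ?]; rewrite /dot3 /dot2 /= /GRing.scale /=; ring.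
exists ((k / h) *: xi + q *: m); last by rewrite dd hxm -hh; field.
have -> : sphere ((k / h) *: xi + q *: m) =
    ((k / h) ^+ 2 * dot3 xi xi + 2 * (k / h) * q * dot3 xi m + q ^+ 2 * dot3 m m = 1).
  rewrite /sphere /=; congr (_ = _).
  by case: (xi) (m) => -[? ?] ? [[? ?] ?]; rewrite /dot3 /dot2 /= /GRing.scale /=; ring.
rewrite hxm hm hq -hh; field; exact: h0.
Qed.

(** The chart is chosen according to the sign of the third coordinate, which keeps the parameter in
    the closed unit disc, well inside the region where [chi] is bounded below. *)
Lemma stereo_onto v : sphere v -> exists e z, stereo e z = v /\ dot2 z z <= 1.
Proof.
case: v => -[v1 v2] v3 h0; have h : v1 * v1 + v2 * v2 + v3 * v3 = 1 := h0.
pose a := `|v3|; have a0 : 0 <= a by exact: normr_ge0.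
have ha : a * a = v3 * v3 by rewrite -!expr2 real_normK ?num_real.
have h1 : 1 + a != 0 by rewrite gt_eqF//; lra.
pose z : R2 R := (v1 / (1 + a), v2 / (1 + a)).
have hq : dot2 z z = (1 - a) / (1 + a).
  have -> : dot2 z z = (v1 * v1 + v2 * v2) / (1 + a) ^+ 2 by rewrite /dot2 /=; field.
  have -> : v1 * v1 + v2 * v2 = (1 - a) * (1 + a) by rewrite mulrBl mulrDr mul1r; lra.
  by field.
have h2 : 1 + (1 - a) / (1 + a) = 2 / (1 + a) by field.
have h3 : (1 - (1 - a) / (1 + a)) / (2 / (1 + a)) = a by field.
exists (v3 < 0), z; split; last first.
  by rewrite hq ler_pdivrMr ?mul1r; lra.
rewrite /stereo hq h2 h3 /=; congr (_, _, _); [by field..|].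
by rewrite /a; case: ltP => [/ltr0_norm->|/ger0_norm->]; rewrite ?expr1 ?expr0 ?mulN1r ?opprK ?mul1r.
Qed.

(** The chordal distance formula of stereographic projection. Its denominator is at least 1, so the
    chart is Lipschitz with constant 2. *)
Lemma stereo_dist e z z' : let u := stereo e z - stereo e z' in
  dot3 u u = 4 * dot2 (z - z') (z - z') / ((1 + dot2 z z) * (1 + dot2 z' z')).
Proof.
have h1 := stereo_den z; have h2 := stereo_den z'; move: h1 h2.
case: z => z1 z2; case: z' => y1 y2; rewrite /stereo /dot3 /dot2 /= => h1 h2.
by case: e; rewrite ?expr1 ?expr0; field; rewrite !gt_eqF.
Qed.

Lemma stereo_dot_lip xi e z z' :
  (dot3 xi (stereo e z) - dot3 xi (stereo e z')) ^+ 2 <= 4 * dot3 xi xi * dot2 (z - z') (z - z').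
Proof.
have -> : dot3 xi (stereo e z) - dot3 xi (stereo e z') = dot3 xi (stereo e z - stereo e z').
  by rewrite /dot3 /dot2 /=; ring.
apply: (le_trans (cauchy_schwarz3 _ _)); rewrite stereo_dist -mulrA mulrCA [leRHS](_ : _ = 4 * (dot3 xi xi * dot2 (z - z') (z - z'))); last by ring.
apply: ler_wpM2l => //; apply: ler_wpM2l; first exact: dot3_ge0.
rewrite ler_pdivrMr ?mulr_gt0 ?stereo_den// ler_peMr ?dot2_ge0//.
by have := dot2_ge0 z; have := dot2_ge0 z'; nra.
Qed.

End directions.

(** * Lower bound for the symbol *)

Section symbol_lower_bound.
Variable R : realType.
Variables (t0 t1 c : R).
Hypotheses (t01 : t0 < t1) (c0 : 0 < c) (c1 : c <= 1).
Local Notation mu2 := (leb2 R).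
Local Notation mu3 := (leb3 R).
Local Notation T := (t1 - t0).
Local Notation nc := Normc.normc.
Let T0 : 0 < T. Proof. by rewrite subr_gt0. Qed.

Lemma ray_symbol_phases (w1 w2 : R3 R -> R[i]) xi : 0 < dot3 xi xi -> exists al be,
  abs2 (w1 xi) + abs2 (w2 xi) / omega c xi ^+ 2 <= 2 * (nc al + nc be) ^+ 2 /\
  forall v, ray_symbol t0 t1 c w1 w2 xi v = phases T al be (omega c xi) (dot3 xi v).
Proof.
move=> p; have o0 : omega c xi != 0 by rewrite gt_eqF// mulr_gt0// sqrtr_gt0.
have [al [be [h1 h2]]] := amplitudes (w1 xi) (w2 xi) o0; exists al, be; split => // v.
rewrite /phases /osc -![_ * cint _ _]mulrC.
have ii b z : cintegrable (leb1 R) (fun tau : R1 R => unit_segment T tau * cis (tau * b) * z).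
  rewrite (_ : (fun tau : R1 R => _) = fun tau : R1 R => z * (unit_segment T tau * cis (tau * b))).
    by apply: cintegrableZ; exact: osc_integrable.
  by apply/funext => tau; rewrite mulrC.
rewrite -!cintZr -?cintD//; try exact: osc_integrable.
congr cint; apply/funext => tau; rewrite /ray_fourier unit_segmentE /=.
by case: ifP => _; rewrite ?h2 ?mul1r// !mul0r addr0.
Qed.

Lemma box_measure (z0 : R2 R) (r : R) : 0 < r ->
  mu2 (`]z0.1 - r, z0.1 + r[ `*` `]z0.2 - r, z0.2 + r[)%classic = ((2 * r) ^+ 2)%:E.
Proof.
move=> r0; rewrite /sigma_finite_product product_measure1E//= !lebesgue_measure_itv /= !lte_fin.
rewrite !ltrD2l !gtrN// -!EFinB -EFinM; congr EFin; ring.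
Qed.

Lemma bool_le_sum (F : bool -> \bar R) e : (forall e, 0 <= F e)%E -> (F e <= \sum_(e : bool) F e)%E.
Proof. by move=> F0; rewrite big_bool; case: e; [exact: leeDl|exact: leeDr]. Qed.

(** Young's inequality with weight [1/8]. Summed over two coordinates of a point with [|z0| <= 1] it
    gives [9/8 + 9/32 = 45/32], which is below the bound [5/3] of [chi_ge]. *)
Lemma square_near (x y : R) : (y - x) ^+ 2 <= 64^-1 -> y * y <= 9 / 8 * (x * x) + 9 / 64.
Proof.
have ey : 9 / 8 * (x * x) + 9 * (y - x) ^+ 2 - y * y = (x - 8 * (y - x)) ^+ 2 / 8 by field.
have h8 : 0 <= (x - 8 * (y - x)) ^+ 2 / 8 by rewrite divr_ge0 ?sqr_ge0.
by move=> h; lra.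
Qed.

(** On a box of half-side [r = k / (1 + |xi|)] around the parameter of a good direction, the phase
    [xi.v] stays within [g] of the value singled out by [phases_ge], and [chi] is bounded below. The
    area [4 r^2] produces the extra factor [1 + |xi|^2] on the right. *)
Lemma symbol_lower (eps : R) : 0 < eps -> exists2 C : R, 0 < C & forall w1 w2 xi,
  L2 mu3 w1 -> L2 mu3 w2 -> eps ^+ 2 <= dot3 xi xi ->
  (((1 + dot3 xi xi) * abs2 (w1 xi) + abs2 (w2 xi))%:E <=
   (C * (1 + dot3 xi xi) ^+ 2)%:E * \sum_(e : bool) sq mu2 (fun z => chart_symbol t0 t1 c w1 w2 e (xi, z)))%E.
Proof.
move=> eps0; have [g g0 hg] := phases_ge T0 (mulr_gt0 c0 eps0).
(* The bound [1/8] on [r] is that of [square_near]. A point of the box is at squared distance at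
   most [2 r^2] from the centre, so the phase varies by at most [sqrt 8 * r * |xi|], which is below
   [3 r |xi|] and hence at most [g]. *)
pose k := Num.min 8^-1 (g / 3); have k0 : 0 < k by rewrite lt_min invr_gt0 divr_gt0// ltr0n.
pose E := expR (- 4) / 2 : R; have E0 : 0 < E by rewrite divr_gt0// expR_gt0.
have CC : 0 < E ^+ 2 * g ^+ 2 * k ^+ 2 by rewrite !mulr_gt0// exprn_gt0.
exists (E ^+ 2 * g ^+ 2 * k ^+ 2)^-1; first by rewrite invr_gt0.
move=> w1 w2 xi lw1 lw2 hxi; pose H := dot3 xi xi.
have H0 : 0 < H by apply: lt_le_trans hxi; exact: exprn_gt0.
pose h := Num.sqrt H; have h0 : 0 < h by rewrite sqrtr_gt0.
have hh : h ^+ 2 = H by exact: sqr_sqrtr (ltW H0).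
have oE : omega c xi = c * h by [].
have ho : c * eps <= omega c xi.
  by rewrite oE ler_wpM2l ?(ltW c0)// -(@ler_pXn2r _ 2) ?nnegrE ?(ltW eps0) ?(ltW h0)// hh.
have [al [be [hA hV]]] := ray_symbol_phases w1 w2 H0.
have [b0 hb0 hb] := hg al be _ ho.
have [v vS hv] : exists2 v, sphere v & dot3 xi v = b0.
  case: hb0 => ->; first by apply: direction => //; rewrite gtr0_norm.
  have nc1 : `|- c| <= 1 by rewrite normrN gtr0_norm.
  by have [v vS hv] := direction H0 nc1; exists v => //; rewrite hv mulNr.
have [e [z0 [ze hz0]]] := stereo_onto vS.
pose r := k / (1 + h); have h10 : 0 < 1 + h by rewrite addr_gt0.
have r0 : 0 < r by rewrite divr_gt0.
have rk : r * (1 + h) = k by rewrite /r divfK// gt_eqF.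
have r8 : r <= 8^-1.
  by rewrite ler_pdivrMr//; apply: (le_trans (_ : k <= 8^-1)); [rewrite ge_min lexx|rewrite ler_peMr ?invr_ge0// lerDl ltW].
have rg : 3 * (r * h) <= g.
  have : k <= g / 3 by rewrite ge_min lexx orbT.
  rewrite ler_pdivlMr// -rk => hk; apply: le_trans hk.
  rewrite (_ : r * (1 + h) * 3 = 3 * (r * h) + r * 3); last by ring.
  by rewrite lerDl mulr_ge0// ltW.
pose B := (`]z0.1 - r, z0.1 + r[ `*` `]z0.2 - r, z0.2 + r[)%classic : set (R2 R).
have mB : measurable B by exact: measurableX.
pose A := abs2 (w1 xi) + abs2 (w2 xi) / omega c xi ^+ 2.
have A0 : 0 <= A by rewrite addr_ge0 ?abs2_ge0// divr_ge0 ?abs2_ge0 ?sqr_ge0.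
pose L := E ^+ 2 * (g ^+ 2 * (A / 2)).
have low z : B z -> L <= abs2 (chart_symbol t0 t1 c w1 w2 e (xi, z)).
  case=> /=; rewrite !in_itv /= => /andP[a1 a2] /andP[a3 a4].
  have d1 : (z.1 - z0.1) ^+ 2 <= r ^+ 2 by rewrite -ler_sqrt ?sqr_ge0// !sqrtr_sqr (gtr0_norm r0) ler_norml; lra.
  have d2 : (z.2 - z0.2) ^+ 2 <= r ^+ 2 by rewrite -ler_sqrt ?sqr_ge0// !sqrtr_sqr (gtr0_norm r0) ler_norml; lra.
  have zz : dot2 z z <= 5 / 3.
    have r64 : r ^+ 2 <= 64^-1 by rewrite (_ : 64^-1 = 8^-1 ^+ 2) ?lerXn2r ?nnegrE ?(ltW r0)//; field.
    by have := square_near (le_trans d1 r64); have := square_near (le_trans d2 r64); move: hz0; rewrite /dot2; lra.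
  rewrite /chart_symbol /= abs2M abs2_real hV; apply: ler_pM.
  - exact: sqr_ge0.
  - by apply: mulr_ge0; [exact: sqr_ge0|exact: divr_ge0].
  - by rewrite lerXn2r ?nnegrE ?chi_ge0 ?(ltW E0)//; exact: chi_ge.
  have hbz : `|dot3 xi (stereo e z) - b0| <= g.
    apply: le_trans rg; rewrite -hv -ze -(@ler_pXn2r _ 2) ?nnegrE//; last by rewrite ?(mulr_ge0 _ (ltW (mulr_gt0 r0 h0))).
    rewrite real_normK ?num_real//; apply: (le_trans (stereo_dot_lip _ _ _ _)).
    have : dot2 (z - z0) (z - z0) <= 2 * r ^+ 2 by move: d1 d2; rewrite /dot2 !expr2 /=; lra.
    move=> hd; apply: (@le_trans _ _ (4 * H * (2 * r ^+ 2))); first by rewrite ler_wpM2l// mulr_ge0// ltW.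
    rewrite (_ : (3 * (r * h)) ^+ 2 = 9 * (H * r ^+ 2)); last by rewrite !exprMn hh; ring.
    rewrite (_ : 4 * H * (2 * r ^+ 2) = 8 * (H * r ^+ 2)); last by ring.
    by rewrite ler_wpM2r ?ler_nat// mulr_ge0 ?sqr_ge0 ?(ltW H0).
  have := hb _ hbz; rewrite -abs2_normc => h2.
  apply: (@le_trans _ _ ((g * (nc al + nc be)) ^+ 2)).
    by rewrite exprMn ler_wpM2l ?sqr_ge0// ler_pdivrMr// mulrC.
  by rewrite lerXn2r ?nnegrE// ?normc_ge0// mulr_ge0 ?(ltW g0)// addr_ge0 ?normc_ge0.
have L0 : 0 <= L.
  by apply: mulr_ge0; [exact: sqr_ge0|apply: mulr_ge0; [exact: sqr_ge0|exact: divr_ge0]].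
have hint : ((L * (2 * r) ^+ 2)%:E <= sq mu2 (fun z => chart_symbol t0 t1 c w1 w2 e (xi, z)))%E.
  have ms : measurable_fun setT (fun z => (abs2 (chart_symbol t0 t1 c w1 w2 e (xi, z)))%:E).
    by apply/measurable_EFinP/measurable_abs2/L2_meas; exact: (chart_symbol_section t01 c0 lw1 lw2 e xi).2.
  rewrite EFinM -(box_measure z0 r0) -[X in (_ * X)%E]/(mu2 B) -integral_cst//.
  apply: (@le_trans _ _ (\int[mu2]_(z in B) (abs2 (chart_symbol t0 t1 c w1 w2 e (xi, z)))%:E)%E).
    have ms' := @measurable_funS _ _ _ _ setT B _ measurableT (@subsetT _ B) ms.
    by apply: ge0_le_integral => //= z Bz; rewrite lee_fin ?low.
  by apply: ge0_subset_integral => // z _; rewrite lee_fin abs2_ge0.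
apply: (@le_trans _ _ (((E ^+ 2 * g ^+ 2 * k ^+ 2)^-1 * (1 + H) ^+ 2)%:E * (L * (2 * r) ^+ 2)%:E)%E).
  have -> : (1 + H) ^+ 2 = (1 + H) * (1 + H) by [].
  rewrite -EFinM lee_fin.
  have -> : (E ^+ 2 * g ^+ 2 * k ^+ 2)^-1 * ((1 + H) * (1 + H)) * (L * (2 * r) ^+ 2) = (1 + H) * A * (2 * (1 + H) / (1 + h) ^+ 2).
    by rewrite /L /r; field; rewrite !gt_eqF.
  have H10 : 0 < 1 + H by rewrite addr_gt0.
  apply: (@le_trans _ _ ((1 + H) * A)).
    rewrite /A -/H [leRHS]mulrDr lerD2l mulrA ler_pdivlMr; last by rewrite exprn_gt0// (lt_le_trans _ ho)// mulr_gt0.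
    rewrite mulrC ler_wpM2r ?abs2_ge0// oE exprMn hh.
    (* Here [c <= 1] gives [omega^2 <= |xi|^2 <= 1 + |xi|^2], so that the division by [omega^2] is
       compensated. *)
    have : c ^+ 2 * H <= 1 * H by rewrite ler_wpM2r ?(ltW H0)// expr_le1// ltW.
    by rewrite mul1r; lra.
  (* The remaining factor is at least 1 because [(1 + h)^2 <= 2 (1 + h^2)]. *)
  rewrite ler_peMr ?mulr_ge0 ?(ltW H10)// ler_pdivlMr ?exprn_gt0// mul1r -hh.
  by have := sqr_ge0 (1 - h); rewrite !sqrrD; lra.
apply: lee_wpmul2l; first by rewrite lee_fin mulr_ge0 ?sqr_ge0// invr_ge0 ltW.
exact: (le_trans hint (bool_le_sum e (fun e => sq_ge0 _ _))).
Qed.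

End symbol_lower_bound.

(** * Low frequencies of compactly supported functions, and Sobolev energies *)

Section low_frequencies.
Context d (T : measurableType d) (R : realType).
Variables (mu : {sigma_finite_measure set T -> \bar R}) (dot : T -> T -> R) (C : R).
Hypothesis P : plancherel_space mu dot C.
Implicit Types u w : T -> R[i].

(** At every [xi] the transform is the pairing of [u] with a character restricted to the ball, whose
    norm does not depend on [xi]. Hence it is bounded by the [L2] norm of [u], which Plancherel's
    identity expresses through [w]. *)
Lemma low_frequency (r : R) : exists2 B : R, 0 < B & forall u w, is_fourier mu dot u w ->
  {ae mu, forall x, r ^+ 2 < dot x x -> u x = 0} ->
  {ae mu, forall xi, abs2 (w xi) <= B * nsq mu w}.
Proof.
pose ball := trunc dot r (fun _ : T => 1 : R[i]).
have lb : L2 mu ball := ball_indic_L2 P r.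
have V0 : 0 < nsq mu ball + 1 by rewrite ltr_wpDl ?nsq_ge0.
have C0 := planch_gt0 P.
exists (4 * (nsq mu ball + 1) * C^-1); first by rewrite !mulr_gt0 ?invr_gt0.
move=> u w fw u0; have lu := is_fourier_L2l fw.
have l12 := trunc_L12 P r lu; have lt := l12.2.
have ut : {ae mu, forall x, u x = trunc dot r u x}.
  by apply: filterS u0 => x hx; rewrite /trunc; case: leP => // /hx.
have ft := is_fourier_ae P (L2_meas lt) ut fw.
have hw := pair_uniq_r P (is_fourier_pair P ft) (pair_F P l12).
apply: filterS hw => xi ->.
pose e x : R[i] := ball x * cis (dot x xi).
have abs2e x : abs2 (e x) = abs2 (ball x) by rewrite abs2M abs2_cis mulr1.
have me : cmeas e.
  by apply: cmeasM (L2_meas lb) _; apply: cmeas_cis; exact: dot_measl P xi.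
have le : L2 mu e by apply: (L2_bnd (k := 1) me lb) => // x; rewrite abs2e mul1r.
have ne : nsq mu e = nsq mu ball by rewrite /nsq; congr fine; apply: eq_integral => x _; rewrite abs2e.
have -> : fourier mu dot (trunc dot r u) xi = ip mu (trunc dot r u) e.
  congr cint; apply/funext => x; rewrite /e /ball /trunc; case: ifP => _; last by rewrite !mul0r.
  by rewrite mul1r cisN.
apply: (le_trans (abs2_le_abs1 _)); set a := abs1 _.
have nu : nsq mu (trunc dot r u) = C^-1 * nsq mu w.
  by rewrite (is_fourier_nsq P ft) mulKf// gt_eqF.
have a0 : 0 <= a by exact: abs1_ge0.
have [->|an] := eqVneq a 0; first by rewrite expr0n /= !mulr_ge0 ?invr_ge0 ?nsq_ge0 ?(ltW C0) ?(ltW V0).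
have ap : 0 < a by rewrite lt0r an.
(* This weight makes the second term of [ip_bound] at most [a / 2], which is absorbed by the
   left-hand side [a] and leaves a bound on [a^2]. *)
have k0 : 0 < 2 * (nsq mu ball + 1) / a by rewrite !mulr_gt0 ?invr_gt0.
have := ip_bound lt le k0; rewrite -/a ne nu => h.
have h2 : (2 * (nsq mu ball + 1) / a)^-1 * nsq mu ball <= a / 2.
  rewrite invf_div mulrAC ler_pdivrMr ?mulr_gt0//.
  have -> : a / 2 * (2 * (nsq mu ball + 1)) = a * (nsq mu ball + 1) by field.
  by rewrite ler_wpM2l// lerDl.
have h3 : a / 2 <= 2 * (nsq mu ball + 1) / a * (C^-1 * nsq mu w) by lra.
have h4 : 2 * a * (a / 2) <= 2 * a * (2 * (nsq mu ball + 1) / a * (C^-1 * nsq mu w)).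
  by rewrite ler_wpM2l// mulr_ge0.
apply: (le_trans (le_trans _ h4)); first by rewrite le_eqVlt; apply/orP; left; apply/eqP; field.
by rewrite le_eqVlt; apply/orP; left; apply/eqP; field; rewrite (gt_eqF ap) (gt_eqF C0).
Qed.

Lemma abs2_weight (p : R) xi (z : R[i]) :
  abs2 (((1 + dot xi xi) `^ (p / 2))%:C%C * z) = (1 + dot xi xi) `^ p * abs2 z.
Proof.
by rewrite abs2M abs2_real -powR_mulrn ?powR_ge0// -powRrM divfK ?pnatr_eq0.
Qed.

Definition sobolev_sq (p : R) w : \bar R := sq mu (fun xi => ((1 + dot xi xi) `^ (p / 2))%:C%C * w xi).

Lemma sobolev_sqE p w : sobolev_sq p w = (\int[mu]_xi ((1 + dot xi xi) `^ p * abs2 (w xi))%:E)%E.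
Proof. by apply: eq_integral => xi _; rewrite abs2_weight. Qed.

Lemma weight_meas (p : R) : measurable_fun setT (fun xi => (1 + dot xi xi) `^ p).
Proof. by have := sobolev_weight_meas P (p * 2); under eq_fun do rewrite mulfK ?pnatr_eq0//. Qed.

Lemma weighted_meas (p : R) w : cmeas w -> measurable_fun setT (fun xi => (1 + dot xi xi) `^ p * abs2 (w xi)).
Proof. by move=> mw; apply: measurable_funM; [exact: weight_meas|exact: measurable_abs2]. Qed.

Lemma sobolev_sqD (p q : R) w w' : cmeas w -> cmeas w' -> (sobolev_sq p w + sobolev_sq q w' =
  \int[mu]_xi ((1 + dot xi xi) `^ p * abs2 (w xi) + (1 + dot xi xi) `^ q * abs2 (w' xi))%:E)%E.
Proof.
move=> mw mw'; rewrite !sobolev_sqE; under [RHS]eq_integral do rewrite EFinD.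
rewrite ge0_integralD//.
- by move=> x _; rewrite lee_fin mulr_ge0 ?powR_ge0 ?abs2_ge0.
- by apply/measurable_EFinP; exact: weighted_meas.
- by move=> x _; rewrite lee_fin mulr_ge0 ?powR_ge0 ?abs2_ge0.
- by apply/measurable_EFinP; exact: weighted_meas.
Qed.

Lemma weight_ge1 (p : R) xi : 0 <= p -> 1 <= (1 + dot xi xi) `^ p.
Proof.
by move=> p0; have := sobolev_weight_ge1 (sigma := p * 2) P xi; rewrite mulfK ?pnatr_eq0//; apply; rewrite mulr_ge0.
Qed.

Lemma nsq_le_sobolev (p : R) w : 0 <= p -> L2 mu w -> ((nsq mu w)%:E <= sobolev_sq p w)%E.
Proof.
move=> p0 lw; rewrite -(L2_fin lw) sobolev_sqE; have mw := measurable_abs2 (L2_meas lw).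
apply: ge0_le_integral => //.
- by move=> x _; rewrite lee_fin abs2_ge0.
- exact/measurable_EFinP.
- by apply/measurable_EFinP; apply: measurable_funM => //; exact: weight_meas.
- by move=> x _; rewrite lee_fin ler_peMl ?abs2_ge0//; exact: weight_ge1.
Qed.

Lemma sobolev_sq_ae p w w' : cmeas w -> cmeas w' -> {ae mu, forall x, w x = w' x} -> sobolev_sq p w = sobolev_sq p w'.
Proof.
move=> mw mw' h; have ms w0 : cmeas w0 -> cmeas (fun xi => ((1 + dot xi xi) `^ (p / 2))%:C%C * w0 xi).
  by apply: cmeasM; apply: cmeas_real; exact: weight_meas.
by apply: sq_ae; [exact: ms|exact: ms|apply: filterS h => x ->].
Qed.

Lemma sobolev_norm_le (p : R) u w (k : R) : is_fourier mu dot u w -> 0 <= k ->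
  (sobolev_sq p w <= (k ^+ 2)%:E)%E -> (sobolev_norm mu dot p u <= k%:E)%E.
Proof.
move=> fw k0 h; apply: (@le_trans _ _ (L2norm mu (fun xi => ((1 + dot xi xi) `^ (p / 2))%:C%C * w xi))).
  by apply: ereal_inf_lbound; exists w.
rewrite L2norm_sqrt; last exact: le_lt_trans h (ltry _).
rewrite lee_fin -(ger0_norm k0) -sqrtr_sqr ler_sqrt ?sqr_ge0// -lee_fin /nsq fineK//.
by rewrite ge0_fin_numE ?sq_ge0//; exact: le_lt_trans h (ltry _).
Qed.

End low_frequencies.

Lemma compact_in_ball (R : realType) (K : set (R3 R)) : compact K ->
  exists r : R, forall x, K x -> dot3 x x <= r ^+ 2.
Proof.
move=> Kc; have cd : continuous (fun x : R3 R => dot3 x x : R).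
  move=> x; have c3 : (fun y : R3 R => y.2) @ x --> x.2 by exact: cvg_snd.
  have c12 : (fun y : R3 R => y.1) @ x --> x.1 by exact: cvg_fst.
  have c1 : (fun y : R3 R => y.1.1) @ x --> x.1.1 by apply: (cvg_comp _ _ c12); exact: cvg_fst.
  have c2 : (fun y : R3 R => y.1.2) @ x --> x.1.2 by apply: (cvg_comp _ _ c12); exact: cvg_snd.
  by rewrite /dot3 /dot2; apply: cvgD; [apply: cvgD|]; apply: cvgM.
have := compact_bounded (continuous_compact (continuous_subspaceT cd) Kc).
move=> [N [_ hN]]; exists (`|N| + 1) => x Kx.
have := hN (`|N| + 1); rewrite ltr_pwDr ?ler_norm// => /(_ isT (dot3 x x)) /= hx.
have {}hx : `|dot3 x x| <= `|N| + 1 by apply: hx; exists x.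
apply: (le_trans (ler_norm _)); apply: (le_trans hx).
by rewrite expr2 ler_peMr ?addr_ge0// lerDr.
Qed.

Lemma fine_add (R : realType) (x y : \bar R) : (0 <= x)%E -> (0 <= y)%E -> (x < +oo)%E -> (y < +oo)%E ->
  (x + y = (fine (x + y))%:E)%E.
Proof. by case: x => //; case: y. Qed.

(** The finiteness of [a], expressed by its type, is what allows the subtraction. *)
Lemma half_absorb (R : realType) (a : R) (x : \bar R) : (0 <= x)%E ->
  (a%:E <= (a / 2)%:E + x)%E -> (a%:E <= 2%:E * x)%E.
Proof.
case: x => [x||]//; first by rewrite -EFinD -EFinM !lee_fin; lra.
by move=> _ _; rewrite gt0_muley ?leey// lte_fin.
Qed.

(** * Absorption of the low frequencies *)

Section key_estimate.
Variable R : realType.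
Variables (t0 t1 c s : R) (K : set (R3 R)).
Hypotheses (t01 : t0 < t1) (c0 : 0 < c) (c1 : c <= 1) (s0 : 0 <= s) (Kc : compact K).
Local Notation mu2 := (leb2 R).
Local Notation mu3 := (leb3 R).
Let P3 := plancherel3 R.
Local Notation weight p xi := ((1 + dot3 xi xi) `^ p).
Local Notation energy p w := (sobolev_sq mu3 (@dot3 R) p w).
Local Notation V w1 w2 e xi := (fun z => chart_symbol t0 t1 c w1 w2 e (xi, z)).

(** Up to a constant, the part of the squared [H^{s+2}] norm of the light ray transform whose weight
    involves only the frequency dual to the base point. *)
Definition symbol_energy w1 w2 : \bar R :=
  (\int[mu3]_xi ((weight (s + 2) xi)%:E * \sum_(e : bool) sq mu2 (V w1 w2 e xi)))%E.

Lemma cube_measure (r : R) : 0 < r ->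
  mu3 (`]- r, r[ `*` `]- r, r[ `*` `]- r, r[)%classic = ((2 * r) ^+ 3)%:E.
Proof.
move=> r0; have h : lebesgue_measure (`]- r, r[%classic : set (R1 R)) = (2 * r)%:E.
  by rewrite lebesgue_measure_itv /= lte_fin gtrN// -EFinB opprK; congr EFin; ring.
rewrite /sigma_finite_product product_measure1E//=; last exact: measurableX.
rewrite [X in (X * _)%E](_ : _ = (leb1 R \x leb1 R)%E (`]- r, r[ `*` `]- r, r[)%classic)//.
by rewrite product_measure1E//= !h -!EFinM; congr EFin; ring.
Qed.

Lemma low_cube (eps : R) xi : 0 < eps -> dot3 xi xi < eps ^+ 2 ->
  (`]- eps, eps[ `*` `]- eps, eps[ `*` `]- eps, eps[)%classic xi.
Proof.
move=> e0; case: xi => -[x1 x2] x3; rewrite /dot3 /dot2 /= -!expr2 => h.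
have one (x : R) : x ^+ 2 < eps ^+ 2 -> x \in `]- eps, eps[.
  by rewrite in_itv /= -ltr_norml -ltr_sqrt ?exprn_gt0// !sqrtr_sqr (gtr0_norm e0).
by do !split; apply: one; have := sqr_ge0 x1; have := sqr_ge0 x2; have := sqr_ge0 x3; lra.
Qed.

Lemma symbol_sum_meas w1 w2 : L2 mu3 w1 -> L2 mu3 w2 ->
  measurable_fun setT (fun xi => ((weight (s + 2) xi)%:E * \sum_(e : bool) sq mu2 (V w1 w2 e xi))%E).
Proof.
move=> lw1 lw2; apply: emeasurable_funM; first by apply/measurable_EFinP; exact: weight_meas P3 _.
under eq_fun do rewrite big_bool.
have ms e : measurable_fun setT (fun xi => sq mu2 (V w1 w2 e xi)).
  by apply: measurable_sq1; exact: chart_symbol_meas.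
exact: emeasurable_funD.
Qed.

(** Frequencies above [eps] are bounded pointwise by [symbol_lower], multiplied by the weight of
    order [s]. Below [eps] the integrand is at most [D * A], where [A] is the finite total energy,
    and the cube of these frequencies is so small that its contribution is at most [A / 2]. *)
Lemma key_estimate : exists2 C : R, 0 < C & forall f1 f2 w1 w2,
  supported_in K f1 -> supported_in K f2 -> is_fourier mu3 dot3 f1 w1 -> is_fourier mu3 dot3 f2 w2 ->
  (energy (s + 1) w1 < +oo)%E -> (energy s w2 < +oo)%E ->
  (energy (s + 1) w1 + energy s w2 <= C%:E * symbol_energy w1 w2)%E.
Proof.
have [r hr] := compact_in_ball Kc.
have [B B0 hB] := low_frequency P3 r.
pose D := 2 `^ (s + 1) * B; have D0 : 0 < D by rewrite mulr_gt0// powR_gt0.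
(* Since [eps <= 1], the weights on the cube are at most [2^(s + 1)] and
   [D * (2 * eps)^3 <= 8 * D * eps], which is at most one half. The choice depends on [K] and [s]
   only. *)
pose eps := Num.min 1 (16 * D)^-1.
have e0 : 0 < eps by rewrite lt_min ltr01 invr_gt0 mulr_gt0.
have [e1 eD] : eps <= 1 /\ eps <= (16 * D)^-1 by split; rewrite ge_min lexx ?orbT.
have De : D * (2 * eps) ^+ 3 <= 2^-1.
  have : D * (16 * eps) <= 1 by move: eD; rewrite -[_^-1]mul1r ler_pdivlMr ?mulr_gt0//; lra.
  have : D * eps ^+ 3 <= D * eps by rewrite ler_wpM2l ?(ltW D0)// exprS ler_piMr ?(ltW e0)// expr_le1// ltW.
  by rewrite exprMn => h1 h2; lra.
have [C C0 hC] := symbol_lower t01 c0 c1 e0.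
exists (2 * C); first by rewrite mulr_gt0.
move=> f1 f2 w1 w2 K1 K2 fw1 fw2 n1 n2.
have lw1 := is_fourier_L2r fw1; have lw2 := is_fourier_L2r fw2.
have out f : supported_in K f -> {ae mu3, forall x, r ^+ 2 < dot3 x x -> f x = 0}.
  by apply: filterS => x hx rx; apply: hx => /hr; rewrite leNgt rx.
have s1 : 0 <= s + 1 by rewrite addr_ge0.
have e10 p w : (0 <= energy p w)%E by exact: sq_ge0.
pose A := fine (energy (s + 1) w1 + energy s w2).
have AE : (energy (s + 1) w1 + energy s w2)%E = A%:E.
  exact: fine_add.
have nA : nsq mu3 w1 + nsq mu3 w2 <= A.
  by rewrite -lee_fin EFinD -AE leeD//; exact: (nsq_le_sobolev P3).
have A0 : 0 <= A by apply: le_trans nA; rewrite addr_ge0 ?nsq_ge0.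
pose Q := (`]- eps, eps[ `*` `]- eps, eps[ `*` `]- eps, eps[)%classic : set (R3 R).
have mQ : measurable Q by do !apply: measurableX.
pose g xi : \bar R := ((weight (s + 2) xi)%:E * \sum_(e : bool) sq mu2 (V w1 w2 e xi))%E.
have mg : measurable_fun setT g := symbol_sum_meas lw1 lw2.
have g0 xi : (0 <= g xi)%E.
  by rewrite mule_ge0 ?lee_fin ?powR_ge0// sume_ge0// => e _; exact: sq_ge0.
pose G xi := weight (s + 1) xi * abs2 (w1 xi) + weight s xi * abs2 (w2 xi).
have G0 xi : 0 <= G xi by rewrite addr_ge0 ?mulr_ge0 ?powR_ge0 ?abs2_ge0.
have mG : measurable_fun setT G.
  exact: measurable_funD (weighted_meas P3 (s + 1) (L2_meas lw1)) (weighted_meas P3 s (L2_meas lw2)).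
have mI : measurable_fun setT (fun xi : R3 R => D * A * \1_Q xi) by apply: measurable_funM => //; exact: measurable_indic.
have DA0 : 0 <= D * A := mulr_ge0 (ltW D0) A0.
have I0 xi : 0 <= D * A * \1_Q xi by apply: mulr_ge0 DA0 _; exact: ler0n.
have pt : {ae mu3, forall xi, setT xi -> ((G xi)%:E <= (D * A * \1_Q xi)%:E + C%:E * g xi)%E}.
  have h1 := hB _ _ fw1 (out _ K1); have h2 := hB _ _ fw2 (out _ K2).
  apply: filterS2 h1 h2 => xi b1 b2 _; have [h|h] := ltP (dot3 xi xi) (eps ^+ 2).
    rewrite indicE mem_set; last exact: low_cube.
    apply: (@le_trans _ _ (D * A * 1%:R)%:E); last by rewrite leeDl// mule_ge0// lee_fin ltW.
    rewrite lee_fin mulr1.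
    have hw p : 0 <= p -> p <= s + 1 -> weight p xi <= 2 `^ (s + 1).
      move=> p0 ps; have d0 := addr_ge0 ler01 (dot3_ge0 xi); apply: (@le_trans _ _ (2 `^ p)).
        apply: ge0_ler_powR; rewrite ?nnegrE//.
        have h' : eps ^+ 2 <= 1 := exprn_ile1 2 (ltW e0) e1.
        by rewrite lerD2l; exact: ltW (lt_le_trans h h').
      by apply: ler_powR => //; rewrite ler1n.
    have q0 : 0 <= 2 `^ (s + 1) :> R by exact: powR_ge0.
    apply: (@le_trans _ _ (2 `^ (s + 1) * (B * nsq mu3 w1) + 2 `^ (s + 1) * (B * nsq mu3 w2))).
      apply: lerD; apply: ler_pM; rewrite ?powR_ge0 ?abs2_ge0//; apply: hw => //.
      by rewrite lerDl.
    by rewrite -!mulrDr mulrA ler_wpM2l// ltW.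
  apply: (@le_trans _ _ (C%:E * g xi)%E); last first.
    by rewrite leeDr// lee_fin I0.
  have d1 : 0 < 1 + dot3 xi xi by rewrite ltr_pwDl ?dot3_ge0.
  have -> : G xi = weight s xi * ((1 + dot3 xi xi) * abs2 (w1 xi) + abs2 (w2 xi)).
    rewrite /G powRD; last by rewrite (gt_eqF d1) implybT.
    by rewrite powRr1 ?(ltW d1)//; ring.
  rewrite EFinM.
  have hh := lee_wpmul2l (_ : 0 <= (weight s xi)%:E)%E (hC w1 w2 xi lw1 lw2 h).
  apply: (le_trans (hh _)); first by rewrite lee_fin powR_ge0.
  rewrite /g powRD; last by rewrite (gt_eqF d1) implybT.
  rewrite !muleA -!EFinM -[weight 2%:R xi]/(weight 2 xi) powR_mulrn ?(ltW d1)// (mulrCA (weight s xi)).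
  by rewrite mulrA.
have Gi : (\int[mu3]_xi (G xi)%:E = A%:E)%E.
  by rewrite -AE (sobolev_sqD P3 _ _ (L2_meas lw1) (L2_meas lw2)).
rewrite AE EFinM -muleA; apply: half_absorb.
  by apply: mule_ge0; [rewrite lee_fin ltW|apply: integral_ge0 => xi _; exact: g0].
rewrite -{1}Gi.
have mCg : measurable_fun setT (fun xi => C%:E * g xi)%E by exact: measurable_funeM.
have mIE : measurable_fun setT (fun xi => (D * A * \1_Q xi)%:E) by exact/measurable_EFinP.
have Cg0 xi : (0 <= C%:E * g xi)%E by apply: mule_ge0 => //; rewrite lee_fin ltW.
have IE0 xi : (0 <= (D * A * \1_Q xi)%:E)%E by rewrite lee_fin I0.
have le1 := ae_ge0_le_integral measurableT (fun x _ => G0 x : (0 <= (G x)%:E)%E) (iffRL (measurable_EFinP _ _) mG)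
  (fun x _ => adde_ge0 (IE0 x) (Cg0 x)) (emeasurable_funD mIE mCg) pt.
apply: (le_trans le1); rewrite (ge0_integralD _ _ (fun x _ => IE0 x) mIE (fun x _ => Cg0 x) mCg)//.
have C0' : (0 <= C%:E)%E by rewrite lee_fin ltW.
rewrite (ge0_integralZl _ measurableT mg (fun x _ => g0 x) C0')//; apply: leeD => //.
under eq_integral do rewrite EFinM.
have mQ1 : measurable_fun setT (fun xi : R3 R => (\1_Q xi : R)%:E) by apply/measurable_EFinP; exact: measurable_indic.
have Q0 (x : R3 R) : (0 <= (\1_Q x : R)%:E)%E by rewrite lee_fin; exact: ler0n.
rewrite (ge0_integralZl _ measurableT mQ1 (fun x _ => Q0 x))//.
have -> : (\int[mu3]_x (\1_Q x : R)%:E = ((2 * eps) ^+ 3)%:E)%E.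
  by rewrite integral_indic// setIT; exact: cube_measure e0.
rewrite -EFinM lee_fin [D * A]mulrC -mulrA.
exact: ler_wpM2l A0 _ _ De.
Qed.

End key_estimate.

Lemma sq_scale_le d (S : measurableType d) (R : realType) (mu : {measure set S -> \bar R}) (a : R[i]) w u :
  cmeas w -> cmeas u -> (forall z, abs2 a * abs2 (w z) <= abs2 (u z)) -> ((abs2 a)%:E * sq mu w <= sq mu u)%E.
Proof.
move=> mw mu_ h; rewrite -sqZ//.
have mz : cmeas (fun x => a * w x) by apply: cmeasM => //; exact: cmeas_cst.
have h1 z : abs2 (a * w z) <= 1 * abs2 (u z) by rewrite mul1r abs2M.
by have := le_sq mu ler01 mz mu_ h1; rewrite mul1e.
Qed.

Lemma integral_ae0 d (S : measurableType d) (R : realType) (mu : {measure set S -> \bar R}) (g : S -> \bar R) :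
  measurable_fun setT g -> {ae mu, forall x, g x = 0%E} -> (\int[mu]_x g x = 0)%E.
Proof.
move=> mg h; rewrite -[RHS](integral0 mu setT); apply: ae_eq_integral => //.
by apply: filterS h => x ->.
Qed.

Lemma sq_section_ae0 d1 d2 (T1 : measurableType d1) (T2 : measurableType d2) (R : realType)
    (m1 : {sigma_finite_measure set T1 -> \bar R}) (m2 : {sigma_finite_measure set T2 -> \bar R}) (u : T1 * T2 -> R[i]) :
  cmeas u -> {ae m2, forall y, sq m1 (fun x => u (x, y)) = 0%E} -> {ae m1, forall x, sq m2 (fun y => u (x, y)) = 0%E}.
Proof.
move=> mu_ h; have m := measurable_sq1 m2 mu_.
have : (\int[m1]_x `|sq m2 (fun y => u (x, y))| = 0)%E.
  rewrite -[RHS](integral_ae0 (measurable_sq2 m1 mu_) h) -(sq_tonelli2 m1 m2 mu_) (sq_tonelli1 m1 m2 mu_).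
  by apply: eq_integral => x _; rewrite gee0_abs// sq_ge0.
by move=> /(ae_eq_integral_abs _ measurableT m); apply: filterS => x; exact.
Qed.

(** * Comparison with the Sobolev norm of the light ray transform *)

Section chart_energy.
Variable R : realType.
Variables (t0 t1 c s : R).
Hypotheses (t01 : t0 < t1) (c0 : 0 < c) (s0 : 0 <= s).
Local Notation mu2 := (leb2 R).
Local Notation mu3 := (leb3 R).
Local Notation mu5 := (leb5 R).
Local Notation C2 := (2 * pi * (2 * pi) : R).
Let P2 := plancherel2 R.
Let P3 := plancherel3 R.
Let P5 := plancherel5 R.
Let C20 : 0 < C2 := planch_gt0 P2.
Local Notation T := (t1 - t0).
Let T0 : 0 < T. Proof. by rewrite subr_gt0. Qed.
Local Notation weight p xi := ((1 + dot3 xi xi) `^ p).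
Local Notation V w1 w2 e xi := (fun z => chart_symbol t0 t1 c w1 w2 e (xi, z)).
Local Notation X f e := (chart_piece e (light_ray_transform t0 t1 f)).

Section one_solution.
Variables (f : R4 R -> R[i]) (w1 w2 : R3 R -> R[i]).
Hypothesis mf : cmeasurable (M t0 t1) f.
Hypotheses (lw1 : L2 mu3 w1) (lw2 : L2 mu3 w2).
Hypothesis hU : forall t, t0 <= t <= t1 -> is_fourier mu3 dot3 (fun x => f (t, x)) (propagate c w1 w2 (t - t0)).

Let mS e : measurable_fun setT (fun xi => sq mu2 (V w1 w2 e xi)).
Proof. by apply: measurable_sq1; exact: chart_symbol_meas. Qed.

(** Dropping the frequency of the chart variable from the weight only decreases it; the integral
    over that frequency is then evaluated by [chart_fourier_section]. *)
Lemma chart_energy e (k : R) : (sobolev_norm5 (s + 2) (X f e) < k%:E)%E ->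
  (\int[mu3]_xi ((weight (s + 2) xi)%:E * sq mu2 (V w1 w2 e xi)) <= (C2^-1 * k ^+ 2)%:E)%E.
Proof.
have s2 : 0 <= s + 2 by rewrite addr_ge0.
move=> /(sobolev_lt s2)[we [hwe k0 hk]].
pose u (p : R5 R) := ((1 + dot5 p p) `^ ((s + 2) / 2))%:C%C * we p.
have mwe := L2_meas (is_fourier_L2r hwe).
have mu_ : cmeas u by apply: cmeasM mwe; exact: cmeas_real (sobolev_weight_meas P5 (s + 2)).
have msu : measurable_fun setT (fun xi => sq mu2 (fun z => u (xi, z))) by exact: measurable_sq1.
have C2i : (0 <= C2^-1%:E)%E by rewrite lee_fin invr_ge0 ltW.
have pt : {ae mu3, forall xi, setT xi ->
    ((weight (s + 2) xi)%:E * sq mu2 (V w1 w2 e xi) <= C2^-1%:E * sq mu2 (fun z => u (xi, z)))%E}.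
  apply: filterS (chart_fourier_section t01 c0 mf lw1 lw2 hU hwe) => xi h _.
  have -> : sq mu2 (V w1 w2 e xi) = (C2^-1%:E * sq mu2 (fun z => we (xi, z)))%E.
    by rewrite h muleA -EFinM mulVf ?gt_eqF// mul1e.
  rewrite muleCA; apply: lee_wpmul2l => //.
  have aw : abs2 ((1 + dot3 xi xi) `^ ((s + 2) / 2))%:C%C = weight (s + 2) xi.
    by have := abs2_weight (@dot3 R) (s + 2) xi 1; rewrite mulr1 => ->; rewrite /abs2 /= expr1n expr0n addr0 mulr1.
  have ms1 := cmeas_section1 xi mwe; have ms2 := cmeas_section1 xi mu_.
  rewrite -aw; apply: (sq_scale_le _ ms1 ms2) => z.
  rewrite /u abs2M; apply: ler_wpM2r; first exact: abs2_ge0.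
  rewrite !abs2_real.
  have d3 := dot3_ge0 xi; have d2 := dot2_ge0 z.
  rewrite lerXn2r ?nnegrE ?powR_ge0//; apply: ge0_ler_powR; rewrite ?divr_ge0// ?nnegrE /dot5 /=; lra.
have h0 xi : (0 <= (weight (s + 2) xi)%:E * sq mu2 (V w1 w2 e xi))%E.
  by rewrite mule_ge0 ?lee_fin ?powR_ge0// sq_ge0.
have u0 xi : (0 <= sq mu2 (fun z => u (xi, z)))%E by exact: sq_ge0.
have m1 : measurable_fun setT (fun xi => ((weight (s + 2) xi)%:E * sq mu2 (V w1 w2 e xi))%E).
  by apply: emeasurable_funM => //; apply/measurable_EFinP; exact: weight_meas P3 _.
have le1 := ae_ge0_le_integral measurableT (fun x _ => h0 x) m1 (fun x _ => mule_ge0 C2i (u0 x)) (measurable_funeM _ msu) pt.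
apply: (le_trans le1); rewrite (ge0_integralZl _ measurableT msu (fun x _ => u0 x) C2i).
rewrite -sq_tonelli1// EFinM; apply: lee_wpmul2l => //; exact: ltW.
Qed.

Lemma symbol_energy_le (k : R) : (sobolev_normC (s + 2) (light_ray_transform t0 t1 f) < k%:E)%E ->
  (symbol_energy t0 t1 c s w1 w2 <= (2 * C2^-1 * k ^+ 2)%:E)%E.
Proof.
move=> hk; have n0 e : (0 <= sobolev_norm5 (s + 2) (X f e))%E.
  by apply: le_ereal_inf_tmp => _ [w _ <-]; exact: L2norm_ge0.
have he e := chart_energy (le_lt_trans (bool_le_sum e n0) hk).
have h0 e xi : (0 <= (weight (s + 2) xi)%:E * sq mu2 (V w1 w2 e xi))%E.
  by rewrite mule_ge0 ?lee_fin ?powR_ge0// sq_ge0.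
have m1 e : measurable_fun setT (fun xi => ((weight (s + 2) xi)%:E * sq mu2 (V w1 w2 e xi))%E).
  by apply: emeasurable_funM => //; apply/measurable_EFinP; exact: weight_meas P3 _.
have -> : symbol_energy t0 t1 c s w1 w2 = (\int[mu3]_xi ((weight (s + 2) xi)%:E * sq mu2 (V w1 w2 true xi)) +
    \int[mu3]_xi ((weight (s + 2) xi)%:E * sq mu2 (V w1 w2 false xi)))%E.
  rewrite -(ge0_integralD _ _ (fun x _ => h0 true x) (m1 true) (fun x _ => h0 false x) (m1 false))//.
  by apply: eq_integral => xi _; rewrite big_bool -ge0_muleDr//; exact: sq_ge0.
rewrite (_ : 2 * C2^-1 * k ^+ 2 = C2^-1 * k ^+ 2 + C2^-1 * k ^+ 2); last by ring.
by rewrite EFinD leeD.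
Qed.

Lemma light_ray_meas v : cmeas (fun y => light_ray_transform t0 t1 f y v).
Proof.
rewrite (_ : (fun y => _) = fun y => cint (leb1 R) (fun tau => ray_data t0 t1 f v (tau, y))).
  by apply: cmeas_cint2; exact: ray_data_meas.
by apply/funext => y; exact: light_rayE.
Qed.

End one_solution.

Lemma propagateB w1 w2 w1' w2' tau (xi : R3 R) :
  propagate c (fun x => w1 x - w1' x) (fun x => w2 x - w2' x) tau xi =
  propagate c w1 w2 tau xi - propagate c w1' w2' tau xi.
Proof. by rewrite /propagate; ring. Qed.

Lemma ray_fourier_integrable w1 w2 v xi : L2 mu3 w1 -> L2 mu3 w2 ->
  cintegrable (leb1 R) (fun tau => ray_fourier t0 t1 c w1 w2 v (tau, xi)).
Proof.
move=> lw1 lw2.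
have h0 : 0 <= 2 * propagate_bound t0 t1 w1 w2 xi.
  by rewrite mulr_ge0// addr_ge0 ?mulr_ge0 ?abs1_ge0// ltW.
have mp : cmeas (fun tau : R1 R => cis (tau * dot3 xi v) * propagate c w1 w2 tau xi).
  by apply: cmeasM; [exact: cis_meas|exact: cmeas_section2 xi (propagate_meas c0 lw1 lw2)].
have := (segment_integrable T0 mp h0 _).1.
rewrite (_ : (fun tau : R1 R => unit_segment T tau * _) = fun tau => ray_fourier t0 t1 c w1 w2 v (tau, xi)).
  apply => tau h; apply: (le_trans (abs1M _ _)); apply: ler_pM; rewrite ?abs1_ge0 ?abs1_cis//.
  exact: propagate_le.
by apply/funext => tau; rewrite /ray_fourier unit_segmentE /=; case: ifP; rewrite ?mul1r ?mul0r.
Qed.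

Lemma chart_symbolB w1 w2 w1' w2' e p : L2 mu3 w1 -> L2 mu3 w2 -> L2 mu3 w1' -> L2 mu3 w2' ->
  chart_symbol t0 t1 c (fun x => w1 x - w1' x) (fun x => w2 x - w2' x) e p =
  chart_symbol t0 t1 c w1 w2 e p - chart_symbol t0 t1 c w1' w2' e p.
Proof.
move=> l1 l2 l1' l2'; rewrite /chart_symbol -mulrBr; congr (_ * _).
rewrite /ray_symbol -cintB; [|exact: ray_fourier_integrable..].
congr cint; apply/funext => tau; rewrite /ray_fourier /=.
by case: ifP => _; rewrite ?propagateB ?mulrBr ?subr0.
Qed.

(** The transforms are not assumed to have finite Sobolev norm here. For almost every [z] the
    difference of the symbols is orthogonal to all transforms of test functions, so it vanishes for
    almost every [xi] by [density]; Tonelli exchanges the order of the two quantifiers. *)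
Lemma symbol_energy0 f f' w1 w2 w1' w2' : cmeasurable (M t0 t1) f -> cmeasurable (M t0 t1) f' ->
  L2 mu3 w1 -> L2 mu3 w2 -> L2 mu3 w1' -> L2 mu3 w2' ->
  (forall t, t0 <= t <= t1 -> is_fourier mu3 dot3 (fun x => f (t, x)) (propagate c w1 w2 (t - t0))) ->
  (forall t, t0 <= t <= t1 -> is_fourier mu3 dot3 (fun x => f' (t, x)) (propagate c w1' w2' (t - t0))) ->
  ae_C (fun y v => light_ray_transform t0 t1 f y v = light_ray_transform t0 t1 f' y v) ->
  symbol_energy t0 t1 c s (fun x => w1 x - w1' x) (fun x => w2 x - w2' x) = 0%E.
Proof.
move=> mf mf' l1 l2 l1' l2' hU hU' hX.
have lD1 := L2B l1 l1'; have lD2 := L2B l2 l2'.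
pose D e := chart_symbol t0 t1 c (fun x => w1 x - w1' x) (fun x => w2 x - w2' x) e.
have lD e : L2 mu5 (D e) := chart_symbol_L2 t01 c0 lD1 lD2 e.
have D0 e : {ae mu3, forall xi, sq mu2 (fun z => D e (xi, z)) = 0%E}.
  have lV := chart_symbol_L2 t01 c0 l1 l2 e; have lV' := chart_symbol_L2 t01 c0 l1' l2' e.
  have hz : {ae mu2, forall z, {ae mu3, forall y, light_ray_transform t0 t1 f y (stereo e z) =
      light_ray_transform t0 t1 f' y (stereo e z)}} := ae_section2 (hX e).
  have sz : {ae mu2, forall z, sq mu3 (fun xi => D e (xi, z)) = 0%E}.
    apply: filterS3 hz (L2_ae2 lV) (L2_ae2 lV') => z hy lz lz'.
    have ae0 : {ae mu3, forall xi, chart_symbol t0 t1 c w1 w2 e (xi, z) - chart_symbol t0 t1 c w1' w2' e (xi, z) = 0}.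
      apply: (density P3 (L2B lz lz')) => k lk; rewrite (ipBl lz lz' (F_L2 P3 lk)); apply/eqP; rewrite subr_eq0; apply/eqP.
      rewrite /ip -(chart_slice_pairing t01 c0 e mf l1 l2 hU z lk) -(chart_slice_pairing t01 c0 e mf' l1' l2' hU' z lk).
      have mX g : cmeasurable (M t0 t1) g -> cmeas (fun y => X g e (y, z) * conjc (k y)).
        move=> mg; apply: cmeasM; last exact: cmeas_conj (L2_meas lk.2).
        exact: (cmeasM (cmeas_cst _ (cutoff e (stereo e z))%:C%C) (light_ray_meas mg (stereo e z))).
      congr (_ * _); apply: cint_ae; [exact: mX|exact: mX|].
      by apply: filterS hy => y; rewrite /chart_piece /= => ->.
    have mz : cmeas (fun xi => D e (xi, z)) by exact: cmeas_section2 (L2_meas (lD e)).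
    rewrite (sq_ae mz (cmeas_cst _ (0 : R[i]))).
      by rewrite /sq integral0_eq// => x _; rewrite abs20.
    by apply: filterS ae0 => xi; rewrite /D chart_symbolB.
  exact: (sq_section_ae0 (L2_meas (lD e)) sz).
rewrite /symbol_energy; refine (integral_ae0 (symbol_sum_meas t0 t1 s c0 lD1 lD2) _).
by apply: filterS2 (D0 true) (D0 false) => xi h1 h2; rewrite big_bool /= -/(D true) -/(D false) h1 h2 adde0 mule0.
Qed.

End chart_energy.

(** * Uniqueness and stability for the Cauchy data *)

Section estimates.
Variable R : realType.
Variables (t0 t1 c s : R) (K : set (R3 R)).
Hypotheses (t01 : t0 < t1) (c0 : 0 < c) (c1 : c <= 1) (s0 : 0 <= s) (Kc : compact K).
Local Notation mu3 := (leb3 R).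
Let P3 := plancherel3 R.
Local Notation energy p w := (sobolev_sq mu3 (@dot3 R) p w).
Let s1 : 0 <= s + 1. Proof. by rewrite addr_ge0. Qed.

Lemma sobolev_ltP (p : R) (u : R3 R -> R[i]) w : 0 <= p -> (sobolev_norm3 p u < +oo)%E -> is_fourier mu3 dot3 u w ->
  (energy p w < +oo)%E.
Proof.
move=> p0 h fw; have n0 : (0 <= sobolev_norm3 p u)%E by apply: le_ereal_inf_tmp => _ [v _ <-]; exact: L2norm_ge0.
have h1 : (sobolev_norm3 p u < (fine (sobolev_norm3 p u) + 1)%:E)%E.
  by rewrite EFinD fineK ?ge0_fin_numE// lteDl// ge0_fin_numE.
have [w' [fw' _ hw']] := sobolev_lt p0 h1.
rewrite (sobolev_sq_ae P3 p (L2_meas (is_fourier_L2r fw)) (L2_meas (is_fourier_L2r fw'))).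
  exact: lt_trans hw' (ltry _).
exact: (pair_uniq_r P3 (is_fourier_pair P3 fw) (is_fourier_pair P3 fw')).
Qed.

Lemma cauchy_data_energy f1 f2 w1 w2 : cauchy_data s K f1 f2 -> is_fourier mu3 dot3 f1 w1 -> is_fourier mu3 dot3 f2 w2 ->
  (energy (s + 1) w1 < +oo)%E /\ (energy s w2 < +oo)%E.
Proof.
have n0 (p : R) u : (0 <= sobolev_norm3 p u)%E by apply: le_ereal_inf_tmp => _ [v _ <-]; exact: L2norm_ge0.
move=> [nf _ _] fw1 fw2; split.
  by apply: sobolev_ltP fw1 => //; apply: le_lt_trans nf; exact: (leeDl _ (n0 _ _)).
by apply: sobolev_ltP fw2 => //; apply: le_lt_trans nf; exact: (leeDr _ (n0 _ _)).
Qed.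

(** Linearity is used on the Fourier side: [key_estimate] is applied to the differences of the data
    and of their transforms, with right-hand side 0 by [symbol_energy0]. The slices then agree
    because [propagate] determines them. *)
Lemma uniqueness (f1 f2 f1' f2' : R3 R -> R[i]) (f f' : R4 R -> R[i]) :
  cauchy_data s K f1 f2 -> wave_solution t0 t1 c s f1 f2 f ->
  cauchy_data s K f1' f2' -> wave_solution t0 t1 c s f1' f2' f' ->
  ae_C (fun y v => light_ray_transform t0 t1 f y v = light_ray_transform t0 t1 f' y v) ->
  [/\ ae_on_slice f1 f1', ae_on_slice f2 f2' &
     forall t, t0 <= t <= t1 -> ae_on_slice (fun x => f (t, x)) (fun x => f' (t, x))].
Proof.
move=> cd ws cd' ws' hX.
have [w1 [w2 [fw1 fw2 hU]]] := wave_slices t01 c0 s0 cd ws.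
have [w1' [w2' [fw1' fw2' hU']]] := wave_slices t01 c0 s0 cd' ws'.
have [n1 n2] := cauchy_data_energy cd fw1 fw2.
have [n1' n2'] := cauchy_data_energy cd' fw1' fw2'.
have [l1 l2] := (is_fourier_L2r fw1, is_fourier_L2r fw2).
have [l1' l2'] := (is_fourier_L2r fw1', is_fourier_L2r fw2').
have fin p w w' : L2 mu3 w -> L2 mu3 w' -> (energy p w < +oo)%E -> (energy p w' < +oo)%E ->
    (energy p (fun x => (w x - w' x)%R) < +oo)%E.
  move=> l l' h h'; have m w0 : cmeas w0 -> cmeas (fun xi => ((1 + dot3 xi xi) `^ (p / 2))%:C%C * w0 xi).
    by apply: cmeasM; apply: cmeas_real; exact: sobolev_weight_meas P3 p.
  have := L2B (conj (m _ (L2_meas l)) h) (conj (m _ (L2_meas l')) h') => -[_].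
  by congr (sq _ _ < _)%E; apply/funext => xi; rewrite mulrBr.
have supp g g' : supported_in K g -> supported_in K g' -> supported_in K (fun x => g x - g' x).
  by move=> h h'; apply: filterS2 h h' => x e e' Kx; rewrite e// e'// subrr.
have [C C0 hC] := key_estimate t01 c0 c1 s0 Kc.
have [_ K1 K2] := cd; have [_ K1' K2'] := cd'.
have e0 := symbol_energy0 s t01 c0 ws.1 ws'.1 l1 l2 l1' l2' hU hU' hX.
have := hC _ _ _ _ (supp _ _ K1 K1') (supp _ _ K2 K2') (is_fourierB P3 fw1 fw1') (is_fourierB P3 fw2 fw2')
  (fin _ _ _ l1 l1' n1 n1') (fin _ _ _ l2 l2' n2 n2').
rewrite e0 mule0 => hE.
have q0 p w : (0 <= energy p w)%E by exact: sq_ge0.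
have zero p w w' : 0 <= p -> L2 mu3 w -> L2 mu3 w' -> (energy p (fun x => (w x - w' x)%R) <= 0)%E ->
    {ae mu3, forall x, w x = w' x}.
  move=> p0 l l' h; have := le_trans (nsq_le_sobolev P3 p0 (L2B l l')) h; rewrite lee_fin => h0.
  by apply: filterS (nsq0P (L2B l l') h0) => x /eqP; rewrite subr_eq0 => /eqP.
have ww1 : {ae mu3, forall x, w1 x = w1' x}.
  by apply: (zero (s + 1)) => //; apply: le_trans hE; exact: (leeDl _ (q0 _ _)).
have ww2 : {ae mu3, forall x, w2 x = w2' x}.
  by apply: (zero s) => //; apply: le_trans hE; exact: (leeDr _ (q0 _ _)).
split.
- exact: (pair_uniq_l P3 (is_fourier_pair P3 fw1) (is_fourier_pair P3 fw1') ww1).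
- exact: (pair_uniq_l P3 (is_fourier_pair P3 fw2) (is_fourier_pair P3 fw2') ww2).
move=> t It; apply: (pair_uniq_l P3 (is_fourier_pair P3 (hU t It)) (is_fourier_pair P3 (hU' t It))).
by apply: filterS2 ww1 ww2 => x; rewrite /propagate => -> ->.
Qed.

(** Sobolev norms are infima, possibly not attained or infinite, so estimates are proved for every
    real [k] strictly above them and closed here. *)
Lemma le_scale_lt (x y : \bar R) (C : R) : 0 < C -> (0 <= x)%E ->
  (forall k : R, (x < k%:E)%E -> (y <= (C * k)%:E)%E) -> (y <= C%:E * x)%E.
Proof.
move=> C0; case: x => [x||]// x0 h; last by rewrite gt0_muley ?leey// lte_fin.
apply/lee_addgt0Pr => e e0; have e1 : 0 < e / C by rewrite divr_gt0.
apply: (le_trans (h (x + e / C) _)); first by rewrite lte_fin ltrDl.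
by rewrite -EFinM -EFinD lee_fin mulrDr mulrCA divff ?mulr1// gt_eqF.
Qed.

Lemma stability : exists2 C : R, 0 < C & forall (f1 f2 : R3 R -> R[i]) (f : R4 R -> R[i]) (k : R),
  cauchy_data s K f1 f2 -> wave_solution t0 t1 c s f1 f2 f ->
  (sobolev_normC (s + 2) (light_ray_transform t0 t1 f) < k%:E)%E ->
  exists w1 w2, [/\ is_fourier mu3 dot3 f1 w1, is_fourier mu3 dot3 f2 w2,
    (forall t, t0 <= t <= t1 -> is_fourier mu3 dot3 (fun x => f (t, x)) (propagate c w1 w2 (t - t0))),
    (energy (s + 1) w1 <= ((C * k) ^+ 2)%:E)%E & (energy s w2 <= ((C * k) ^+ 2)%:E)%E].
Proof.
have [C C0 hC] := key_estimate t01 c0 c1 s0 Kc.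
have B0 : 0 < (2 * pi * (2 * pi) : R) := planch_gt0 (plancherel2 R).
move: (2 * pi * (2 * pi) : R) B0 (@symbol_energy_le R t0 t1 c s t01 c0 s0) => B B0 hB.
have D0 : 0 < C * (2 * B^-1) by rewrite !mulr_gt0// invr_gt0.
exists (Num.sqrt (C * (2 * B^-1))); first by rewrite sqrtr_gt0.
move=> f1 f2 f k cd ws hk; have [w1 [w2 [fw1 fw2 hU]]] := wave_slices t01 c0 s0 cd ws.
exists w1, w2; have [n1 n2] := cauchy_data_energy cd fw1 fw2; have [_ K1 K2] := cd.
have h := hC _ _ _ _ K1 K2 fw1 fw2 n1 n2.
have hs := hB _ _ _ ws.1 (is_fourier_L2r fw1) (is_fourier_L2r fw2) hU _ hk.
have {}h : (energy (s + 1) w1 + energy s w2 <= ((Num.sqrt (C * (2 * B^-1)) * k) ^+ 2)%:E)%E.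
  apply: (le_trans h); rewrite exprMn sqr_sqrtr ?(ltW D0)// -mulrA EFinM; apply: lee_wpmul2l => //.
  by rewrite lee_fin ltW.
have q0 p w : (0 <= energy p w)%E by exact: sq_ge0.
split => //; apply: le_trans h; [exact: (leeDl _ (q0 _ _))|exact: (leeDr _ (q0 _ _))].
Qed.

Lemma normN_le f1 f2 w1 w2 (k : R) : 0 <= k -> is_fourier mu3 dot3 f1 w1 -> is_fourier mu3 dot3 f2 w2 ->
  (energy (s + 1) w1 <= (k ^+ 2)%:E)%E -> (energy s w2 <= (k ^+ 2)%:E)%E -> (normN s f1 f2 <= (2 * k)%:E)%E.
Proof.
move=> k0 fw1 fw2 h1 h2; rewrite mulrDl mul1r EFinD.
by rewrite leeD// ; [exact: sobolev_norm_le fw1 k0 h1|exact: sobolev_norm_le fw2 k0 h2].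
Qed.

End estimates.

(** * Extension of the solution *)

Lemma small_powers (R : realType) (x E : R) : (forall n, `|x| <= E * 2^-1 ^+ n) -> x = 0.
Proof.
move=> h; have c : E * 2^-1 ^+ n @[n --> \oo] --> E * 0.
  by apply: cvgM; [exact: cvg_cst|apply: cvg_expr; rewrite ger0_norm ?invr_ge0// invf_lt1// ltr1n].
have : `|x| <= E * 0 by apply: (cvgr_to_ge c); exact: nearW.
by rewrite mulr0 normr_le0 => /eqP.
Qed.

Lemma geometric_increments_cvg (R : realType) (u : R^nat) (k : R) : 0 <= k ->
  (forall n, `|u n.+1 - u n| <= k * 2^-1 ^+ n) -> cvgn u.
Proof.
move=> k0 h; have h2 : `|2^-1 : R| < 1 by rewrite ger0_norm ?invr_ge0// invf_lt1// ltr1n.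
have : cvgn (series (telescope u)).
  have c := @is_cvg_geometric_series R k _ h2.
  apply: normed_cvg; apply: (@series_le_cvg _ (fun n => `|telescope u n|) (geometric k 2^-1)) => // n.
  by rewrite /geometric /= mulr_ge0// exprn_ge0// invr_ge0.
rewrite telescopeK => c; have -> : u = (fun n => (u n - u 0%N) + u 0%N) by apply/funext => n; rewrite subrK.
by apply: is_cvgD => //; exact: is_cvg_cst.
Qed.

(** * Completeness of L2 *)

Section riesz_fischer.
Context d (T : measurableType d) (R : realType).
Variable mu : {measure set T -> \bar R}.
Implicit Types u v : T -> R[i].
Variable u : nat -> T -> R[i].
Hypothesis lu : forall n, L2 mu (u n).
Hypothesis hu : forall n, nsq mu (fun x => u n.+1 x - u n x) <= 16^-1 ^+ n.

Let a n x := abs2 (u n.+1 x - u n x).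
(** The squared norms of the increments are at most [16^-k], so this weighted sum has a finite
    integral; where it is finite the increments are of order [2^-k] and the sequence converges. *)
Let H x : \bar R := (\sum_(0 <= k <oo) (4 ^+ k * a k x)%:E)%E.

Let a0 n x : 0 <= a n x. Proof. exact: abs2_ge0. Qed.
Let t0 n x : (0 <= (4 ^+ n * a n x)%:E)%E. Proof. by rewrite lee_fin mulr_ge0// exprn_ge0. Qed.
Let ma n : measurable_fun setT (fun x => (4 ^+ n * a n x)%:E).
Proof.
apply/measurable_EFinP; apply: measurable_funM => //; apply: measurable_abs2.
exact: cmeasB (L2_meas (lu _)) (L2_meas (lu _)).
Qed.

Let H0 x : (0 <= H x)%E. Proof. exact: nneseries_ge0. Qed.
Let mH : measurable_fun setT H.
Proof. by apply: (@ge0_emeasurable_sum _ _ _ setT _ predT) => //; move=> n _; exact: ma. Qed.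

Let intH : (\int[mu]_x H x <= 2%:E)%E.
Proof.
rewrite integral_nneseries//; apply: lime_le.
  by apply: is_cvg_nneseries => n _ _; apply: integral_ge0 => x _.
(* The bound on the partial sums is strengthened to [2 - 2 * 4^-n], whose increments exceed the
   terms [4^-n], so that induction goes through. *)
apply/nearW => n; apply: (@le_trans _ _ (2 - 2 * 4^-1 ^+ n)%:E); last first.
  by rewrite lee_fin gerBl mulr_ge0// exprn_ge0// invr_ge0.
elim: n => [|n IH]; first by rewrite big_geq// expr0 mulr1 subrr.
rewrite big_nat_recr//=; apply: (le_trans (leeD IH (_ : _ <= (4^-1 ^+ n)%:E)%E)).
  under eq_integral do rewrite EFinM.
  have ia := L2B (lu n.+1) (lu n).
  have mE : measurable_fun setT (fun x => (a n x)%:E) by apply/measurable_EFinP; exact: measurable_abs2 (L2_meas ia).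
  have E0 x : (0 <= (a n x)%:E)%E by rewrite lee_fin.
  rewrite (ge0_integralZl _ measurableT mE (fun x _ => E0 x)); last by rewrite lee_fin exprn_ge0.
  rewrite (_ : (\int[mu]_x (a n x)%:E)%E = (nsq mu (fun x => u n.+1 x - u n x))%:E); last by rewrite -L2_fin.
  rewrite -EFinM lee_fin; apply: (le_trans (ler_wpM2l _ (hu n))); first by rewrite exprn_ge0.
  by rewrite -exprMn (_ : 4 * 16^-1 = 4^-1 :> R)//; field.
have : 0 <= 4^-1 ^+ n :> R by rewrite exprn_ge0// invr_ge0.
by rewrite -EFinD lee_fin exprS; move: (4^-1 ^+ n) => y y0; lra.
Qed.

Let tail x : (H x < +oo)%E -> forall n j, abs2 (u (n + j)%N x - u n x) <= 4 * 4^-1 ^+ n * fine (H x).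
Proof.
move=> hx; have fH : (fine (H x))%:E = H x by rewrite fineK// ge0_fin_numE.
have aH n : a n x <= 4^-1 ^+ n * fine (H x).
  have : ((4 ^+ n * a n x)%:E <= H x)%E.
    apply: (@le_trans _ _ (\sum_(0 <= k < n.+1) (4 ^+ k * a k x)%:E)%E); last exact: nneseries_lim_ge.
    by rewrite big_nat_recr//= leeDr// sume_ge0.
  rewrite -fH lee_fin => h; by rewrite exprVn ler_pdivlMl ?exprn_gt0.
move=> n j; elim: j n => [|j IH] n.
  by rewrite addn0 subrr abs20 !mulr_ge0 ?exprn_ge0 ?invr_ge0 ?fine_ge0.
have -> : u (n + j.+1)%N x - u n x = (u n.+1 x - u n x) + (u (n.+1 + j)%N x - u n.+1 x).
  by rewrite addnS addSn; ring.
apply: (le_trans (abs2D _ _)); have := IH n.+1; have := aH n; rewrite exprS -/(a n x).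
by move: (a n x) (abs2 _) (4^-1 ^+ n) (fine (H x)) => p q r s; lra.
Qed.

Lemma L2_complete : exists v, L2 mu v /\ forall n, nsq mu (fun x => v x - u n x) <= 8 * 4^-1 ^+ n.
Proof.
pose B := [set x | (H x < +oo)%E].
have mB : measurable B by rewrite -[B]setTI; exact: emeasurable_fun_infty_o.
(* Setting the functions to 0 where [H] is infinite makes the limit exist at every point, hence
   measurable. *)
pose w n := cut B (u n).
have mw n : cmeas (w n) by apply: cmeas_cutT => //; exact: L2_meas (lu n).
have wx n x : w n x = if (H x < +oo)%E then u n x else 0.
  by rewrite /w /cut (_ : (x \in B) = (H x < +oo)%E)//; apply/idP/idP; rewrite inE.
have cw x (p : R[i] -> R) : (forall z z', p (z - z') = p z - p z') -> (forall z, p z ^+ 2 <= abs2 z) -> cvgn (fun n => p (w n x)).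
  move=> pB p2; have [h|h] := boolP (H x < +oo)%E; last first.
    by apply: cvgP (_ : _ --> p 0); apply: cvg_near_cst; apply/nearW => n; rewrite wx (negPf h).
  have k0 : 0 <= Num.sqrt (4 * fine (H x)) by exact: sqrtr_ge0.
  apply: (geometric_increments_cvg k0) => n; rewrite -pB !wx h.
  rewrite -(@ler_pXn2r _ 2) ?nnegrE ?mulr_ge0 ?exprn_ge0 ?invr_ge0// real_normK ?num_real//.
  apply: (le_trans (p2 _)); have := tail h n 1; rewrite addn1; move/le_trans; apply.
  rewrite exprMn sqr_sqrtr ?mulr_ge0 ?fine_ge0// -exprM mulnC exprM (_ : 2^-1 ^+ 2 = 4^-1 :> R); last by field.
  by rewrite mulrAC.
have cR x : cvgn (fun n => cRe (w n x)) by apply: cw => z; [move=> z'; rewrite !cE|rewrite /abs2 lerDl sqr_ge0].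
have cI x : cvgn (fun n => cIm (w n x)) by apply: cw => z; [move=> z'; rewrite !cE|rewrite /abs2 lerDr sqr_ge0].
pose v x : R[i] := (lim (cRe (w n x) @[n --> \oo]) +i* lim (cIm (w n x) @[n --> \oo]))%C.
have mv : cmeas v.
  by split; [apply: (measurable_fun_cvg (fun n => (mw n).1))|apply: (measurable_fun_cvg (fun n => (mw n).2))] => x _; [exact: cR|exact: cI].
have bnd n x : ((abs2 (v x - u n x))%:E <= (4 * 4^-1 ^+ n)%:E * H x)%E.
  have c0 : 0 < 4 * 4^-1 ^+ n :> R by rewrite mulr_gt0// exprn_gt0// invr_gt0.
  have [h|] := boolP (H x < +oo)%E; last first.
    by rewrite ltey negbK => /eqP ->; rewrite gt0_muley ?lte_fin ?leey.
  rewrite -(fineK (_ : H x \is a fin_num)) ?ge0_fin_numE// -EFinM lee_fin.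
  have cv : abs2 (w m x - u n x) @[m --> \oo] --> abs2 (v x - u n x).
    rewrite /abs2; under eq_fun do rewrite !cE; rewrite !cE /v /=.
    by apply: cvgD; rewrite expr2; under eq_fun do rewrite expr2; apply: cvgM; apply: cvgB => //; try exact: cvg_cst.
  apply: (cvgr_to_le cv); exists n => // m /= nm.
  by rewrite wx h -(subnKC nm); exact: tail.
have sqb n : (sq mu (fun x => (v x - u n x)%R) <= (8 * 4^-1 ^+ n)%:E)%E.
  have c0 : (0 <= (4 * 4^-1 ^+ n)%:E :> \bar R)%E by rewrite lee_fin mulr_ge0// exprn_ge0// invr_ge0.
  apply: (@le_trans _ _ (\int[mu]_x ((4 * 4^-1 ^+ n)%:E * H x))%E).
    apply: ge0_le_integral => //.
    - by move=> x _; rewrite lee_fin abs2_ge0.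
    - by apply/measurable_EFinP/measurable_abs2; exact: cmeasB mv (L2_meas (lu n)).
    - exact: measurable_funeM.
  rewrite (ge0_integralZl _ measurableT mH (fun x _ => H0 x) c0).
  apply: (le_trans (lee_wpmul2l c0 intH)); rewrite -EFinM lee_fin le_eqVlt; apply/orP; left; apply/eqP; ring.
have lvu n : L2 mu (fun x => v x - u n x).
  by split; [exact: cmeasB mv (L2_meas (lu n))|exact: le_lt_trans (sqb n) (ltry _)].
exists v; split.
  by have := L2D (lvu 0%N) (lu 0%N); congr L2; apply/funext => x; rewrite subrK.
by move=> n; rewrite -lee_fin -(L2_fin (lvu n)).
Qed.

End riesz_fischer.

(** * Surjectivity of the Fourier transform on L2 *)

Section fourier_onto.
Context d (T : measurableType d) (R : realType).
Variables (mu : {sigma_finite_measure set T -> \bar R}) (dot : T -> T -> R) (C : R).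
Hypothesis P : plancherel_space mu dot C.
Implicit Types u v w : T -> R[i].
Local Notation F := (fourier mu dot).
Let C0 : 0 < C := planch_gt0 P.

(** The preimage is [C^-1] times [conj (F (conj w))], that is the inverse transform; the
    multiplication formula verifies the pairing. *)
Lemma fourier_onto_L12 w : cintegrable mu w /\ L2 mu w -> exists u, is_fourier mu dot u w.
Proof.
move=> [iw lw]; have ic := cintegrable_conj iw.
have lc : L2 mu (fun x => conjc (w x)) := L2_conj lw.
have lF := F_L2 P (conj ic lc); pose g x := conjc (F (fun y => conjc (w y)) x).
have lg : L2 mu g := L2_conj lF.
exists (fun x => (C^-1)%:C%C * g x); apply: (pair_is_fourier P).
  split => //; first exact: L2Z.
  move=> k lk; rewrite (ipZl _ lg lk.2) mulrA -rmorphM /= mulfV ?gt_eqF// mul1r.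
  have iFk := L2_mulc lw (F_L2 P lk).
  have h := mult_formula P ic lk.1.
  rewrite /ip -[LHS]conjcc -cint_conj//.
  rewrite (_ : (fun x => conjc (w x * _)) = fun x => conjc (w x) * F k x); last by apply/funext => x; rewrite conjcM conjcc.
  rewrite -h -cint_conj; last first.
    have := L2_mulc lF (L2_conj lk.2); congr cintegrable; apply/funext => x; by rewrite conjcc.
  by congr cint; apply/funext => x; rewrite conjcM.
rewrite (nsqZ _ lg) abs2_real.
have -> : nsq mu g = C * nsq mu w.
  have -> : nsq mu g = nsq mu (F (fun y => conjc (w y))) by rewrite /nsq /g sq_conj.
  by rewrite (nsq_F P (conj ic lc)); congr (_ * _); rewrite /nsq sq_conj.
by field; rewrite gt_eqF.
Qed.

(** Truncations of [w] with errors below [C / 4 * 16^-n] have preimages that satisfy the hypothesis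
    of [L2_complete], by isometry. The pairing and the norm identity pass to the limit with the
    weight [2^n] in [ip_bound], against errors of order [4^-n]. *)
Lemma fourier_onto w : L2 mu w -> exists u, is_fourier mu dot u w.
Proof.
move=> lw; have d0 n : 0 < C / 4 * 16^-1 ^+ n by rewrite !mulr_gt0 ?exprn_gt0 ?invr_gt0.
have [r hr] := choice (fun n => trunc_cvg P lw (d0 n)).
pose W n := trunc dot (r n) w.
have hW n : nsq mu (fun x => w x - W n x) <= C / 4 * 16^-1 ^+ n by apply/ltW; have [_ h] := hr n; exact: h.
have l12 n := trunc_L12 P (r n) lw; have lW n : L2 mu (W n) := (l12 n).2.
have [u hu] := choice (fun n => fourier_onto_L12 (l12 n)).
have lu n := is_fourier_L2l (hu n).
have du n : nsq mu (fun x => u n.+1 x - u n x) <= 16^-1 ^+ n.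
  have := is_fourier_nsq P (is_fourierB P (hu n.+1) (hu n)) => e.
  rewrite -(ler_pM2l C0) -e.
  have -> : (fun x => W n.+1 x - W n x) = fun x => (w x - W n x) - (w x - W n.+1 x) by apply/funext => x; ring.
  have lD m : L2 mu (fun x => w x - W m x) := L2B lw (lW m).
  have := nsqD_le (lD n) (L2N (lD n.+1)); rewrite nsqN => /le_trans; apply.
  have := hW n; have := hW n.+1; rewrite exprS => h1 h2.
  have p0 : 0 <= C / 4 * 16^-1 ^+ n := ltW (d0 n).
  have : C / 4 * (16^-1 * 16^-1 ^+ n) <= C / 4 * 16^-1 ^+ n.
    by rewrite ler_wpM2l ?divr_ge0 ?(ltW C0)// ler_piMl ?exprn_ge0 ?invr_ge0// invf_le1// ler1n.
  have -> : C * 16^-1 ^+ n = 4 * (C / 4 * 16^-1 ^+ n) by field.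
  lra.
have [v [lv hv]] := L2_complete lu du.
have e42 n : 4^-1 ^+ n = 2^-1 ^+ n * 2^-1 ^+ n :> R by rewrite -exprMn; congr (_ ^+ _); field.
have hW4 n : nsq mu (fun x => w x - W n x) <= C * 4^-1 ^+ n.
  apply: (le_trans (hW n)); apply: ler_pM; rewrite ?divr_ge0 ?(ltW C0) ?exprn_ge0 ?invr_ge0//.
    by rewrite ler_pdivrMr// ler_peMr ?(ltW C0)// ler1n.
  by rewrite lerXn2r ?nnegrE ?invr_ge0// lef_pV2 ?posrE// ler_nat.
have k0 n : 0 < 2 ^+ n :> R by rewrite exprn_gt0.
have k2 n : 2 ^+ n * (2^-1 ^+ n * 2^-1 ^+ n) = 2^-1 ^+ n :> R.
  by rewrite mulrA exprVn mulfV ?mul1r// gt_eqF.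
have lW' n : L2 mu (fun x => w x - W n x) := L2B lw (lW n).
have lv' n : L2 mu (fun x => v x - u n x) := L2B lv (lu n).
exists v; apply: (pair_is_fourier P).
  split => // k lk; have lF := F_L2 P lk.
  pose D := ip mu w (F k) - C%:C%C * ip mu v k.
  have DE n : D = ip mu (fun x => w x - W n x) (F k) - C%:C%C * ip mu (fun x => v x - u n x) k.
    rewrite (ipBl lw (lW n) lF) (ipBl lv (lu n) lk.2).
    by have [_ _ ->//] := is_fourier_pair P (hu n); rewrite /D; ring.
  apply/eqP; rewrite -subr_eq0 -abs2_eq0; suff: abs1 D = 0.
    by move=> h; rewrite eq_le abs2_ge0 andbT; have := abs2_le_abs1 D; rewrite h expr0n.
  apply: (@small_powers R _ (C + nsq mu (F k) + C * (8 + nsq mu k))) => n.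
  rewrite ger0_norm ?abs1_ge0// (DE n); apply: (le_trans (abs1D _ _)); rewrite abs1N.
  have h1 := ip_bound (lW' n) lF (k0 n); have h2 := ip_bound (lv' n) lk.2 (k0 n).
  have h3 : 2 ^+ n * nsq mu (fun x => w x - W n x) <= C * 2^-1 ^+ n.
    by apply: (le_trans (ler_wpM2l (ltW (k0 n)) (hW4 n))); rewrite e42 mulrCA k2.
  have h4 : 2 ^+ n * nsq mu (fun x => v x - u n x) <= 8 * 2^-1 ^+ n.
    by apply: (le_trans (ler_wpM2l (ltW (k0 n)) (hv n))); rewrite e42 mulrCA k2.
  have h5 : abs1 (C%:C%C * ip mu (fun x => v x - u n x) k) <= C * (8 * 2^-1 ^+ n + 2^-1 ^+ n * nsq mu k).
    apply: (le_trans (abs1M _ _)); rewrite abs1_real (gtr0_norm C0) ler_wpM2l ?(ltW C0)//.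
    by apply: (le_trans h2); rewrite -exprVn lerD2r.
  rewrite -exprVn in h1.
  have -> : (C + nsq mu (F k) + C * (8 + nsq mu k)) * 2^-1 ^+ n =
     (C * 2^-1 ^+ n + 2^-1 ^+ n * nsq mu (F k)) + C * (8 * 2^-1 ^+ n + 2^-1 ^+ n * nsq mu k) by ring.
  by apply: lerD => //; apply: (le_trans h1); rewrite lerD2r.
apply/eqP; rewrite -subr_eq0; apply/eqP.
pose A := nsq mu v + C^-1 * nsq mu w.
apply: (@small_powers R _ (C + C * (8 + (2 * nsq mu v + 2 * (C^-1 * nsq mu w))))) => n.
have lp : L2 mu (fun x => v x + u n x) := L2D lv (lu n).
have nuw : nsq mu (u n) = C^-1 * nsq mu (W n) by rewrite (is_fourier_nsq P (hu n)) mulKf// gt_eqF.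
have nW : nsq mu (W n) <= nsq mu w.
  by rewrite -subr_ge0 -(nsq_sub_trunc P _ lw) nsq_ge0.
have eW : nsq mu w - C * nsq mu v = nsq mu (fun x => w x - W n x) - C * (nsq mu v - nsq mu (u n)).
  by rewrite (nsq_sub_trunc P _ lw) nuw -/(W n); field; rewrite gt_eqF.
(* A difference of square norms is the pairing of the difference with the sum, so it inherits the
   rate of convergence. *)
have rv : nsq mu v - nsq mu (u n) = rip mu (fun x => v x - u n x) (fun x => v x + u n x).
  have := Re_ip_polar (lv' n) lp; rewrite /rip.
  have -> : (fun x => v x - u n x + (v x + u n x)) = fun x => (2%:C)%C * v x.
    by apply/funext => x; apply: complex_ext; rewrite !cE; ring.
  have -> : (fun x => v x - u n x - (v x + u n x)) = fun x => ((-2)%:C)%C * u n x.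
    by apply/funext => x; apply: complex_ext; rewrite !cE; ring.
  by rewrite (nsqZ _ lv) (nsqZ _ (lu n)) !abs2_real sqrrN; lra.
have h1 := rip_bound (lv' n) lp (k0 n).
have h4 : 2 ^+ n * nsq mu (fun x => v x - u n x) <= 8 * 2^-1 ^+ n.
  by apply: (le_trans (ler_wpM2l (ltW (k0 n)) (hv n))); rewrite e42 mulrCA k2.
have h6 : nsq mu (fun x => v x + u n x) <= 2 * nsq mu v + 2 * (C^-1 * nsq mu w).
  apply: (le_trans (nsqD_le lv (lu n))); rewrite lerD2l ler_wpM2l// nuw ler_wpM2l// invr_ge0 ltW//.
have h7 : 4^-1 ^+ n <= 2^-1 ^+ n :> R by rewrite e42 ler_piMl ?exprn_ge0 ?invr_ge0// exprn_ile1 ?invr_ge0// invf_le1// ler1n.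
rewrite eW; apply: (le_trans (ler_normB _ _)); rewrite mulrDl; apply: lerD.
  rewrite ger0_norm ?nsq_ge0//; apply: (le_trans (hW4 n)); by rewrite ler_wpM2l// ltW.
rewrite normrM (gtr0_norm C0) -mulrA ler_wpM2l ?(ltW C0)// rv; apply: (le_trans h1).
rewrite mulrDl -exprVn; apply: lerD => //; rewrite mulrC ler_wpM2r// exprn_ge0// invr_ge0//.
Qed.

End fourier_onto.

(** * Recovering a function from its partial transforms *)

Section product_swap.
Context d1 d2 (T1 : measurableType d1) (T2 : measurableType d2) (R : realType).
Variables (m1 : {sigma_finite_measure set T1 -> \bar R}) (m2 : {sigma_finite_measure set T2 -> \bar R}).
Variables (dot1 : T1 -> T1 -> R) (dot2 : T2 -> T2 -> R) (C1 C2 : R).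
Hypotheses (P1 : plancherel_space m1 dot1 C1) (P2 : plancherel_space m2 dot2 C2).
Local Notation m12 := (sigma_finite_product m1 m2).
Local Notation dot := (fun p q : T1 * T2 => dot1 p.1 q.1 + dot2 p.2 q.2).
Let P : plancherel_space m12 dot (C1 * C2) := plancherel_prod P1 P2.
Local Notation pf1 := (partial_fourier1 m1 dot1).
Local Notation pf2 := (partial_fourier2 m2 dot2).
Implicit Types u K : T1 * T2 -> R[i].

Lemma partial_fourier2_integrand u eta : cintegrable m12 u ->
  cintegrable m12 (fun p => u p * cis (- dot2 p.2 eta)).
Proof.
move=> iu; apply: (cintegrableM iu (k := 2)); last by move=> ?; exact: abs1_cis.
by apply: (cmeas_comp (f := snd) (u := fun x => cis (- dot2 x eta))) => //; exact: (cmeas_cisl P2 eta).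
Qed.

Lemma partial_fourier2_integrable u eta : cintegrable m12 u -> cintegrable m1 (fun x => pf2 u (x, eta)).
Proof. by move=> iu; exact: (cintegrable_fubini1 (partial_fourier2_integrand eta iu)). Qed.

Lemma partial_fourier2_L2 u : cintegrable m12 u -> L2 m12 u -> L2 m12 (pf2 u).
Proof.
move=> iu lu; split; first exact: (partial_fourier2_meas P2 (cintegrable_meas iu)).
rewrite (sq_partial_fourier2 P2) ?(L2_fin lu) -?EFinM ?ltry//; first exact: cintegrable_meas iu.
by apply: filterS2 (cintegrable_ae1 iu) (L2_ae1 lu).
Qed.

Lemma fourier_prod_swap u : cintegrable m12 u -> fourier m12 dot u = pf1 (pf2 u).
Proof.
move=> iu; have i2 eta := partial_fourier2_integrand eta iu.
have i1 xi eta : cintegrable m12 (fun p => u p * cis (- dot2 p.2 eta) * cis (- dot1 p.1 xi)).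
  apply: (cintegrableM (i2 eta) (k := 2)); last by move=> ?; exact: abs1_cis.
  by apply: (cmeas_comp (f := fst) (u := fun x => cis (- dot1 x xi))) => //; exact: (cmeas_cisl P1 xi).
apply/funext => -[xi eta]; rewrite /partial_fourier1 /partial_fourier2 /fourier /=.
transitivity (cint m12 (fun p => u p * cis (- dot2 p.2 eta) * cis (- dot1 p.1 xi))).
  by congr cint; apply/funext => p; rewrite opprD cisD -mulrA [cis (- dot2 _ _) * _]mulrC.
rewrite cint_fubini1//; apply: cint_ae.
- exact: (cintegrable_meas (cintegrable_fubini1 (i1 xi eta))).
- apply: cmeasM; last exact: (cmeas_cisl P1 xi).
  exact: (cintegrable_meas (cintegrable_fubini1 (i2 eta))).
- by apply: filterS (cintegrable_ae1 (i2 eta)) => y hy /=; rewrite cintZr.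
Qed.

Section slices.
Variables (G Psi : T1 * T2 -> R[i]).
Hypothesis lPsi : L2 m12 Psi.
Hypothesis sPsi : forall y, cintegrable m1 (fun x => Psi (x, y)) /\ L2 m1 (fun x => Psi (x, y)).
Hypothesis hG : is_fourier m12 dot G (pf1 Psi).

(** The full transform of [G] is the transform of [Psi] in the first variable. Removing that one by
    polarisation on almost every slice shows, in weak form, that [Psi] is the transform of [G] in
    the second variable alone. *)
Lemma slice_pairing K : cintegrable m12 K /\ L2 m12 K -> C2%:C%C * ip m12 G K = ip m12 Psi (pf2 K).
Proof.
move=> lK; have [iK l2K] := lK; have [_ lw hp] := is_fourier_pair P hG.
have lF := partial_fourier2_L2 iK l2K.
have C10 : C1%:C%C != 0 :> R[i] by rewrite -abs2_eq0 abs2_real expf_neq0// gt_eqF// (planch_gt0 P1).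
apply: (mulfI C10); rewrite mulrA -rmorphM /= -(hp _ lK) (fourier_prod_swap iK).
have iL := L2_mulc lw (F_L2 P lK); rewrite (fourier_prod_swap iK) in iL; have iP := L2_mulc lPsi lF.
rewrite /ip (cint_fubini2 iL) (cint_fubini2 iP) -(cintZ _ (cintegrable_fubini2 iP)).
apply: cint_ae.
- exact: cintegrable_meas (cintegrable_fubini2 iL).
- exact: cintegrable_meas (cintegrableZ _ (cintegrable_fubini2 iP)).
- by apply: filterS (L2_ae2 lF) => y l; exact: (polar P1 (sPsi y) (conj (partial_fourier2_integrable y iK) l)).
Qed.

(** Test functions cut to [A] remain integrable and square integrable. Against them [G] and [g] have
    the same pairings, by [slice_pairing] and by the slicewise hypothesis, so their difference cut
    to [A] vanishes. *)
Lemma slices_determine (A : set T1) (g : T1 * T2 -> R[i]) : measurable A -> L2 m12 g ->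
  (forall x, A x -> fourier_pair m2 dot2 C2 (fun y => g (x, y)) (fun y => Psi (x, y))) ->
  {ae m12, forall p, A p.1 -> G p = g p}.
Proof.
move=> mA lg hA; have lG := is_fourier_L2l hG; have lD := L2B lG lg.
have C20 : C2%:C%C != 0 :> R[i] by rewrite -abs2_eq0 abs2_real expf_neq0// gt_eqF// (planch_gt0 P2).
have mAT : measurable (A `*` [set: T2]) by exact: measurableX.
pose Q := cut (A `*` [set: T2]) (fun p => G p - g p).
have cutE u p : cut (A `*` [set: T2]) u p = if p.1 \in A then u p else 0.
  by rewrite /cut; congr (if _ then _ else _); apply/idP/idP; rewrite !inE; [case|split].
have l12 u : cintegrable m12 u /\ L2 m12 u -> cintegrable m12 (cut (A `*` [set: T2]) u) /\ L2 m12 (cut (A `*` [set: T2]) u).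
  move=> [iu lu]; have mc : cmeas (cut (A `*` [set: T2]) u) := cmeas_cutT mAT (L2_meas lu).
  split.
    apply: (cintegrable_bnd (v := u) (k := 1) mc iu) => p; rewrite mul1r cutE.
    by case: ifP => // _; rewrite /abs1 !cE normr0 addr0 addr_ge0.
  apply: (L2_bnd (k := 1) mc lu) => // p; rewrite mul1r cutE.
  by case: ifP => // _; rewrite abs20 abs2_ge0.
have lQ : L2 m12 Q.
  apply: (L2_bnd (k := 1) (cmeas_cutT mAT (L2_meas lD)) lD) => // p; rewrite mul1r /Q cutE.
  by case: ifP => // _; rewrite abs20 abs2_ge0.
have Q0 : {ae m12, forall p, Q p = 0}.
  apply: (ip_test0 P lQ) => k lk; pose k' := cut (A `*` [set: T2]) k.
  have lk' := l12 _ lk; rewrite -/k' in lk'; have [ik' l2k'] := lk'.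
  have -> : ip m12 Q k = ip m12 (fun p => G p - g p) k'.
    congr cint; apply/funext => p; rewrite /Q /k' !cutE; case: ifP => _ //.
    by rewrite (_ : conjc 0 = 0) ?mulr0 ?mul0r//; apply: complex_ext; rewrite !cE ?oppr0.
  rewrite (ipBl lG lg l2k'); apply/eqP; rewrite subr_eq0; apply/eqP/(mulfI C20).
  have lF := partial_fourier2_L2 ik' l2k'.
  have ig := L2_mulc lg l2k'; have iP := L2_mulc lPsi lF.
  rewrite (slice_pairing lk') /ip (cint_fubini1 ig) (cint_fubini1 iP) -(cintZ _ (cintegrable_fubini1 ig)).
  apply: cint_ae.
  - exact: cintegrable_meas (cintegrable_fubini1 iP).
  - exact: cintegrable_meas (cintegrableZ _ (cintegrable_fubini1 ig)).
  apply: filterS2 (cintegrable_ae1 ik') (L2_ae1 l2k') => x ix lx.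
  have [xA|xA] := boolP (x \in A).
    have [_ _ hx] := hA x (set_mem xA); exact: hx (conj ix lx).
  have z y : k' (x, y) = 0 by rewrite /k' cutE /= (negPf xA).
  have zc : (0 : R[i])^*%C = 0 by apply: complex_ext; rewrite !cE ?oppr0.
  have F0 : fourier m2 dot2 (fun y => k' (x, y)) = fun=> 0.
    apply/funext => y; rewrite /fourier (_ : (fun x0 => _) = fun=> 0) ?cint0//.
    by apply/funext => x0; rewrite z mul0r.
  rewrite (_ : (fun y => g (x, y) * _) = fun=> 0); last by apply/funext => y; rewrite z zc mulr0.
  rewrite cint0 mulr0 (_ : (fun y => Psi (x, y) * _) = fun=> 0) ?cint0//.
  by apply/funext => y; rewrite (_ : pf2 k' (x, y) = 0) ?zc ?mulr0//; exact: (congr1 (fun h => h y) F0).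
apply: filterS Q0 => p; rewrite /Q cutE => h Ap; move: h; rewrite mem_set// => /eqP.
by rewrite subr_eq0 => /eqP.
Qed.

End slices.
End product_swap.

(** * Decay in the frequency dual to time *)

Section time_decay.
Variable R : realType.
Variables (c t0 : R).
Hypothesis c0 : 0 < c.
Local Notation mu := (leb1 R).
Local Notation C_ g := (fun x : R1 R => (g x)%:C%C).
Local Notation F := (fourier mu (@dot1 R)).
Let P1 := plancherel1 R.
Implicit Types (g h chi : R -> R) (w Y : R).

(** With [Y = 1 + |xi|^2] the weight is the [m]-th power of the space-time weight at a fixed spatial
    frequency. *)
Definition time_energy (m : nat) g Y : \bar R :=
  (\int[mu]_theta (((Y + theta ^+ 2) ^+ m * abs2 (F (C_ g) theta))%:E))%E.
Local Notation J := time_energy.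

Let F_cmeas g : continuous g -> csupp g -> cmeas (F (C_ g)).
Proof. by move=> cg sg; exact: (F_meas P1 (L2_meas (csupp_L12 cg sg).2)). Qed.

Let J_meas m Y (v : R1 R -> R[i]) : cmeas v ->
  measurable_fun setT (fun theta : R1 R => ((Y + theta ^+ 2) ^+ m * abs2 (v theta))%:E).
Proof.
move=> mv; apply/measurable_EFinP; apply: measurable_funM; last exact: measurable_abs2.
by apply: measurable_funX; apply: measurable_funD => //; exact: measurable_funX.
Qed.

Let J_ge0 m Y (v : R1 R -> R[i]) (theta : R1 R) : 0 <= Y -> (0 <= ((Y + theta ^+ 2) ^+ m * abs2 (v theta))%:E)%E.
Proof. by move=> Y0; rewrite lee_fin mulr_ge0 ?abs2_ge0// exprn_ge0// addr_ge0// sqr_ge0. Qed.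

Lemma time_energy0 g Y : continuous g -> csupp g -> J 0 g Y = ((2 * pi)%:E * sq mu (C_ g))%E.
Proof.
move=> cg sg; have [ig lg] := csupp_L12 cg sg; rewrite -(planch P1 ig lg).
by apply: eq_integral => x _; rewrite expr0 mul1r.
Qed.

(** The factor [theta^2] is absorbed by [fourier_der] as a derivative in time. *)
Lemma time_energyS m g g' Y : 0 <= Y -> (forall x : R, is_derive x (1 : R) g (g' x)) -> continuous g' -> csupp g ->
  J m.+1 g Y = (Y%:E * J m g Y + J m g' Y)%E.
Proof.
move=> Y0 d cg' sg; have cg : continuous g by move=> x; exact: der_cont (d x).
have mg := F_cmeas cg sg; have mg' := F_cmeas cg' (csupp_der d sg).
rewrite /J -(ge0_integralZl _ measurableT (J_meas m Y mg) (fun x _ => J_ge0 m _ x Y0)); last by rewrite lee_fin.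
have YE : (0 <= Y%:E :> \bar R)%E by rewrite lee_fin.
have p1 (x : R1 R) := J_ge0 m (F (C_ g)) x Y0; have p2 (x : R1 R) := J_ge0 m (F (C_ g')) x Y0.
rewrite -(ge0_integralD _ _ (fun x _ => mule_ge0 YE (p1 x)) (measurable_funeM _ (J_meas m Y mg)) (fun x _ => p2 x) (J_meas m Y mg'))//.
apply: eq_integral => x _; rewrite -EFinM -EFinD; congr EFin.
rewrite (fourier_der x d cg' sg) abs2M (_ : abs2 (0 +i* x)%C = x ^+ 2); last by rewrite /abs2 !cE expr0n add0r.
by rewrite exprS; ring.
Qed.

Lemma time_energyD m g h (a : R) Y : 0 <= Y -> continuous g -> continuous h -> csupp g -> csupp h ->
  (J m (fun x => (g x + a * h x)%R) Y <= 2%:E * J m g Y + (2 * a ^+ 2)%:E * J m h Y)%E.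
Proof.
move=> Y0 cg ch sg sh; have mg := F_cmeas cg sg; have mh := F_cmeas ch sh.
have [ig _] := csupp_L12 cg sg; have [ih _] := csupp_L12 ch sh.
have FE : F (C_ (fun x => g x + a * h x)) = fun xi => F (C_ g) xi + a%:C%C * F (C_ h) xi.
  transitivity (F (fun x : R1 R => (g x)%:C%C + a%:C%C * (h x)%:C%C)).
    by congr fourier; apply/funext => x; apply: complex_ext; rewrite !cE; ring.
  by rewrite (FD P1 ig (cintegrableZ _ ih)) (FZ P1 _ ih).
have m1 := J_meas m Y mg; have m2 := J_meas m Y mh.
have p1 (x : R1 R) := J_ge0 m (F (C_ g)) x Y0; have p2 (x : R1 R) := J_ge0 m (F (C_ h)) x Y0.
have a0 : (0 <= (2 * a ^+ 2)%:E :> \bar R)%E by rewrite lee_fin mulr_ge0// sqr_ge0.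
have t0' : (0 <= 2%:E :> \bar R)%E by rewrite lee_fin.
rewrite /J -(ge0_integralZl _ measurableT m1 (fun x _ => p1 x) t0') -(ge0_integralZl _ measurableT m2 (fun x _ => p2 x) a0).
have q1 := measurable_funeM 2%:E m1; have q2 := measurable_funeM (2 * a ^+ 2)%:E m2.
rewrite -(ge0_integralD _ _ (fun x _ => mule_ge0 t0' (p1 x)) q1 (fun x _ => mule_ge0 a0 (p2 x)) q2)//.
have mF : cmeas (F (C_ (fun x => g x + a * h x))).
  by rewrite FE; apply: cmeasD mg _; apply: cmeasM mh; exact: cmeas_cst.
apply: (ge0_le_integral mu measurableT (fun x _ => J_ge0 m _ x Y0) (J_meas m Y mF) (emeasurable_funD q1 q2)) => x _.
rewrite FE -!EFinM -EFinD lee_fin.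
rewrite (_ : 2 * _ + 2 * a ^+ 2 * _ = (Y + x ^+ 2) ^+ m * (2 * abs2 (F (C_ g) x) + 2 * (a ^+ 2 * abs2 (F (C_ h) x)))); last by ring.
apply: ler_wpM2l; first by rewrite exprn_ge0// addr_ge0// sqr_ge0.
by apply: (le_trans (abs2D _ _)); rewrite abs2M abs2_real.
Qed.

Local Notation cosg chi w := (fun t => chi t * cos (w * (t - t0))).
Local Notation sing chi w := (fun t => chi t * sincw w (t - t0)).

Lemma sincw_sin w x : w * sincw w x = sin (w * x).
Proof. by rewrite /sincw; case: eqP => [->|/eqP w0]; [rewrite !mul0r sin0|field]. Qed.

Let der_shift (x : R) : is_derive x (1 : R) (fun t => t - t0) 1.
Proof. by apply: der_eq (derB (derid x) (dercst t0 x)) _; rewrite subr0. Qed.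

Let der_cosg chi chi' w x : is_derive x (1 : R) chi (chi' x) ->
  is_derive x (1 : R) (cosg chi w) (chi' x * cos (w * (x - t0)) + (- w ^+ 2) * (chi x * sincw w (x - t0))).
Proof.
move=> d; apply: der_eq (derM d (dercomp (f := fun t => cos (w * t)) (der_shift x) (der_cosw w (x - t0)))) _.
by rewrite /=; ring.
Qed.

Let der_sing chi chi' w x : is_derive x (1 : R) chi (chi' x) ->
  is_derive x (1 : R) (sing chi w) (chi' x * sincw w (x - t0) + 1 * (chi x * cos (w * (x - t0)))).
Proof.
move=> d; apply: der_eq (derM d (dercomp (f := sincw w) (der_shift x) (der_sincw w (x - t0)))) _.
by rewrite /=; ring.
Qed.

Let cont_cos w : continuous (fun t : R => cos (w * (t - t0))).
Proof. by move=> x; exact: der_cont (dercomp (f := fun t => cos (w * t)) (der_shift x) (der_cosw w (x - t0))). Qed.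

Let cont_sin w : continuous (fun t : R => sincw w (t - t0)).
Proof. by move=> x; exact: der_cont (dercomp (f := sincw w) (der_shift x) (der_sincw w (x - t0))). Qed.

(** Induction on [m] for all cutoffs at once: a time derivative falls either on the cutoff, replaced
    by [chi'], or on the propagator, where it exchanges cosine and sine and costs [w^2], at most
    [c^2 Y]. The sine term is better by a factor [Y], since [sincw] is bounded on the support and
    [w * sincw] is at most 1; this pays for one half of the factor [w^4]. *)
Lemma time_energy_le m chi : smooth1 chi -> csupp chi -> exists2 C : R, 0 <= C &
  forall w Y, 1 <= Y -> w ^+ 2 = c ^+ 2 * (Y - 1) ->
  (J m (cosg chi w) Y <= (C * Y ^+ m)%:E)%E /\ (Y%:E * J m (sing chi w) Y <= (C * Y ^+ m)%:E)%E.
Proof.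
have sq1 (x : R) : `|x| <= 1 -> x ^+ 2 <= 1.
  by rewrite -(real_normK (num_real x)) => x1; exact: exprn_ile1.
have contM' g h : continuous g -> continuous h -> continuous (fun t : R => g t * h t) := @contM R g h.
elim: m chi => [|m IH] chi schi kchi; have cchi := smooth1_cont schi.
  have [N hN] := kchi; have [ichi lchi] := csupp_L12 cchi kchi.
  pose L := `|N| + `|t0|; have L0 : 0 <= L by rewrite addr_ge0.
  pose B := 1 + (L ^+ 2 + (c ^+ 2)^-1).
  have B1 : 0 <= L ^+ 2 + (c ^+ 2)^-1 by rewrite addr_ge0 ?invr_ge0 ?sqr_ge0.
  have pi0 : 0 <= 2 * pi :> R by rewrite mulr_ge0// pi_ge0.
  have C0 : 0 <= 2 * pi * (B * nsq mu (C_ chi)).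
    by rewrite mulr_ge0// mulr_ge0 ?nsq_ge0// addr_ge0.
  exists (2 * pi * (B * nsq mu (C_ chi))) => // w Y Y1 hw; have Y0 : 0 < Y by exact: lt_le_trans Y1.
  have cc := contM' _ _ cchi (@cont_cos w); have cs := contM' _ _ cchi (@cont_sin w).
  rewrite expr0 mulr1 (time_energy0 _ cc (csuppM _ kchi)) (time_energy0 _ cs (csuppM _ kchi)).
  have mC g : continuous g -> cmeas (C_ g) by move=> cg; apply: cmeas_real; exact: contmeas.
  have pE : (0 <= (2 * pi)%:E :> \bar R)%E by rewrite lee_fin.
  split.
    rewrite [leRHS]EFinM; apply: lee_wpmul2l => //.
    have h x : abs2 (C_ (cosg chi w) x) <= 1 * abs2 (C_ chi x).
      rewrite !abs2_real mul1r exprMn ler_piMr ?sqr_ge0//.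
    have := le_sq mu ler01 (mC _ cc) (mC _ cchi) h; rewrite mul1e (L2_fin lchi) => /le_trans; apply.
    by rewrite lee_fin ler_peMl ?nsq_ge0// lerDl.
  rewrite muleCA [leRHS]EFinM; apply: lee_wpmul2l => //.
  have k0 : 0 <= (L ^+ 2 + (c ^+ 2)^-1) / Y by rewrite divr_ge0// ltW.
  have h x : abs2 (C_ (sing chi w) x) <= (L ^+ 2 + (c ^+ 2)^-1) / Y * abs2 (C_ chi x).
    rewrite !abs2_real exprMn mulrC; have [xN|xN] := leP N `|x|.
      by rewrite hN// expr0n !mulr0.
    apply: ler_wpM2r; first exact: sqr_ge0.
    (* Then [Y * sincw^2] is [sincw^2 + (w * sincw)^2 / c^2], bounded by [L^2] and [1 / c^2]
       respectively. *)
    rewrite ler_pdivlMr// (_ : Y = 1 + w ^+ 2 / c ^+ 2); last first.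
      by rewrite hw; field; rewrite gt_eqF.
    rewrite mulrDr mulr1 mulrA -exprMn [sincw _ _ * w]mulrC sincw_sin; apply: lerD.
      rewrite -(real_normK (num_real (sincw w (x - t0)))) lerXn2r ?nnegrE//.
      apply: (le_trans (sincw_le _ _)); apply: (le_trans (ler_normB _ _)); rewrite lerD2r.
      by apply: ltW; apply: (lt_le_trans xN); exact: ler_norm.
    rewrite ler_piMl ?invr_ge0 ?sqr_ge0//.
  have := le_sq mu k0 (mC _ cs) (mC _ cchi) h; rewrite (L2_fin lchi) -EFinM => h1.
  apply: (le_trans (lee_wpmul2l (_ : 0 <= Y%:E)%E h1)); first by rewrite lee_fin ltW.
  rewrite -EFinM lee_fin mulrA mulrCA mulfV ?gt_eqF// mulr1 ler_wpM2r ?nsq_ge0//.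
  by rewrite lerDr.
have [chi' [schi' dchi]] := smooth1_der schi.
have cchi' := smooth1_cont schi'; have kchi' := csupp_der dchi kchi.
have [C C0 hC] := IH chi schi kchi; have [C' C0' hC'] := IH chi' schi' kchi'.
exists (C + 2 * C' + 2 * C + 2 * c ^+ 4 * C); first by rewrite !addr_ge0 ?mulr_ge0 ?exprn_ge0 ?(ltW c0).
move=> w Y Y1 hw; have Y0 : 0 <= Y by exact: le_trans Y1.
have [a1 a2] := hC w Y Y1 hw; have [b1 b2] := hC' w Y Y1 hw.
have cc := contM' _ _ cchi (@cont_cos w); have cs := contM' _ _ cchi (@cont_sin w).
have cc' := contM' _ _ cchi' (@cont_cos w); have cs' := contM' _ _ cchi' (@cont_sin w).
have kc := csuppM (fun t => cos (w * (t - t0))) kchi; have ks := csuppM (fun t => sincw w (t - t0)) kchi.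
have kc' := csuppM (fun t => cos (w * (t - t0))) kchi'; have ks' := csuppM (fun t => sincw w (t - t0)) kchi'.
have YE : (0 <= Y%:E)%E by rewrite lee_fin.
have ym : 0 <= Y ^+ m by exact: exprn_ge0.
have J0 g : (0 <= J m g Y)%E by apply: integral_ge0 => x _; exact: J_ge0.
have w4 : (- w ^+ 2) ^+ 2 <= c ^+ 4 * Y * Y.
  rewrite sqrrN hw exprMn -exprM -mulrA ler_wpM2l ?exprn_ge0 ?(ltW c0)// expr2.
  by apply: ler_pM; rewrite ?subr_ge0//; rewrite gerBl.
split.
  have cd : continuous (fun x => chi' x * cos (w * (x - t0)) + (- w ^+ 2) * (chi x * sincw w (x - t0))).
    by apply: contD => //; apply: contM => //; exact: contcst.
  rewrite (time_energyS m Y0 (fun x => der_cosg w (dchi x)) cd kc).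
  apply: (@le_trans _ _ (Y%:E * (C * Y ^+ m)%:E + (2%:E * (C' * Y ^+ m)%:E + (2 * c ^+ 4 * Y)%:E * (C * Y ^+ m)%:E))%E).
    apply: leeD; first exact: lee_wpmul2l.
    apply: (le_trans (time_energyD m _ Y0 cc' cs kc' ks)); apply: leeD; first by apply: lee_wpmul2l.
    apply: (@le_trans _ _ ((2 * c ^+ 4 * Y)%:E * (Y%:E * J m (sing chi w) Y))%E).
      rewrite muleA -EFinM; apply: lee_wpmul2r => //; rewrite lee_fin.
      by rewrite (_ : 2 * c ^+ 4 * Y * Y = 2 * (c ^+ 4 * Y * Y)) ?ler_wpM2l//; ring.
    by apply: lee_wpmul2l => //; rewrite lee_fin !mulr_ge0 ?exprn_ge0 ?(ltW c0).
  rewrite -!EFinM -!EFinD lee_fin (exprS Y m).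
  have e1 : Y ^+ m <= Y * Y ^+ m by rewrite ler_peMl.
  have h1 : 0 <= C' * (Y * Y ^+ m - Y ^+ m) by rewrite mulr_ge0// subr_ge0.
  have h2 : 0 <= C * (Y * Y ^+ m) by rewrite !mulr_ge0.
  have -> : (C + 2 * C' + 2 * C + 2 * c ^+ 4 * C) * (Y * Y ^+ m) =
    Y * (C * Y ^+ m) + (2 * (C' * Y ^+ m) + 2 * c ^+ 4 * Y * (C * Y ^+ m)) + 2 * (C' * (Y * Y ^+ m - Y ^+ m)) + 2 * (C * (Y * Y ^+ m)) by ring.
  by rewrite -addrA lerDl addr_ge0// mulr_ge0.
have cd : continuous (fun x => chi' x * sincw w (x - t0) + 1 * (chi x * cos (w * (x - t0)))).
  by apply: contD => //; apply: contM => //; exact: contcst.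
rewrite (time_energyS m Y0 (fun x => der_sing w (dchi x)) cd ks).
rewrite ge0_muleDr; [|by rewrite mule_ge0 ?J0|exact: J0].
apply: (@le_trans _ _ (Y%:E * (C * Y ^+ m)%:E + (2%:E * (C' * Y ^+ m)%:E + 2%:E * (Y%:E * (C * Y ^+ m)%:E)))%E).
  apply: leeD; first exact: lee_wpmul2l.
  apply: (le_trans (lee_wpmul2l YE (time_energyD m 1 Y0 cs' cc ks' kc))).
  rewrite expr1n mulr1 ge0_muleDr; [|by rewrite mule_ge0 ?lee_fin ?J0..].
  have gen (x y p q : \bar R) : (Y%:E * x <= p -> y <= q -> Y%:E * (2%:E * x) + Y%:E * (2%:E * y) <= 2%:E * p + 2%:E * (Y%:E * q))%E.
    have t2 : (0 <= 2%:E :> \bar R)%E by rewrite lee_fin.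
    by move=> h h'; rewrite (muleCA _ _ x) (muleCA _ _ y); exact: leeD (lee_wpmul2l t2 h) (lee_wpmul2l t2 (lee_wpmul2l YE h')).
  exact: gen b2 a1.
rewrite -!EFinM -!EFinD lee_fin (exprS Y m).
have e1 : Y ^+ m <= Y * Y ^+ m by rewrite ler_peMl.
have h1 : 0 <= C' * (Y * Y ^+ m - Y ^+ m) by rewrite mulr_ge0// subr_ge0.
have h2 : 0 <= c ^+ 4 * C * (Y * Y ^+ m) by rewrite !mulr_ge0 ?exprn_ge0 ?(ltW c0).
have -> : (C + 2 * C' + 2 * C + 2 * c ^+ 4 * C) * (Y * Y ^+ m) =
  Y * (C * Y ^+ m) + (2 * (C' * Y ^+ m) + 2 * (Y * (C * Y ^+ m))) + 2 * (C' * (Y * Y ^+ m - Y ^+ m)) + 2 * (c ^+ 4 * C * (Y * Y ^+ m)) by ring.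
by rewrite -addrA lerDl addr_ge0// mulr_ge0.
Qed.

End time_decay.

Section extension.
Variable R : realType.
Variables (t0 t1 c : R).
Hypotheses (t01 : t0 < t1) (c0 : 0 < c).
Local Notation mu1 := (leb1 R).
Local Notation mu3 := (leb3 R).
Local Notation mu4 := (leb4 R).
Local Notation C_ g := (fun x : R1 R => (g x)%:C%C).
Local Notation F1 := (fourier mu1 (@dot1 R)).
Local Notation cosg chi w := (fun t => chi t * cos (w * (t - t0))).
Local Notation sing chi w := (fun t => chi t * sincw w (t - t0)).
Local Notation energy p w := (sobolev_sq mu3 (@dot3 R) p w).
Let P1 := plancherel1 R.
Let P3 := plancherel3 R.
Let P4 := plancherel4 R.

(** Passes from integer to real orders: relative to [Y] the weight is a power of [(Y + x) / Y >= 1],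
    which grows with the exponent. *)
Lemma weight_ratio (p Y x : R) m : 0 <= p -> p <= m%:R -> 1 <= Y -> 0 <= x ->
  (Y + x) `^ p <= Y `^ p / Y ^+ m * (Y + x) ^+ m.
Proof.
move=> p0 pm Y1 x0; have Y0 : 0 < Y by exact: lt_le_trans Y1.
have q1 : 1 <= (Y + x) / Y by rewrite ler_pdivlMr// mul1r lerDl.
have -> : Y + x = Y * ((Y + x) / Y) by field; rewrite gt_eqF.
have q0 : 0 <= (Y + x) / Y by exact: le_trans q1.
rewrite powRM ?(ltW Y0)// exprMn mulrA divfK ?expf_neq0 ?gt_eqF//.
by apply: ler_wpM2l; [exact: powR_ge0|rewrite -powR_mulrn//; exact: ler_powR].
Qed.

Definition time_sobolev (p : R) (g : R -> R) (Y : R) : \bar R :=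
  (\int[mu1]_theta ((Y + theta ^+ 2) `^ p * abs2 (F1 (C_ g) theta))%:E)%E.

Lemma time_sobolev_le (p : R) chi : 0 <= p -> smooth1 chi -> csupp chi -> exists2 C : R, 0 <= C &
  forall w Y, 1 <= Y -> w ^+ 2 = c ^+ 2 * (Y - 1) ->
  (time_sobolev p (cosg chi w) Y <= (C * Y `^ p)%:E)%E /\ (Y%:E * time_sobolev p (sing chi w) Y <= (C * Y `^ p)%:E)%E.
Proof.
move=> p0 schi kchi; pose m := Num.bound p.
have pm : p <= m%:R by apply/ltW; exact: archi_boundP.
have [C C0 hC] := time_energy_le t0 c0 m schi kchi.
exists C => // w Y Y1 hw; have Y0 : 0 < Y by exact: lt_le_trans Y1.
have [h1 h2] := hC w Y Y1 hw; have cchi := smooth1_cont schi.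
have dsh (x : R) : is_derive x (1 : R) (fun t => t - t0) 1.
  by apply: der_eq (derB (derid x) (dercst t0 x)) _; rewrite subr0.
have cc : continuous (cosg chi w).
  apply: contM => // x; exact: der_cont (dercomp (f := fun t => cos (w * t)) (dsh x) (der_cosw w (x - t0))).
have cs : continuous (sing chi w).
  apply: contM => // x; exact: der_cont (dercomp (f := sincw w) (dsh x) (der_sincw w (x - t0))).
have gen g : continuous g -> csupp g -> (time_sobolev p g Y <= (Y `^ p / Y ^+ m)%:E * time_energy m g Y)%E.
  move=> cg kg; have mF := F_meas P1 (L2_meas (csupp_L12 cg kg).2).
  have mE : measurable_fun setT (fun theta : R1 R => ((Y + theta ^+ 2) ^+ m * abs2 (F1 (C_ g) theta))%:E).
    apply/measurable_EFinP; apply: measurable_funM; last exact: measurable_abs2.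
    by apply: measurable_funX; apply: measurable_funD => //; exact: measurable_funX.
  have mS : measurable_fun setT (fun theta : R1 R => ((Y + theta ^+ 2) `^ p * abs2 (F1 (C_ g) theta))%:E).
    apply/measurable_EFinP; apply: measurable_funM; last exact: measurable_abs2.
    apply: (@measurableT_comp _ _ _ _ _ _ (fun x : R => x `^ p) _ (fun theta : R1 R => Y + theta ^+ 2)).
      exact: measurable_powR.
    by apply: measurable_funD => //; exact: measurable_funX.
  have E0 (x : R1 R) : (0 <= ((Y + x ^+ 2) ^+ m * abs2 (F1 (C_ g) x))%:E)%E.
    by rewrite lee_fin mulr_ge0 ?abs2_ge0// exprn_ge0// addr_ge0 ?(ltW Y0)// sqr_ge0.
  have S0 (x : R1 R) : (0 <= ((Y + x ^+ 2) `^ p * abs2 (F1 (C_ g) x))%:E)%E.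
    by rewrite lee_fin mulr_ge0 ?abs2_ge0// powR_ge0.
  have k0 : (0 <= (Y `^ p / Y ^+ m)%:E :> \bar R)%E by rewrite lee_fin divr_ge0 ?powR_ge0// exprn_ge0// ltW.
  rewrite /time_energy -(ge0_integralZl _ measurableT mE (fun x _ => E0 x) k0).
  apply: (ge0_le_integral mu1 measurableT (fun x _ => S0 x) mS (measurable_funeM _ mE)) => x _.
  rewrite -EFinM lee_fin mulrA ler_wpM2r ?abs2_ge0//; apply: weight_ratio => //; exact: sqr_ge0.
have e : Y `^ p / Y ^+ m * (C * Y ^+ m) = C * Y `^ p by field; rewrite expf_neq0// gt_eqF.
have k0 : (0 <= (Y `^ p / Y ^+ m)%:E :> \bar R)%E by rewrite lee_fin divr_ge0 ?powR_ge0// exprn_ge0// ltW.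
have YE : (0 <= Y%:E)%E by rewrite lee_fin ltW.
split; rewrite -e EFinM.
  exact: le_trans (gen _ cc (csuppM _ kchi)) (lee_wpmul2l k0 h1).
apply: (le_trans (lee_wpmul2l YE (gen _ cs (csuppM _ kchi)))).
by rewrite muleCA; exact: lee_wpmul2l k0 _ _ h2.
Qed.

End extension.

(** * The cut-off evolution as an extension of the solution *)

Section extended_solution.
Variable R : realType.
Variables (t0 t1 c s : R).
Hypotheses (t01 : t0 < t1) (c0 : 0 < c) (s0 : 0 <= s).
Local Notation mu1 := (leb1 R).
Local Notation mu3 := (leb3 R).
Local Notation mu4 := (leb4 R).
Local Notation C_ g := (fun x : R1 R => (g x)%:C%C).
Local Notation F1 := (fourier mu1 (@dot1 R)).
Local Notation energy p w := (sobolev_sq mu3 (@dot3 R) p w).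
Let P1 := plancherel1 R.
Let P3 := plancherel3 R.
Let P4 := plancherel4 R.
Variable chi : R -> R.
Hypotheses (schi : smooth1 chi) (kchi : csupp chi) (chi1 : forall t, t0 <= t <= t1 -> chi t = 1).
Variables (w1 w2 : R3 R -> R[i]).
Hypotheses (lw1 : L2 mu3 w1) (lw2 : L2 mu3 w2).

Let cosg w (t : R) := chi t * cos (w * (t - t0)).
Let sing w (t : R) := chi t * sincw w (t - t0).

Let dsh (x : R) : is_derive x (1 : R) (fun t => t - t0) 1.
Proof. by apply: der_eq (derB (derid x) (dercst t0 x)) _; rewrite subr0. Qed.

Let cosg12 w : cintegrable mu1 (C_ (cosg w)) /\ L2 mu1 (C_ (cosg w)).
Proof.
apply: csupp_L12; last exact: csuppM _ kchi.
apply: contM (smooth1_cont schi) _ => x.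
exact: der_cont (dercomp (f := fun t => cos (w * t)) (dsh x) (der_cosw w (x - t0))).
Qed.

Let sing12 w : cintegrable mu1 (C_ (sing w)) /\ L2 mu1 (C_ (sing w)).
Proof.
apply: csupp_L12; last exact: csuppM _ kchi.
apply: contM (smooth1_cont schi) _ => x.
exact: der_cont (dercomp (f := sincw w) (dsh x) (der_sincw w (x - t0))).
Qed.

(** Defined for all times, and equal to the spatial transform of the solution while [chi] is 1; its
    partial transform in time is the full transform of an extension of the solution. *)
Definition cutoff_evolution (p : R4 R) : R[i] := (chi p.1)%:C%C * propagate c w1 w2 (p.1 - t0) p.2.
Local Notation Psi := cutoff_evolution.
Local Notation Phi := (partial_fourier1 mu1 (@dot1 R) Psi).

Let PsiE t xi : Psi (t, xi) = w1 xi * (cosg (omega c xi) t)%:C%C + w2 xi * (sing (omega c xi) t)%:C%C.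
Proof. by rewrite /Psi /propagate /cosg /sing /= !rmorphM /=; ring. Qed.

Let Psi12 xi : cintegrable mu1 (fun t => Psi (t, xi)) /\ L2 mu1 (fun t => Psi (t, xi)).
Proof.
have [i1 l1] := cosg12 (omega c xi); have [i2 l2] := sing12 (omega c xi).
have -> : (fun t => Psi (t, xi)) = (fun t : R1 R => w1 xi * (cosg (omega c xi) t)%:C%C + w2 xi * (sing (omega c xi) t)%:C%C).
  by apply/funext => t; exact: PsiE.
by split; [exact: cintegrableD (cintegrableZ _ i1) (cintegrableZ _ i2)|exact: L2D (L2Z _ l1) (L2Z _ l2)].
Qed.

Let PhiE theta xi : Phi (theta, xi) =
  w1 xi * F1 (C_ (cosg (omega c xi))) theta + w2 xi * F1 (C_ (sing (omega c xi))) theta.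
Proof.
have [i1 _] := cosg12 (omega c xi); have [i2 _] := sing12 (omega c xi).
rewrite /partial_fourier1 /=.
have -> : (fun t => Psi (t, xi)) = (fun t : R1 R => w1 xi * (cosg (omega c xi) t)%:C%C + w2 xi * (sing (omega c xi) t)%:C%C).
  by apply/funext => t; exact: PsiE.
by rewrite (FD P1 (cintegrableZ _ i1) (cintegrableZ _ i2)) (FZ P1 _ i1) (FZ P1 _ i2).
Qed.

Let Psi_meas : cmeas Psi.
Proof.
apply: cmeasM.
  apply: cmeas_real; apply: (measurableT_comp (contmeas (smooth1_cont schi))); exact: measurable_fst.
apply: (cmeas_comp (f := fun p : R4 R => (p.1 - t0, p.2) : R4 R) _ (propagate_meas c0 lw1 lw2)).
by apply: measurable_fun_pair; [apply: measurable_funB|]; mfun.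
Qed.

Let Phi_meas : cmeas Phi. Proof. exact: (partial_fourier1_meas P1 Psi_meas). Qed.

Let Y xi : R := 1 + dot3 xi xi.
Let Y1 xi : 1 <= Y xi. Proof. by rewrite lerDl; exact: dot3_ge0. Qed.
Let wY xi : omega c xi ^+ 2 = c ^+ 2 * (Y xi - 1).
Proof. by rewrite omega_sq /Y [1 + _]addrC addrK. Qed.

(** At each [xi] the estimate is one in the time frequency. The gain of a factor [Y] in the sine
    term lowers the weight of [w2] from order [s + 1] to order [s], and the factor 2 comes from
    [abs2D]. *)
Lemma slice_energy (C : R) : 0 <= C ->
  (forall w y, 1 <= y -> w ^+ 2 = c ^+ 2 * (y - 1) ->
    (time_sobolev (s + 1) (cosg w) y <= (C * y `^ (s + 1))%:E)%E /\
    (y%:E * time_sobolev (s + 1) (sing w) y <= (C * y `^ (s + 1))%:E)%E) ->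
  (sobolev_sq mu4 (@dot4 R) (s + 1) Phi <= (2 * C)%:E * (energy (s + 1) w1 + energy s w2))%E.
Proof.
move=> C0 hC; pose u (q : R4 R) := ((1 + dot4 q q) `^ ((s + 1) / 2))%:C%C * Phi q.
have mu_ : cmeas u by apply: cmeasM Phi_meas; exact: cmeas_real (sobolev_weight_meas P4 (s + 1)).
have mF g : cintegrable mu1 (C_ g) /\ L2 mu1 (C_ g) -> cmeas (F1 (C_ g)).
  by move=> [_ l]; exact: (F_meas P1 (L2_meas l)).
have slice xi : (sq mu1 (fun theta => u (theta, xi)) <=
    (2 * C * ((1 + dot3 xi xi) `^ (s + 1) * abs2 (w1 xi) + (1 + dot3 xi xi) `^ s * abs2 (w2 xi)))%:E)%E.
  have [h1 h2] := hC (omega c xi) (Y xi) (Y1 xi) (wY xi).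
  have Y0 : 0 < Y xi by exact: lt_le_trans (Y1 xi).
  pose E g (theta : R1 R) : \bar R := ((Y xi + theta ^+ 2) `^ (s + 1) * abs2 (F1 (C_ g) theta))%:E.
  have mE g : cintegrable mu1 (C_ g) /\ L2 mu1 (C_ g) -> measurable_fun setT (E g).
    move=> l; apply/measurable_EFinP; apply: measurable_funM; last exact: measurable_abs2 (mF g l).
    apply: (@measurableT_comp _ _ _ _ _ _ (fun x : R => x `^ (s + 1)) _ (fun theta : R1 R => Y xi + theta ^+ 2)).
      exact: measurable_powR.
    by apply: measurable_funD => //; exact: measurable_funX.
  have E0 g (theta : R1 R) : (0 <= E g theta)%E by rewrite lee_fin mulr_ge0 ?abs2_ge0// powR_ge0.
  have m1 := mE _ (cosg12 (omega c xi)); have m2 := mE _ (sing12 (omega c xi)).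
  have k1 : (0 <= (2 * abs2 (w1 xi))%:E :> \bar R)%E by rewrite lee_fin mulr_ge0// abs2_ge0.
  have k2 : (0 <= (2 * abs2 (w2 xi))%:E :> \bar R)%E by rewrite lee_fin mulr_ge0// abs2_ge0.
  have n1 := measurable_funeM (2 * abs2 (w1 xi))%:E m1; have n2 := measurable_funeM (2 * abs2 (w2 xi))%:E m2.
  apply: (@le_trans _ _ ((2 * abs2 (w1 xi))%:E * time_sobolev (s + 1) (cosg (omega c xi)) (Y xi) +
      (2 * abs2 (w2 xi))%:E * time_sobolev (s + 1) (sing (omega c xi)) (Y xi))%E).
    rewrite /time_sobolev -(ge0_integralZl _ measurableT m1 (fun x _ => E0 _ x) k1).
    rewrite -(ge0_integralZl _ measurableT m2 (fun x _ => E0 _ x) k2).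
    rewrite -(ge0_integralD _ _ (fun x _ => mule_ge0 k1 (E0 _ x)) n1 (fun x _ => mule_ge0 k2 (E0 _ x)) n2)//.
    have mu1_ := measurable_abs2 (cmeas_section2 xi mu_).
    have p0 (x : R1 R) : (0 <= (abs2 (u (x, xi)))%:E :> \bar R)%E by rewrite lee_fin abs2_ge0.
    apply: (ge0_le_integral mu1 measurableT (fun x _ => p0 x) (iffRL (measurable_EFinP _ _) mu1_) (emeasurable_funD n1 n2)) => x _.
    rewrite /u (abs2_weight (@dot4 R)) PhiE /E -!EFinM -EFinD lee_fin.
    have -> : 1 + dot4 (x, xi) (x, xi) = Y xi + x ^+ 2 by rewrite /dot4 /Y /=; ring.
    rewrite (_ : 2 * abs2 (w1 xi) * _ + _ = (Y xi + x ^+ 2) `^ (s + 1) *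
      (2 * (abs2 (w1 xi) * abs2 (F1 (C_ (cosg (omega c xi))) x)) + 2 * (abs2 (w2 xi) * abs2 (F1 (C_ (sing (omega c xi))) x)))); last by ring.
    by rewrite ler_wpM2l ?powR_ge0//; apply: (le_trans (abs2D _ _)); rewrite !abs2M.
  have h2' : (time_sobolev (s + 1) (sing (omega c xi)) (Y xi) <= (C * Y xi `^ s)%:E)%E.
    have Yi : (0 <= (Y xi)^-1%:E :> \bar R)%E by rewrite lee_fin invr_ge0 ltW.
    have := lee_wpmul2l Yi h2; rewrite muleA -!EFinM mulVf ?gt_eqF// mul1e.
    have -> : (Y xi)^-1 * (C * Y xi `^ (s + 1)) = C * Y xi `^ s => //.
    rewrite powRD; last by rewrite (gt_eqF Y0) implybT.
    by rewrite powRr1 ?(ltW Y0)//; field; rewrite gt_eqF.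
  apply: (le_trans (leeD (lee_wpmul2l k1 h1) (lee_wpmul2l k2 h2'))).
  rewrite -!EFinM -EFinD lee_fin -/(Y xi) le_eqVlt; apply/orP; left; apply/eqP; ring.
have m3 : measurable_fun setT (fun xi => (1 + dot3 xi xi) `^ (s + 1) * abs2 (w1 xi) + (1 + dot3 xi xi) `^ s * abs2 (w2 xi)).
  exact: measurable_funD (weighted_meas P3 (s + 1) (L2_meas lw1)) (weighted_meas P3 s (L2_meas lw2)).
have p3 xi : (0 <= ((1 + dot3 xi xi) `^ (s + 1) * abs2 (w1 xi) + (1 + dot3 xi xi) `^ s * abs2 (w2 xi))%:E :> \bar R)%E.
  by rewrite lee_fin addr_ge0// mulr_ge0 ?powR_ge0 ?abs2_ge0.
have C2 : (0 <= (2 * C)%:E :> \bar R)%E by rewrite lee_fin mulr_ge0.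
have mE3 := iffRL (measurable_EFinP _ _) m3.
rewrite (sobolev_sqD P3 _ _ (L2_meas lw1) (L2_meas lw2)) -(ge0_integralZl _ measurableT mE3 (fun x _ => p3 x) C2).
rewrite /sobolev_sq -/u (sq_tonelli2 mu1 mu3 mu_).
apply: (ge0_le_integral mu3 measurableT (fun x _ => sq_ge0 _ _) (measurable_sq2 mu1 mu_) (measurable_funeM _ mE3)) => xi _.
by rewrite -EFinM; exact: slice.
Qed.

(** Finite energy puts the transform in [L2], where [fourier_onto] inverts it. The result agrees
    with the solution on the slab by [slices_determine], because both have the slices of
    [cutoff_evolution] as spatial transforms there. *)
Lemma extension_exists (f : R4 R -> R[i]) : cmeasurable (M t0 t1) f ->
  (forall t, t0 <= t <= t1 -> is_fourier mu3 dot3 (fun x => f (t, x)) (propagate c w1 w2 (t - t0))) ->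
  (sobolev_sq mu4 (@dot4 R) (s + 1) Phi < +oo)%E ->
  exists2 G, is_fourier mu4 dot4 G Phi & {ae mu4, forall p, M t0 t1 p -> G p = f p}.
Proof.
move=> mf hU fin; have s1 : 0 <= s + 1 by rewrite addr_ge0.
have C30 := planch_gt0 P3; have C10 := planch_gt0 P1.
have lPhi : L2 mu4 Phi.
  have mw : cmeas (fun q : R4 R => ((1 + dot4 q q) `^ ((s + 1) / 2))%:C%C * Phi q).
    by apply: cmeasM Phi_meas; exact: cmeas_real (sobolev_weight_meas P4 (s + 1)).
  apply: (L2_bnd (k := 1) Phi_meas (conj mw fin)) => // q.
  by rewrite mul1r (abs2_weight (@dot4 R)) ler_peMl ?abs2_ge0// (weight_ge1 P4).
have lPsi : L2 mu4 Psi.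
  split; first exact: Psi_meas.
  have e : sq mu4 Phi = ((2 * pi)%:E * sq mu4 Psi)%E.
    by apply: (sq_partial_fourier1 P1 Psi_meas); apply/nearW => xi; exact: Psi12.
  have := lPhi.2; rewrite e; case: (sq mu4 Psi) (sq_ge0 mu4 Psi) => [r||]//; first by move=> _ _; exact: ltry.
  by rewrite gt0_muley// lte_fin.
have [G hG] := fourier_onto P4 lPhi; exists G => //.
pose g := cut (M t0 t1) f.
have gin t x : t0 <= t <= t1 -> g (t, x) = f (t, x) by move=> h; rewrite /g /cut mem_set.
have [B B0 hB] := U_sq t01 c0 lw1 lw2.
have lg : L2 mu4 g.
  apply: (L2_slab t01 (K := (2 * pi * (2 * pi) * (2 * pi))^-1 * B)).
  - exact: cmeas_cut (measurable_M t0 t1) mf.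
  - move=> t It; have h := hU t It.
    have -> : (fun x => g (t, x)) = fun x => f (t, x) by apply/funext => x; exact: gin.
    rewrite (L2_fin (is_fourier_L2l h)) lee_fin mulrC ler_pdivlMr// mulrC -(is_fourier_nsq P3 h).
    have Tt : 0 <= t - t0 <= t1 - t0 by rewrite subr_ge0 lerD2r.
    exact: (hB _ Tt).2.
  - by move=> t x h; rewrite /g /cut memNset//; exact/negP.
have key := @slices_determine _ _ _ _ _ _ _ _ _ _ _ P1 P3 G Psi lPsi Psi12 hG `[t0, t1]%classic g (measurable_itv _) lg.
have {}key : {ae mu4, forall p, `[t0, t1]%classic p.1 -> G p = g p}.
  apply: key => t; rewrite /= in_itv /= => It.
  have := is_fourier_pair P3 (hU t It); congr fourier_pair; apply/funext => x.
    by rewrite gin.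
  by rewrite /Psi /= chi1// mul1r.
have gf p : (`[t0, t1]%classic p.1 -> G p = g p) -> (M t0 t1 p -> G p = f p).
  by case: p => t x h It; rewrite h; [exact: gin|rewrite /= in_itv].
exact: (@filterS _ _ (ae_filter_ringOfSetsType mu4) _ _ gf key).
Qed.

End extended_solution.

(** * The estimate on the slab and the theorem *)

Lemma normM_le (R : realType) (t0 t1 c s : R) : t0 < t1 -> 0 < c -> 0 <= s -> exists2 D : R, 0 < D &
  forall (f : R4 R -> R[i]) w1 w2 (k : R), 0 <= k -> cmeasurable (M t0 t1) f -> L2 (leb3 R) w1 -> L2 (leb3 R) w2 ->
  (forall t, t0 <= t <= t1 -> is_fourier (leb3 R) dot3 (fun x => f (t, x)) (propagate c w1 w2 (t - t0))) ->
  (sobolev_sq (leb3 R) dot3 (s + 1) w1 <= (k ^+ 2)%:E)%E -> (sobolev_sq (leb3 R) dot3 s w2 <= (k ^+ 2)%:E)%E ->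
  (sobolev_normM t0 t1 (s + 1) f <= (D * k)%:E)%E.
Proof.
move=> t01 c0 s0; have s1 : 0 <= s + 1 by rewrite addr_ge0.
have e1 : 0 < 1 :> R by [].
pose chi := plateau 1 (t0 - 1) (t1 + 1).
have schi : smooth1 chi by exact: smooth1_plateau.
have kchi : csupp chi.
  apply: (@csupp_itv _ _ (t0 - 2) (t1 + 2)) => x; rewrite in_itv /= negb_and -!ltNge => /orP h.
  by apply: plateau_out => //; [lra|case: h => h; [left|right]; lra].
have chi1 t : t0 <= t <= t1 -> chi t = 1 by move=> /andP[? ?]; apply: plateau_in => //; lra.
have [C C0 hC] := time_sobolev_le t0 c0 s1 schi kchi.
have CC : 0 <= 4 * C by rewrite mulr_ge0.
(* The constant of [slice_energy] is doubled by the two energies of the data; the added 1 keeps the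
   constant positive when [C] is 0. *)
exists (Num.sqrt (4 * C) + 1); first by rewrite ltr_wpDl ?sqrtr_ge0.
move=> f w1 w2 k k0 mf lw1 lw2 hU h1 h2.
have hE := slice_energy c0 schi kchi lw1 lw2 C0 hC.
have {}hE : (sobolev_sq (leb4 R) (@dot4 R) (s + 1) (partial_fourier1 (leb1 R) (@dot1 R) (cutoff_evolution t0 c chi w1 w2))
    <= ((Num.sqrt (4 * C) * k) ^+ 2)%:E)%E.
  have C2 : (0 <= (2 * C)%:E :> \bar R)%E by rewrite lee_fin mulr_ge0.
  apply: (le_trans hE); apply: (le_trans (lee_wpmul2l C2 (leeD h1 h2))).
  by rewrite -EFinD -EFinM lee_fin exprMn sqr_sqrtr// le_eqVlt; apply/orP; left; apply/eqP; ring.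
have [G hG hGf] := extension_exists t01 c0 s0 schi kchi chi1 lw1 lw2 mf hU (le_lt_trans hE (ltry _)).
apply: (@le_trans _ _ (sobolev_norm4 (s + 1) G)); first by apply: ereal_inf_lbound; exists G.
apply: (@le_trans _ _ (Num.sqrt (4 * C) * k)%:E).
  by apply: sobolev_norm_le hG _ hE; rewrite mulr_ge0 ?sqrtr_ge0.
by rewrite lee_fin ler_wpM2r// lerDl.
Qed.

Theorem theorem1p1 (R : realType) (t0 t1 c s : R) (K : set (R3 R))
    (t01 : t0 < t1) (c0 : 0 < c) (c1 : c <= 1) (s0 : 0 <= s) (Kc : compact K) :
  (forall (f1 f2 f1' f2' : R3 R -> R[i]) (f f' : R4 R -> R[i]),
     cauchy_data s K f1 f2 -> wave_solution t0 t1 c s f1 f2 f ->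
     cauchy_data s K f1' f2' -> wave_solution t0 t1 c s f1' f2' f' ->
     ae_C (fun y v => light_ray_transform t0 t1 f y v
                    = light_ray_transform t0 t1 f' y v) ->
     [/\ ae_on_slice f1 f1', ae_on_slice f2 f2' &
       forall t, t0 <= t <= t1 ->
         ae_on_slice (fun x => f (t, x)) (fun x => f' (t, x))]) /\
  (exists2 C : R, 0 < C &
     forall (f1 f2 : R3 R -> R[i]) (f : R4 R -> R[i]),
       cauchy_data s K f1 f2 -> wave_solution t0 t1 c s f1 f2 f ->
       (normN s f1 f2 <=
          C%:E * sobolev_normC (s + 2)%R (light_ray_transform t0 t1 f))%E /\
       (sobolev_normM t0 t1 (s + 1)%R f <=
          C%:E * sobolev_normC (s + 2)%R (light_ray_transform t0 t1 f))%E).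
Proof.
split; first exact: uniqueness t01 c0 c1 s0 Kc.
have [C C0 hC] := stability t01 c0 c1 s0 Kc; have [D D0 hD] := normM_le t01 c0 s0.
(* One constant for both bounds: the term 2 comes from the two norms summed in [normN], the term [D]
   from the slab. *)
have B0 : 0 < (2 + D) * C by rewrite mulr_gt0 ?addr_gt0.
exists ((2 + D) * C) => // f1 f2 f cd ws.
have n0 : (0 <= sobolev_normC (s + 2) (light_ray_transform t0 t1 f))%E.
  by apply: sume_ge0 => e _; apply: le_ereal_inf_tmp => _ [w _ <-]; exact: L2norm_ge0.
split; apply: (le_scale_lt B0 n0) => k hk; have k0 : 0 < k by rewrite -lte_fin (le_lt_trans n0).
  have [w1 [w2 [fw1 fw2 hU e1 e2]]] := hC _ _ _ _ cd ws hk.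
  apply: (le_trans (normN_le (ltW (mulr_gt0 C0 k0)) fw1 fw2 e1 e2)).
  rewrite lee_fin mulrA ler_wpM2r ?(ltW k0)// ler_wpM2r ?(ltW C0)// lerDl ltW//.
have [w1 [w2 [fw1 fw2 hU e1 e2]]] := hC _ _ _ _ cd ws hk.
apply: (le_trans (hD _ _ _ _ (ltW (mulr_gt0 C0 k0)) ws.1 (is_fourier_L2r fw1) (is_fourier_L2r fw2) hU e1 e2)).
by rewrite lee_fin mulrA ler_wpM2r ?(ltW k0)// ler_wpM2r ?(ltW C0)// lerDr.
Qed.
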